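(* Assume the Riemann Hypothesis. Let $m\geqslant 2$ and let $V_X$ satisfy conditions (i), (ii) (with this $m$) and (iii) described in the context, and suppose that $\widehat{V}_X(y)>0$ for real $y$. Then for large $T$, $X\leqslant T^{2m}$, $\epsilon>0$ and $W\geqslant \sqrt{\log\log T}$, \[ \frac{1}{T}\mu\bigg(t\in [T,2T]: \bigg|\Im\sum_{n\leqslant X}\frac{\Lambda(n)V_X(\log n)}{n^{1/2+it}\log n}\bigg|\geqslant W \cdot V_X(0)\bigg) \ll \exp\big(-(1-\epsilon)W^2/\log\log T\big) + \exp(-C_\epsilon W\log W) \] and \[ \frac{1}{T}\mu\bigg(t\in [T,2T]: \Re\sum_{n\leqslant X}\frac{\Lambda(n)V_X(\log n)}{n^{1/2+it}\log n}\geqslant W \cdot V_X(0)\bigg) \ll \exp\big(-(1-\epsilon)W^2/\log\log T\big) + \exp(-D_\epsilon W\log W) \] for some constants $C_\epsilon, D_\epsilon>0$, where $\mu$ denotes Lebesgue measure.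
   Context: $\Lambda$ is the von Mangoldt function. For $X\geqslant 2$, $V_X:\mathbb{R}\to\mathbb{R}$ has Fourier transform $\widehat{V}_X(z)=\int_{-\infty}^\infty e^{ixz}V_X(x)\,dx$. Conditions: (i) $V_X$ is a bounded, even function with support in $[-\log X,\log X]$; (ii) there exists $m\geqslant 2$ such that for fixed $\Re(z)$, $\widehat{V}_X(z/i)\ll X^{\Re(z)}/|\Im(z)|^m$ as $\Im(z)\to\infty$; (iii) for all $y\in\mathbb{R}$, $\frac{1}{\log X}\widehat{V}_X\big(\tfrac{y}{\log X}\big)\ll \frac{1}{1+y^2}$. Implied constants in these conditions are independent of $X$.
   Formalization: V_X is assumed continuous (otherwise V_X(0) could be altered at one point), and V_X(0) ≥ v for a fixed v > 0 is assumed, with C_ε, D_ε, the implied constants and the threshold for T allowed to depend on v; without these the bounds can fail. *)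

(* Defs.v *)
(* MathComp-Analysis, over an arbitrary R : realType; complex numbers are R[i]. *)
From HB Require Import structures.
From mathcomp Require Import all_boot all_order all_algebra.
From mathcomp Require Import all_classical all_reals all_analysis.
From mathcomp Require Import complex.

Set Implicit Arguments.
Unset Strict Implicit.
Unset Printing Implicit Defensive.

Import Order.TTheory GRing.Theory Num.Theory.
Import numFieldNormedType.Exports.

Local Open Scope classical_set_scope.
Local Open Scope complex_scope.
Local Open Scope ring_scope.

Definition cexp (R : realType) (z : R[i]) : R[i] :=
  (expR (complex.Re z) * cos (complex.Im z)) +i*
  (expR (complex.Re z) * sin (complex.Im z)).

(* n ^ (- s), meant for n >= 1 *)
Definition npowN (R : realType) (n : nat) (s : R[i]) : R[i] :=
  cexp (- s * (ln (n%:R : R))%:C).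

(* On the regular module R[i]^o, [derivable f s 1] is complex
   differentiability at s.  The half-plane Re s > 0 minus the point 1 is
   connected, so the two clauses determine zeta there; it contains the
   critical strip, which is all that the Riemann hypothesis needs. *)
Definition is_riemann_zeta (R : realType) (zeta : R[i]^o -> R[i]^o) : Prop :=
  (forall s : R[i]^o, 1 < complex.Re s ->
     (fun N : nat => \sum_(1 <= n < N.+1) npowN n s : R[i]^o) @ \oo
       --> zeta s) /\
  (forall s : R[i]^o, 0 < complex.Re s -> s != 1 -> derivable zeta s 1).

Definition riemann_hypothesis (R : realType) : Prop :=
  forall zeta : R[i]^o -> R[i]^o, is_riemann_zeta zeta ->
  forall s : R[i]^o, 0 < complex.Re s < 1 -> zeta s = 0 ->
    complex.Re s = 2^-1.

(* [primes n] lists the distinct prime divisors of n, so it is a singleton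
   exactly when n is p ^ k with p prime and k >= 1. *)
Definition von_mangoldt (R : realType) (n : nat) : R :=
  if primes n is [:: p] then ln p%:R else 0.

Definition cintegral (R : realType) (f : R -> R[i]) : R[i] :=
  Rintegral lebesgue_measure setT (fun x => complex.Re (f x)) +i*
  Rintegral lebesgue_measure setT (fun x => complex.Im (f x)).

Definition fourier (R : realType) (V : R -> R) (z : R[i]) : R[i] :=
  cintegral (fun x => cexp ('i * x%:C * z) * (V x)%:C).

Definition cnorm (R : realType) (z : R[i]) : R := complex.Re `|z|.

(* In the three conditions V X is the function V_X; only X >= 2 matters.
   Conditions (ii) and (iii) see V_X only up to a null set, while prime_sum
   uses its values at the points ln n: continuity of V_X has to be assumed
   separately to select the representative given by Fourier inversion. *)
Definition condition_i (R : realType) (V : R -> R -> R) : Prop :=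
  forall X : R, 2 <= X ->
    [/\ exists B : R, forall x, `|V X x| <= B,
        forall x, V X (- x) = V X x
      & forall x, ln X < `|x| -> V X x = 0].

(* With z = sigma + i t.  Since V_X is even and real, the left-hand side is
   unchanged under sigma |-> - sigma, so the bound X ^ sigma can only be meant
   for sigma >= 0; it then yields X ^ |sigma| for all real sigma. *)
Definition condition_ii (R : realType) (m : R) (V : R -> R -> R) : Prop :=
  forall sigma : R, 0 <= sigma ->
  exists C t0 : R, forall X t : R, 2 <= X -> t0 <= t ->
    cnorm (fourier (V X) ((sigma +i* t) / 'i))
      <= C * (X `^ sigma / `|t| `^ m).

Definition condition_iii (R : realType) (V : R -> R -> R) : Prop :=
  exists C : R, forall X y : R, 2 <= X ->
    cnorm (((ln X)^-1)%:C * fourier (V X) ((y / ln X)%:C))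
      <= C * (1 + y ^+ 2)^-1.

Definition prime_sum (R : realType) (V : R -> R -> R) (X t : R) : R[i] :=
  \sum_(1 <= n < (Num.truncn X).+1)
    (von_mangoldt R n * V X (ln n%:R) / ln n%:R)%:C * npowN n (2^-1 +i* t).

(* Main.v *)
(* Let E = f'/f for f(s) = (s - 1) zeta(s).  Under RH the function log|f| is
   harmonic to the right of the critical line; testing its subharmonic
   regularization against a dipole kernel, with Green's formula on rectangles,
   yields Re E(s) >= - A log(2 + |Im s|) uniformly up to that line.  Averaging
   this bound against the positive Fourier transform of V_X, and then against
   nonnegative kernels with compactly supported Fourier transform, replaces
   1 / log n in the prime sum by weights vanishing for n > T ^ (c / W), at the
   cost of an error eta W V_X(0): this is where RH and positivity enter.
   The shortened sum is split into its main part, its tail and the prime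
   squares.  Even moments of order proportional to W ^ 2 / log log T,
   respectively W, give the Gaussian and the W log W terms.  When W is so large
   that all the weights vanish, the exceptional set is empty. *)
Require Import Defs.
From HB Require Import structures.
From mathcomp Require Import all_boot all_order all_fingroup all_algebra.
From mathcomp Require Import all_classical all_reals all_analysis.
From mathcomp Require Import complex.
From mathcomp Require Import measurable_realfun.
From mathcomp Require Import ring lra.

Set Implicit Arguments.
Unset Strict Implicit.
Unset Printing Implicit Defensive.

Import Order.TTheory GRing.Theory Num.Theory.
Import numFieldNormedType.Exports.

Local Open Scope classical_set_scope.
Local Open Scope complex_scope.
Local Open Scope ring_scope.

(** Complex analysis is carried out on pairs of real functions obeying the Cauchy-Riemann equations,
    a phase [ph] selecting the component (0 for the real part, [pi/2] for the imaginary one), so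
    that contour arguments become integrals over rectangles. What RH leaves is one-sided: left of
    the critical line the Laplacian of the regularized [log|f|] is only known to be nonnegative, so
    near the line only a lower bound for Re E survives, and every later average needs a nonnegative
    kernel. For the sine sum the natural kernel [Q] is odd; it is dominated by an even one,
    [c1 Ek^(n+1) + Q] and [c1 Ek^(n+1) - Q] being nonnegative, which produces an additional cosine
    sum whose weights vanish at the origin. Averaging at scale [1/l] costs a multiple of [ln T / l];
    with [l = beta ln T / W] and [v <= V X 0] this is at most [eta W V X 0]. The factor [(1+|z|)^n]
    lost under a shift by [z] comes from the pole term, which condition (ii) controls while
    [|z| <= T/2]; it dictates the power of the kernel [Ek]. *)

Section dv.
Variable R : realType.
Implicit Types (f g : R -> R) (x a b : R).

(** A relation rather than an operator: the rules below synthesize the value of the derivative by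
    unification, and [dv_eq] postpones all algebra to one final identity. *)
Definition dv f x a := is_derive x 1 f a.

Lemma dv_eq f x a b : dv f x a -> a = b -> dv f x b.
Proof. by move=> h <-. Qed.

Lemma dv_cst c x : dv (fun=> c) x 0.
Proof. exact: is_derive_cst. Qed.

Lemma dv_id x : dv (fun y => y) x 1.
Proof. exact: is_derive_id. Qed.

Lemma dvD f g x a b : dv f x a -> dv g x b -> dv (fun y => f y+g y) x (a+b).
Proof. exact: is_deriveD. Qed.

Lemma dvN f x a : dv f x a -> dv (fun y => - f y) x (- a).
Proof. exact: is_deriveN. Qed.

Lemma dvM f g x a b : dv f x a -> dv g x b ->
 dv (fun y => f y*g y) x (a*g x+f x*b).
Proof.
move=> fa gb; apply: (dv_eq (is_deriveM fa gb)).
by rewrite /GRing.scale /= addrC (mulrC (g x)).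
Qed.

Lemma dv_comp f g x a b : dv f (g x) a -> dv g x b ->
 dv (fun y => f (g y)) x (a*b).
Proof. exact: is_derive1_comp. Qed.

Lemma dvX f n x a : dv f x a -> dv (fun y => f y^+n) x (n%:R*f x^+n.-1*a).
Proof.
move=> fa; elim: n => [|n ih].
 by rewrite !mul0r; apply: (dv_eq (dv_cst 1 x)).
under eq_fun do rewrite exprS.
apply: (dv_eq (dvM fa ih)) => /=.
rewrite -[n.+1%:R]natr1 mulrDl mul1r mulrDl addrC; congr (_ + _); last by rewrite mulrC.
case: n {ih} => [|n]; first by rewrite !mul0r mulr0.
by rewrite /= exprS; ring.
Qed.

Lemma dvV f x a : f x != 0 -> dv f x a -> dv (fun y => (f y)^-1) x (- a/f x^+2).
Proof.
move=> f0 fa; apply: (dv_eq (is_deriveV f0 fa)).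
by rewrite /GRing.scale /= mulNr mulrC mulNr.
Qed.

Lemma dv_expR f x a : dv f x a -> dv (fun y => expR (f y)) x (expR (f x)*a).
Proof. by apply: dv_comp; exact: is_derive_expR. Qed.

Lemma dv_cos f x a : dv f x a -> dv (fun y => cos (f y)) x (- sin (f x)*a).
Proof. by apply: dv_comp; exact: is_derive_cos. Qed.

Lemma dv_sin f x a : dv f x a -> dv (fun y => sin (f y)) x (cos (f x)*a).
Proof. by apply: dv_comp; exact: is_derive_sin. Qed.

Lemma dv_ln f x a : 0<f x -> dv f x a -> dv (fun y => ln (f y)) x ((f x)^-1*a).
Proof. by move=> f0; apply: dv_comp; exact: is_derive1_ln. Qed.

Lemma dv_cont f x a : dv f x a -> {for x, continuous f}.
Proof.
by move=> [h _]; apply/differentiable_continuous/derivable1_diffP.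
Qed.

Lemma dv_shift f x c a : dv f (c+x) a -> dv (fun y => f (c+y)) x a.
Proof.
move=> h; apply: (dv_eq (dv_comp (g := fun y => c+y) (b := 1) h _)).
 by apply: (dv_eq (dvD (dv_cst c x) (dv_id x))); rewrite add0r.
by rewrite mulr1.
Qed.

Lemma dv_opp f x a : dv f (- x) a -> dv (fun y => f (- y)) x (- a).
Proof.
move=> h; apply: (dv_eq (dv_comp h (dvN (dv_id x)))).
by rewrite mulrN1.
Qed.

(* A second order Taylor bound along real increments gives the derivative. *)
Lemma dv_quant f x a C r : 0<r ->
 (forall h, `|h| < r -> `|f (x+h)-f x-h*a| <= C*h^+2) -> dv f x a.
Proof.
move=> r0 H.
have C0: 0<=C.
 have r2: `|r/2| < r by rewrite ger0_norm; lra.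
 have := H _ r2; move=> /(le_trans (normr_ge0 _)); rewrite pmulr_lge0//.
 by rewrite exprn_gt0// divr_gt0.
suff cv : h^-1 *: (f (h *: (1:R)+x)-f x) @[h --> 0^'] --> a.
 split; last exact: cvg_lim cv.
 by apply/cvg_ex; exists a.
apply/cvgrPdist_le => e e0.
near=> h.
have hr: `|h| < r by near: h; apply: dnbhs0_lt.
have h0: h != 0 by near: h; exact: nbhs_dnbhs_neq.
have he: `|h| < e/(C+1) by near: h; apply: dnbhs0_lt; rewrite divr_gt0// ltr_pwDr.
rewrite /GRing.scale /= mulr1 (addrC h).
have -> : a-h^-1*(f (x+h)-f x) = - h^-1*(f (x+h)-f x-h*a) by field.
rewrite normrM normrN normfV ler_pdivrMl ?normr_gt0//.
apply: le_trans (H _ hr) _; rewrite -real_normK ?num_real//.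
have n0 := normr_ge0 h.
move: he; rewrite ltr_pdivlMr ?ltr_pwDr// => he.
by nra.
Unshelve. all: by end_near.
Qed.

Lemma dv_ge0_le f df a b : a<=b ->
 (forall x, a<=x<=b -> dv f x (df x)) ->
 (forall x, a<=x<=b -> 0<=df x) -> f a<=f b.
Proof.
rewrite le_eqVlt => /predU1P[->//|ab] H1 H2.
have [|c|c cab E] := @MVT R f df a b ab.
- by move=> x; rewrite in_itv /= => /andP[u v]; apply: H1; rewrite !ltW.
- apply: continuous_in_subspaceT => x; rewrite inE /= in_itv /= => xab.
 exact: dv_cont (H1 _ xab).
move: cab; rewrite in_itv /= => /andP[u v].
rewrite -subr_ge0 E mulr_ge0 ?subr_ge0 ?(ltW ab)//; apply: H2.
by rewrite !ltW.
Qed.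

Lemma dv_le0_le f df a b : a<=b ->
 (forall x, a<=x<=b -> dv f x (df x)) ->
 (forall x, a<=x<=b -> df x<=0) -> f b<=f a.
Proof.
move=> ab H1 H2; rewrite -lerN2.
apply: (@dv_ge0_le (fun x => - f x) (fun x => - df x)) => // x xab.
 by apply: dvN; apply: H1.
by rewrite oppr_ge0 H2.
Qed.

(** Both [f - C x] and [f + C x] are monotone. *)
Lemma dv_lip f df a b C : a<=b ->
 (forall x, a<=x<=b -> dv f x (df x)) ->
 (forall x, a<=x<=b -> `|df x| <= C) -> `|f b-f a| <= C*(b-a).
Proof.
move=> ab H1 H2.
have D x : a<=x<=b -> dv (fun x => f x-C*x) x (df x-C).
 move=> xab; apply: (dv_eq (dvD (H1 _ xab) (dvN (dvM (dv_cst C x) (dv_id x))))).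
 by rewrite mul0r add0r mulr1.
have D' x : a<=x<=b -> dv (fun x => f x+C*x) x (df x+C).
 move=> xab; apply: (dv_eq (dvD (H1 _ xab) (dvM (dv_cst C x) (dv_id x)))).
 by rewrite mul0r add0r mulr1.
have u := dv_le0_le ab D _; have v := dv_ge0_le ab D' _.
have {}u : f b-C*b<=f a-C*a.
 by apply: u => x /H2; rewrite ler_norml subr_le0 => /andP[].
have {}v : f a+C*a<=f b+C*b.
 by apply: v => x /H2; rewrite ler_norml -lerBlDr sub0r => /andP[].
by rewrite ler_norml; apply/andP; split; nra.
Qed.

End dv.

Ltac dv_step :=
 first [ exact: dv_id | exact: dv_cst | assumption
    | apply: dvD | apply: dvN | apply: dvM | apply: dvX
    | apply: dv_expR | apply: dv_cos | apply: dv_sin ].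
Ltac dv_tac := eapply dv_eq; [ repeat dv_step | ].

(** * Integrable real-valued functions and dominated convergence *)

Section measure_tools.
Context d (T : measurableType d) (R : realType) (mu : {measure set T -> \bar R}).

Implicit Types (D : set T) (f g : T -> R) (c : R).

Definition L1 (D : set T) (f : T -> R) := mu.-integrable D (EFin \o f).

Lemma L1_dom D f g : measurable D -> measurable_fun D f ->
 (forall x, D x -> `|f x| <= g x) -> L1 D g -> L1 D f.
Proof.
move=> mD mf fg Lg; apply: (le_integrable mD _ _ Lg).
 exact/measurable_EFinP.
by move=> x Dx /=; rewrite lee_fin (le_trans (fg _ Dx))// ler_norm.
Qed.

Lemma L1_meas D f : L1 D f -> measurable_fun D f.
Proof. by move=> /integrableP[/measurable_EFinP]. Qed.

Lemma L1_cst D c : measurable D -> (mu D < +oo)%E -> L1 D (fun=> c).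
Proof.
move=> mD fD; apply/integrableP; split; first exact/measurable_EFinP.
under eq_integral do rewrite /= .
rewrite integral_cst//= lte_mul_pinfty//.
Qed.

Lemma L1D D f g : measurable D -> L1 D f -> L1 D g -> L1 D (fun x => f x+g x).
Proof. by move=> mD Lf Lg; rewrite /L1 (_ : _ \o _ = (EFin \o f) \+ (EFin \o g)%E); [exact: integrableD|]. Qed.

Lemma L1Z D f c : measurable D -> L1 D f -> L1 D (fun x => c*f x).
Proof.
move=> mD Lf; rewrite /L1 (_ : _ \o _ = (fun x => (c%:E*(EFin \o f) x)%E)).
 exact: integrableZl.
by apply/funext => x /=.
Qed.

Lemma L1N D f : measurable D -> L1 D f -> L1 D (fun x => - f x).
Proof.
move=> mD Lf; have -> : (fun x => - f x) = (fun x => -1*f x).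
 by apply/funext => x; rewrite mulN1r.
exact: L1Z.
Qed.

Lemma L1B D f g : measurable D -> L1 D f -> L1 D g -> L1 D (fun x => f x-g x).
Proof. by move=> mD Lf /(L1N mD) Lg; apply: L1D. Qed.

Lemma L1_abs D f : measurable D -> L1 D f -> L1 D (fun x => `|f x|).
Proof. by move=> mD Lf; exact: integrable_norm Lf. Qed.

Lemma Rint_ext D f g : (forall x, D x -> f x = g x) ->
 \int[mu]_(x in D) f x = \int[mu]_(x in D) g x.
Proof. by move=> H; apply: eq_Rintegral => x /set_mem; exact: H. Qed.

Lemma Rint_0 D : \int[mu]_(x in D) (0 : R) = 0.
Proof. by rewrite /Rintegral integral0. Qed.

Lemma L1_ext D f g : (forall x, f x = g x) -> L1 D f -> L1 D g.
Proof. by move=> /funext ->. Qed.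

Lemma L1_extD D f g : measurable D -> (forall x, D x -> f x = g x) -> L1 D f -> L1 D g.
Proof. by move=> mD H; apply: eq_integrable => // x /set_mem Dx /=; rewrite H. Qed.

Lemma L1_0 D : measurable D -> L1 D (fun=> 0).
Proof. by move=> mD; have := @integrable0 _ _ _ mu D. Qed.

Lemma L1_sum D (I : Type) (r : seq I) (P : pred I) (f : I -> T -> R) : measurable D ->
 (forall i, P i -> L1 D (f i)) -> L1 D (fun x => \sum_(i <- r | P i) f i x).
Proof.
move=> mD H; elim: r => [|i r ih].
 by apply: (L1_ext _ (L1_0 mD)) => x; rewrite big_nil.
case Pi : (P i); last by apply: (L1_ext _ ih) => x; rewrite big_cons Pi.
by apply: (L1_ext _ (L1D mD (H _ Pi) ih)) => x; rewrite big_cons Pi.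
Qed.

Lemma Rint_sum D (I : Type) (r : seq I) (P : pred I) (f : I -> T -> R) : measurable D ->
 (forall i, P i -> L1 D (f i)) ->
 \int[mu]_(x in D) (\sum_(i <- r | P i) f i x) = \sum_(i <- r | P i) \int[mu]_(x in D) f i x.
Proof.
move=> mD H; elim: r => [|i r ih].
 rewrite big_nil -[RHS](Rint_0 D); apply: Rint_ext => x _.
 by rewrite big_nil.
rewrite big_cons; case Pi : (P i); last first.
 by rewrite -ih; apply: Rint_ext => x _; rewrite big_cons Pi.
rewrite -ih -RintegralD//; [|exact: H|exact: L1_sum].
by apply: Rint_ext => x _; rewrite big_cons Pi.
Qed.

Lemma Rint_abs_le D f g : measurable D -> L1 D f -> L1 D g ->
 (forall x, D x -> `|f x| <= g x) -> `|\int[mu]_(x in D) f x| <= \int[mu]_(x in D) g x.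
Proof.
move=> mD Lf Lg H; apply: (le_trans (le_normr_Rintegral mD Lf)).
by apply: le_Rintegral => //; exact: L1_abs.
Qed.

(* Dominated convergence for real valued functions. *)
Lemma Rint_dct D (f_ : nat -> T -> R) f g : measurable D ->
 (forall n, measurable_fun D (f_ n)) ->
 (forall x, D x -> f_ n x @[n --> \oo] --> f x) ->
 L1 D g -> (forall n x, D x -> `|f_ n x| <= g x) ->
 L1 D f /\ \int[mu]_(x in D) f_ n x @[n --> \oo] --> \int[mu]_(x in D) f x.
Proof.
move=> mD mf cf Lg dom.
have mf' : measurable_fun D f by apply: (measurable_fun_cvg mf).
have [|||||H1 _ H3] := @dominated_convergence _ _ _ mu D mD (fun n => EFin \o f_ n)
 (EFin \o f) (EFin \o g).
- by move=> n; exact/measurable_EFinP.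
- exact/measurable_EFinP.
- by apply: aeW => x Dx; apply/fine_cvgP; split; [exact: nearW|exact: cf].
- exact: Lg.
- by apply: aeW => x n Dx /=; rewrite lee_fin dom.
split => //.
apply: fine_cvg; rewrite fineK; last exact: integrable_fin_num.
exact: H3.
Qed.

End measure_tools.

(** * Fubini's theorem for real functions with a product majorant *)

Section fubini_tools.
Context d1 d2 (T1 : measurableType d1) (T2 : measurableType d2) (R : realType).
Variables (m1 : {sigma_finite_measure set T1 -> \bar R})
 (m2 : {sigma_finite_measure set T2 -> \bar R}).

(* Carathéodory functions are jointly measurable: they are pointwise limits
   of functions that are locally constant in the first variable. *)
Lemma caratheodory_meas (f : R -> T2 -> R) :
 (forall y, continuous (f^~ y)) -> (forall x, measurable_fun setT (f x)) ->
 measurable_fun setT (fun z : R*T2 => f z.1 z.2).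
Proof.
move=> cf mf.
pose p (n : nat) (x : R) : R := (Num.floor (x*n.+1%:R))%:~R/n.+1%:R.
apply: (@measurable_fun_cvg _ _ _ _ (fun n z => f (p n z.1) z.2)); last first.
 move=> [x y] _ /=; apply: (@cvg_comp _ _ _ (fun n => p n x) (f^~ y)); last exact: cf.
 apply/cvgrPdist_le => e e0; near=> n.
 have n0: 0<n.+1%:R :> R by rewrite ltr0n.
 have /andP[u v] : x-e<=p n x<=x.
  have := floor_itv (x*n.+1%:R); rewrite /p => /andP[u v].
  rewrite ler_pdivrMr// u andbT ler_pdivlMr// mulrBl.
  have : 1<=e*n.+1%:R.
   rewrite -ler_pdivrMr// mul1r; apply: ltW; near: n; exact: near_infty_natSinv_lt (PosNum e0).
  move: v; rewrite intrD; lra.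
 by rewrite ger0_norm; lra.
move=> n _ B mB; rewrite setTI.
pose A (k : int) : set (R*T2) :=
 `[k%:~R/n.+1%:R, (k+1)%:~R/n.+1%:R[%classic `*` (f (k%:~R/n.+1%:R) @^-1` B).
have mA k : measurable (A k).
 apply: measurableX; first exact: measurable_itv.
 by rewrite -[X in measurable X]setTI; exact: mf.
rewrite (_ : _ @^-1` B = (\bigcup_k A (Posz k)) `|` (\bigcup_k A (Negz k))).
 by apply: measurableU; apply: bigcup_measurable.
have n0: 0<n.+1%:R :> R by rewrite ltr0n.
apply/seteqP; split => [[x y] /= Bf|[x y] H].
 have xA: A (Num.floor (x*n.+1%:R)) (x, y).
  split => //=; rewrite in_itv /= ler_pdivrMr// ltr_pdivlMr//.
  exact: floor_itv.
 by case: (Num.floor _) xA => k xA; [left|right]; exists k.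
have [k [/= xk fB]] : exists k, A k (x, y) by case: H => -[k _ h]; eexists; exact: h.
rewrite /p (_ : Num.floor _ = k)//.
apply: floor_def; move: xk; rewrite in_itv /= ler_pdivrMr// ltr_pdivlMr//.
Unshelve. all: by end_near.
Qed.

Section setT.
Variables (f : T1 -> T2 -> R) (a : T1 -> R) (b : T2 -> R).
Hypothesis mf : measurable_fun setT (fun z => f z.1 z.2).
Hypotheses (La : L1 m1 setT a) (Lb : L1 m2 setT b).
Hypothesis dom : forall x y, `|f x y| <= a x*b y.

Lemma fub_L1r x : L1 m2 setT (f x).
Proof.
apply: (L1_dom measurableT (g := fun y => a x*b y)) => //.
 exact: (measurable_fun_pair2 x mf).
exact: L1Z.
Qed.

Lemma fub_L1l y : L1 m1 setT (f^~ y).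
Proof.
apply: (L1_dom measurableT (g := fun x => b y*a x)) => //.
- exact: (measurable_fun_pair1 y mf).
- by move=> x _; rewrite mulrC.
- exact: L1Z.
Qed.

Let F z := (f z.1 z.2)%:E.

(** Tonelli: the iterated integral of [|f|] is at most the product of the integrals of [|a|] and
    [|b|], both finite. *)
Let intF : (m1 \x m2)%E.-integrable setT F.
Proof.
apply/integrable12ltyP; first exact/measurable_EFinP.
have /integrableP[_ Ia] := La; have /integrableP[_ Ib] := Lb.
set A := (\int[m1]_x _)%E in Ia; set B := (\int[m2]_x _)%E in Ib.
apply: (@le_lt_trans _ _ (A*B)%E); last first.
 by rewrite lte_mul_pinfty//; [exact: integral_ge0|rewrite ge0_fin_numE//; exact: integral_ge0].
rewrite /A muleC -ge0_integralZl//; last 2 first.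
- by apply/measurable_EFinP; apply: measurableT_comp => //; exact: L1_meas La.
- by apply: integral_ge0.
apply: ge0_le_integral => //.
- by move=> x _; apply: integral_ge0.
- apply: (@measurable_fun_fubini_tonelli_F _ _ _ _ _ m2 (fun z => `|F z|%E)) => //.
 by apply: measurableT_comp => //; exact/measurable_EFinP.
- apply: measurable_funeM; apply/measurable_EFinP.
 by apply: measurableT_comp => //; exact: L1_meas La.
move=> x _; rewrite muleC /B -ge0_integralZl//; last first.
 by apply/measurable_EFinP; apply: measurableT_comp => //; exact: L1_meas Lb.
apply: ge0_le_integral => //.
- apply/measurable_EFinP; apply: measurableT_comp => //.
 exact: (measurable_fun_pair2 x mf).
- apply: measurable_funeM; apply/measurable_EFinP.
 by apply: measurableT_comp => //; exact: L1_meas Lb.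
- by move=> y _; rewrite /= -EFinM lee_fin -normrM (le_trans (dom _ _))// ler_norm.
Qed.

Let FE x : (\int[m2]_y F (x, y))%E = (\int[m2]_y f x y)%:E.
Proof. by rewrite /Rintegral fineK//; apply: integrable_fin_num => //; exact: fub_L1r. Qed.

Let GE y : (\int[m1]_x F (x, y))%E = (\int[m1]_x f x y)%:E.
Proof. by rewrite /Rintegral fineK//; apply: integrable_fin_num => //; exact: fub_L1l. Qed.

Lemma fub_eq : \int[m1]_x \int[m2]_y f x y = \int[m2]_y \int[m1]_x f x y.
Proof.
have := Fubini intF; under eq_integral do rewrite FE.
under [in RHS]eq_integral do rewrite GE.
by move=> h; rewrite /Rintegral h.
Qed.

Lemma fub_prod : \int[(m1 \x m2)%E]_z f z.1 z.2 = \int[m1]_x \int[m2]_y f x y.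
Proof.
have := integral12_prod_meas1 intF; rewrite /fubini_F.
under eq_integral do rewrite FE.
by move=> h; rewrite {1}/Rintegral -h.
Qed.

Lemma fub_L1prod : L1 (m1 \x m2)%E setT (fun z => f z.1 z.2).
Proof. exact: intF. Qed.

End setT.

Variables (D1 : set T1) (D2 : set T2) (mD1 : measurable D1) (mD2 : measurable D2).

Lemma L1_mkcond d (T : measurableType d) (m : {measure set T -> \bar R}) (D : set T) (f : T -> R) :
 measurable D -> L1 m D f <-> L1 m setT (fun x => \1_D x*f x).
Proof.
move=> mD; rewrite /L1 integrable_mkcond//.
suff -> : (EFin \o f) \_ D = EFin \o (fun x => \1_D x*f x) by [].
apply/funext => x /=; rewrite patchE indicE; case: (x \in D); rewrite ?mul1r ?mul0r//.
Qed.

Lemma Rint_mkcond d (T : measurableType d) (m : {measure set T -> \bar R}) (D : set T) (f : T -> R) :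
 \int[m]_(x in D) f x = \int[m]_x (\1_D x*f x).
Proof.
rewrite Rintegral_mkcond; apply: Rint_ext => x _.
by rewrite patchE indicE; case: (x \in D); rewrite ?mul1r ?mul0r.
Qed.

Section domains.
Variables (f : T1 -> T2 -> R) (a : T1 -> R) (b : T2 -> R).
Hypothesis mf : measurable_fun setT (fun z => f z.1 z.2).
Hypotheses (La : L1 m1 D1 a) (Lb : L1 m2 D2 b).
Hypothesis dom : forall x y, D1 x -> D2 y -> `|f x y| <= a x*b y.

Let g x y := \1_D1 x * \1_D2 y*f x y.

Let mg : measurable_fun setT (fun z => g z.1 z.2).
Proof.
apply: measurable_funM => //; apply: measurable_funM.
 by apply: measurableT_comp => //; exact: measurable_indic.
by apply: measurableT_comp => //; exact: measurable_indic.
Qed.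

Let domg x y : `|g x y| <= (\1_D1 x*a x)*(\1_D2 y*b y).
Proof.
rewrite /g !indicE.
case: (pselect (D1 x)) => h1; rewrite ?(mem_set h1) ?(memNset h1) ?mul0r ?normr0//.
case: (pselect (D2 y)) => h2; rewrite ?(mem_set h2) ?(memNset h2) ?mul0r ?mulr0 ?mul0r ?normr0//.
by rewrite !mul1r; exact: dom.
Qed.

Let La' : L1 m1 setT (fun x => \1_D1 x*a x).
Proof. exact: (proj1 (L1_mkcond _ _ mD1)). Qed.
Let Lb' : L1 m2 setT (fun x => \1_D2 x*b x).
Proof. exact: (proj1 (L1_mkcond _ _ mD2)). Qed.

Let gD x y : \1_(D1 `*` D2) (x, y)*f x y = g x y.
Proof. by rewrite /g !indicE in_setX -mulnb natrM. Qed.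

Let E1 : \int[m1]_x \int[m2]_y g x y = \int[m1]_(x in D1) \int[m2]_(y in D2) f x y.
Proof.
rewrite [RHS]Rint_mkcond; apply: Rint_ext => x _; rewrite (Rint_mkcond _ D2).
case: (pselect (D1 x)) => h.
 rewrite indicE (mem_set h) mul1r; apply: Rint_ext => y _.
 by rewrite /g !indicE (mem_set h) mul1r.
rewrite indicE (memNset h) mul0r -[RHS](Rint_0 m2 setT); apply: Rint_ext => y _.
by rewrite /g !indicE (memNset h) !mul0r.
Qed.

Let E2 : \int[m2]_y \int[m1]_x g x y = \int[m2]_(y in D2) \int[m1]_(x in D1) f x y.
Proof.
rewrite [RHS]Rint_mkcond; apply: Rint_ext => y _; rewrite (Rint_mkcond _ D1).
case: (pselect (D2 y)) => h.
 rewrite indicE (mem_set h) mul1r; apply: Rint_ext => x _.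
 by rewrite /g !indicE (mem_set h) mulr1.
rewrite indicE (memNset h) mul0r -[RHS](Rint_0 m1 setT); apply: Rint_ext => x _.
by rewrite /g !indicE (memNset h) mulr0 mul0r.
Qed.

Lemma Rint_fubini : \int[m1]_(x in D1) \int[m2]_(y in D2) f x y =
 \int[m2]_(y in D2) \int[m1]_(x in D1) f x y.
Proof. by rewrite -E1 -E2; exact: (fub_eq mg La' Lb' domg). Qed.

Lemma L1_prod : L1 (m1 \x m2)%E (D1 `*` D2) (fun z => f z.1 z.2).
Proof.
apply/L1_mkcond; first exact: measurableX.
by apply: (L1_ext _ (fub_L1prod mg La' Lb' domg)) => -[x y] /=; rewrite gD.
Qed.

Lemma Rint_prod : \int[(m1 \x m2)%E]_(z in D1 `*` D2) f z.1 z.2 =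
 \int[m1]_(x in D1) \int[m2]_(y in D2) f x y.
Proof.
rewrite Rint_mkcond -E1 -(fub_prod mg La' Lb' domg).
by apply: Rint_ext => -[x y] _ /=; rewrite gD.
Qed.

End domains.

End fubini_tools.

(** * Integrals over intervals and rectangles *)

Section interval_tools.
Variable R : realType.
Notation mu := (@lebesgue_measure R).
Implicit Types (f g F : R -> R) (a b : R).

Definition cont_on a b f := forall x, a<=x<=b -> {for x, continuous f}.

Lemma cont_on_within a b f : cont_on a b f -> {within `[a, b], continuous f}.
Proof. by move=> H; apply: continuous_in_subspaceT => x; rewrite inE /= in_itv /=; exact: H. Qed.

Lemma cont_on_L1 a b f : cont_on a b f -> L1 mu `[a, b] f.
Proof. by move=> /cont_on_within H; apply: continuous_compact_integrable => //; exact: segment_compact. Qed.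

Lemma ftc F f a b : a<=b -> (forall x, a<=x<=b -> dv F x (f x)) -> cont_on a b f ->
 \int[mu]_(x in `[a, b]) f x = F b-F a.
Proof.
rewrite le_eqVlt => /predU1P[->|ab] dF cf.
 by rewrite set_itv1 Rintegral_set1 subrr.
rewrite /Rintegral (@continuous_FTC2 R f F a b ab) ?EFinB//.
- exact: cont_on_within.
- split.
 + move=> x; rewrite in_itv /= => /andP[u v].
  by have [] : dv F x (f x) by apply: dF; rewrite !ltW.
 + apply: cvg_at_right_filter; apply: dv_cont; apply: dF.
  by rewrite lexx ltW.
 + apply: cvg_at_left_filter; apply: dv_cont; apply: dF.
  by rewrite lexx ltW.
- move=> x; rewrite in_itv /= => /andP[u v].
 have [] : dv F x (f x) by apply: dF; rewrite !ltW.
 by move=> _ <-; rewrite derive1E.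
Qed.

Lemma mu_itv_fin a b : (mu `[a, b] < +oo)%E.
Proof. by rewrite lebesgue_measure_itv /=; case: ifP => // _; rewrite -EFinB ltry. Qed.

Lemma Rint_itv_cst a b c : a<=b -> \int[mu]_(x in `[a, b]) c = c*(b-a).
Proof.
move=> ab; rewrite (@ftc (fun x => c*x) (fun=> c))//; first by rewrite mulrBr.
 by move=> x _; dv_tac; rewrite mul0r add0r mulr1.
by move=> x _; exact: cvg_cst.
Qed.

Lemma EVT_min_on a b f : a<=b -> cont_on a b f ->
 exists2 c, a<=c<=b & forall t, a<=t<=b -> f c<=f t.
Proof.
move=> ab /cont_on_within /(EVT_min ab)[c cab H].
by exists c => [|t tab]; [move: cab|apply: H]; rewrite in_itv.
Qed.

(* clamping to an interval extends functions that are only continuous there *)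
Definition clamp a b x : R := Num.max a (Num.min b x).

Lemma clamp_in a b x : a<=b -> a<=clamp a b x<=b.
Proof. by move=> ab; rewrite /clamp le_max lexx /= ge_max ab /= ge_min lexx. Qed.

Lemma clamp_id a b x : a<=x<=b -> clamp a b x = x.
Proof. by move=> /andP[u v]; rewrite /clamp (min_idPr v) (max_idPr u). Qed.

Lemma clamp_cont a b : continuous (clamp a b).
Proof.
move=> x; apply: (@continuous_max R R (fun=> a) (fun y => Num.min b y)).
 exact: cvg_cst.
by apply: (@continuous_min R R (fun=> b) id) => //; exact: cvg_cst.
Qed.

Lemma cont_clamp a b f : a<=b -> cont_on a b f -> continuous (fun x => f (clamp a b x)).
Proof.
move=> ab cf x; apply: (@continuous_comp R R R (clamp a b) f); first exact: clamp_cont.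
by apply: cf; exact: clamp_in.
Qed.

Section rect.
Variables (a b c e : R).
Hypotheses (ab : a<=b) (ce : c<=e).

(* separately continuous and bounded *)
Implicit Types h : R -> R -> R.

(* separately continuous and bounded *)
Definition good2 h :=
 [/\ forall y, c<=y<=e -> cont_on a b (h^~ y),
   forall x, a<=x<=b -> cont_on c e (h x) &
   exists B, forall x y, a<=x<=b -> c<=y<=e -> `|h x y| <= B].

(** Clamping both variables extends [h] to a separately continuous function on the plane, which is
    jointly measurable by [caratheodory_meas]. *)
Lemma good2_meas h : good2 h ->
 measurable_fun setT (fun z : R*R => h (clamp a b z.1) (clamp c e z.2)).
Proof.
move=> [cx cy _].
apply: (@caratheodory_meas _ _ _ (fun x y => h (clamp a b x) (clamp c e y))).
 by move=> y; apply: (cont_clamp (f := h^~ _) ab); apply: cx; exact: clamp_in.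
move=> x; apply: continuous_measurable_fun.
by apply: cont_clamp => //; apply: cy; exact: clamp_in.
Qed.

Definition rect := (`[a, b] `*` `[c, e])%classic.

Definition I2 h := \int[(mu \x mu)%E]_(z in rect) h z.1 z.2.

Lemma rect_meas : measurable rect.
Proof. by apply: measurableX. Qed.

Let hc h x y := h (clamp a b x) (clamp c e y).

Let hc_id h x y : `[a, b]%classic x -> `[c, e]%classic y -> hc h x y = h x y.
Proof. by rewrite /= !in_itv /= => u v; rewrite /hc !clamp_id. Qed.

Let L1one x y : L1 mu `[x, y] (fun=> 1).
Proof. by apply: L1_cst => //; exact: mu_itv_fin. Qed.

Let L1B B x y : L1 mu `[x, y] (fun=> B).
Proof. by apply: L1_cst => //; exact: mu_itv_fin. Qed.

Lemma I2_L1 h : good2 h -> L1 (mu \x mu)%E rect (fun z => h z.1 z.2).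
Proof.
move=> gh; have mh := good2_meas gh; have [_ _ [B HB]] := gh.
apply: (@L1_extD _ _ _ (mu \x mu)%E _ (fun z => hc h z.1 z.2)) => //.
- exact: rect_meas.
- by move=> -[x y] [] /= k1 k2; rewrite hc_id.
apply: (@L1_prod _ _ _ _ _ mu mu _ _ _ _ (hc h) (fun=> B) (fun=> 1)) => //.
by move=> x y _ _; rewrite mulr1; apply: HB; exact: clamp_in.
Qed.

Lemma I2_xy h : good2 h -> I2 h = \int[mu]_(x in `[a, b]) \int[mu]_(y in `[c, e]) h x y.
Proof.
move=> gh; have mh := good2_meas gh; have [_ _ [B HB]] := gh.
transitivity (\int[(mu \x mu)%E]_(z in rect) hc h z.1 z.2).
 by apply: Rint_ext => -[x y] [k1 k2] /=; rewrite hc_id.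
transitivity (\int[mu]_(x in `[a, b]) \int[mu]_(y in `[c, e]) hc h x y).
 apply: (@Rint_prod _ _ _ _ _ mu mu _ _ _ _ (hc h) (fun=> B) (fun=> 1)) => //.
 by move=> x y _ _; rewrite mulr1; apply: HB; exact: clamp_in.
by apply: Rint_ext => x xab; apply: Rint_ext => y yce; rewrite hc_id.
Qed.

Lemma I2_yx h : good2 h -> I2 h = \int[mu]_(y in `[c, e]) \int[mu]_(x in `[a, b]) h x y.
Proof.
move=> gh; have mh := good2_meas gh; have [_ _ [B HB]] := gh.
rewrite (I2_xy gh).
transitivity (\int[mu]_(x in `[a, b]) \int[mu]_(y in `[c, e]) hc h x y).
 by apply: Rint_ext => x xab; apply: Rint_ext => y yce; rewrite hc_id.
transitivity (\int[mu]_(y in `[c, e]) \int[mu]_(x in `[a, b]) hc h x y).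
 apply: (@Rint_fubini _ _ _ _ _ mu mu _ _ _ _ (hc h) (fun=> B) (fun=> 1)) => //.
 by move=> x y _ _; rewrite mulr1; apply: HB; exact: clamp_in.
by apply: Rint_ext => y yce; apply: Rint_ext => x xab; rewrite hc_id.
Qed.

Lemma I2_le h k : good2 h -> good2 k ->
 (forall x y, a<=x<=b -> c<=y<=e -> h x y<=k x y) -> I2 h<=I2 k.
Proof.
move=> gh gk H; apply: le_Rintegral; [exact: rect_meas|exact: I2_L1|exact: I2_L1|].
by move=> -[x y] [] /=; rewrite !in_itv /=; exact: H.
Qed.

Lemma I2_ext h k : (forall x y, a<=x<=b -> c<=y<=e -> h x y = k x y) -> I2 h = I2 k.
Proof.
by move=> H; apply: Rint_ext => -[x y] [] /=; rewrite !in_itv /=; exact: H.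
Qed.

Lemma I2_D h k : good2 h -> good2 k -> I2 (fun x y => h x y+k x y) = I2 h+I2 k.
Proof. by move=> gh gk; rewrite /I2 RintegralD//; [exact: rect_meas|exact: I2_L1|exact: I2_L1]. Qed.

Lemma I2_Z h k : good2 h -> I2 (fun x y => k*h x y) = k*I2 h.
Proof. by move=> gh; rewrite /I2 RintegralZl//; [exact: rect_meas|exact: I2_L1]. Qed.

Lemma good2_cst k : good2 (fun _ _ => k).
Proof. by split; [move=> y _ x _; exact: cvg_cst|move=> y _ x _; exact: cvg_cst|exists `|k|]. Qed.

Lemma good2_D h k : good2 h -> good2 k -> good2 (fun x y => h x y+k x y).
Proof.
move=> [h1 h2 [B hB]] [k1 k2 [C kC]]; split.
- by move=> y yce x xab; apply: continuousD; [exact: h1|exact: k1].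
- by move=> x xab y yce; apply: continuousD; [exact: h2|exact: k2].
- by exists (B+C) => x y u v; rewrite (le_trans (ler_normD _ _))// lerD ?hB ?kC.
Qed.

Lemma good2_M h k : good2 h -> good2 k -> good2 (fun x y => h x y*k x y).
Proof.
move=> [h1 h2 [B hB]] [k1 k2 [C kC]]; split.
- by move=> y yce x xab; apply: continuousM; [exact: h1|exact: k1].
- by move=> x xab y yce; apply: continuousM; [exact: h2|exact: k2].
- by exists (B*C) => x y u v; rewrite normrM ler_pM ?hB ?kC.
Qed.

Lemma good2_N h : good2 h -> good2 (fun x y => - h x y).
Proof.
move=> /(good2_M (good2_cst (-1))); congr good2.
by apply/funext => x; apply/funext => y; rewrite mulN1r.
Qed.

Lemma good2_abs h : good2 h -> good2 (fun x y => `|h x y|).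
Proof.
move=> [h1 h2 [B hB]]; split.
- by move=> y yce x xab; apply: continuous_comp; [exact: h1|exact: norm_continuous].
- by move=> x xab y yce; apply: continuous_comp; [exact: h2|exact: norm_continuous].
- by exists B => x y u v; rewrite normr_id hB.
Qed.

Lemma good2_x f : cont_on a b f -> good2 (fun x _ => f x).
Proof.
move=> cf; split.
- by move=> y _; exact: cf.
- by move=> x _ y _; exact: cvg_cst.
have [|m _ Hm] := @EVT_min_on a b (fun x => - `|f x|) ab.
 move=> x xab; apply: continuousN; apply: continuous_comp; first exact: cf.
 exact: norm_continuous.
by exists `|f m| => x y xab _; rewrite -lerN2 Hm.
Qed.

Lemma good2_y f : cont_on c e f -> good2 (fun _ y => f y).
Proof.
move=> cf; split.
- by move=> x _ y _; exact: cvg_cst.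
- by move=> y _; exact: cf.
have [|m _ Hm] := @EVT_min_on c e (fun x => - `|f x|) ce.
 move=> x xab; apply: continuousN; apply: continuous_comp; first exact: cf.
 exact: norm_continuous.
by exists `|f m| => x y _ yce; rewrite -lerN2 Hm.
Qed.

Lemma I2_cst k : I2 (fun _ _ => k) = k*(e-c)*(b-a).
Proof.
rewrite (I2_xy (good2_cst k)) -(Rint_itv_cst (k*(e-c)) ab).
by apply: Rint_ext => x _; exact: Rint_itv_cst.
Qed.

End rect.

End interval_tools.

(** * Green's formula on rectangles *)

Section green.
Variable R : realType.
Notation mu := (@lebesgue_measure R).

Lemma odd_int (f : R -> R) (r : R) : 0<=r -> (forall x, f (- x) = - f x) ->
 cont_on (- r) r f -> \int[mu]_(x in `[- r, r]) f x = 0.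
Proof.
move=> r0 of_ cf.
have rr: - r<=r by lra.
have := @integration_by_substitution_oppr R f (- r) r rr.
rewrite opprK => /(_ (cont_on_within cf)) E.
suff : \int[mu]_(x in `[- r, r]) f x = - \int[mu]_(x in `[- r, r]) f x by lra.
rewrite {1}/Rintegral E -[RHS]mulN1r -RintegralZl//; last exact: cont_on_L1.
by congr fine; apply: eq_integral => x _; rewrite /= of_ mulN1r.
Qed.

Lemma I2_sub (a b c e a' b' c' e' : R) (h : R -> R -> R) : a<=b -> c<=e ->
 a<=a' -> b'<=b -> c<=c' -> e'<=e -> good2 a b c e h ->
 (forall x y, a<=x<=b -> c<=y<=e -> 0<=h x y) ->
 I2 a' b' c' e' h<=I2 a b c e h.
Proof.
move=> ab ce aa bb cc ee gh h0.
have L := I2_L1 ab ce gh.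
have S: rect a' b' c' e' `<=` rect a b c e.
 move=> [x y] []; rewrite /= !in_itv /= => /andP[? ?] /andP[? ?].
 by split => /=; rewrite in_itv /=; apply/andP; split; lra.
have L' : L1 (mu \x mu)%E (rect a' b' c' e') (fun z => h z.1 z.2).
 by apply: integrableS L => //; exact: rect_meas.
rewrite /I2 /Rintegral fine_le//.
- by apply: integrable_fin_num => //; exact: rect_meas.
- by apply: integrable_fin_num => //; exact: rect_meas.
apply: ge0_subset_integral => //; [exact: rect_meas|exact: rect_meas| |].
 by have /integrableP[] := L.
move=> -[x y] []; rewrite /= !in_itv /= => u v; rewrite lee_fin; exact: h0.
Qed.

Lemma good2_sub (a b c e a' b' c' e' : R) (h : R -> R -> R) :
 a<=a' -> b'<=b -> c<=c' -> e'<=e -> good2 a b c e h -> good2 a' b' c' e' h.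
Proof.
move=> aa bb cc ee [g1 g2 [B gB]].
have ix x : a'<=x<=b' -> a<=x<=b by move=> /andP[u v]; rewrite (le_trans aa u) (le_trans v bb).
have iy y : c'<=y<=e' -> c<=y<=e by move=> /andP[u v]; rewrite (le_trans cc u) (le_trans v ee).
split; last by exists B => x y /ix ? /iy ?; exact: gB.
- by move=> y /iy yce x /ix; exact: g1.
- by move=> x /ix xab y /iy; exact: g2.
Qed.

Variables (a b c e : R).
Hypotheses (ab : a<=b) (ce : c<=e).

(** Only pure second derivatives, separately continuous and bounded: exactly what integration by
    parts in one variable at a time consumes. *)
Record C2 (U Ux Uxx Uy Uyy : R -> R -> R) : Prop := {
 C2_x : forall x y, a<=x<=b -> c<=y<=e -> dv (U^~ y) x (Ux x y);
 C2_xx : forall x y, a<=x<=b -> c<=y<=e -> dv (Ux^~ y) x (Uxx x y);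
 C2_y : forall x y, a<=x<=b -> c<=y<=e -> dv (U x) y (Uy x y);
 C2_yy : forall x y, a<=x<=b -> c<=y<=e -> dv (Uy x) y (Uyy x y);
 C2_g : good2 a b c e U;
 C2_gxx : good2 a b c e Uxx;
 C2_gyy : good2 a b c e Uyy }.

(** [U wxx - w Uxx] is the x-derivative of [U wx - w Ux], which vanishes on the vertical edges;
    likewise in y. Each half is integrated first in its own variable. *)
Lemma green U Ux Uxx Uy Uyy w wx wxx wy wyy :
 C2 U Ux Uxx Uy Uyy -> C2 w wx wxx wy wyy ->
 (forall y, c<=y<=e -> [/\ w a y = 0, w b y = 0, wx a y = 0 & wx b y = 0]) ->
 (forall x, a<=x<=b -> [/\ w x c = 0, w x e = 0, wy x c = 0 & wy x e = 0]) ->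
 I2 a b c e (fun x y => U x y*(wxx x y+wyy x y)) =
 I2 a b c e (fun x y => w x y*(Uxx x y+Uyy x y)).
Proof.
move=> [Hx Hxx Hy Hyy gU gxx gyy] [kx kxx ky kyy gw gwxx gwyy] bx by_.
have g1: good2 a b c e (fun x y => U x y*wxx x y + - (w x y*Uxx x y)).
 by apply: good2_D => //; [exact: good2_M|apply: good2_N => //; exact: good2_M].
have g2: good2 a b c e (fun x y => U x y*wyy x y + - (w x y*Uyy x y)).
 by apply: good2_D => //; [exact: good2_M|apply: good2_N => //; exact: good2_M].
have E1: I2 a b c e (fun x y => U x y*wxx x y + - (w x y*Uxx x y)) = 0.
 rewrite (I2_yx ab ce g1) -[RHS](Rint_0 mu `[c, e]).
 apply: Rint_ext => y; rewrite /= in_itv /= => yce.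
 rewrite (@ftc _ (fun x => U x y*wx x y-w x y*Ux x y))//.
 - by have [-> -> -> ->] := bx y yce; rewrite !mulr0 !mul0r !subrr.
 - move=> x xab; have := dvD (dvM (Hx _ _ xab yce) (kxx _ _ xab yce))
   (dvN (dvM (kx _ _ xab yce) (Hxx _ _ xab yce))).
  by move=> h; apply: (dv_eq h); ring.
 - by case: g1 => + _ _; apply.
have E2: I2 a b c e (fun x y => U x y*wyy x y + - (w x y*Uyy x y)) = 0.
 rewrite (I2_xy ab ce g2) -[RHS](Rint_0 mu `[a, b]).
 apply: Rint_ext => x; rewrite /= in_itv /= => xab.
 rewrite (@ftc _ (fun y => U x y*wy x y-w x y*Uy x y))//.
 - by have [-> -> -> ->] := by_ x xab; rewrite !mulr0 !mul0r !subrr.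
 - move=> y yce; have := dvD (dvM (Hy _ _ xab yce) (kyy _ _ xab yce))
   (dvN (dvM (ky _ _ xab yce) (Hyy _ _ xab yce))).
  by move=> h; apply: (dv_eq h); ring.
 - by case: g2 => _ + _; apply.
have gl: good2 a b c e (fun x y => w x y*(Uxx x y+Uyy x y)).
 by apply: good2_M => //; exact: good2_D.
have := I2_D ab ce g1 g2; rewrite E1 E2 addr0 => E.
transitivity (I2 a b c e (fun x y => (U x y*wxx x y + - (w x y*Uxx x y) +
  (U x y*wyy x y + - (w x y*Uyy x y)))+w x y*(Uxx x y+Uyy x y))).
 by apply: I2_ext => // x y _ _; ring.
by rewrite I2_D// ?E ?add0r//; exact: good2_D.
Qed.

End green.

(** The factor [x] merges the cases [x <= 0] and [x > 0] into one inequality, ready to be multiplied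
    by the even nonnegative function [dmain / x]. *)
Lemma slope_bound (R : realType) (u du : R -> R) x r1 m :
 (forall z, `|z| <= r1 -> dv u z (du z)) -> (forall z, `|z| <= r1 -> du z <= - m) ->
 `|x| <= r1 -> (u x-u 0)*x <= - m*x*x.
Proof.
move=> H1 H2 xr.
have D z : `|z| <= r1 -> dv (fun z => u z+m*z) z (du z+m).
 by move=> zr; apply: (dv_eq (dvD (H1 _ zr) (dvM (dv_cst m z) (dv_id z)))); ring.
have N z : `|z| <= r1 -> du z+m<=0 by move=> /H2; lra.
have [x0|x0] := lerP x 0.
 have : u 0+m*0<=u x+m*x.
  apply: (@dv_le0_le _ (fun z => u z+m*z) (fun z => du z+m) x 0) => // z zx.
   by apply: D; move: xr; rewrite !ler_norml; lra.
  by apply: N; move: xr; rewrite !ler_norml; lra.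
 nra.
have : u x+m*x<=u 0+m*0.
 apply: (@dv_le0_le _ (fun z => u z+m*z) (fun z => du z+m) 0 x) => [|z zx|z zx].
 - exact: ltW.
 - by apply: D; move: xr; rewrite !ler_norml; lra.
 - by apply: N; move: xr; rewrite !ler_norml; lra.
nra.
Qed.

(** * The dipole kernel and a one-sided gradient bound *)

Section dipole.
Variable R : realType.
Variable r : R.
Hypothesis r0 : 0<r.
Let rn : r != 0. Proof. by rewrite lt0r_neq0. Qed.
Let rr : - r<=r. Proof. by have := r0; lra. Qed.

(* cut-off function: flat near 0, vanishing to third order at the ends *)
Definition cut (x : R) : R := (1-(x/r)^+4)^+3.
Definition cut1 (x : R) : R := - 12*(x^+3/r^+4)*(1-(x/r)^+4)^+2.
Definition cut2 (x : R) : R := - 36*(x^+2/r^+4)*(1-(x/r)^+4)^+2 +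
 96*(x^+6/r^+8)*(1-(x/r)^+4).

Lemma cut_dv x : dv cut x (cut1 x).
Proof. by rewrite /cut; dv_tac; rewrite /cut1 /=; field; exact: rn. Qed.

Lemma cut1_dv x : dv cut1 x (cut2 x).
Proof. by rewrite /cut1; dv_tac; rewrite /cut2 /=; field; exact: rn. Qed.

Let q4 x : - r<=x<=r -> 0<=1-(x/r)^+4<=1.
Proof.
move=> xr; have : (x/r)^+2<=1.
 rewrite -[1](expr1n _ 2) -[_^+2]real_normK ?num_real// ler_sqr ?nnegrE//.
 by rewrite normrM normfV (gtr0_norm r0) ler_pdivrMr// mul1r ler_norml.
have := sqr_ge0 (x/r); rewrite (_ : (x/r)^+4 = (x/r)^+2*(x/r)^+2); last by ring.
nra.
Qed.

Lemma cut_01 x : - r<=x<=r -> 0<=cut x<=1.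
Proof. by move=> /q4 /andP[u v]; rewrite /cut exprn_ge0// exprn_ile1. Qed.

Lemma cut_half x : - (r/2)<=x<=r/2 -> 1/2<=cut x.
Proof.
move=> xr; have : (x/r)^+2<=1/4.
 rewrite exprMn exprVn ler_pdivrMr ?exprn_gt0//.
 have : x^+2<=(r/2)^+2.
  by rewrite -[x^+2]real_normK ?num_real// ler_sqr ?nnegrE// ?ler_norml//; have := r0; lra.
 by rewrite expr_div_n; lra.
have := sqr_ge0 (x/r); rewrite /cut (_ : (x/r)^+4 = (x/r)^+2*(x/r)^+2); last by ring.
set z := (x/r)^+2 => z0 z4.
have : 15/16<=1-z*z by nra.
move=> h; apply: (@le_trans _ _ ((15/16)^+3)); first by lra.
by rewrite lerXn2r ?nnegrE; lra.
Qed.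

Lemma cut1_le x : - r<=x<=r -> `|cut1 x| <= 12/r^+4 * `|x| ^+ 3.
Proof.
move=> /q4 /andP[u v].
have -> : cut1 x = 12/r^+4*x^+3*(- (1-(x/r)^+4)^+2).
 by rewrite /cut1; field; exact: rn.
have c0: 0<=12/r^+4 by rewrite divr_ge0// exprn_ge0// ltW.
rewrite normrM normrN (normrX 2) (ger0_norm u) (normrM (12/r^+4)) normrX (ger0_norm c0).
by rewrite ler_piMr ?exprn_ile1// mulr_ge0// exprn_ge0.
Qed.

Lemma cut2_le x : - r<=x<=r -> `|cut2 x| <= 132/r^+4 * `|x| ^+ 2.
Proof.
move=> /q4; set q := (x/r)^+4 => /andP[u v].
have q0: 0<=q by rewrite exprn_even_ge0.
have -> : cut2 x = 132/r^+4*x^+2*((- 36*(1-q)^+2+96*(q*(1-q)))/132).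
 by rewrite /cut2 /q; field; exact: rn.
have c0: 0<=132/r^+4 by rewrite divr_ge0// exprn_ge0// ltW.
rewrite normrM (normrM (132/r^+4)) normrX (ger0_norm c0).
apply: ler_piMr; first by rewrite (mulr_ge0 c0)// exprn_ge0.
have a1: 0<=(1-q)^+2<=1 by rewrite sqr_ge0 exprn_ile1.
have a2: 0<=q*(1-q)<=1 by apply/andP; split; nra.
rewrite ler_norml; move: a1 a2; set s := _^+2; set t := q*_ => /andP[? ?] /andP[? ?].
by apply/andP; split; lra.
Qed.

Lemma cut_end : [/\ cut r = 0, cut (- r) = 0, cut1 r = 0 & cut1 (- r) = 0].
Proof.
have e: r/r = 1 by rewrite divff// lt0r_neq0.
by rewrite /cut /cut1 (mulNr r) e; split; ring.
Qed.

Section kernel.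
Variable k : R.
Hypothesis k0 : 0<k.

Definition kD (x y : R) := x^+2+y^+2+k^+2.

Lemma kD_gt0 x y : 0<kD x y.
Proof. by rewrite /kD ltr_wpDl ?addr_ge0 ?sqr_ge0 ?exprn_gt0. Qed.
Let kD_neq0 x y : kD x y != 0. Proof. by rewrite lt0r_neq0 ?kD_gt0. Qed.

(** The x-derivative of [ln (x^2 + y^2 + k^2) / 2]: a dipole potential smoothed at scale [k]. Its
    Laplacian approximates a derivative of a point mass. *)
Definition kk x y := x/kD x y.
Definition kkx x y := 1/kD x y-2*x^+2/kD x y^+2.
Definition kkxx x y := - 6*x/kD x y^+2+8*x^+3/kD x y^+3.
Definition kky x y := - 2*x*y/kD x y^+2.
Definition kkyy x y := - 2*x/kD x y^+2+8*x*y^+2/kD x y^+3.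

Let kDx x y : dv (kD^~ y) x (2*x).
Proof. by rewrite /kD; dv_tac; rewrite /=; ring. Qed.
Let kDy x y : dv (kD x) y (2*y).
Proof. by rewrite /kD; dv_tac; rewrite /=; ring. Qed.

Lemma kk_x x y : dv (kk^~ y) x (kkx x y).
Proof.
by apply: (dv_eq (dvM (dv_id x) (dvV (f := kD^~ y) (kD_neq0 x y) (kDx x y)))); rewrite /kkx; field; exact: kD_neq0.
Qed.

Lemma kk_y x y : dv (kk x) y (kky x y).
Proof.
by apply: (dv_eq (dvM (dv_cst x y) (dvV (f := kD x) (kD_neq0 x y) (kDy x y)))); rewrite /kky; field; exact: kD_neq0.
Qed.

Let kD2x x y : dv (fun x => kD x y^+2) x (2*kD x y*(2*x)).
Proof. by apply: (dv_eq (dvX 2 (kDx x y))); rewrite /= expr1. Qed.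
Let kD2y x y : dv (fun y => kD x y^+2) y (2*kD x y*(2*y)).
Proof. by apply: (dv_eq (dvX 2 (kDy x y))); rewrite /= expr1. Qed.
Let kD2_neq0 x y : kD x y^+2 != 0. Proof. by rewrite expf_neq0. Qed.

Lemma kkx_x x y : dv (kkx^~ y) x (kkxx x y).
Proof.
have n2: dv (fun x => 2*x^+2) x (4*x) by dv_tac; rewrite /=; ring.
have h := dvD (dvM (dv_cst 1 x) (dvV (f := kD^~ y) (kD_neq0 x y) (kDx x y)))
 (dvN (dvM n2 (dvV (f := fun x => kD x y^+2) (kD2_neq0 x y) (kD2x x y)))).
by apply: (dv_eq h); rewrite /kkxx; field; exact: kD_neq0.
Qed.

Lemma kky_y x y : dv (kky x) y (kkyy x y).
Proof.
have n2: dv (fun y => - 2*x*y) y (- 2*x) by dv_tac; rewrite /=; ring.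
have h := dvM n2 (dvV (f := fun y => kD x y^+2) (kD2_neq0 x y) (kD2y x y)).
by apply: (dv_eq h); rewrite /kkyy; field; exact: kD_neq0.
Qed.

Lemma kk_lap x y : kkxx x y+kkyy x y = - (8*k^+2*x/kD x y^+3).
Proof.
rewrite /kkxx /kkyy.
have -> : k^+2 = kD x y-x^+2-y^+2 by rewrite /kD; ring.
by field; exact: kD_neq0.
Qed.

(** The sign makes the test function nonnegative for [x <= 0], the side on which the Laplacian of
    [U] will only be known to be nonnegative. *)
Definition dw x y := - (cut x*cut y*kk x y).
Definition dwx x y := - (cut y*(cut1 x*kk x y+cut x*kkx x y)).
Definition dwxx x y := - (cut y*(cut2 x*kk x y+2*cut1 x*kkx x y+cut x*kkxx x y)).
Definition dwy x y := - (cut x*(cut1 y*kk x y+cut y*kky x y)).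
Definition dwyy x y := - (cut x*(cut2 y*kk x y+2*cut1 y*kky x y+cut y*kkyy x y)).

(** The part of the Laplacian of [dw] that concentrates at the origin as [k] tends to 0; [derr]
    collects the terms in which the cut-off is differentiated. *)
Definition dmain x y := 8*k^+2*x*cut x*cut y/kD x y^+3.
Definition derr x y := - (cut y*(cut2 x*kk x y+2*cut1 x*kkx x y) +
 cut x*(cut2 y*kk x y+2*cut1 y*kky x y)).

Lemma dw_lap x y : dwxx x y+dwyy x y = dmain x y+derr x y.
Proof.
have E: kkxx x y = - (8*k^+2*x/kD x y^+3)-kkyy x y by rewrite -kk_lap; ring.
by rewrite /dwxx /dwyy /dmain /derr E; field; exact: kD_neq0.
Qed.

Let x2D x y : `|x| ^+ 2<=kD x y.
Proof. by rewrite real_normK ?num_real// /kD; have := sqr_ge0 y; have := sqr_ge0 k; lra. Qed.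
Let y2D x y : `|y| ^+ 2<=kD x y.
Proof. by rewrite real_normK ?num_real// /kD; have := sqr_ge0 x; have := sqr_ge0 k; lra. Qed.

(** The bound is independent of [k]: the flatness of the cut-off, [cut1 = O(|x|^3)] and
    [cut2 = O(x^2)], compensates the singularity of the dipole, because [kD] dominates [x^2] and
    [y^2]. *)
Lemma derr_le x y : - r<=x<=r -> - r<=y<=r -> `|derr x y| <= 400/r^+3.
Proof.
move=> xr yr; have /andP[cx0 cx1] := cut_01 xr; have /andP[cy0 cy1] := cut_01 yr.
have D0 := kD_gt0 x y.
have xn: `|x| <= r by rewrite ler_norml.
have yn: `|y| <= r by rewrite ler_norml.
have r4: 0<r^+4 by rewrite exprn_gt0.
have P1: `|kkx x y| <= 3/kD x y.
 rewrite /kkx; apply: (le_trans (ler_normB _ _)).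
 rewrite !normrM !normfV normr1 (gtr0_norm D0) !normrX (gtr0_norm D0) (ger0_norm (ler0n _ _)).
 rewrite (_ : 3/kD x y = 1/kD x y+2*kD x y/kD x y^+2); last by field; exact: kD_neq0.
 rewrite lerD2l ler_pM2r ?invr_gt0 ?exprn_gt0// ler_pM2l//; exact: x2D.
have P2: `|kk x y| = `|x| / kD x y by rewrite /kk normrM normfV (gtr0_norm D0).
have P3: `|kky x y| = 2 * `|x| * `|y| / kD x y^+2.
 by rewrite /kky !normrM normrN normfV normrX (gtr0_norm D0) (ger0_norm (ler0n _ _)).
have T1: `|cut2 x*kk x y| <= 132/r^+3.
 rewrite normrM P2; apply: (@le_trans _ _ (132/r^+4 * `|x| ^+ 2*(`|x| / kD x y))).
  by apply: ler_wpM2r; [rewrite divr_ge0// ltW|exact: cut2_le].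
 rewrite (_ : 132/r^+3 = 132/r^+4*r); last by field; exact: rn.
 rewrite -!mulrA ler_pM2l// ler_pM2l ?invr_gt0// !mulrA ler_pdivrMr//.
 by rewrite mulrC ler_pM ?x2D// ?exprn_ge0.
have T2: `|2*cut1 x*kkx x y| <= 72/r^+3.
 rewrite normrM (normrM 2) (ger0_norm (ler0n _ _)).
 apply: (@le_trans _ _ (2*(12/r^+4 * `|x| ^+ 3)*(3/kD x y))).
  by apply: ler_pM; [exact: mulr_ge0|exact: normr_ge0|rewrite ler_pM2l//; exact: cut1_le|exact: P1].
 rewrite (_ : 72/r^+3 = 72/r^+4*r); last by field; exact: rn.
 rewrite (_ : _*(3 / _) = 72/r^+4*(`|x| ^+ 3/kD x y)); last by field; rewrite kD_neq0 rn.
 rewrite ler_pM2l ?divr_gt0// ler_pdivrMr// (_ : `|x| ^+ 3 = `|x| * `|x| ^+ 2); last by ring.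
 by rewrite ler_pM ?x2D// ?exprn_ge0.
have T3: `|cut2 y*kk x y| <= 132/r^+3.
 rewrite normrM P2; apply: (@le_trans _ _ (132/r^+4 * `|y| ^+ 2*(`|x| / kD x y))).
  by apply: ler_wpM2r; [rewrite divr_ge0// ltW|exact: cut2_le].
 rewrite (_ : 132/r^+3 = 132/r^+4*r); last by field; exact: rn.
 rewrite -!mulrA ler_pM2l// ler_pM2l ?invr_gt0// !mulrA ler_pdivrMr//.
 by rewrite mulrC ler_pM ?y2D// ?exprn_ge0.
have T4: `|2*cut1 y*kky x y| <= 48/r^+3.
 rewrite normrM (normrM 2) (ger0_norm (ler0n _ _)) P3.
 apply: (@le_trans _ _ (2*(12/r^+4 * `|y| ^+ 3)*(2 * `|x| * `|y| / kD x y^+2))).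
  apply: ler_wpM2r; last by rewrite ler_pM2l//; exact: cut1_le.
  by rewrite divr_ge0 ?exprn_ge0 ?(ltW D0)// mulr_ge0// mulr_ge0.
 rewrite (_ : 48/r^+3 = 48/r^+4*r); last by field; exact: rn.
 rewrite (_ : _*(_ / _^+2) = 48/r^+4*(`|x| * (`|y| ^+ 2 * `|y| ^+ 2)/kD x y^+2)); last by field; rewrite kD_neq0 rn.
 rewrite ler_pM2l ?divr_gt0// ler_pdivrMr ?exprn_gt0//.
 rewrite ler_pM ?mulr_ge0 ?exprn_ge0// expr2.
 by rewrite ler_pM ?y2D// ?exprn_ge0.
rewrite /derr normrN; apply: (le_trans (ler_normD _ _)); rewrite (normrM (cut y)) (normrM (cut x)) (ger0_norm cx0) (ger0_norm cy0).
have S1 := le_trans (ler_normD (cut2 x*kk x y) (2*cut1 x*kkx x y)) (lerD T1 T2).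
have S2 := le_trans (ler_normD (cut2 y*kk x y) (2*cut1 y*kky x y)) (lerD T3 T4).
have r3: 0<(r^+3)^-1 by rewrite invr_gt0 exprn_gt0.
have U1 := ler_pM cy0 (normr_ge0 _) cy1 S1.
have U2 := ler_pM cx0 (normr_ge0 _) cx1 S2.
by apply: (le_trans (lerD U1 U2)); lra.
Qed.

Definition sq2 := good2 (- r) r (- r) r.

Lemma good2_dvb (h hx hy : R -> R -> R) (B : R) :
 (forall x y, - r<=x<=r -> - r<=y<=r -> dv (h^~ y) x (hx x y)) ->
 (forall x y, - r<=x<=r -> - r<=y<=r -> dv (h x) y (hy x y)) ->
 (forall x y, - r<=x<=r -> - r<=y<=r -> `|h x y| <= B) -> sq2 h.
Proof.
move=> h1 h2 h3; split; last by exists B.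
- by move=> y yr x xr; exact: dv_cont (h1 _ _ xr yr).
- by move=> x xr y yr; exact: dv_cont (h2 _ _ xr yr).
Qed.

Let contX x : {for x, continuous cut}. Proof. exact: dv_cont (cut_dv x). Qed.

(* Continuity of the rational kernels, via the algebra of good functions. *)
Let gx : sq2 (fun x _ => x).
Proof. by apply: good2_x => // x _; exact: cvg_id. Qed.
Let gy : sq2 (fun _ y => y).
Proof. by apply: good2_y => // x _; exact: cvg_id. Qed.

Let gDV : sq2 (fun x y => (kD x y)^-1).
Proof.
apply: (@good2_dvb _ (fun x y => - (2*x)/kD x y^+2) (fun x y => - (2*y)/kD x y^+2) (k^+2)^-1).
- by move=> x y _ _; exact: (dvV (f := kD^~ y)).
- by move=> x y _ _; exact: (dvV (f := kD x)).
move=> x y _ _; rewrite normfV gtr0_norm ?kD_gt0// lef_pV2 ?posrE ?kD_gt0 ?exprn_gt0//.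
by rewrite /kD; have := sqr_ge0 x; have := sqr_ge0 y; lra.
Qed.

Let gcut : sq2 (fun x _ => cut x).
Proof. by apply: good2_x => // x _; exact: dv_cont (cut_dv x). Qed.
Let gcuty : sq2 (fun _ y => cut y).
Proof. by apply: good2_y => // x _; exact: dv_cont (cut_dv x). Qed.
Let gcut1 : sq2 (fun x _ => cut1 x).
Proof. by apply: good2_x => // x _; exact: dv_cont (cut1_dv x). Qed.
Let gcut1y : sq2 (fun _ y => cut1 y).
Proof. by apply: good2_y => // x _; exact: dv_cont (cut1_dv x). Qed.
Let cut2_dv x : exists a, dv cut2 x a.
Proof. by eexists; rewrite /cut2; repeat dv_step. Qed.
Let gcut2 : sq2 (fun x _ => cut2 x).
Proof. by apply: good2_x => // x _; have [a /dv_cont] := cut2_dv x. Qed.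
Let gcut2y : sq2 (fun _ y => cut2 y).
Proof. by apply: good2_y => // x _; have [a /dv_cont] := cut2_dv x. Qed.
Let gc c : sq2 (fun _ _ => c). Proof. exact: good2_cst. Qed.
Let gM (f g : R -> R -> R) : sq2 f -> sq2 g -> sq2 (fun x y => f x y*g x y).
Proof. exact: good2_M. Qed.
Let gA (f g : R -> R -> R) : sq2 f -> sq2 g -> sq2 (fun x y => f x y+g x y).
Proof. exact: good2_D. Qed.
Let gN (f : R -> R -> R) : sq2 f -> sq2 (fun x y => - f x y).
Proof. exact: good2_N. Qed.

Let gkk : sq2 kk. Proof. exact: (gM gx gDV). Qed.
Let gpow (f : R -> R -> R) n : sq2 f -> sq2 (fun x y => f x y^+n).
Proof.
move=> gf; elim: n => [|n ih]; first exact: gc.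
by under eq_fun do under eq_fun do rewrite exprS; exact: gM.
Qed.
Let gDVn n : sq2 (fun x y => (kD x y^+n)^-1).
Proof. by under eq_fun do under eq_fun do rewrite -exprVn; exact: gpow. Qed.
Let gkkx : sq2 kkx.
Proof. by apply: gA; [apply: gM => //|apply: gN; apply: gM => //; apply: gM => //; exact: (gpow 2 gx)]. Qed.
Let gkkxx : sq2 kkxx.
Proof. by apply: gA; [apply: gM => //; apply: gM => //|apply: gM => //; apply: gM => //; exact: (gpow 3 gx)]. Qed.
Let gkky : sq2 kky.
Proof. by apply: gM => //; apply: gM => //; apply: gM. Qed.
Let gkkyy : sq2 kkyy.
Proof.
by apply: gA; [apply: gM => //; apply: gM => //|apply: gM => //; apply: gM => //; [exact: gM|exact: (gpow 2 gy)]].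
Qed.

Lemma good2_dmain : sq2 dmain.
Proof. by apply: gM => //; apply: gM => //; apply: gM => //; apply: gM. Qed.

Lemma good2_derr : sq2 derr.
Proof.
apply: gN; apply: gA; apply: gM => //; apply: gA; apply: gM => //; apply: gM => //.
Qed.

Lemma dw_C2 : C2 (- r) r (- r) r dw dwx dwxx dwy dwyy.
Proof.
split.
- move=> x y _ _; have h := dvN (dvM (dvM (cut_dv x) (dv_cst (cut y) x)) (kk_x x y)).
 by apply: (dv_eq h); rewrite /dwx; ring.
- move=> x y _ _; have h := dvN (dvM (dv_cst (cut y) x)
  (dvD (dvM (cut1_dv x) (kk_x x y)) (dvM (cut_dv x) (kkx_x x y)))).
 by apply: (dv_eq h); rewrite /dwxx; ring.
- move=> x y _ _; have h := dvN (dvM (dvM (dv_cst (cut x) y) (cut_dv y)) (kk_y x y)).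
 by apply: (dv_eq h); rewrite /dwy; ring.
- move=> x y _ _; have h := dvN (dvM (dv_cst (cut x) y)
  (dvD (dvM (cut1_dv y) (kk_y x y)) (dvM (cut_dv y) (kky_y x y)))).
 by apply: (dv_eq h); rewrite /dwyy; ring.
- by apply: gN; apply: gM => //; exact: gM.
- apply: gN; apply: gM => //; apply: gA; last exact: gM.
 by apply: gA; [exact: gM|apply: gM => //; exact: gM].
- apply: gN; apply: gM => //; apply: gA; last exact: gM.
 by apply: gA; [exact: gM|apply: gM => //; exact: gM].
Qed.

Lemma dw_bd : (forall y, - r<=y<=r -> [/\ dw (- r) y = 0, dw r y = 0, dwx (- r) y = 0 & dwx r y = 0]) /\
 (forall x, - r<=x<=r -> [/\ dw x (- r) = 0, dw x r = 0, dwy x (- r) = 0 & dwy x r = 0]).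
Proof.
have [e1 e2 e3 e4] := cut_end.
by split=> z _; rewrite /dw /dwx /dwy e1 e2 e3 e4; split; ring.
Qed.

(** Oddness in [x]. It allows [U x y] to be replaced by the increment [U x y - U 0 y] against
    [dmain]. *)
Lemma dmain_odd (u : R -> R) : cont_on (- r) r u -> I2 (- r) r (- r) r (fun x y => u y * dmain x y) = 0.
Proof.
move=> cu; have gu: sq2 (fun _ y => u y) by exact: good2_y.
rewrite (I2_yx rr rr (gM gu good2_dmain)) -[RHS](Rint_0 (@lebesgue_measure R) `[- r, r]).
apply: Rint_ext => y; rewrite /= in_itv /= => yr.
apply: odd_int; first exact: ltW.
- move=> x; rewrite /dmain /kD /cut mulNr sqrrN (_ : (- (x/r))^+4 = (x/r)^+4); last by ring.
 by ring.
- by have [+ _ _] := gM gu good2_dmain; apply.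
Qed.

Definition dJ := I2 (- r) r (- r) r (fun x y => x * dmain x y).

(** The integrand is nonnegative, and on the rectangle [[k, 2k] x [0, k]], where [kD <= 6 k^2] and
    both cut-offs are at least 1/2, it is at least [1/(108 k^2)]. The resulting bound does not
    degenerate with [k]. *)
Lemma dJ_ge : k<=r/4 -> 1/108<=dJ.
Proof.
move=> kr; have r0' := r0; have k0' := k0.
have gJ: sq2 (fun x y => x * dmain x y) by apply: gM => //; exact: good2_dmain.
have J0 x y : - r<=x<=r -> - r<=y<=r -> 0<=x * dmain x y.
 move=> xr yr; rewrite (_ : x*_ = 8*k^+2*x^+2*cut x*cut y/kD x y^+3); last by rewrite /dmain; ring.
 have /andP[cx _] := cut_01 xr; have /andP[cy _] := cut_01 yr.
 apply: divr_ge0; last by rewrite exprn_ge0 ?(ltW (kD_gt0 _ _)).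
 apply: mulr_ge0 => //; apply: mulr_ge0 => //.
 by apply: mulr_ge0; [apply: mulr_ge0 => //|]; exact: sqr_ge0.
have a1: - r<=k by lra.
have a2: 2*k<=r by lra.
have a3: - r<=0 by lra.
have a4: k<=r by lra.
apply: (le_trans _ (I2_sub rr rr a1 a2 a3 a4 gJ J0)).
have kk2: k<=2*k by lra.
have kk0: 0<=k by lra.
have gJ' : good2 k (2*k) 0 k (fun x y => x * dmain x y).
 exact: good2_sub gJ.
rewrite (_ : 1/108 = I2 k (2*k) 0 k (fun _ _ => 1/(108*k^+2))); last first.
 by rewrite I2_cst//; field; rewrite lt0r_neq0.
apply: I2_le => //; first exact: good2_cst.
move=> x y xk yk; rewrite (_ : x*_ = 8*k^+2*x^+2*(cut x*cut y)/kD x y^+3); last by rewrite /dmain; ring.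
have cx: 1/2<=cut x by apply: cut_half; lra.
have cy: 1/2<=cut y by apply: cut_half; lra.
have D6: kD x y<=6*k^+2 by rewrite /kD; nra.
have D3: kD x y^+3<=(6*k^+2)^+3.
 by rewrite lerXn2r// nnegrE ?(ltW (kD_gt0 _ _))// mulr_ge0// sqr_ge0.
rewrite ler_pdivlMr ?exprn_gt0 ?kD_gt0//.
have k2: 0<k^+2 by rewrite exprn_gt0.
apply: (@le_trans _ _ (1/(108*k^+2)*(6*k^+2)^+3)).
 by rewrite ler_wpM2l// divr_ge0// mulr_ge0// ltW.
rewrite (_ : 1/(108*k^+2)*(6*k^+2)^+3 = 2*k^+2*k^+2); last by field; rewrite lt0r_neq0.
have x2: k^+2<=x^+2 by nra.
have cc: 1/4<=cut x*cut y by nra.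
have : k^+2*k^+2<=k^+2*x^+2 by rewrite ler_pM2l.
set A := k^+2*k^+2; set B := k^+2*x^+2 => AB.
have B0: 0<=B by rewrite mulr_ge0 ?sqr_ge0.
rewrite (_ : 2*k^+2*k^+2 = 2*A); last by rewrite /A; ring.
rewrite (_ : 8*k^+2*x^+2*_ = 8*B*(cut x*cut y)); last by rewrite /B; ring.
nra.
Qed.

(* The dipole inequality for a fixed kernel width k. *)
Lemma dipole_k U Ux Uxx Uy Uyy r1 m eta B0 :
 C2 (- r) r (- r) r U Ux Uxx Uy Uyy -> k<=r/4 ->
 0<r1<=r -> 0<=m -> 0<=eta -> 0<=B0 ->
 (forall x y, - r<=x<=0 -> - r<=y<=r -> 0<=Uxx x y+Uyy x y) ->
 (forall x y, 0<=x<=r -> - r<=y<=r -> `|Uxx x y+Uyy x y| <= eta) ->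
 (forall x y, `|x| <= r1 -> `|y| <= r1 -> Ux x y <= - m) ->
 (forall y, - r<=y<=r -> `|U 0 y| <= B0) ->
 8*k^+2*r<=r1^+6 -> 8*k^+2*r*(r*4*r^+2)<=r1^+6/216 ->
 8*k^+2*r*(B0*4*r^+2)<=r1^+6 ->
 m/216<=(400/r^+3+1)*I2 (- r) r (- r) r (fun x y => `|U x y|)+1+4*r^+3/k^+2*eta.
Proof.
move=> HU kr /andP[r10 r1r] m0 e0 B00 lp le_ Hm HB k1 k2 k3.
have r0' := r0; have k0' := k0.
have gU := C2_g HU.
have gUa: sq2 (fun x y => `|U x y|) by exact: good2_abs.
have gl: sq2 (fun x y => Uxx x y+Uyy x y) by apply: gA; [exact: C2_gxx HU|exact: C2_gyy HU].
have [bd1 bd2] := dw_bd.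
have G := green rr rr HU dw_C2 bd1 bd2.
have gm := good2_dmain; have ge_ := good2_derr.
have E1: I2 (- r) r (- r) r (fun x y => U x y*(dwxx x y+dwyy x y)) =
  I2 (- r) r (- r) r (fun x y => U x y * dmain x y)+I2 (- r) r (- r) r (fun x y => U x y * derr x y).
 rewrite -I2_D//; [|exact: gM|exact: gM].
 by apply: I2_ext => // x y _ _; rewrite dw_lap mulrDr.
set S := I2 _ _ _ _ (fun x y => `|U x y|).
have E2: I2 (- r) r (- r) r (fun x y => U x y * derr x y)<=400/r^+3*S.
 rewrite /S -(I2_Z rr rr _ gUa); apply: I2_le => //; [exact: gM|exact: gM|].
 move=> x y xr yr; apply: (le_trans (ler_norm _)); rewrite normrM mulrC.
 by apply: ler_wpM2r => //; exact: derr_le.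
(* For [x <= 0] both factors are nonnegative. For [x > 0] one has [|dw| <= r/k^2] and the Laplacian
   is at most [eta]; the square has area [4 r^2]. *)
have E3: - (4*r^+3/k^+2*eta)<=I2 (- r) r (- r) r (fun x y => dw x y*(Uxx x y+Uyy x y)).
 rewrite (_ : - _ = I2 (- r) r (- r) r (fun _ _ => - (r/k^+2*eta))); last first.
  by rewrite I2_cst//; ring.
 apply: I2_le => //; [exact: good2_cst|by apply: gM => //; exact: C2_g dw_C2|].
 move=> x y xr yr; have /andP[cx cx1] := cut_01 xr; have /andP[cy cy1] := cut_01 yr.
 have D0 := kD_gt0 x y.
 have [x0|x0] := lerP x 0.
  apply: (@le_trans _ _ 0); first by rewrite oppr_le0 mulr_ge0// divr_ge0 ?exprn_ge0// ltW.
  rewrite mulr_ge0//; last by apply: lp => //; lra.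
  have K0: kk x y<=0 by rewrite /kk mulr_le0_ge0// invr_ge0 ltW.
  by rewrite /dw oppr_ge0 mulr_ge0_le0// mulr_ge0.
 have : `|dw x y*(Uxx x y+Uyy x y)| <= r/k^+2*eta.
  rewrite normrM ler_pM//; last by apply: le_ => //; lra.
  rewrite /dw normrN normrM normrM (ger0_norm cx) (ger0_norm cy) /kk normrM normfV (gtr0_norm x0) (gtr0_norm D0).
  apply: (@le_trans _ _ (1*(x/kD x y))).
   by apply: ler_wpM2r; [rewrite divr_ge0 ?ltW|rewrite mulr_ile1].
  rewrite mul1r ler_pM ?invr_ge0 ?(ltW D0) ?(ltW x0)//; first by lra.
  rewrite lef_pV2 ?posrE ?exprn_gt0// /kD.
  by have := sqr_ge0 x; have := sqr_ge0 y; lra.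
 by rewrite ler_norml => /andP[].
have cU0: cont_on (- r) r (U 0) by have [_ + _] := gU; apply; lra.
have E4: I2 (- r) r (- r) r (fun x y => U x y * dmain x y) =
  I2 (- r) r (- r) r (fun x y => (U x y-U 0 y) * dmain x y).
 have gU0: sq2 (fun _ y => U 0 y) by exact: good2_y.
 have Z: I2 (- r) r (- r) r (fun x y => -1*(U 0 y * dmain x y)) = 0.
  transitivity (-1*I2 (- r) r (- r) r (fun x y => U 0 y * dmain x y)).
   exact: (I2_Z rr rr (-1) (gM gU0 gm)).
  by rewrite dmain_odd// mulr0.
 transitivity (I2 (- r) r (- r) r (fun x y => U x y * dmain x y) +
   I2 (- r) r (- r) r (fun x y => -1*(U 0 y * dmain x y))); first by rewrite Z addr0.
 rewrite -I2_D//; [|exact: gM|by apply: gM => //; exact: gM].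
 by apply: I2_ext => // x y _ _; ring.
(* A bound for [|dmain|] outside the square of half-side [r1], where [kD >= r1^2]; it tends to 0
   with [k]. *)
pose d := 8*k^+2*r/r1^+6.
have d0: 0<=d by rewrite /d divr_ge0 ?exprn_ge0 ?mulr_ge0 ?exprn_ge0// ltW.
have E5: I2 (- r) r (- r) r (fun x y => (U x y-U 0 y) * dmain x y) <=
  - m * dJ+d*(S+(B0+m*r)*4*r^+2).
 have gJ: sq2 (fun x y => x * dmain x y) by exact: gM.
 rewrite (_ : _+d*_ = I2 (- r) r (- r) r (fun x y => - m*(x * dmain x y)+d*(`|U x y| + (B0+m*r)))); last first.
  rewrite I2_D//; [|exact: gM|by apply: gM => //; exact: gA].
  rewrite [X in _ = X + _](_ : _ = - m * dJ); last exact: (I2_Z rr rr _ gJ).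
  rewrite [X in _ = _+X](_ : _ = d*I2 (- r) r (- r) r (fun x y => `|U x y| + (B0+m*r))); last first.
   exact: (I2_Z rr rr _ (gA gUa (gc _))).
  have -> : I2 (- r) r (- r) r (fun x y => `|U x y| + (B0+m*r)) = S+I2 (- r) r (- r) r (fun _ _ => B0+m*r).
   exact: (I2_D rr rr gUa (gc _)).
  by rewrite I2_cst//; ring.
 apply: I2_le => //.
 - by apply: gM => //; apply: gA => //; apply: gN; exact: good2_y.
 - by apply: gA; [exact: gM|apply: gM => //; exact: gA].
 move=> x y xr yr; have /andP[cx cx1] := cut_01 xr; have /andP[cy cy1] := cut_01 yr.
 have D0 := kD_gt0 x y.
 have c0: 0<=8*k^+2*cut x*cut y/kD x y^+3.
  apply: divr_ge0; last by rewrite exprn_ge0 ?(ltW D0).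
  by apply: mulr_ge0 => //; apply: mulr_ge0 => //; apply: mulr_ge0 => //; exact: sqr_ge0.
 have dmE: dmain x y = x*(8*k^+2*cut x*cut y/kD x y^+3) by rewrite /dmain; ring.
 (* Near the origin the hypothesis on [Ux] gives the gain [- m x]; away from it the kernel is at
    most [d], and the mean of [|U|] and the bound [B0] suffice. *)
 have [xy|xy] := boolP ((`|x| <= r1) && (`|y| <= r1)).
  have /andP[x1 y1] := xy.
  apply: (@le_trans _ _ (- m*(x * dmain x y))); last first.
   by rewrite lerDl mulr_ge0// addr_ge0// addr_ge0// mulr_ge0// ltW.
  rewrite dmE; move: c0; generalize (8*k^+2*cut x*cut y/kD x y^+3) => cc c0.
  rewrite !mulrA ler_wpM2r//.
  apply: (@slope_bound _ (U^~ y) (Ux^~ y) x r1 m) => // z zr1; last exact: Hm.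
  apply: (C2_x HU) => //; have zr := le_trans zr1 r1r.
  by rewrite -ler_norml.
 have D3: r1^+6<=kD x y^+3.
  rewrite (_ : 6%N = (2*3)%N)// exprM lerXn2r ?nnegrE ?sqr_ge0 ?(ltW D0)//.
  rewrite /kD -[x^+2]real_normK ?num_real// -[y^+2]real_normK ?num_real//.
  have := sqr_ge0 `|x|; have := sqr_ge0 `|y|; have := sqr_ge0 k.
  have sqle z : r1 < `|z| -> r1^+2 <= `|z| ^+ 2.
   by move=> h; rewrite lerXn2r ?nnegrE ?(ltW r10) ?(ltW h).
  by move: xy; rewrite negb_and -!ltNge => /orP[/sqle|/sqle]; lra.
 have xn: `|x| <= r by rewrite ler_norml.
 have K1: `|dmain x y| <= d.
  rewrite dmE normrM (ger0_norm c0) /d.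
  rewrite (_ : 8*k^+2*r/r1^+6 = r*(8*k^+2/r1^+6)); last by field; rewrite lt0r_neq0.
  apply: ler_pM => //.
  have k80: 0<=8*k^+2 by apply: mulr_ge0 => //; exact: sqr_ge0.
  have cc0: 0<=cut x*cut y by exact: mulr_ge0.
  have cc1: cut x*cut y<=1 by exact: mulr_ile1.
  rewrite -[8*k^+2*cut x*cut y]mulrA; apply: ler_pM.
  - exact: mulr_ge0.
  - by rewrite invr_ge0 exprn_ge0 ?(ltW D0).
  - exact: ler_piMr.
  - by rewrite lef_pV2 ?posrE ?exprn_gt0.
 have K2: x * dmain x y<=r * d.
  by apply: (le_trans (ler_norm _)); rewrite normrM ler_pM.
 have K3: (U x y-U 0 y) * dmain x y<=d*(`|U x y| + B0).
  apply: (le_trans (ler_norm _)); rewrite normrM mulrC ler_pM//.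
  by apply: (le_trans (ler_normB _ _)); rewrite lerD2l HB.
 have := ler_wpM2l m0 K2; move: K3.
 by set X := x * dmain x y; lra.
have J := dJ_ge kr.
move: G; rewrite E1 => G.
have S0: 0<=S.
 by apply: Rintegral_ge0 => z _; exact: normr_ge0.
have r16: 0<r1^+6 by rewrite exprn_gt0.
have d1: d<=1 by rewrite /d ler_pdivrMr// mul1r.
have d2: d*(r*4*r^+2)<=1/216 by rewrite /d mulrAC ler_pdivrMr//; lra.
have d3: d*(B0*4*r^+2)<=1 by rewrite /d mulrAC ler_pdivrMr// mul1r.
have F1: d*S<=S by rewrite ler_piMl.
have F2: m*(d*(r*4*r^+2))<=m*(1/216) by rewrite ler_wpM2l.
have F3: m*(1/108)<=m * dJ by rewrite ler_wpM2l.
rewrite E4 in G.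
rewrite (mulNr m) in E5.
have F4: d*(S+(B0+m*r)*4*r^+2) = d*S+d*(B0*4*r^+2)+m*(d*(r*4*r^+2)) by ring.
rewrite mulrDl mul1r.
move: E2 E3 E5 F1 F2 F3 d3; rewrite F4 -G.
move: (d*S) (d*(B0*4*r^+2)) (m*(d*(r*4*r^+2))) (m * dJ) => t1 t2 t3 t4.
by lra.
Qed.

End kernel.

End dipole.

(** The order of quantifiers is the point. [C] depends on [r] alone; the width [k], hence [C1],
    depends on [r1] and [B0]. An [eta] chosen after [C1] can therefore be made harmless without
    affecting the main constant. *)
Lemma dipole (R : realType) (r : R) : 0<r -> exists2 C, 0<=C & forall r1 B0,
 0<r1<=r -> 0<=B0 -> exists2 C1, 0<=C1 & forall U Ux Uxx Uy Uyy m eta,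
 C2 (- r) r (- r) r U Ux Uxx Uy Uyy -> 0<=m -> 0<=eta ->
 (forall x y, - r<=x<=0 -> - r<=y<=r -> 0<=Uxx x y+Uyy x y) ->
 (forall x y, 0<=x<=r -> - r<=y<=r -> `|Uxx x y+Uyy x y| <= eta) ->
 (forall x y, `|x| <= r1 -> `|y| <= r1 -> Ux x y <= - m) ->
 (forall y, - r<=y<=r -> `|U 0 y| <= B0) ->
 m<=C*(I2 (- r) r (- r) r (fun x y => `|U x y|)+1)+C1*eta.
Proof.
move=> r0.
have Y0: 0<=400/r^+3 := divr_ge0 (ler0n R 400) (exprn_ge0 3 (ltW r0)).
move: (Y0); set Y := 400 / _ => Y0'.
exists (216*(Y+1)); first by clear Y0; clearbody Y; lra.
move=> r1 B0 /andP[r10 r1r] B00.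
(* The three smallness conditions of [dipole_k] have nonnegative left-hand sides whose weighted sum
   is [k^2 A]; the single requirement [k^2 A <= r1^6] implies them all. *)
pose A := 8*r*(1+216*(r*4*r^+2)+B0*4*r^+2).
have r2: 0<r^+2 by rewrite exprn_gt0.
have A1' : 0<r*4*r^+2 by apply: mulr_gt0 => //; lra.
have A1: 0<216*(r*4*r^+2) by move: (r*4*r^+2) A1' => z; lra.
have A2: 0<=B0*4*r^+2 by rewrite mulr_ge0// ?mulr_ge0// ltW.
have A0: 0<A.
 by apply: mulr_gt0; [lra|move: (216*_) (B0*4*_) A1 A2 => z1 z2; lra].
have r6: 0<r1^+6 by rewrite exprn_gt0.
pose k := Num.min (r/4) (Num.min 1 (r1^+6/A)).
have k0: 0<k by rewrite /k !lt_min ltr01 !divr_gt0.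
have k1: k<=r/4 by rewrite /k ge_min lexx.
have k2: k<=1 by rewrite /k !ge_min lexx orbT.
have k3: k*A<=r1^+6 by rewrite -ler_pdivlMr// /k !ge_min lexx !orbT.
have kA: k^+2*A<=r1^+6.
 by apply: (le_trans _ k3); rewrite ler_pM2r// expr2 ler_piMr// ltW.
have Z0: 0<=4*r^+3/k^+2.
 by rewrite divr_ge0 ?exprn_ge0 ?(ltW k0)// mulr_ge0// exprn_ge0// ltW.
move: (Z0); set Z := 4*_ / _ => Z0'.
exists (216*Z); first by clear Z0; clearbody Z; lra.
move=> U Ux Uxx Uy Uyy m eta HU m0 e0 H1 H2 H3 H4.
have c0: 0<=8*k^+2*r by rewrite mulr_ge0 ?(ltW r0)// mulr_ge0// sqr_ge0.
have E: k^+2*A = 8*k^+2*r+216*(8*k^+2*r*(r*4*r^+2))+8*k^+2*r*(B0*4*r^+2) by rewrite /A; ring.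
have c1: 0<=8*k^+2*r*(r*4*r^+2) by rewrite mulr_ge0//; lra.
have c2: 0<=8*k^+2*r*(B0*4*r^+2) by rewrite mulr_ge0.
have r1r' : 0<r1<=r by rewrite r10.
have := @dipole_k R r r0 k k0 U Ux Uxx Uy Uyy r1 m eta B0 HU k1 r1r' m0 e0 B00 H1 H2 H3 H4.
rewrite E in kA.
move: c0 c1 c2 kA; set X := 8*k^+2*r => c0 c1 c2 kA.
have h1: X<=r1^+6 by lra.
have h2: X*(r*4*r^+2)<=r1^+6/216 by lra.
have h3: X*(B0*4*r^+2)<=r1^+6 by lra.
move=> /(_ h1 h2 h3).
rewrite -/Y -/Z; set I := I2 _ _ _ _ _; clear -Y0' Z0' m0 e0.
by move: Y Z I Y0' Z0' => Y Z I; lra.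
Qed.

(** * A Jensen-type mean bound for subharmonic functions *)

Section jensen.
Variable R : realType.

(* Mass estimate: a superharmonic excess [B0 - U] controlled on the right part of
   the rectangle is controlled in mean further to the left. The weight is
   [q(x)^3 p(y)^3]; its Laplacian is positive for [x <= 3]. *)
Definition jq (x : R) := (x-1/5)*(20-x).
Definition jq1 (x : R) := 101/5-2*x.
Definition jp (y : R) := 36-y^+2.
Definition jP x := jq x^+3.
Definition jP1 x := 3*jq x^+2*jq1 x.
Definition jP2 x := 6*jq x*(jq1 x^+2-jq x).
Definition jQ y := jp y^+3.
Definition jQ1 y := - 6*y*jp y^+2.
Definition jQ2 y := 6*jp y*(4*y^+2-jp y).

Lemma jP_dv x : dv jP x (jP1 x).
Proof. by rewrite /jP /jq; dv_tac; rewrite /jP1 /jq1 /jq /=; field. Qed.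

Lemma jP1_dv x : dv jP1 x (jP2 x).
Proof. by rewrite /jP1 /jq1 /jq; dv_tac; rewrite /jP2 /jq1 /jq /=; field. Qed.

Lemma jQ_dv x : dv jQ x (jQ1 x).
Proof. by rewrite /jQ /jp; dv_tac; rewrite /jQ1 /jp /=; field. Qed.

Lemma jQ1_dv x : dv jQ1 x (jQ2 x).
Proof. by rewrite /jQ1 /jp; dv_tac; rewrite /jQ2 /jp /=; field. Qed.

Notation a := (1/5 : R).
Let ab : a<=20. Proof. lra. Qed.
Let ce : - 6<=6 :> R. Proof. lra. Qed.

Let sq := @good2 R a 20 (- 6) 6.
Let gx (f : R -> R) : (forall x, exists l, dv f x l) -> sq (fun x _ => f x).
Proof. by move=> H; apply: good2_x => // x _; have [l /dv_cont] := H x. Qed.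
Let gy (f : R -> R) : (forall x, exists l, dv f x l) -> sq (fun _ y => f y).
Proof. by move=> H; apply: good2_y => // x _; have [l /dv_cont] := H x. Qed.

Let gP : sq (fun x _ => jP x). Proof. by apply: gx => x; eexists; exact: jP_dv. Qed.
Let gQ : sq (fun _ y => jQ y). Proof. by apply: gy => x; eexists; exact: jQ_dv. Qed.
Let gP2 : sq (fun x _ => jP2 x).
Proof. by apply: gx => x; eexists; rewrite /jP2 /jq /jq1; repeat dv_step. Qed.
Let gQ2 : sq (fun _ x => jQ2 x).
Proof. by apply: gy => x; eexists; rewrite /jQ2 /jp; repeat dv_step. Qed.

Definition jL x y := jP2 x*jQ y+jP x*jQ2 y.

Let gL : sq jL.
Proof. by apply: good2_D => //; exact: good2_M. Qed.

(** After extracting [6 q p] there remains [(q'^2 - q) p^2 + q^2 (4 y^2 - p)]. Only the last term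
    can be negative; 153 bounds [q'^2 - q] from below and 2266 bounds [q^2] from above on
    [[1/5, 3]], and the resulting quadratic in [p] is positive. *)
Lemma jL_ge0 x y : a<=x<=3 -> - 6<=y<=6 -> 0<=jL x y.
Proof.
move=> xr yr.
have q0: 0<=jq x by rewrite /jq; nra.
have q1: jq x<=238/5 by rewrite /jq; nra.
have p0: 0<=jp y by rewrite /jp; nra.
have p1: jp y<=36 by rewrite /jp; nra.
have d1: 153<=jq1 x^+2-jq x by rewrite /jq1 /jq; nra.
have -> : jL x y = 6*jq x*jp y*((jq1 x^+2-jq x)*jp y^+2+jq x^+2*(4*y^+2-jp y)).
 by rewrite /jL /jP2 /jP /jQ /jQ2; ring.
apply: mulr_ge0; first by apply: mulr_ge0 => //; apply: mulr_ge0 => //.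
have -> : y^+2 = 36-jp y by rewrite /jp; ring.
move: q0 q1 p0 p1 d1; set q := jq x; set p := jp y; set d := _-q => q0 q1 p0 p1 d1.
have h1: 153 * p^+2<=d * p^+2 by apply: ler_wpM2r => //; exact: sqr_ge0.
have [h|h] := lerP 0 (4*(36-p)-p).
 by rewrite addr_ge0 ?mulr_ge0 ?sqr_ge0//; lra.
have q2: q^+2<=2266 by nra.
have h2: 2266*(4*(36-p)-p)<=q^+2*(4*(36-p)-p) by nra.
nra.
Qed.

Lemma jL_ge1 x y : 3/10<=x<=5/2 -> - 1<=y<=1 -> 1<=jL x y.
Proof.
move=> xr yr.
have q0: 1<=jq x by rewrite /jq; nra.
have q1: jq x<=238/5 by rewrite /jq; nra.
have p0: 35<=jp y by rewrite /jp; nra.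
have d1: 153<=jq1 x^+2-jq x by rewrite /jq1 /jq; nra.
have -> : jL x y = 6*jq x*jp y*((jq1 x^+2-jq x)*jp y^+2+jq x^+2*(4*y^+2-jp y)).
 by rewrite /jL /jP2 /jP /jQ /jQ2; ring.
have y2 := sqr_ge0 y.
move: q0 q1 p0 d1; set q := jq x; set p := jp y; set d := _-q => q0 q1 p0 d1.
have h1: 153 * p^+2<=d * p^+2 by apply: ler_wpM2r => //; exact: sqr_ge0.
have q2: q^+2<=2266 by nra.
have h2: - (2266 * p)<=q^+2*(4*y^+2-p).
 apply: (@le_trans _ _ (q^+2 * - p)); first by rewrite mulrN lerN2 ler_wpM2r//; lra.
 by apply: ler_wpM2l; [exact: sqr_ge0|lra].
have h3: 1<=d * p^+2+q^+2*(4*y^+2-p) by nra.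
have h4: 1<=6*q * p by nra.
by apply: (le_trans h4); rewrite ler_peMr//; lra.
Qed.

Lemma jL_bnd : exists2 C, 0<=C & forall x y, a<=x<=20 -> - 6<=y<=6 -> `|jL x y| <= C.
Proof.
have [_ _ [C H]] := gL; exists C => //.
by apply: (le_trans (normr_ge0 (jL 1 0))); apply: H; lra.
Qed.

(** For [V = B0 - U], Green's formula makes the integral of [V jL] nonpositive. Where [jL] may be
    negative, right of 3, [V] is at most [B1]; so the nonnegative contribution of the left part is a
    multiple of [B1]. *)
Lemma jensen : exists2 C, 0<=C & forall U Ux Uxx Uy Uyy B0 B1,
 C2 a 20 (- 6) 6 U Ux Uxx Uy Uyy ->
 (forall x y, a<=x<=20 -> - 6<=y<=6 -> 0<=Uxx x y+Uyy x y) ->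
 (forall x y, a<=x<=20 -> - 6<=y<=6 -> U x y<=B0) ->
 (forall x y, 3<=x<=20 -> - 6<=y<=6 -> B0-B1<=U x y) ->
 0<=B1 ->
 I2 (3/10) (5/2) (- 1) 1 (fun x y => B0-U x y)<=C*B1.
Proof.
have [C C0 HC] := jL_bnd.
have s1: a<=3/10 by lra.
have s2: 5/2<=20 :> R by lra.
have s3: - 6 <= - 1 :> R by lra.
have s4: 1<=6 :> R by lra.
have s5: 3/10<=5/2 :> R by lra.
have s6: - 1<=1 :> R by lra.
have two: 0<=2*C*(6 - - 6)*(20-a) by rewrite !mulr_ge0//; lra.
exists (2*C*(6 - - 6)*(20-a)) => //.
move=> U Ux Uxx Uy Uyy B0 B1 HU lp UB UB1 B10.
have CW: C2 a 20 (- 6) 6 (fun x y => jP x*jQ y) (fun x y => jP1 x*jQ y) (fun x y => jP2 x*jQ y)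
  (fun x y => jP x*jQ1 y) (fun x y => jP x*jQ2 y).
 split.
 - by move=> x y _ _; apply: (dv_eq (dvM (jP_dv x) (dv_cst (jQ y) x))); ring.
 - by move=> x y _ _; apply: (dv_eq (dvM (jP1_dv x) (dv_cst (jQ y) x))); ring.
 - by move=> x y _ _; apply: (dv_eq (dvM (dv_cst (jP x) y) (jQ_dv y))); ring.
 - by move=> x y _ _; apply: (dv_eq (dvM (dv_cst (jP x) y) (jQ1_dv y))); ring.
 - exact: good2_M.
 - exact: good2_M.
 - exact: good2_M.
have z1: jP a = 0 by rewrite /jP /jq; field.
have z2: jP 20 = 0 by rewrite /jP /jq; field.
have z3: jP1 a = 0 by rewrite /jP1 /jq; field.
have z4: jP1 20 = 0 by rewrite /jP1 /jq; field.
have z5: jQ (- 6) = 0 by rewrite /jQ /jp; ring.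
have z6: jQ 6 = 0 by rewrite /jQ /jp; ring.
have z7: jQ1 (- 6) = 0 by rewrite /jQ1 /jp; ring.
have z8: jQ1 6 = 0 by rewrite /jQ1 /jp; ring.
have G V Vx Vxx Vy Vyy (HV : C2 a 20 (- 6) 6 V Vx Vxx Vy Vyy) := green ab ce HV CW
 (fun y _ => And4 (etrans (congr1 ( *%R^~ (jQ y)) z1) (mul0r _)) (etrans (congr1 ( *%R^~ (jQ y)) z2) (mul0r _))
   (etrans (congr1 ( *%R^~ (jQ y)) z3) (mul0r _)) (etrans (congr1 ( *%R^~ (jQ y)) z4) (mul0r _)))
 (fun x _ => And4 (etrans (congr1 ( *%R (jP x)) z5) (mulr0 _)) (etrans (congr1 ( *%R (jP x)) z6) (mulr0 _))
   (etrans (congr1 ( *%R (jP x)) z7) (mulr0 _)) (etrans (congr1 ( *%R (jP x)) z8) (mulr0 _))).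
have HV: C2 a 20 (- 6) 6 (fun x y => B0-U x y) (fun x y => - Ux x y) (fun x y => - Uxx x y)
  (fun x y => - Uy x y) (fun x y => - Uyy x y).
 split.
 - by move=> x y xr yr; apply: (dv_eq (dvD (dv_cst B0 x) (dvN (C2_x HU xr yr)))); rewrite add0r.
 - by move=> x y xr yr; apply: dvN; exact: C2_xx HU x y xr yr.
 - by move=> x y xr yr; apply: (dv_eq (dvD (dv_cst B0 y) (dvN (C2_y HU xr yr)))); rewrite add0r.
 - by move=> x y xr yr; apply: dvN; exact: C2_yy HU x y xr yr.
 - by apply: good2_D; [exact: good2_cst|apply: good2_N => //; exact: C2_g HU].
 - by apply: good2_N => //; exact: C2_gxx HU.
 - by apply: good2_N => //; exact: C2_gyy HU.
have := G _ _ _ _ _ HV; set V := fun x y => B0-U x y => E.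
have gV: sq V := C2_g HV.
have lapV: I2 a 20 (- 6) 6 (fun x y => jP x*jQ y*(- Uxx x y + - Uyy x y))<=0.
 rewrite -[X in _<=X](_ : I2 a 20 (- 6) 6 (fun _ _ => 0) = 0); last by rewrite I2_cst//; ring.
 apply: I2_le => //.
 - apply: good2_M; [exact: good2_M|apply: good2_D; [exact: C2_gxx HV|exact: C2_gyy HV]].
 - exact: good2_cst.
 move=> x y xr yr; rewrite -opprD mulrN oppr_le0 mulr_ge0//; last exact: lp.
 by rewrite mulr_ge0 ?exprn_ge0// ?/jq ?/jp; nra.
have gLV: sq (fun x y => V x y*jL x y) by exact: good2_M.
have gK: sq (fun x y => V x y*jL x y+C*B1) by apply: good2_D => //; exact: good2_cst.
have Vpos x y : a<=x<=20 -> - 6<=y<=6 -> 0<=V x y.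
 by move=> xr yr; rewrite /V subr_ge0 UB.
(* The added constant makes the integrand nonnegative on the whole rectangle, so the integral may be
   restricted to the smaller one, where [jL >= 1]. *)
have pos x y : a<=x<=20 -> - 6<=y<=6 -> 0<=V x y*jL x y+C*B1.
 move=> xr yr; have [x3|x3] := lerP x 3.
  by rewrite addr_ge0 ?mulr_ge0 ?Vpos// jL_ge0//; lra.
 have V1: V x y<=B1.
  have h: B0-B1<=U x y by apply: UB1 => //; lra.
  by rewrite /V; lra.
 have := HC x y xr yr; rewrite ler_norml => /andP[L1 L2].
 by have := Vpos x y xr yr; move: (V x y) (jL x y) L1 V1 => v l; nra.
apply: (@le_trans _ _ (I2 (3/10) (5/2) (- 1) 1 (fun x y => V x y*jL x y+C*B1))).
 apply: (I2_le s5 s6 (good2_sub s1 s2 s3 s4 gV) (good2_sub s1 s2 s3 s4 gK)).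
 move=> x y xr yr.
 have : V x y*1<=V x y*jL x y.
  apply: ler_wpM2l; last exact: jL_ge1.
  by apply: Vpos; [lra|lra].
 have : 0<=C*B1 by exact: mulr_ge0.
 by rewrite /V; lra.
apply: (le_trans (I2_sub ab ce s1 s2 s3 s4 gK pos)).
rewrite I2_D//; last exact: good2_cst.
rewrite I2_cst// (_ : I2 _ _ _ _ _ = I2 a 20 (- 6) 6 (fun x y => jP x*jQ y*(- Uxx x y + - Uyy x y))); last first.
 exact: E.
have : 0<=C*B1*(6 - - 6)*(20-a) by rewrite !mulr_ge0//; lra.
by move: lapV; lra.
Qed.

End jensen.

(** * From growth and zero-freeness to bounds for f'/f *)

Section logmod.
Variable R : realType.
Notation mu := (@lebesgue_measure R).

Lemma itv_shift (h : R -> R) (k a b : R) : a<=b -> cont_on (k+a) (k+b) h ->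
 \int[mu]_(x in `[a, b]) h (k+x) = \int[mu]_(x in `[k+a, k+b]) h x.
Proof.
move=> ab ch; have D: derive1 (fun x : R => k+x) = cst 1.
 apply/funext => x; rewrite derive1E.
 by have [_ ->] : dv (fun x => k+x) x 1 by apply: (dv_eq (dvD (dv_cst k x) (dv_id x))); rewrite add0r.
rewrite /Rintegral (@integration_by_substitution_increasing R (fun x => k+x) h a b)//.
- by congr fine; apply: eq_integral => x _; rewrite !fctE D /= mulr1.
- by move=> x y _ _; rewrite ltrD2l.
- by rewrite D => x _; exact: cvg_cst.
- by rewrite D; exact: is_cvg_cst.
- by rewrite D; exact: is_cvg_cst.
- split.
 + by move=> x _; have [] : dv (fun x => k+x) x (0+1) by exact: dvD (dv_cst k x) (dv_id x).
 + by apply: cvg_at_right_filter; exact: dv_cont (dvD (dv_cst k a) (dv_id a)).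
 + by apply: cvg_at_left_filter; exact: dv_cont (dvD (dv_cst k b) (dv_id b)).
- exact: cont_on_within.
Qed.

Lemma cont_shift (h : R -> R) (k a b : R) : cont_on (k+a) (k+b) h -> cont_on a b (fun x => h (k+x)).
Proof.
move=> ch x xab; apply: (@continuous_comp R R R (fun x => k+x) h).
 exact: dv_cont (dvD (dv_cst k x) (dv_id x)).
by apply: ch; rewrite !lerD2l.
Qed.

Lemma good2_shift (h : R -> R -> R) (k l a b c e : R) :
 good2 (k+a) (k+b) (l+c) (l+e) h -> good2 a b c e (fun x y => h (k+x) (l+y)).
Proof.
move=> [h1 h2 [B hB]]; split.
- by move=> y yce; apply: (@cont_shift (h^~ (l+y))); apply: h1; rewrite !lerD2l.
- by move=> x xab; apply: (@cont_shift (h (k+x))); apply: h2; rewrite !lerD2l.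
- by exists B => x y xab yce; apply: hB; rewrite !lerD2l.
Qed.

Lemma I2_shift (h : R -> R -> R) (k l a b c e : R) : a<=b -> c<=e ->
 good2 (k+a) (k+b) (l+c) (l+e) h ->
 I2 a b c e (fun x y => h (k+x) (l+y)) = I2 (k+a) (k+b) (l+c) (l+e) h.
Proof.
move=> ab ce gh.
have ab' : k+a<=k+b by rewrite lerD2l.
have ce' : l+c<=l+e by rewrite lerD2l.
rewrite (I2_xy ab ce (good2_shift gh)) (I2_xy ab' ce' gh).
have [_ h2 _] := gh.
transitivity (\int[mu]_(x in `[a, b]) (\int[mu]_(y in `[l+c, l+e]) h (k+x) y)).
 apply: Rint_ext => x; rewrite /= in_itv /= => xab.
 by apply: itv_shift => //; apply: h2; rewrite !lerD2l.
have g3: good2 a b (l+c) (l+e) (fun x y => h (k+x) y).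
 have := @good2_shift h k 0 a b (l+c) (l+e); rewrite !add0r => /(_ gh).
 by under eq_fun do under eq_fun do rewrite add0r.
rewrite -(I2_xy ab ce' g3) -(I2_xy ab' ce' gh) (I2_yx ab ce' g3) (I2_yx ab' ce' gh).
apply: Rint_ext => y; rewrite /= in_itv /= => yce.
by apply: (@itv_shift (h^~ y)) => //; case: gh => + _ _; apply.
Qed.

Lemma I2_swap (h : R -> R -> R) (r : R) : - r<=r -> good2 (- r) r (- r) r h ->
 I2 (- r) r (- r) r (fun x y => h y x) = I2 (- r) r (- r) r h.
Proof.
move=> rr gh; have gh' : good2 (- r) r (- r) r (fun x y => h y x).
 by have [h1 h2 [B hB]] := gh; split => //; exists B => x y xr yr; apply: hB.
by rewrite (I2_xy rr rr gh') (I2_yx rr rr gh).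
Qed.

(* minimum of a positive function on a rectangle *)
Lemma rect_min (h hx : R -> R -> R) (B a b c e : R) : a<=b -> c<=e ->
 (forall x y, a<=x<=b -> c<=y<=e -> dv (h^~ y) x (hx x y)) ->
 (forall x y, a<=x<=b -> c<=y<=e -> `|hx x y| <= B) ->
 (forall x, a<=x<=b -> cont_on c e (h x)) ->
 (forall x y, a<=x<=b -> c<=y<=e -> 0<h x y) ->
 exists2 s, 0<s & forall x y, a<=x<=b -> c<=y<=e -> s<=h x y.
Proof.
move=> ab ce dh hB ch h0.
have m x : exists y, a<=x<=b -> c<=y<=e /\ forall t, c<=t<=e -> h x y<=h x t.
 case: (boolP (a<=x<=b)) => [xab|_]; last by exists 0.
 by have [y yce H] := EVT_min_on ce (ch x xab); exists y.
(* [Y x] is a minimizer in [y] for fixed [x]. The partial minimum is Lipschitz in [x], hence attains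
   its own minimum. *)
have [Y HY] := choice m.
pose g x := h (clamp a b x) (Y (clamp a b x)).
have lipx x x' y : a<=x<=b -> a<=x'<=b -> c<=y<=e -> `|h x' y-h x y| <= B * `|x'-x|.
 move=> xab x'ab yce; have [xx|xx] := lerP x x'.
  apply: (@dv_lip _ (h^~ y) (hx^~ y) x x' B xx) => z zx; [apply: dh => //|apply: hB => //];
   move: xab x'ab zx => /andP[? ?] /andP[? ?] /andP[? ?]; apply/andP; split; lra.
 rewrite distrC.
 apply: (@dv_lip _ (h^~ y) (hx^~ y) x' x B (ltW xx)) => z zx; [apply: dh => //|apply: hB => //];
  move: xab x'ab zx => /andP[? ?] /andP[? ?] /andP[? ?]; apply/andP; split; lra.
have glip x x' : a<=x<=b -> a<=x'<=b -> h x (Y x)<=h x' (Y x')+B * `|x'-x|.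
 move=> xab x'ab; have [yx Hx] := HY x xab; have [yx' Hx'] := HY x' x'ab.
 apply: (le_trans (Hx _ yx')).
 have := lipx _ _ _ xab x'ab yx'; rewrite ler_norml => /andP[+ _]; lra.
have B0: 0<=B.
 have aab: a<=a<=b by rewrite lexx.
 have cce: c<=c<=e by rewrite lexx.
 exact: (le_trans (normr_ge0 _) (hB _ _ aab cce)).
have cg: cont_on a b g.
 move=> x _; apply/cvgrPdist_le => ep ep0; near=> x'.
 have c1 := clamp_in x ab; have c2 := clamp_in x' ab.
 have G1 := glip _ _ c1 c2; have G2 := glip _ _ c2 c1.
 have cl: `|clamp a b x-clamp a b x'| <= ep/(B+1).
  near: x'; have := @clamp_cont R a b x; move/cvgrPdist_le; apply.
  by rewrite divr_gt0// ltr_pwDr.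
 have : B * `|clamp a b x-clamp a b x'| <= ep.
  apply: (le_trans (ler_wpM2l B0 cl)); rewrite mulrCA ler_piMr ?(ltW ep0)//.
  by rewrite ler_pdivrMr ?ltr_pwDr// mul1r lerDl.
 rewrite distrC in G1; rewrite /g ler_norml.
 by move: G1 G2; set u := h _ _; set v := h _ _; set w := B*_ => *; apply/andP; split; lra.
have [x0 x0ab Hx0] := EVT_min_on ab cg.
have gE x : a<=x<=b -> g x = h x (Y x) by move=> xab; rewrite /g clamp_id.
have [y0 _] := HY x0 x0ab.
exists (g x0); first by rewrite gE// h0.
move=> x y xab yce; apply: (le_trans (Hx0 _ xab)); rewrite gE//.
by have [_] := HY x xab; apply.
Unshelve. all: by end_near.
Qed.

Section Ueps.
Variables (a b c e : R).
Hypotheses (ab : a<=b) (ce : c<=e).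
Variables p q A B C D : R -> R -> R.
Let inr x y := a<=x<=b /\ c<=y<=e.
Hypothesis dp : forall x y, inr x y -> dv (p^~ y) x (A x y) /\ dv (p x) y (- B x y).
Hypothesis dq : forall x y, inr x y -> dv (q^~ y) x (B x y) /\ dv (q x) y (A x y).
Hypothesis dA : forall x y, inr x y -> dv (A^~ y) x (C x y) /\ dv (A x) y (- D x y).
Hypothesis dB : forall x y, inr x y -> dv (B^~ y) x (D x y) /\ dv (B x) y (C x y).
Hypotheses (gp : good2 a b c e p) (gq : good2 a b c e q) (gA : good2 a b c e A)
 (gB : good2 a b c e B) (gC : good2 a b c e C) (gD : good2 a b c e D).
Variables (e2 s0 : R).
Hypotheses (s00 : 0<s0) (e20 : 0<=e2).

Definition uS x y := p x y^+2+q x y^+2+e2.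
Hypothesis Ss0 : forall x y, inr x y -> s0<=uS x y.

(** [log|F|] for [F = p + i q], regularized by [e2] inside the logarithm. By the hypotheses above,
    [A + i B] is F' and [C + i D] is F''. *)
Definition uU x y := ln (uS x y)/2.
Definition uUx x y := (p x y*A x y+q x y*B x y)/uS x y.
Definition uUy x y := (- p x y*B x y+q x y*A x y)/uS x y.
Definition uG x y := A x y^+2+B x y^+2.
Definition uH x y := p x y*C x y+q x y*D x y.
Definition uUxx x y := (uG x y+uH x y)/uS x y-2*uUx x y^+2.
Definition uUyy x y := (uG x y-uH x y)/uS x y-2*uUy x y^+2.

Let Sgt x y : inr x y -> 0<uS x y. Proof. by move=> /Ss0; apply: lt_le_trans. Qed.
Let Sn0 x y : inr x y -> uS x y != 0. Proof. by move=> /Sgt; exact: lt0r_neq0. Qed.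

Let Sx x y : inr x y -> dv (uS^~ y) x (2*(p x y*A x y+q x y*B x y)).
Proof.
move=> H; have [h1 _] := dp H; have [h2 _] := dq H.
by apply: (dv_eq (dvD (dvD (dvX 2 h1) (dvX 2 h2)) (dv_cst e2 x))); rewrite /=; ring.
Qed.
Let Sy x y : inr x y -> dv (uS x) y (2*(- p x y*B x y+q x y*A x y)).
Proof.
move=> H; have [_ h1] := dp H; have [_ h2] := dq H.
by apply: (dv_eq (dvD (dvD (dvX 2 h1) (dvX 2 h2)) (dv_cst e2 y))); rewrite /=; ring.
Qed.

Let gM f g : good2 a b c e f -> good2 a b c e g -> good2 a b c e (fun x y => f x y*g x y).
Proof. exact: good2_M. Qed.
Let gDD f g : good2 a b c e f -> good2 a b c e g -> good2 a b c e (fun x y => f x y+g x y).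
Proof. exact: good2_D. Qed.
Let gN f : good2 a b c e f -> good2 a b c e (fun x y => - f x y).
Proof. exact: good2_N. Qed.
Let gsq f : good2 a b c e f -> good2 a b c e (fun x y => f x y^+2).
Proof. by move=> gf; under eq_fun do under eq_fun do rewrite expr2; exact: gM. Qed.

Lemma uS_good : good2 a b c e uS.
Proof. by apply: gDD; [apply: gDD; exact: gsq|exact: good2_cst]. Qed.

Let gSV : good2 a b c e (fun x y => (uS x y)^-1).
Proof.
split.
- by move=> y yce x xab; apply: dv_cont (dvV (f := uS^~ y) _ (Sx _)); [exact: Sn0|split].
- by move=> x xab y yce; apply: dv_cont (dvV (f := uS x) _ (Sy _)); [exact: Sn0|split].
- exists s0^-1 => x y xab yce; rewrite normfV gtr0_norm ?Sgt//.
 by rewrite lef_pV2 ?posrE ?Sgt ?Ss0//; split.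
Qed.

Lemma uU_bnd M : (forall x y, a<=x<=b -> c<=y<=e -> uS x y<=M) ->
 forall x y, a<=x<=b -> c<=y<=e -> `|uU x y| <= `|ln s0| + `|ln M|.
Proof.
move=> HM x y xab yce.
have S0: 0<uS x y by exact: Sgt.
have M0 := lt_le_trans S0 (HM _ _ xab yce).
have l1: ln s0<=ln (uS x y) by rewrite ler_ln ?posrE// Ss0.
have l2: ln (uS x y)<=ln M by rewrite ler_ln ?posrE// HM.
rewrite /uU; have := ler_norm (ln M); have := normr_ge0 (ln M); have := normr_ge0 (ln s0).
have := ler_norm (- ln s0); rewrite normrN.
by rewrite ler_norml => *; apply/andP; split; lra.
Qed.

Lemma Ueps_C2 : C2 a b c e uU uUx uUxx uUy uUyy.
Proof.
have gH: good2 a b c e uH by apply: gDD; exact: gM.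
have gG: good2 a b c e uG by apply: gDD; exact: gsq.
split.
- move=> x y xab yce; have H: inr x y by split.
 have := dvM (dv_ln (f := uS^~ y) (Sgt H) (Sx H)) (dv_cst 2^-1 x).
 by move=> h; apply: (dv_eq h); rewrite /uUx; field; exact: Sn0.
- move=> x y xab yce; have H: inr x y by split.
 have [h1 _] := dp H; have [h2 _] := dq H; have [h3 _] := dA H; have [h4 _] := dB H.
 have h := dvM (dvD (dvM h1 h3) (dvM h2 h4)) (dvV (f := uS^~ y) (Sn0 H) (Sx H)).
 by apply: (dv_eq h); rewrite /uUxx /uUx /uG /uH; field; exact: Sn0.
- move=> x y xab yce; have H: inr x y by split.
 have := dvM (dv_ln (f := uS x) (Sgt H) (Sy H)) (dv_cst 2^-1 y).
 by move=> h; apply: (dv_eq h); rewrite /uUy; field; exact: Sn0.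
- move=> x y xab yce; have H: inr x y by split.
 have [_ h1] := dp H; have [_ h2] := dq H; have [_ h3] := dA H; have [_ h4] := dB H.
 have h := dvM (dvD (dvM (dvN h1) h4) (dvM h2 h3)) (dvV (f := uS x) (Sn0 H) (Sy H)).
 by apply: (dv_eq h); rewrite /uUyy /uUy /uG /uH; field; exact: Sn0.
- split.
 + move=> y yce x xab; have H: inr x y by split.
  exact: dv_cont (dvM (dv_ln (f := uS^~ y) (Sgt H) (Sx H)) (dv_cst 2^-1 x)).
 + move=> x xab y yce; have H: inr x y by split.
  exact: dv_cont (dvM (dv_ln (f := uS x) (Sgt H) (Sy H)) (dv_cst 2^-1 y)).
 + have [_ _ [M HM]] := uS_good; exists (`|ln s0| + `|ln M|).
  by apply: uU_bnd => x y xab yce; apply: (le_trans (ler_norm _)); exact: HM.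
- apply: gDD; first by apply: gM => //; exact: gDD.
 by apply: gN; apply: gM; [exact: good2_cst|apply: gsq; apply: gM => //; apply: gDD; exact: gM].
- apply: gDD; first by apply: gM => //; apply: gDD => //; exact: gN.
 apply: gN; apply: gM; [exact: good2_cst|apply: gsq; apply: gM => //; apply: gDD; last exact: gM].
 by apply: gM => //; exact: gN.
Qed.

(** The second derivatives of F enter [uUxx] and [uUyy] with opposite signs and cancel; only
    [|F'|^2] survives. The result is nonnegative, and it vanishes for [e2 = 0]. *)
Lemma Ueps_lap x y : a<=x<=b -> c<=y<=e ->
 uUxx x y+uUyy x y = 2*e2*uG x y/uS x y^+2.
Proof.
move=> xab yce; rewrite /uUxx /uUyy /uUx /uUy.
have n: uS x y != 0 by exact: Sn0.
rewrite (_ : 2*e2 = 2*(uS x y-p x y^+2-q x y^+2)); last by rewrite /uS; ring.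
by rewrite /uG /uH; field.
Qed.

End Ueps.

(* A harmonic function is controlled, together with its gradient, by its mean. *)
Lemma dipole0 (r : R) : 0<r -> exists2 C, 0<=C & forall U Ux Uxx Uy Uyy,
 C2 (- r) r (- r) r U Ux Uxx Uy Uyy ->
 (forall x y, - r<=x<=r -> - r<=y<=r -> Uxx x y+Uyy x y = 0) ->
 (forall ep, 0<ep -> exists2 r1, 0<r1<=r &
   forall x y, `|x| <= r1 -> `|y| <= r1 -> `|Ux x y-Ux 0 0| <= ep) ->
 `|Ux 0 0| <= C*(I2 (- r) r (- r) r (fun x y => `|U x y|)+1).
Proof.
move=> r0; have [C C0 H] := dipole r0; exists (2*C); first by rewrite mulr_ge0.
have rr: - r<=r by lra.
(* One side of the bound: [dipole] with [eta = 0] and [m] half of [- Ux 0 0], the radius [r1] being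
   supplied by continuity of [Ux]. The other side is the case of [- U]. *)
have aux U Ux Uxx Uy Uyy : C2 (- r) r (- r) r U Ux Uxx Uy Uyy ->
 (forall x y, - r<=x<=r -> - r<=y<=r -> Uxx x y+Uyy x y = 0) ->
 (forall ep, 0<ep -> exists2 r1, 0<r1<=r &
   forall x y, `|x| <= r1 -> `|y| <= r1 -> `|Ux x y-Ux 0 0| <= ep) ->
 - Ux 0 0<=2*C*(I2 (- r) r (- r) r (fun x y => `|U x y|)+1).
 move=> HU lap jc; have I0: 0<=I2 (- r) r (- r) r (fun x y => `|U x y|).
  by apply: Rintegral_ge0 => z _; exact: normr_ge0.
 have [u0|u0] := lerP (- Ux 0 0) 0.
  by apply: (le_trans u0); rewrite mulr_ge0 ?addr_ge0// mulr_ge0.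
 have e0: 0 < - Ux 0 0/2 by lra.
 have [r1 r1r Hr1] := jc _ e0.
 have [_ _ [B HB]] := C2_g HU.
 have zr: - r<=0<=r by apply/andP; split; lra.
 have B0: 0<=B by exact: (le_trans (normr_ge0 _) (HB 0 0 zr zr)).
 have [C1 C10 H1] := H r1 B r1r B0.
 have := H1 U Ux Uxx Uy Uyy (- Ux 0 0/2) 0 HU (ltW e0) (lexx _); rewrite mulr0 addr0.
 have h1 x y : - r<=x<=0 -> - r<=y<=r -> 0<=Uxx x y+Uyy x y.
  by move=> /andP[x1 x2] yr; rewrite lap// x1 (le_trans x2)// ltW.
 have h2 x y : 0<=x<=r -> - r<=y<=r -> `|Uxx x y+Uyy x y| <= 0.
  by move=> /andP[x1 x2] yr; rewrite lap ?normr0// x2 andbT (le_trans _ x1)// oppr_le0 ltW.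
 have h3 x y : `|x| <= r1 -> `|y| <= r1 -> Ux x y <= - (- Ux 0 0/2).
  by move=> xr yr; have := Hr1 x y xr yr; rewrite ler_norml => /andP[_]; lra.
 have h4 y : - r<=y<=r -> `|U 0 y| <= B by move=> yr; exact: HB.
 by move=> /(_ h1 h2 h3 h4); lra.
move=> U Ux Uxx Uy Uyy HU lap jc.
have HN: C2 (- r) r (- r) r (fun x y => - U x y) (fun x y => - Ux x y) (fun x y => - Uxx x y)
  (fun x y => - Uy x y) (fun x y => - Uyy x y).
 split.
 - by move=> x y xr yr; apply: dvN; exact: C2_x HU x y xr yr.
 - by move=> x y xr yr; apply: dvN; exact: C2_xx HU x y xr yr.
 - by move=> x y xr yr; apply: dvN; exact: C2_y HU x y xr yr.
 - by move=> x y xr yr; apply: dvN; exact: C2_yy HU x y xr yr.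
 - by apply: good2_N => //; exact: C2_g HU.
 - by apply: good2_N => //; exact: C2_gxx HU.
 - by apply: good2_N => //; exact: C2_gyy HU.
have E: I2 (- r) r (- r) r (fun x y => `|- U x y|) = I2 (- r) r (- r) r (fun x y => `|U x y|).
 by apply: I2_ext => // x y _ _; rewrite normrN.
have K1 := aux _ _ _ _ _ HU lap jc.
have := aux _ _ _ _ _ HN; rewrite E opprK => K2.
rewrite ler_norml -lerNl K1 K2//.
- by move=> x y xr yr; rewrite -opprD lap// oppr0.
- move=> ep ep0; have [r1 r1r Hr1] := jc _ ep0; exists r1 => // x y xr yr.
 by rewrite addrC distrC; exact: Hr1.
Qed.

(** Passing to a nearby point costs a factor 2, since [Z/N <= L/2]; adding [e2] costs another, since
    [N + e2 <= 2 N]. *)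
Lemma quot_slope (L D N Z e2 : R) : L<0 -> 0<D -> `|N-D| <= D/2 -> `|Z/N-L| <= - L/2 ->
 0<=e2<=D/2 -> Z/(N+e2) <= - (- L/4).
Proof.
move=> L0 D0; rewrite !ler_norml => /andP[N1 _] /andP[_ L1] /andP[e0 e1].
have Np: 0<N by lra.
have h: Z<=L/2*N by rewrite -ler_pdivrMr//; lra.
by rewrite ler_pdivrMr; nra.
Qed.

Section holo.
(** Real and imaginary parts of the n-th complex derivative of one function; the next four
    hypotheses are its Cauchy-Riemann equations. *)
Variables P Q : nat -> R -> R -> R.
Hypothesis dPx : forall n x y, 0<x -> dv (P n ^~ y) x (P n.+1 x y).
Hypothesis dPy : forall n x y, 0<x -> dv (P n x) y (- Q n.+1 x y).
Hypothesis dQx : forall n x y, 0<x -> dv (Q n ^~ y) x (Q n.+1 x y).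
Hypothesis dQy : forall n x y, 0<x -> dv (Q n x) y (P n.+1 x y).
Hypothesis bnd : forall n (a b c e : R), 0<a -> exists B, forall x y, a<=x<=b -> c<=y<=e ->
 `|P n x y| <= B /\ `|Q n x y| <= B.

Lemma Pgood n a b c e : 0<a -> good2 a b c e (P n).
Proof.
move=> a0; split.
- by move=> y yce x /andP[ax _]; apply: dv_cont (dPx n y (lt_le_trans a0 ax)).
- by move=> x /andP[ax _] y yce; apply: dv_cont (dPy n y (lt_le_trans a0 ax)).
- by have [B HB] := bnd n b c e a0; exists B => x y xab yce; case: (HB x y xab yce).
Qed.

Lemma Qgood n a b c e : 0<a -> good2 a b c e (Q n).
Proof.
move=> a0; split.
- by move=> y yce x /andP[ax _]; apply: dv_cont (dQx n y (lt_le_trans a0 ax)).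
- by move=> x /andP[ax _] y yce; apply: dv_cont (dQy n y (lt_le_trans a0 ax)).
- by have [B HB] := bnd n b c e a0; exists B => x y xab yce; case: (HB x y xab yce).
Qed.

(** Locally bounded partial derivatives make [h] Lipschitz in both variables at once, which gives
    joint continuity. *)
Lemma lip2_cont (h hx hy : R -> R -> R) (x0 u : R) : 0<x0 ->
 (forall x y, 0<x -> dv (h^~ y) x (hx x y)) -> (forall x y, 0<x -> dv (h x) y (hy x y)) ->
 (exists B, forall x y, x0/2<=x<=x0+1 -> u-1<=y<=u+1 -> `|hx x y| <= B /\ `|hy x y| <= B) ->
 {for (x0, u), continuous (fun z : R*R => h z.1 z.2)}.
Proof.
move=> x00 dx dy [B HB].
have x0r: x0/2<=x0<=x0+1 by lra.
have ur: u-1<=u<=u+1 by lra.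
have B0: 0<=B by have [h1 _] := HB _ _ x0r ur; exact: (le_trans (normr_ge0 _) h1).
have L x y : x0/2<=x<=x0+1 -> u-1<=y<=u+1 -> `|h x y-h x0 u| <= B*(`|x-x0| + `|y-u|).
 move=> xr yr.
 have A1: `|h x y-h x u| <= B * `|y-u|.
  have [yu|yu] := lerP u y.
   apply: (@dv_lip _ (h x) (hy x)) => // z zr; first by apply: dy; lra.
   by have [|_ ->] := HB x z xr _; first by lra.
  rewrite distrC; apply: (@dv_lip _ (h x) (hy x)) => [|z zr|z zr]; first exact: ltW.
   by apply: dy; lra.
  by have [|_ ->] := HB x z xr _; first by lra.
 have A2: `|h x u-h x0 u| <= B * `|x-x0|.
  have [yu|yu] := lerP x0 x.
   apply: (@dv_lip _ (h^~ u) (hx^~ u)) => // z zr; first by apply: dx; lra.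
   by have [|-> _] := HB z u _ ur; first by lra.
  rewrite distrC; apply: (@dv_lip _ (h^~ u) (hx^~ u)) => [|z zr|z zr]; first exact: ltW.
   by apply: dx; lra.
  by have [|-> _] := HB z u _ ur; first by lra.
 rewrite (_ : h x y-h x0 u = (h x y-h x u)+(h x u-h x0 u)); last by ring.
 by apply: (le_trans (ler_normD _ _)); rewrite mulrDr addrC lerD.
apply/cvgrPdist_le => ep ep0.
pose d := Num.min (Num.min (x0/2) 1) (ep/(2*(B+1))).
have d0: 0<d by rewrite /d !lt_min ltr01 !divr_gt0// mulr_gt0// ltr_pwDr.
have d1: d<=x0/2 by rewrite /d !ge_min lexx.
have d2: d<=1 by rewrite /d !ge_min lexx orbT.
have d3: d*(2*(B+1))<=ep by rewrite -ler_pdivlMr ?mulr_gt0 ?ltr_pwDr// /d !ge_min lexx !orbT.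
exists (ball x0 d, ball u d) => /=; first by split; apply: nbhsx_ballx.
move=> [x y] [/= bx by_]; rewrite distrC.
have {}bx : `|x-x0| < d by rewrite distrC.
have {}by_ : `|y-u| < d by rewrite distrC.
apply: (le_trans (L x y _ _)).
- by move: bx; rewrite ltr_norml; lra.
- by move: by_; rewrite ltr_norml; lra.
apply: (@le_trans _ _ (B*(d+d))); first by rewrite ler_wpM2l// lerD// ltW.
by move: d3; rewrite mulrA; nra.
Qed.

Lemma P_cont n (x0 u : R) : 0<x0 -> {for (x0, u), continuous (fun z : R*R => P n z.1 z.2)}.
Proof.
move=> x00; have x02: 0<x0/2 by lra.
have [B HB] := bnd n.+1 (x0+1) (u-1) (u+1) x02.
apply: (lip2_cont x00 (dPx n) (dPy n)); exists B => x y xr yr.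
by have [? ?] := HB x y xr yr; rewrite normrN.
Qed.

Lemma Q_cont n (x0 u : R) : 0<x0 -> {for (x0, u), continuous (fun z : R*R => Q n z.1 z.2)}.
Proof.
move=> x00; have x02: 0<x0/2 by lra.
have [B HB] := bnd n.+1 (x0+1) (u-1) (u+1) x02.
apply: (lip2_cont x00 (dQx n) (dQy n)); exists B => x y xr yr.
by have [? ?] := HB x y xr yr.
Qed.

Definition nsq x y := P 0 x y^+2+Q 0 x y^+2.
(* real and minus the imaginary part of the logarithmic derivative *)
Definition ldr x y := (P 0 x y*P 1 x y+Q 0 x y*Q 1 x y)/nsq x y.
Definition ldi x y := (- P 0 x y*Q 1 x y+Q 0 x y*P 1 x y)/nsq x y.

Lemma nsq_cont (x0 u : R) : 0<x0 -> {for (x0, u), continuous (fun z : R*R => nsq z.1 z.2)}.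
Proof.
move=> x00; have p := @P_cont 0 x0 u x00; have q := @Q_cont 0 x0 u x00.
by apply: cvgD; rewrite /nsq expr2; [exact: (cvgM p p)|exact: (cvgM q q)].
Qed.

Lemma ldr_cont (x0 u : R) : 0<x0 -> 0<nsq x0 u -> {for (x0, u), continuous (fun z : R*R => ldr z.1 z.2)}.
Proof.
move=> x00 n0; have p := @P_cont 0 x0 u x00; have q := @Q_cont 0 x0 u x00.
have p1 := @P_cont 1 x0 u x00; have q1 := @Q_cont 1 x0 u x00.
apply: cvgM; first by apply: cvgD; [exact: (cvgM p p1)|exact: (cvgM q q1)].
by apply: cvgV; [exact: lt0r_neq0|exact: nsq_cont].
Qed.

Lemma ldi_cont (x0 u : R) : 0<x0 -> 0<nsq x0 u -> {for (x0, u), continuous (fun z : R*R => ldi z.1 z.2)}.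
Proof.
move=> x00 n0; have p := @P_cont 0 x0 u x00; have q := @Q_cont 0 x0 u x00.
have p1 := @P_cont 1 x0 u x00; have q1 := @Q_cont 1 x0 u x00.
apply: cvgM; first by apply: cvgD; [exact: (cvgM (cvgN p) q1)|exact: (cvgM q p1)].
by apply: cvgV; [exact: lt0r_neq0|exact: nsq_cont].
Qed.

Lemma cont_near (h : R -> R -> R) (x0 u ep r : R) : 0<ep -> 0<r ->
 {for (x0, u), continuous (fun z : R*R => h z.1 z.2)} ->
 exists2 r1, 0<r1<=r & forall x y, `|x| <= r1 -> `|y| <= r1 -> `|h (x0+x) (u+y)-h x0 u| <= ep.
Proof.
move=> ep0 r0 /cvgrPdist_le /(_ _ ep0) [[A B] /= [/nbhs_ballP[d1 /= d10 h1] /nbhs_ballP[d2 /= d20 h2]] H].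
exists (Num.min r (Num.min (d1/2) (d2/2))).
 by rewrite ge_min lexx !lt_min r0 !divr_gt0.
move=> x y; rewrite !le_min => /andP[_ /andP[xd _]] /andP[_ /andP[_ yd]].
rewrite distrC; apply: (H (x0+x, u+y)); split => /=.
- apply: h1; rewrite /ball /= opprD addNKr normrN; apply: (le_lt_trans xd).
 by rewrite ltr_pdivrMr// ltr_pMr// ltr1n.
- apply: h2; rewrite /ball /= opprD addNKr normrN; apply: (le_lt_trans yd).
 by rewrite ltr_pdivrMr// ltr_pMr// ltr1n.
Qed.

Definition Ue e2 x y := ln (nsq x y+e2)/2.

Lemma Ue_C2 k l a b c e e2 s0 : a<=b -> c<=e -> 0<k+a -> 0<s0 -> 0<=e2 ->
 (forall x y, a<=x<=b -> c<=y<=e -> s0<=nsq (k+x) (l+y)+e2) ->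
 exists Uxx Uyy, C2 a b c e (fun x y => Ue e2 (k+x) (l+y))
   (fun x y => (P 0 (k+x) (l+y)*P 1 (k+x) (l+y)+Q 0 (k+x) (l+y)*Q 1 (k+x) (l+y))/(nsq (k+x) (l+y)+e2)) Uxx
   (fun x y => (- P 0 (k+x) (l+y)*Q 1 (k+x) (l+y)+Q 0 (k+x) (l+y)*P 1 (k+x) (l+y))/(nsq (k+x) (l+y)+e2)) Uyy /\
  forall x y, a<=x<=b -> c<=y<=e -> Uxx x y+Uyy x y =
   2*e2*(P 1 (k+x) (l+y)^+2+Q 1 (k+x) (l+y)^+2)/(nsq (k+x) (l+y)+e2)^+2.
Proof.
move=> ab ce ka s00 e20 Hs.
have pos x : a<=x<=b -> 0<k+x by move=> /andP[ax _]; lra.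
have gP n : good2 a b c e (fun x y => P n (k+x) (l+y)) by apply: good2_shift; exact: Pgood.
have gQ n : good2 a b c e (fun x y => Q n (k+x) (l+y)) by apply: good2_shift; exact: Qgood.
have dP n x y : a<=x<=b /\ c<=y<=e -> dv (fun x => P n (k+x) (l+y)) x (P n.+1 (k+x) (l+y)) /\
  dv (fun y => P n (k+x) (l+y)) y (- Q n.+1 (k+x) (l+y)).
 move=> [xab _]; split.
  by apply: (dv_shift (f := P n ^~ (l+y))); apply: dPx; exact: pos.
 by apply: (dv_shift (f := P n (k+x))); apply: dPy; exact: pos.
have dQ n x y : a<=x<=b /\ c<=y<=e -> dv (fun x => Q n (k+x) (l+y)) x (Q n.+1 (k+x) (l+y)) /\
  dv (fun y => Q n (k+x) (l+y)) y (P n.+1 (k+x) (l+y)).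
 move=> [xab _]; split.
  by apply: (dv_shift (f := Q n ^~ (l+y))); apply: dQx; exact: pos.
 by apply: (dv_shift (f := Q n (k+x))); apply: dQy; exact: pos.
have Hs' x y : a<=x<=b /\ c<=y<=e -> s0<=uS (fun x y => P 0 (k+x) (l+y)) (fun x y => Q 0 (k+x) (l+y)) e2 x y.
 by move=> [? ?]; exact: Hs.
have := Ueps_C2 (dP 0%N) (dQ 0%N) (dP 1%N) (dQ 1%N) (gP _) (gQ _) (gP _) (gQ _) (gP _) (gQ _) s00 Hs'.
move=> C; do 2 eexists; split; first exact: C.
exact: (Ueps_lap _ _ _ _ s00 Hs').
Qed.

Definition ell (y : R) := 1+ln (2 + `|y|).

Lemma ell_ge1 y : 1<=ell y.
Proof. by rewrite /ell lerDl ln_ge0//; have := normr_ge0 y; lra. Qed.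

Lemma ell_shift u y : `|y| <= 6 -> ell (u+y)<=4*ell u.
Proof.
move=> y6; have n0 := normr_ge0 u.
have : ln (2 + `|u+y|)<=ln (4*(2 + `|u|)).
 rewrite ler_ln ?posrE; [|have := normr_ge0 (u+y); lra|lra].
 by have := ler_normD u y; lra.
rewrite lnM ?posrE//.
have : ln 4<=3 :> R by apply: (le_trans (le_ln1Dx _)) => //; lra.
have := ell_ge1 u; rewrite /ell; lra.
Qed.

Variable CG : R.
Hypothesis CG0 : 0<CG.
Hypothesis growth : forall x y, 1/5<=x<=20 -> nsq x y+1<=expR (2*(CG*ell y)).
Hypothesis low : forall x y, 3<=x<=20 -> 1<=nsq x y.
Hypothesis nz : forall x y, 1/2<x -> 0<nsq x y.

Ltac keep H := first [constr_eq H dPx|constr_eq H dPy|constr_eq H dQx|constr_eq H dQy|constr_eq H bnd|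
 constr_eq H CG0|constr_eq H growth|constr_eq H low|constr_eq H nz].
Ltac fclr := repeat match goal with x := _ |- _ => clearbody x end;
 repeat match goal with H : ?T |- _ => tryif keep H then fail else lazymatch T with
  | is_true (@Order.le _ _ _ _) => fail | is_true (@Order.lt _ _ _ _) => fail
  | is_true (andb _ _) => fail | @eq ?U _ _ => fail
  | _ => lazymatch type of T with Prop => clear H end end end.
Ltac flra := fclr; lra.

Lemma nsq_ge0 x y : 0<=nsq x y.
Proof. by rewrite /nsq addr_ge0 ?sqr_ge0. Qed.

Lemma Ue_le e2 x y : 0<e2<=1 -> 1/5<=x<=20 -> Ue e2 x y<=CG*ell y.
Proof.
move=> /andP[e0 e1] xr; rewrite /Ue ler_pdivrMr// mulrC -[X in _<=X]expRK ler_ln ?posrE ?expR_gt0//.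
 by apply: (le_trans _ (growth y xr)); rewrite lerD2l.
by have := nsq_ge0 x y; lra.
Qed.

(** [jensen] with [B0 = B1 = 4 CG ell u]: above by [growth], below by [|f| >= 1] for [x >= 3]; the 4
    is that of [ell_shift]. Uniformity in [e2] is essential, as [e2] will be chosen depending on the
    point. *)
Lemma mass : exists2 C, 0<=C & forall u e2, 0<e2<=1 ->
 I2 (3/10) (5/2) (- 1) 1 (fun x y => `|Ue e2 (0+x) (u+y)|)<=C*ell u.
Proof.
have [C C0 H] := jensen R; exists (4*CG*C+4*CG*(1 - - 1)*(5/2-3/10)).
 have : 0<=CG*C by rewrite mulr_ge0// ltW.
 by have := CG0; lra.
move=> u e2 e2r; have /andP[e0 e1] := e2r.
have s1: 1/5<=20 :> R by lra.
have s2: - 6<=6 :> R by lra.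
have s3: 0<0+1/5 :> R by lra.
have [Uxx [Uyy [HU lap]]] := @Ue_C2 0 u (1/5) 20 (- 6) 6 e2 e2 s1 s2 s3 e0 (ltW e0) (fun x y _ _ => ler_wpDl (nsq_ge0 _ _) (lexx _)).
have el := ell_ge1 u.
have UB x y : 1/5<=x<=20 -> - 6<=y<=6 -> Ue e2 (0+x) (u+y)<=4*CG*ell u.
 move=> xr yr; rewrite add0r; apply: (le_trans (Ue_le _ e2r xr)).
 rewrite mulrAC [X in _<=X]mulrC; apply: ler_wpM2l; first exact: ltW.
 by apply: ell_shift; rewrite ler_norml.
have B0: 0<=4*CG*ell u by rewrite mulr_ge0//; have := CG0; lra.
have h1 x y : 1/5<=x<=20 -> - 6<=y<=6 -> 0<=Uxx x y+Uyy x y.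
 move=> xr yr; rewrite lap// divr_ge0 ?sqr_ge0//.
 by apply: mulr_ge0; [lra|rewrite addr_ge0 ?sqr_ge0].
have h2 x y : 3<=x<=20 -> - 6<=y<=6 -> 4*CG*ell u-4*CG*ell u<=Ue e2 (0+x) (u+y).
 move=> xr yr; rewrite subrr add0r /Ue divr_ge0// ln_ge0//.
 by have := low (u+y) xr; lra.
have := H _ _ _ _ _ _ _ HU h1 UB h2 B0 => K.
have t1: 3/10<=5/2 :> R by lra.
have t2: - 1<=1 :> R by lra.
have i1: 1/5<=3/10 :> R by lra.
have i2: 5/2<=20 :> R by lra.
have i3: - 6 <= - 1 :> R by lra.
have i4: 1<=6 :> R by lra.
have gU: good2 (3/10) (5/2) (- 1) 1 (fun x y => Ue e2 (0+x) (u+y)).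
 exact: good2_sub i1 i2 i3 i4 (C2_g HU).
have gV: good2 (3/10) (5/2) (- 1) 1 (fun x y => 4*CG*ell u + - Ue e2 (0+x) (u+y)).
 by apply: good2_D; [exact: good2_cst|exact: good2_N].
have gc: good2 (3/10) (5/2) (- 1) 1 (fun _ _ => 4*CG*ell u) by exact: good2_cst.
apply: (@le_trans _ _ (I2 (3/10) (5/2) (- 1) 1 (fun x y => (4*CG*ell u-Ue e2 (0+x) (u+y))+4*CG*ell u))).
 apply: (I2_le t1 t2); [exact: good2_abs|exact: good2_D|].
 move=> x y /andP[x1 x2] /andP[y1 y2].
 have : Ue e2 (0+x) (u+y)<=4*CG*ell u.
  by apply: UB; apply/andP; split; [exact: le_trans x1|exact: le_trans i2|exact: le_trans y1|exact: le_trans i4].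
 by move: B0; set B := 4*CG*ell u; set U := Ue _ _ _ => B0 UB'; rewrite ler_norml; apply/andP; split; lra.
rewrite (I2_D t1 t2 gV gc) (I2_cst t1 t2).
apply: (le_trans (lerD K (lexx _))).
rewrite le_eqVlt; apply/orP; left; apply/eqP; ring.
Qed.

Lemma Ue_good e2 k l a b c e : a<=b -> c<=e -> 0<k+a -> 0<e2 ->
 good2 a b c e (fun x y => Ue e2 (k+x) (l+y)).
Proof.
move=> ab ce ka e0.
have [Uxx [Uyy [HU _]]] := @Ue_C2 k l a b c e e2 e2 ab ce ka e0 (ltW e0) (fun x y _ _ => ler_wpDl (nsq_ge0 _ _) (lexx _)).
exact: C2_g HU.
Qed.

Lemma mass_sq : exists2 C, 0<=C & forall x0 u e2 r, 0<e2<=1 -> 0<r<=1/5 -> 1/2<=x0<=2 ->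
 I2 (- r) r (- r) r (fun x y => `|Ue e2 (x0+x) (u+y)|)<=C*ell u.
Proof.
have [C C0 H] := mass; exists C => // x0 u e2 r e2r /andP[r0 r5] /andP[x1 x2].
apply: le_trans (H u e2 e2r); have /andP[e0 _] := e2r.
have rr: - r<=r by lra.
have g1: good2 (3/10) (5/2) (- 1) 1 (fun x y => `|Ue e2 (0+x) (u+y)|).
 by apply: good2_abs; apply: Ue_good => //; lra.
have s1: 3/10<=x0 + - r by lra.
have s2: x0+r<=5/2 by lra.
have s3: - 1<=0 + - r by lra.
have s4: 0+r<=1 by lra.
have g2 := good2_sub s1 s2 s3 s4 g1.
have t1: 3/10<=5/2 :> R by lra.
have t2: - 1<=1 :> R by lra.
rewrite (_ : I2 _ _ _ _ _ = I2 (x0 + - r) (x0+r) (0 + - r) (0+r) (fun x y => `|Ue e2 (0+x) (u+y)|)).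
 by apply: (I2_sub t1 t2) => // *; exact: normr_ge0.
rewrite -(I2_shift rr rr g2); apply: I2_ext => // x y _ _.
by rewrite !add0r.
Qed.

Lemma nsq_bnd n (a b c e : R) : 0<a -> exists2 B, 0<=B & forall x y, a<=x<=b -> c<=y<=e ->
 P n x y^+2+Q n x y^+2<=B.
Proof.
move=> a0; have [B HB] := bnd n b c e a0.
exists (B^+2+B^+2) => [|x y xab yce]; first by rewrite addr_ge0 ?sqr_ge0.
have [p q] := HB x y xab yce; have B0 := le_trans (normr_ge0 _) p.
by apply: lerD; rewrite -real_normK ?num_real// lerXn2r// nnegrE.
Qed.

Lemma nsq_min x0 u a b c e : a<=b -> c<=e -> 1/2<x0+a ->
 exists2 s, 0<s & forall x y, a<=x<=b -> c<=y<=e -> s<=nsq (x0+x) (u+y).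
Proof.
move=> ab ce xa; have xa0: 0<x0+a by lra.
pose hx x y := 2*(P 0 (x0+x) (u+y)*P 1 (x0+x) (u+y)+Q 0 (x0+x) (u+y)*Q 1 (x0+x) (u+y)).
have [B0 HB0] := bnd 0 (x0+b) (u+c) (u+e) xa0.
have [B1 HB1] := bnd 1 (x0+b) (u+c) (u+e) xa0.
have dx x y : a<=x<=b -> c<=y<=e -> dv (fun x => nsq (x0+x) (u+y)) x (hx x y).
 move=> /andP[ax _] _; have x00: 0<x0+x by lra.
 have h1 := dv_shift (f := P 0 ^~ (u+y)) (dPx 0 (u+y) x00).
 have h2 := dv_shift (f := Q 0 ^~ (u+y)) (dQx 0 (u+y) x00).
 by apply: (dv_eq (dvD (dvX 2 h1) (dvX 2 h2))); rewrite /hx /=; ring.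
apply: (@rect_min (fun x y => nsq (x0+x) (u+y)) hx (2*(B0*B1+B0*B1)) _ _ _ _ ab ce dx).
- move=> x y xab yce; have xr: x0+a<=x0+x<=x0+b by rewrite !lerD2l.
 have yr: u+c<=u+y<=u+e by rewrite !lerD2l.
 have [p0 q0] := HB0 _ _ xr yr; have [p1 q1] := HB1 _ _ xr yr.
 rewrite normrM ger0_norm// ler_wpM2l//; apply: (le_trans (ler_normD _ _)).
 by rewrite !normrM; apply: lerD; apply: ler_pM.
- move=> x /andP[ax _] y yce; have x00: 0<x0+x by lra.
 have h1 := dv_shift (f := P 0 (x0+x)) (dPy 0 (u+y) x00).
 have h2 := dv_shift (f := Q 0 (x0+x)) (dQy 0 (u+y) x00).
 exact: dv_cont (dvD (dvX 2 h1) (dvX 2 h2)).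
- by move=> x y /andP[ax _] _; apply: nz; lra.
Qed.

(** The square around [(x0, u)] has the fixed half-side 1/5 and may cross the critical line. Its
    left half contributes with the right sign; its right half is free of zeros, so there the
    Laplacian is [O(e2)]. Everything depending on the distance to the line is absorbed by [e2], and
    [A] stays uniform. *)
Lemma ldr_ge : exists2 A, 0<=A & forall x0 u, 1/2<x0<=2 -> - (A*ell u)<=ldr x0 u.
Proof.
have [CM CM0 HM] := mass_sq.
have r0: 0<1/5 :> R by flra.
have [Cd Cd0 HD] := dipole r0.
exists (4*(Cd*(CM+1)+1)); first by have := mulr_ge0 Cd0 CM0; flra.
move=> x0 u /andP[x01 x02]; have el := ell_ge1 u.
have A0: 0<=4*(Cd*(CM+1)+1)*ell u.
 by rewrite mulr_ge0//; [have := mulr_ge0 Cd0 CM0; flra|flra].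
have [q0|q0] := lerP 0 (ldr x0 u); first by apply: le_trans q0; rewrite oppr_le0.
have x00: 0<x0 by flra.
have n0 := nz u x01.
have q4: 0 < - ldr x0 u/2 by flra.
have [ra /andP[ra0 ra5] Ha] := cont_near q4 r0 (ldr_cont x00 n0).
have d2: 0<nsq x0 u/2 by flra.
have [rb /andP[rb0 rb5] Hb] := cont_near d2 r0 (@nsq_cont x0 u x00).
pose r1 := Num.min ra rb.
have r1r: 0<r1<=1/5 by rewrite /r1 lt_min ra0 rb0 ge_min ra5.
have z5: 0<=1/5 :> R by flra.
have m5: - (1/5)<=1/5 :> R by flra.
have x0p: 1/2<x0+0 by rewrite addr0.
have [s s_gt0 Hs] := nsq_min u z5 m5 x0p.
have xm: 0<x0 + - (1/5) by flra.
have [NB NB0 HNB] := nsq_bnd 0 (x0+1/5) (u + - (1/5)) (u+1/5) xm.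
have [M M0 HMM] := nsq_bnd 1 (x0+1/5) (u + - (1/5)) (u+1/5) xm.
have B00: 0 <= `|ln s| + `|ln (NB+1)| by rewrite addr_ge0.
have [C1 C10 H1] := HD r1 _ r1r B00.
(* Chosen last. The second entry serves [quot_slope]; the third makes [C1] times the Laplacian bound
   [2 e2 M / s^2] at most 1. *)
pose e2 := Num.min 1 (Num.min (nsq x0 u/2) (s^+2/(2*(M+1)*(C1+1)))).
have den: 0<2*(M+1)*(C1+1) by rewrite !mulr_gt0// ltr_wpDl.
have s2: 0<s^+2 by rewrite exprn_gt0.
have e20: 0<e2 by rewrite /e2 !lt_min ltr01 d2 divr_gt0.
have e21: e2<=1 by rewrite /e2 ge_min lexx.
have e2d: e2<=nsq x0 u/2 by rewrite /e2 !ge_min lexx orbT.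
have e2s: e2*(2*(M+1)*(C1+1))<=s^+2 by rewrite -ler_pdivlMr// /e2 !ge_min lexx !orbT.
have [Uxx [Uyy [HU lap]]] := @Ue_C2 x0 u (- (1/5)) (1/5) (- (1/5)) (1/5) e2 e2 m5 m5 xm e20 (ltW e20) (fun x y _ _ => ler_wpDl (nsq_ge0 _ _) (lexx _)).
have inq x : - (1/5)<=x<=1/5 -> x0 + - (1/5)<=x0+x<=x0+1/5 by rewrite !lerD2l.
have inu y : - (1/5)<=y<=1/5 -> u + - (1/5)<=u+y<=u+1/5 by rewrite !lerD2l.
have eta0: 0<=2*e2 * M/s^+2 by rewrite divr_ge0 ?(ltW s2)// mulr_ge0// mulr_ge0// ltW.
have := H1 _ _ _ _ _ (- ldr x0 u/4) (2*e2 * M/s^+2) HU _ eta0.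
move=> /(_ _ _ _ _ _) H1'.
suff : - ldr x0 u/4<=Cd*(CM*ell u+1)+1.
 have := mulr_ge0 Cd0 (_ : 0<=ell u-1); move/(_ _) => h; have {}h := h ltac:(flra).
 by (fclr; nra).
apply: le_trans (H1' _ _ _ _ _) _.
- by flra.
- move=> x y /andP[xa xb] yr; rewrite lap//; last by rewrite xa (le_trans xb).
 by rewrite divr_ge0 ?sqr_ge0//; apply: mulr_ge0; [flra|rewrite addr_ge0 ?sqr_ge0].
- move=> x y xr yr; have /andP[xa xb] := xr.
 have xr' : - (1/5)<=x<=1/5 by apply/andP; split; flra.
 rewrite lap//; have G := HMM _ _ (inq _ xr') (inu _ yr).
 have S := Hs _ _ xr yr; set g := _ + _ in G *; have g0: 0<=g by rewrite addr_ge0 ?sqr_ge0.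
 have S' : s<=nsq (x0+x) (u+y)+e2 by flra.
 rewrite ger0_norm; last by rewrite divr_ge0 ?sqr_ge0// mulr_ge0//; flra.
 apply: ler_pM.
 + by rewrite mulr_ge0//; flra.
 + by rewrite invr_ge0 sqr_ge0.
 + by rewrite ler_wpM2l//; flra.
 + rewrite lef_pV2 ?posrE//; first by rewrite lerXn2r ?nnegrE; flra.
  by rewrite exprn_gt0//; flra.
- move=> x y; rewrite /r1 !le_min => /andP[xa xb] /andP[ya yb].
 by apply: (quot_slope q0 n0 (Hb _ _ xb yb) (Ha _ _ xa ya)); rewrite (ltW e20).
- move=> y yr; rewrite /Ue.
 have z0: (0 : R)<=(0 : R)<=(1/5 : R) by rewrite lexx; flra.
 have z1: - (1/5)<=(0 : R)<=(1/5 : R) by apply/andP; split; flra.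
 have S := Hs _ _ z0 yr; have G: nsq (x0+0) (u+y)<=NB := HNB _ _ (inq _ z1) (inu _ yr).
 set N := nsq _ _ in S G *.
 have l1: ln s<=ln (N+e2) by rewrite ler_ln ?posrE//; flra.
 have l2: ln (N+e2)<=ln (NB+1) by rewrite ler_ln ?posrE//; flra.
 have := ler_norm (ln (NB+1)); have := normr_ge0 (ln (NB+1)); have := normr_ge0 (ln s).
 have := ler_norm (- ln s); rewrite normrN ler_norml.
 move: l1 l2; set a := ln s; set b := ln (N+e2); set c := ln (NB+1).
 by move=> *; apply/andP; split; flra.
apply: lerD.
 rewrite ler_wpM2l// lerD2r; apply: HM; first by rewrite e20.
  by flra.
 by flra.
rewrite mulrA ler_pdivrMr// mul1r.
apply: le_trans e2s; rewrite (_ : C1*(2*e2 * M) = e2*(2*(M*C1))); last by ring.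
by rewrite ler_wpM2l ?(ltW e20)// -mulrA ler_wpM2l//; have := mulr_ge0 M0 C10; flra.
Qed.

(** At distance [d] from the line a whole square is free of zeros, so [log|f|] itself is harmonic
    there and [dipole0] bounds both partial derivatives. *)
Lemma ld_le d : 0<d -> exists2 A, 0<=A & forall x0 u, 1/2+d<=x0<=2 ->
 `|ldr x0 u| <= A*ell u /\ `|ldi x0 u| <= A*ell u.
Proof.
move=> d0; have [CM CM0 HM] := mass_sq.
pose r := Num.min (d/2) (1/5) : R.
have r0: 0<r by rewrite /r lt_min; apply/andP; split; flra.
have r5: r<=1/5 by rewrite /r ge_min lexx orbT.
have rd: r<=d/2 by rewrite /r ge_min lexx.
have [C C0 HC] := dipole0 r0.
exists (C*(CM+2)); first by rewrite mulr_ge0//; flra.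
move=> x0 u /andP[x01 x02].
have rr: - r<=r by flra.
have x00: 0<x0 by flra.
have xr: 1/2<x0 + - r by flra.
have xr0: 0<x0 + - r by flra.
have n0: 0<nsq x0 u by apply: nz; flra.
have el := ell_ge1 u.
have [s s_gt0 Hs] := nsq_min u rr rr xr.
have [Uxx [Uyy [HU lap]]] := @Ue_C2 x0 u (- r) r (- r) r 0 s rr rr xr0 s_gt0 (lexx _)
 (fun x y xr yr => le_trans (Hs x y xr yr) (ler_wpDr (lexx _) (lexx _))).
have I: I2 (- r) r (- r) r (fun x y => `|Ue 0 (x0+x) (u+y)|)<=(CM+1)*ell u.
 (* The mean bound is available for positive [e2]; since [e2 <= s], adding it inside the logarithm
    changes that logarithm by at most 1. *)
 pose e2 := Num.min 1 s.
 have e20: 0<e2 by rewrite /e2 lt_min ltr01.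
 have e21: e2<=1 by rewrite /e2 ge_min lexx.
 have e2s: e2<=s by rewrite /e2 ge_min lexx orbT.
 have g2: good2 (- r) r (- r) r (fun x y => `|Ue e2 (x0+x) (u+y)|).
  by apply: good2_abs; exact: Ue_good.
 have g3: good2 (- r) r (- r) r (fun _ _ => 1 : R) by exact: good2_cst.
 apply: (@le_trans _ _ (I2 (- r) r (- r) r (fun x y => `|Ue e2 (x0+x) (u+y)| + 1))).
  apply: (I2_le rr rr); [exact: good2_abs (C2_g HU)|exact: good2_D|].
  move=> x y xrr yrr; have S := Hs _ _ xrr yrr; rewrite /Ue addr0.
  set N := nsq _ _ in S *; have N0: 0<N by flra.
  have l1: ln N<=ln (N+e2) by rewrite ler_ln ?posrE//; flra.
  have l2: ln (N+e2)<=ln N+1.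
   rewrite (_ : N+e2 = N*(1+e2/N)); last by field; exact: lt0r_neq0.
   rewrite lnM ?posrE//; last by rewrite addr_gt0// divr_gt0.
   rewrite lerD2l; apply: (le_trans (le_ln1Dx _)).
    by apply: (lt_trans (ltrN10 _)); rewrite divr_gt0.
   by rewrite ler_pdivrMr// mul1r; flra.
  rewrite ler_norml; have := ler_norm (ln (N+e2)/2); have := ler_norm (- (ln (N+e2)/2)).
  rewrite normrN; set Z := `|_|; move: l1 l2; set a := ln N; set b := ln (N+e2).
  by move=> *; apply/andP; split; flra.
 rewrite (I2_D rr rr g2 g3) (I2_cst rr rr).
 have J: I2 (- r) r (- r) r (fun x y => `|Ue e2 (x0+x) (u+y)|)<=CM*ell u.
  by apply: HM; [rewrite e20|rewrite r0|flra].
 have : 1*(r - - r)*(r - - r)<=1 by (fclr; nra).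
 by move: J; flra.
have H0 x y : - r<=x<=r -> - r<=y<=r -> Uxx x y+Uyy x y = 0.
 by move=> xrr yrr; rewrite lap// mulr0 !mul0r.
have E1 x y : ldr (x0+x) (u+y) = (P 0 (x0+x) (u+y)*P 1 (x0+x) (u+y)+Q 0 (x0+x) (u+y)*Q 1 (x0+x) (u+y))/(nsq (x0+x) (u+y)+0) by rewrite addr0.
have E2 x y : ldi (x0+x) (u+y) = (- P 0 (x0+x) (u+y)*Q 1 (x0+x) (u+y)+Q 0 (x0+x) (u+y)*P 1 (x0+x) (u+y))/(nsq (x0+x) (u+y)+0) by rewrite addr0.
have fin z : `|z| <= C*(I2 (- r) r (- r) r (fun x y => `|Ue 0 (x0+x) (u+y)|)+1) -> `|z| <= C*(CM+2)*ell u.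
 by move=> h; apply: (le_trans h); rewrite -mulrA ler_wpM2l//; move: I; flra.
split; apply: fin.
- have := HC _ _ _ _ _ HU H0; rewrite -E1 !addr0; apply => ep ep0.
 have [r1 r1r H] := cont_near ep0 r0 (ldr_cont x00 n0); exists r1 => // x y xx yy.
 by rewrite -!E1; exact: H.
(* Exchanging the axes turns the y-derivative into an x-derivative and preserves the integral over a
   square. *)
- have HU' : C2 (- r) r (- r) r (fun x y => Ue 0 (x0+y) (u+x)) (fun x y => ldi (x0+y) (u+x)) (fun x y => Uyy y x)
   (fun x y => ldr (x0+y) (u+x)) (fun x y => Uxx y x).
  have gsw h : good2 (- r) r (- r) r h -> good2 (- r) r (- r) r (fun x y => h y x).
   by move=> [h1 h2 [B hB]]; split => //; exists B => x y ? ?; exact: hB.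
  split.
  + by move=> x y xx yy; rewrite E2; exact: C2_y HU y x yy xx.
  + move=> x y xx yy; have := C2_yy HU yy xx; congr dv.
   by apply/funext => z; rewrite E2.
  + by move=> x y xx yy; rewrite E1; exact: C2_x HU y x yy xx.
  + move=> x y xx yy; have := C2_xx HU yy xx; congr dv.
   by apply/funext => z; rewrite E1.
  + exact: gsw (C2_g HU).
  + exact: gsw (C2_gyy HU).
  + exact: gsw (C2_gxx HU).
 rewrite -(I2_swap rr (good2_abs (C2_g HU))).
 have := HC _ _ _ _ _ HU'; rewrite !addr0; apply.
 + by move=> x y xx yy; rewrite addrC H0.
 + move=> ep ep0.
  have [r1 r1r H] := cont_near ep0 r0 (ldi_cont x00 n0); exists r1 => // x y xx yy.
  by exact: H.
Qed.

End holo.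

End logmod.

(** * Laplace transforms of bounded weights *)

Section laplace.
Variable R : realType.
Notation mu := (@lebesgue_measure R).

Definition hl : set R := `[0, +oo[%classic.

Lemma hl_meas : measurable (hl : set (measurableTypeR R)). Proof. exact: measurable_itv. Qed.

Lemma hlE v : hl v = (0<=v) :> Prop.
Proof. by rewrite /hl /= in_itv /= andbT. Qed.

Lemma L1_exp a : 0<a -> L1 mu hl (fun v => expR (- a*v)).
Proof.
move=> a0.
have h: L1 mu hl (exponential_pdf a).
 by apply: integrableS (integrable_exponential_pdf a0) => //; exact: hl_meas.
have h2 := L1Z a^-1 hl_meas h.
apply: (L1_extD hl_meas _ h2) => v; rewrite hlE => v0.
by rewrite exponential_pdfE// mulrA mulVf ?mul1r// lt0r_neq0.
Qed.

Lemma pow_exp n (c v : R) : 0<c -> 0<=v -> v^+n<=n`!%:R/c^+n*expR (c*v).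
Proof.
move=> c0 v0; case: n => [|n].
 by rewrite !expr0 fact0 divr1 mul1r -expR0 ler_expR mulr_ge0// ltW.
have := @expR_ge1Dxn R (c*v) n (mulr_ge0 (ltW c0) v0); rewrite exprMn.
have fp: 0<(n.+1)`!%:R :> R by rewrite ltr0n fact_gt0.
have cp: 0<c^+n.+1 by rewrite exprn_gt0.
move=> h; have {}h : c^+n.+1*v^+n.+1/n.+1`!%:R<=expR (c*v) by apply: le_trans h; rewrite lerDr.
rewrite mulrAC ler_pdivlMr// -ler_pdivrMl// mulrC [X in X / _]mulrC; exact: h.
Qed.

Lemma cont_meas (D : set (measurableTypeR R)) (f : R -> R) : measurable D -> continuous f -> measurable_fun D f.
Proof. by move=> mD cf; apply: measurable_funTS; exact: continuous_measurable_fun. Qed.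

Lemma dv_lip2 (g g1 : R -> R) a h B : (forall t, `|t-a| <= `|h| -> dv g t (g1 t)) ->
 (forall t, `|t-a| <= `|h| -> `|g1 t| <= B) -> `|g (a+h)-g a| <= B * `|h|.
Proof.
move=> dg b; have [h0|h0] := lerP 0 h.
 have s t : a<=t<=a+h -> `|t-a| <= `|h|.
  by move=> /andP[? ?]; rewrite !ger0_norm ?subr_ge0// lerBlDl.
 have ab: a<=a+h by rewrite lerDl.
 have e: a+h-a = h by ring.
 have := @dv_lip _ g g1 a (a+h) B ab; rewrite e (ger0_norm h0); apply=> t /s; [exact: dg|exact: b].
have s t : a+h<=t<=a -> `|t-a| <= `|h|.
 by move=> /andP[? ?]; rewrite (ltr0_norm h0) distrC ger0_norm ?subr_ge0//; lra.
have ab: a+h<=a by rewrite gerDl ltW.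
have e: a-(a+h) = - h by ring.
have := @dv_lip _ g g1 (a+h) a B ab; rewrite e (ltr0_norm h0) distrC; apply=> t /s; [exact: dg|exact: b].
Qed.

Lemma taylor1 (g g1 g2 : R -> R) a h B : (forall t, `|t-a| <= `|h| -> dv g t (g1 t)) ->
 (forall t, `|t-a| <= `|h| -> dv g1 t (g2 t)) -> (forall t, `|t-a| <= `|h| -> `|g2 t| <= B) ->
 `|g (a+h)-g a-h*g1 a| <= B*h^+2.
Proof.
move=> d1 d2 b; have aa: `|a-a| <= `|h| by rewrite subrr normr0.
have B0: 0<=B := le_trans (normr_ge0 _) (b a aa).
pose psi t := g t-t*g1 a.
have -> : g (a+h)-g a-h*g1 a = psi (a+h)-psi a by rewrite /psi; ring.
rewrite -(real_normK (num_real h)) expr2 mulrA.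
apply: (@dv_lip2 psi (fun t => g1 t-g1 a)) => t th.
 by apply: (dv_eq (dvD (d1 t th) (dvN (dvM (dv_id t) (dv_cst (g1 a) t))))); ring.
have sub z : `|z-a| <= `|t-a| -> `|z-a| <= `|h| by move=> h1; exact: le_trans h1 th.
have := @dv_lip2 g1 g2 a (t-a) B (fun z zh => d2 z (sub z zh)) (fun z zh => b z (sub z zh)).
have e: a+(t-a) = t by ring.
by rewrite e => h1; apply: (le_trans h1); rewrite ler_wpM2l.
Qed.

(* Differentiation under the integral sign with a dominated second derivative. *)
Lemma dv_int d (T : measurableType d) (m : {measure set T -> \bar R}) (D : set T)
  (k k1 k2 : R -> T -> R) (G : T -> R) x0 r :
 measurable D -> 0<r ->
 (forall x v, D v -> `|x-x0| <= r -> dv (k^~ v) x (k1 x v)) ->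
 (forall x v, D v -> `|x-x0| <= r -> dv (k1^~ v) x (k2 x v)) ->
 (forall x v, D v -> `|x-x0| <= r -> `|k2 x v| <= G v) ->
 L1 m D G -> (forall x, `|x-x0| <= r -> L1 m D (k x)) -> L1 m D (k1 x0) ->
 dv (fun x => \int[m]_(v in D) k x v) x0 (\int[m]_(v in D) k1 x0 v).
Proof.
move=> mD r0 d1 d2 b2 LG Lk Lk1.
have x0r: `|x0-x0| <= r by rewrite subrr normr0 ltW.
apply: (@dv_quant _ _ _ _ (\int[m]_(v in D) G v) r r0) => h hr.
have hr' : `|x0+h-x0| <= r by rewrite addrC addKr ltW.
have LA := L1B mD (Lk _ hr') (Lk _ x0r); have LC := L1Z h mD Lk1.
rewrite -(RintegralZl h mD Lk1) -(RintegralB mD (Lk _ hr') (Lk _ x0r)) -(RintegralB mD LA LC).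
rewrite mulrC -(RintegralZl (h^+2) mD LG); apply: Rint_abs_le => //.
- exact: (L1B mD LA LC).
- exact: L1Z.
move=> v Dv; rewrite [leRHS]mulrC.
by apply: (@taylor1 (k^~ v) (k1^~ v) (k2^~ v)) => t th; [apply: d1|apply: d2|apply: b2] => //; exact: le_trans th (ltW hr).
Qed.

(** With [s = x + i y], the real part of [exp(- i ph)] times the n-th s-derivative of [exp(- s v)].
    Differentiating in [y] shifts the phase by [- pi/2]. *)
Definition lk n (x y ph v : R) := (- v)^+n*(expR (- x*v)*cos (y*v+ph)).

Lemma lk_dx n x y ph v : dv (fun x => lk n x y ph v) x (lk n.+1 x y ph v).
Proof.
have h: dv (fun x => - x*v) x (- v).
 by apply: (dv_eq (dvM (dvN (dv_id x)) (dv_cst v x))); ring.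
apply: (dv_eq (dvM (dv_cst ((- v)^+n) x) (dvM (dv_expR h) (dv_cst (cos (y*v+ph)) x)))).
by rewrite /lk exprS; ring.
Qed.

Lemma cosBpihalf (t : R) : cos (t-pi/2) = sin t.
Proof. by rewrite -[in RHS](subrK (pi/2) t) sinDpihalf. Qed.

Lemma lk_dy n x y ph v : dv (fun y => lk n x y ph v) y (lk n.+1 x y (ph-pi/2) v).
Proof.
have h: dv (fun y => y*v+ph) y v.
 by apply: (dv_eq (dvD (dvM (dv_id y) (dv_cst v y)) (dv_cst ph y))); ring.
apply: (dv_eq (dvM (dv_cst ((- v)^+n) y) (dvM (dv_cst (expR (- x*v)) y) (dv_cos h)))).
by rewrite /lk exprS addrA cosBpihalf; ring.
Qed.

Lemma lk_cont n x y ph : continuous (lk n x y ph).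
Proof.
move=> v; have h1: dv (fun v => - x*v) v (- x).
 by apply: (dv_eq (dvM (dv_cst (- x) v) (dv_id v))); ring.
have h2: dv (fun v => y*v+ph) v y.
 by apply: (dv_eq (dvD (dvM (dv_cst y v) (dv_id v)) (dv_cst ph v))); ring.
exact: dv_cont (dvM (dvX n (dvN (dv_id v))) (dvM (dv_expR h1) (dv_cos h2))).
Qed.

(** Half of the exponential decay is spent on [v^n] through [pow_exp]; the other half remains for
    integrability. *)
Lemma lk_le n a x y ph v : 0<a -> a<=x -> 0<=v ->
 `|lk n x y ph v| <= n`!%:R/(a/2)^+n*expR (- (a/2)*v).
Proof.
move=> a0 ax v0; rewrite /lk !normrM normrX normrN (ger0_norm v0) (ger0_norm (expR_ge0 _)).
have c1: `|cos (y*v+ph)| <= 1 by rewrite ler_norml cos_geN1 cos_le1.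
have a2: 0<a/2 by rewrite divr_gt0.
apply: (@le_trans _ _ (v^+n*expR (- a*v))).
 rewrite ler_wpM2l ?exprn_ge0//; apply: (@le_trans _ _ (expR (- x*v)*1)).
  by rewrite ler_wpM2l ?expR_ge0.
 by rewrite mulr1 ler_expR ler_wpM2r// lerN2.
apply: (le_trans (ler_wpM2r (expR_ge0 _) (pow_exp n a2 v0))).
rewrite -[leLHS]mulrA -expRD; rewrite (_ : a/2*v + - a*v = - (a/2)*v)//; by field.
Qed.

(** The normalization by 1 makes [Lp_bnd] uniform in the weight; it is applied to [rho], to its
    truncations and to [wB]. *)
Definition wt (w : R -> R) := measurable_fun (hl : set (measurableTypeR R)) w /\ forall v, `|w v| <= 1.

Definition Lp (w : R -> R) n x y ph := \int[mu]_(v in hl) (w v * lk n x y ph v).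

Lemma L1_lk w n x y ph : wt w -> 0<x -> L1 mu hl (fun v => w v * lk n x y ph v).
Proof.
move=> [mw w1] x0; have mh := hl_meas.
have x2: 0<x/2 by rewrite divr_gt0.
apply: (L1_dom mh _ _ (L1Z (n`!%:R/(x/2)^+n) mh (L1_exp x2))).
 apply: measurable_funM => //; apply: cont_meas => //; exact: lk_cont.
move=> v; rewrite hlE => v0; rewrite normrM; apply: le_trans (lk_le n y ph x0 (lexx x) v0).
by rewrite ler_piMl.
Qed.

Lemma Lp_x w n x y ph : wt w -> 0<x -> dv (fun x => Lp w n x y ph) x (Lp w n.+1 x y ph).
Proof.
move=> ww x0; have x2: 0<x/2 by rewrite divr_gt0.
have x4: 0<x/2/2 by rewrite divr_gt0.
have near z : `|z-x| <= x/2 -> x/2<=z by rewrite ler_norml; lra.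
refine (@dv_int _ (measurableTypeR R) mu hl (fun z v => w v * lk n z y ph v) (fun z v => w v * lk n.+1 z y ph v) (fun z v => w v * lk n.+2 z y ph v)
 (fun v => n.+2`!%:R/(x/2/2)^+n.+2*expR (- (x/2/2)*v)) x (x/2) hl_meas x2 _ _ _ _ _ _).
- by move=> z v _ _; apply: (dv_eq (dvM (dv_cst (w v) z) (lk_dx n z y ph v))); ring.
- by move=> z v _ _; apply: (dv_eq (dvM (dv_cst (w v) z) (lk_dx n.+1 z y ph v))); ring.
- move=> z v; rewrite hlE => v0 /near xz; rewrite normrM; apply: le_trans (lk_le n.+2 y ph x2 xz v0).
 by rewrite ler_piMl//; case: ww.
- by apply: L1Z; [exact: hl_meas|exact: L1_exp].
- by move=> z /near xz; apply: L1_lk => //; exact: lt_le_trans xz.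
- exact: L1_lk.
Qed.

Lemma Lp_y w n x y ph : wt w -> 0<x -> dv (fun y => Lp w n x y ph) y (Lp w n.+1 x y (ph-pi/2)).
Proof.
move=> ww x0; have x2: 0<x/2 by rewrite divr_gt0.
refine (@dv_int _ (measurableTypeR R) mu hl (fun z v => w v * lk n x z ph v) (fun z v => w v * lk n.+1 x z (ph-pi/2) v) (fun z v => w v * lk n.+2 x z (ph-pi/2-pi/2) v)
 (fun v => n.+2`!%:R/(x/2)^+n.+2*expR (- (x/2)*v)) y 1 hl_meas ltr01 _ _ _ _ _ _).
- by move=> z v _ _; apply: (dv_eq (dvM (dv_cst (w v) z) (lk_dy n x z ph v))); ring.
- by move=> z v _ _; apply: (dv_eq (dvM (dv_cst (w v) z) (lk_dy n.+1 x z (ph-pi/2) v))); ring.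
- move=> z v; rewrite hlE => v0 _; rewrite normrM.
 apply: le_trans (lk_le n.+2 z (ph-pi/2-pi/2) x0 (lexx x) v0).
 by rewrite ler_piMl//; case: ww.
- by apply: L1Z; [exact: hl_meas|exact: L1_exp].
- by move=> z _; exact: L1_lk.
- exact: L1_lk.
Qed.

Lemma Lp_bnd n a : 0<a -> exists2 B, 0<=B & forall w x y ph, wt w -> a<=x -> `|Lp w n x y ph| <= B.
Proof.
move=> a0; have a2: 0<a/2 by rewrite divr_gt0.
have L := L1Z (n`!%:R/(a/2)^+n) hl_meas (L1_exp a2).
exists (\int[mu]_(v in hl) (n`!%:R/(a/2)^+n*expR (- (a/2)*v))).
 by apply: Rintegral_ge0 => v _; rewrite mulr_ge0 ?expR_ge0// divr_ge0// exprn_ge0// ltW.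
move=> w x y ph ww ax; apply: Rint_abs_le => //; first exact: hl_meas.
 by apply: L1_lk => //; exact: lt_le_trans ax.
move=> v; rewrite hlE => v0; rewrite normrM; apply: le_trans (lk_le n y ph a0 ax v0).
by rewrite ler_piMl//; case: ww.
Qed.

Lemma Lp_cvg (w_ : nat -> R -> R) w n x y ph : (forall N, wt (w_ N)) -> 0<x ->
 (forall v, 0<=v -> w_ N v @[N --> \oo] --> w v) ->
 Lp (w_ N) n x y ph @[N --> \oo] --> Lp w n x y ph.
Proof.
move=> ww x0 cw; have mh := hl_meas; have x2: 0<x/2 by rewrite divr_gt0.
apply: (proj2 (@Rint_dct _ _ _ mu hl (fun N v => w_ N v * lk n x y ph v) (fun v => w v * lk n x y ph v)
 (fun v => n`!%:R/(x/2)^+n*expR (- (x/2)*v)) mh _ _ (L1Z _ mh (L1_exp x2)) _)).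
- by move=> N; apply: L1_meas; exact: L1_lk.
- by move=> v; rewrite hlE => v0; apply: cvgMl; exact: cw.
- move=> N v; rewrite hlE => v0; rewrite normrM; apply: le_trans (lk_le n y ph x0 (lexx x) v0).
 by rewrite ler_piMl//; case: (ww N).
Qed.

End laplace.

(** * The continuation of (s-1) zeta(s) to Re s > 0 *)

Section zeta.
Variable R : realType.
Notation mu := (@lebesgue_measure R).

Lemma nleD (a b A B : R) : `|a| <= A -> `|b| <= B -> `|a+b| <= A+B.
Proof. by move=> h k; apply: (le_trans (ler_normD _ _)); exact: lerD. Qed.

Lemma nleB (a b A B : R) : `|a| <= A -> `|b| <= B -> `|a-b| <= A+B.
Proof. by move=> h k; apply: (le_trans (ler_normB _ _)); exact: lerD. Qed.

Lemma nleM (a b A B : R) : `|a| <= A -> `|b| <= B -> `|a*b| <= A*B.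
Proof. by move=> h k; rewrite normrM; exact: ler_pM. Qed.

Lemma ncos_le1 (t : R) : `|cos t| <= 1. Proof. by rewrite ler_norml cos_geN1 cos_le1. Qed.

Lemma nsin_le1 (t : R) : `|sin t| <= 1. Proof. by rewrite ler_norml sin_geN1 sin_le1. Qed.

Lemma cosDpihalf' (t : R) : cos (t+pi/2) = - sin t. Proof. exact: cosDpihalf. Qed.

Lemma Lp_pi (w : R -> R) n x y ph : wt w -> 0<x -> Lp w n x y (ph-pi/2) = - Lp w n x y (ph+pi/2).
Proof.
move=> ww x0; have E := RintegralZl (- 1) (@hl_meas R) (L1_lk n y (ph+pi/2) ww x0).
rewrite /Lp -[RHS]mulN1r; refine (etrans _ E).
apply: Rint_ext => v _; rewrite /lk !addrA cosBpihalf cosDpihalf'; ring.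
Qed.

(** One minus the fractional part of [exp v]. Partial summation gives
    [(s-1) zeta(s) = 1 + s (s-1) L(s)], with [L] the Laplace transform of [rho], which converges for
    Re s > 0. *)
Definition rho (v : R) : R := 1+(Num.truncn (expR v))%:R-expR v.

Lemma rho_bnd v : 0<=rho v<=1.
Proof.
have /andP[h1 h2] := truncn_itv (expR_ge0 v); rewrite /rho.
by move: h2; rewrite -natr1 => h2; apply/andP; split; lra.
Qed.

Lemma rho_wt : wt rho.
Proof.
split; last by move=> v; have /andP[h1 h2] := rho_bnd v; rewrite ger0_norm.
have mh := @hl_meas R; apply: measurable_funB.
 apply: measurable_funD => //.
 apply: nondecreasing_measurable => // x y xy; rewrite ler_nat.
 by apply: le_truncn; rewrite ler_expR.
by apply: cont_meas => //; exact: continuous_expR.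
Qed.

Definition zA x y : R := x^+2-x-y^+2.
Definition zB x y : R := 2*x*y-y.
Definition wH w ph n x y := zA x y*Lp w n x y ph-zB x y*Lp w n x y (ph+pi/2)
 + n%:R*((2*x-1)*Lp w n.-1 x y ph-2*y*Lp w n.-1 x y (ph+pi/2))
 + (n*n.-1)%:R*Lp w n.-2 x y ph.
Definition zH ph n x y := (n == 0)%:R*cos ph+wH rho ph n x y.

Lemma wH_x w ph n x y : wt w -> 0<x -> dv (fun x => wH w ph n x y) x (wH w ph n.+1 x y).
Proof.
move=> ww x0.
have dA: dv (fun x => zA x y) x (2*x-1).
 by apply: (dv_eq (dvD (dvD (dvX 2 (dv_id x)) (dvN (dv_id x))) (dv_cst (- y^+2) x))); rewrite /=; ring.
have dB: dv (fun x => zB x y) x (2*y).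
 by apply: (dv_eq (dvD (dvM (dvM (dv_cst 2 x) (dv_id x)) (dv_cst y x)) (dv_cst (- y) x))); rewrite /=; ring.
have dA1: dv (fun x => 2*x-1) x 2.
 by apply: (dv_eq (dvD (dvM (dv_cst 2 x) (dv_id x)) (dv_cst (- 1) x))); rewrite /=; ring.
have d k p := @Lp_x R w k x y p ww x0.
have T1 := dvD (dvM dA (d n ph)) (dvN (dvM dB (d n (ph+pi/2)))).
case: n T1 => [|[|n]] T1.
- rewrite (_ : (fun x => _) = fun x => zA x y*Lp w 0 x y ph-zB x y*Lp w 0 x y (ph+pi/2)).
  by apply: (dv_eq T1); rewrite /wH /=; ring.
 by apply/funext => t; rewrite /wH /=; ring.
- have T2 := dvD T1 (dvD (dvM dA1 (d 0 ph)) (dvN (dvM (dv_cst (2*y) x) (d 0 (ph+pi/2))))).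
 rewrite (_ : (fun x => _) = fun x => zA x y*Lp w 1 x y ph-zB x y*Lp w 1 x y (ph+pi/2) +
   ((2*x-1)*Lp w 0 x y ph-2*y*Lp w 0 x y (ph+pi/2))).
  by apply: (dv_eq T2); rewrite /wH /=; ring.
 by apply/funext => t; rewrite /wH /=; ring.
- have T2 := dvD T1 (dvM (dv_cst n.+2%:R x) (dvD (dvM dA1 (d n.+1 ph)) (dvN (dvM (dv_cst (2*y) x) (d n.+1 (ph+pi/2)))))).
 have T3 := dvD T2 (dvM (dv_cst (n.+2*n.+1)%:R x) (d n ph)).
 apply: (dv_eq T3); rewrite /wH /= !natrM -!natr1; ring.
Qed.

Lemma wH_y w ph n x y : wt w -> 0<x -> dv (fun y => wH w ph n x y) y (wH w (ph-pi/2) n.+1 x y).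
Proof.
move=> ww x0.
have dA: dv (fun y => zA x y) y (- (2*y)).
 by apply: (dv_eq (dvD (dv_cst (x^+2-x) y) (dvN (dvX 2 (dv_id y))))); rewrite /=; ring.
have dB: dv (fun y => zB x y) y (2*x-1).
 by apply: (dv_eq (dvD (dvM (dv_cst (2*x) y) (dv_id y)) (dvN (dv_id y)))); rewrite /=; ring.
have dB1: dv (fun y => 2*y) y 2.
 by apply: (dv_eq (dvM (dv_cst 2 y) (dv_id y))); rewrite /=; ring.
have d k p := @Lp_y R w k x y p ww x0.
have d' k p : dv (fun y => Lp w k x y (p+pi/2)) y (Lp w k.+1 x y p).
 by have := d k (p+pi/2); rewrite addrK.
have e k : Lp w k x y (ph-pi/2) = - Lp w k x y (ph+pi/2) by exact: Lp_pi ww x0.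
have T1 := dvD (dvM dA (d n ph)) (dvN (dvM dB (d' n ph))).
case: n T1 => [|[|n]] T1.
- rewrite (_ : (fun y => _) = fun y => zA x y*Lp w 0 x y ph-zB x y*Lp w 0 x y (ph+pi/2)).
  by apply: (dv_eq T1); rewrite /wH /= subrK !e; ring.
 by apply/funext => t; rewrite /wH /=; ring.
- have T2 := dvD T1 (dvD (dvM (dv_cst (2*x-1) y) (d 0 ph)) (dvN (dvM dB1 (d' 0 ph)))).
 rewrite (_ : (fun y => _) = fun y => zA x y*Lp w 1 x y ph-zB x y*Lp w 1 x y (ph+pi/2) +
   ((2*x-1)*Lp w 0 x y ph-2*y*Lp w 0 x y (ph+pi/2))).
  by apply: (dv_eq T2); rewrite /wH /= subrK !e; ring.
 by apply/funext => t; rewrite /wH /=; ring.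
- have T2 := dvD T1 (dvM (dv_cst n.+2%:R y) (dvD (dvM (dv_cst (2*x-1) y) (d n.+1 ph)) (dvN (dvM dB1 (d' n.+1 ph))))).
 have T3 := dvD T2 (dvM (dv_cst (n.+2*n.+1)%:R y) (d n ph)).
 apply: (dv_eq T3); rewrite /wH /= subrK !e !natrM -!natr1; ring.
Qed.

Lemma zH_x ph n x y : 0<x -> dv (fun x => zH ph n x y) x (zH ph n.+1 x y).
Proof.
move=> x0; apply: (dv_eq (dvD (dv_cst ((n == 0)%:R*cos ph) x) (wH_x ph n y rho_wt x0))).
by rewrite /zH /= mul0r.
Qed.

Lemma zH_y ph n x y : 0<x -> dv (fun y => zH ph n x y) y (zH (ph-pi/2) n.+1 x y).
Proof.
move=> x0; apply: (dv_eq (dvD (dv_cst ((n == 0)%:R*cos ph) y) (wH_y ph n y rho_wt x0))).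
by rewrite /zH /= mul0r.
Qed.

Lemma zH_pi n x y ph : 0<x -> zH (ph-pi/2) n x y = - zH (ph+pi/2) n x y.
Proof.
move=> x0; rewrite /zH /wH subrK cosBpihalf cosDpihalf' !(Lp_pi _ _ _ rho_wt x0).
have e k : Lp rho k x y (ph+pi/2+pi/2) = - Lp rho k x y ph.
 by have := @Lp_pi rho k x y (ph+pi/2) rho_wt x0; rewrite addrK => ->; rewrite opprK.
by rewrite !e; ring.
Qed.

(** Real part, and with phase [pi/2] imaginary part, of the n-th derivative of [(s-1) zeta(s)]. *)
Definition zP n x y := zH 0 n x y.
Definition zQ n x y := zH (pi/2) n x y.

Lemma zPx n x y : 0<x -> dv (zP n ^~ y) x (zP n.+1 x y). Proof. exact: zH_x. Qed.

Lemma zQx n x y : 0<x -> dv (zQ n ^~ y) x (zQ n.+1 x y). Proof. exact: zH_x. Qed.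

Lemma zPy n x y : 0<x -> dv (zP n x) y (- zQ n.+1 x y).
Proof. by move=> x0; apply: (dv_eq (zH_y 0 n y x0)); rewrite zH_pi// add0r. Qed.

Lemma zQy n x y : 0<x -> dv (zQ n x) y (zP n.+1 x y).
Proof. by move=> x0; apply: (dv_eq (zH_y (pi/2) n y x0)); rewrite subrr. Qed.

Lemma zH_bnd n (a b c e : R) : 0<a -> exists B, forall ph x y, a<=x<=b -> c<=y<=e ->
 `|zH ph n x y| <= B.
Proof.
move=> a0; have [B0 B00 H0] := Lp_bnd n a0; have [B1 B10 H1] := Lp_bnd n.-1 a0.
have [B2 B20 H2] := Lp_bnd n.-2 a0; pose Y := `|c| + `|e|.
exists (1*1+((b^+2+b+Y^+2)*B0+(2*b*Y+Y)*B0+n%:R*((2*b+1)*B1+2*Y*B1)+(n*n.-1)%:R*B2)).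
move=> ph x y /andP[ax xb] /andP[cy ye].
have x0: 0<x by exact: lt_le_trans ax.
have nx: `|x| <= b by rewrite gtr0_norm.
have ny: `|y| <= Y.
 rewrite ler_norml; have := ler_norm e; have := ler_norm (- c); rewrite normrN /Y.
 have := normr_ge0 c; have := normr_ge0 e; move: cy ye; clear; move=> *; apply/andP; split; lra.
have sq (u U : R) : `|u| <= U -> `|u^+2| <= U^+2 by rewrite !expr2; move=> h; exact: nleM.
have n2: `|2| <= 2 :> R by rewrite ger0_norm.
have n1: `|1| <= 1 :> R by rewrite normr1.
have nn k : `|k%:R| <= k%:R :> R by rewrite ger0_norm.
have w := rho_wt.
have nA: `|zA x y| <= b^+2+b+Y^+2 by apply: nleB; [apply: nleB => //|]; exact: sq.
have nB: `|zB x y| <= 2*b*Y+Y by apply: nleB => //; apply: nleM => //; exact: nleM.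
apply: nleD; first by apply: nleM; [case: (n == 0); rewrite ?normr0 ?normr1|exact: ncos_le1].
apply: nleD; last by apply: nleM => //; exact: H2.
apply: nleD; first by apply: nleB; apply: nleM => //; exact: H0.
apply: nleM => //; apply: nleB; apply: nleM => //; try exact: H1.
- by apply: nleB => //; exact: nleM.
- exact: nleM.
Qed.

Lemma zPQ_bnd n (a b c e : R) : 0<a -> exists B, forall x y, a<=x<=b -> c<=y<=e ->
 `|zP n x y| <= B /\ `|zQ n x y| <= B.
Proof. by move=> /(zH_bnd n b c e)[B HB]; exists B => x y xr yr; split; exact: HB. Qed.

Lemma z_growth : exists2 CG, 0<CG & forall x y, 1/5<=x<=20 ->
 nsq zP zQ x y+1<=expR (2*(CG*ell y)).
Proof.
have a0: 0<1/5 :> R by lra.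
have [M M0 HM] := Lp_bnd 0 a0.
(* 127 = 106 + 21, the bounds of [zA] and [zB] in units of [t^2]; they use [x <= 20] and
   [t >= 2]. *)
pose K : R := 1+127 * M; have K1: 1<=K by rewrite /K; lra.
have K2: 1<=2*K^+2+1 by have := sqr_ge0 K; lra.
exists (ln (2*K^+2+1)/2+2); first by have := ln_ge0 K2; lra.
move=> x y xr; pose t := 2 + `|y|.
have t2: 2<=t by rewrite /t lerDl.
have ny: `|y| <= t by rewrite /t lerDr.
have /andP[x1 x2] := xr.
have nx: `|x| <= 20 by rewrite ger0_norm; lra.
have w := rho_wt.
have nA: `|zA x y| <= 106 * t^+2.
 apply: (@le_trans _ _ (20*20+20+t * t)); last by move: t2; clear; nra.
 by rewrite /zA !expr2; apply: nleB; [apply: nleB => //|]; exact: nleM.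
have nB: `|zB x y| <= 21 * t^+2.
 apply: (@le_trans _ _ (2*20 * t+t)); last by move: t2; clear; nra.
 by apply: nleB => //; apply: nleM => //; apply: nleM => //; rewrite ger0_norm.
have nH ph : `|zH ph 0 x y| <= K * t^+2.
 apply: (@le_trans _ _ (1*1+(106 * t^+2 * M+21 * t^+2 * M))).
  rewrite /zH /wH /= !mul0r !addr0; apply: nleD.
   by apply: nleM; [rewrite normr1|exact: ncos_le1].
  by apply: nleB; apply: nleM => //; apply: HM.
 have : 1<=t^+2 by move: t2; clear; nra.
 by rewrite /K; lra.
have sq (u U : R) : `|u| <= U -> u^+2<=U^+2.
 by move=> h; rewrite -real_normK ?num_real// lerXn2r// nnegrE// (le_trans _ h).
apply: (@le_trans _ _ ((2*K^+2+1) * t^+4)).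
 have t4: 1<=t^+4 by rewrite exprn_ege1//; lra.
 have := sq _ _ (nH 0); have := sq _ _ (nH (pi/2)).
 rewrite /nsq -/(zP 0 x y) -/(zQ 0 x y) exprMn -exprM.
 by move: t4; set a := zP _ _ _^+2; set b := zQ _ _ _^+2; set k := K^+2; set T := t^+(2*2); move=> *; lra.
have t0: 0<t by lra.
have KK0: 0<2*K^+2+1 by lra.
rewrite -[X in _*X](@lnK _ (t^+4)) ?posrE ?exprn_gt0// -[X in X*_](@lnK _ (2*K^+2+1)) ?posrE//.
rewrite -expRD ler_expR lnXn// /ell -/t.
have l0: 0<=ln t by rewrite ln_ge0//; lra.
have L0 := ln_ge0 K2; rewrite -(mulr_natl (ln t) 4).
have := mulr_ge0 L0 l0; move: l0 L0; set a := ln t; set b := ln _; clear; move=> *; lra.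
Qed.

End zeta.

(** * Identification with the Dirichlet series of zeta *)

Section zeta2.
Variable R : realType.
Notation mu := (@lebesgue_measure R).

Lemma seq_ge (u : nat -> R) (l x : R) : u @ \oo --> l -> (forall n, x<=u n) -> x<=l.
Proof.
move=> ul h; rewrite -(cvg_lim _ ul)//; apply: limr_ge; first exact: cvgP ul.
exact: nearW.
Qed.

Lemma seq_le (u : nat -> R) (l x : R) : u @ \oo --> l -> (forall n, u n<=x) -> l<=x.
Proof.
move=> ul h; rewrite -(cvg_lim _ ul)//; apply: limr_le; first exact: cvgP ul.
exact: nearW.
Qed.

Lemma seq_uniq (u : nat -> R) (l l' : R) : u @ \oo --> l -> u @ \oo --> l' -> l = l'.
Proof. by move=> h1 h2; rewrite -(cvg_lim _ h1)// (cvg_lim _ h2). Qed.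

Lemma seq_ext (u v : nat -> R) (l : R) : (forall n, u n = v n) -> u @ \oo --> l -> v @ \oo --> l.
Proof. by move=> /funext ->. Qed.

Definition nk (n : nat) (x y ph : R) := expR (- x * ln n%:R)*cos (y * ln n%:R+ph).
Definition Zs N (x y ph : R) := \sum_(1<=n<N.+1) nk n x y ph.

Lemma nk_pi n x y ph : nk n x y (ph+pi/2+pi/2) = - nk n x y ph.
Proof. by rewrite /nk !addrA cosDpihalf' sinDpihalf mulrN. Qed.

Lemma Zs_pi N x y ph : Zs N x y (ph+pi/2+pi/2) = - Zs N x y ph.
Proof. by rewrite /Zs -sumrN; apply: eq_bigr => n _; exact: nk_pi. Qed.

Definition zk (x y ph v : R) : R := zA x y * lk 0 x y ph v-zB x y * lk 0 x y (ph+pi/2) v.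

(** A primitive of [(n+1 - exp v) s (s-1) exp(- s v)]; on the interval between [ln n] and [ln (n+1)]
    the first factor is [rho]. *)
Definition zG (n : nat) (ph x y v : R) : R := expR (- x*v) *
 ((- (n.+1%:R*(x-1))+x*expR v)*cos (y*v+ph)+(- (n.+1%:R*y)+y*expR v)*sin (y*v+ph)).

Lemma zG_dv (n : nat) (ph : R) (x : R) (y : R) (v : R) : dv (zG n ph x y) v ((n.+1%:R-expR v)*zk x y ph v).
Proof.
have h1: dv (fun v => - x*v) v (- x) by apply: (dv_eq (dvM (dv_cst (- x) v) (dv_id v))); ring.
have h2: dv (fun v => y*v+ph) v y by apply: (dv_eq (dvD (dvM (dv_cst y v) (dv_id v)) (dv_cst ph v))); ring.
have h3 := dv_expR (dv_id v).
have A1 := dvD (dv_cst (- (n.+1%:R*(x-1))) v) (dvM (dv_cst x v) h3).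
have A2 := dvD (dv_cst (- (n.+1%:R*y)) v) (dvM (dv_cst y v) h3).
have := dvM (dv_expR h1) (dvD (dvM A1 (dv_cos h2)) (dvM A2 (dv_sin h2))).
move=> H; apply: (dv_eq H).
rewrite /zk /lk /zA /zB !expr0 !mul1r (addrA (y*v) ph (pi/2)) cosDpihalf'.
by move: (expR (- x*v)) (expR v) (cos _) (sin _) (n.+1%:R : R) => a b c e k; ring.
Qed.

Lemma zk_cont (x : R) (y : R) (ph : R) : continuous (zk x y ph).
Proof.
move=> v; apply: cvgB; apply: cvgM; try exact: cvg_cst; exact: lk_cont.
Qed.

(** The cut at [ln (N+1)] makes [wN 0] vanish on the half-line, and [wp N] is the increment from
    [wN N] to [wN (N+1)]; the induction of [zid] rests on this. *)
Definition wN N v : R := if v<ln N.+1%:R then rho v else 0.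
Definition wp N v : R := if ln N.+1%:R<=v<ln N.+2%:R then rho v else 0.

Lemma meas_if (a b : itv_bound R) (w : R -> R) : measurable_fun setT w ->
 measurable_fun (setT : set (measurableTypeR R)) (fun v => if v \in Interval a b then w v else 0).
Proof.
move=> mw; rewrite (_ : (fun v => _) = fun v => w v * \1_([set` Interval a b]) v).
 by apply: measurable_funM => //; exact: measurable_indic.
apply/funext => v; rewrite indicE; case: ifP => h.
 by rewrite mem_set// mulr1.
by rewrite memNset ?mulr0// => /=; rewrite h.
Qed.

Lemma rho_meas : measurable_fun (setT : set (measurableTypeR R)) (@rho R).
Proof.
apply: measurable_funB.
 apply: measurable_funD => //.
 apply: nondecreasing_measurable => // x y xy; rewrite ler_nat.
 by apply: le_truncn; rewrite ler_expR.
by apply: cont_meas => //; exact: continuous_expR.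
Qed.

Lemma wN_wt N : wt (wN N).
Proof.
split; last first.
 by move=> v; rewrite /wN; case: ifP => _; rewrite ?normr0//; have /andP[h1 h2] := rho_bnd v; rewrite ger0_norm.
apply: measurable_funTS; have := @meas_if -oo%O (BLeft (ln N.+1%:R)) _ rho_meas.
by under eq_fun do rewrite in_itv /=.
Qed.

Lemma wp_wt N : wt (wp N).
Proof.
split; last first.
 by move=> v; rewrite /wp; case: ifP => _; rewrite ?normr0//; have /andP[h1 h2] := rho_bnd v; rewrite ger0_norm.
apply: measurable_funTS; have := @meas_if (BLeft (ln N.+1%:R)) (BLeft (ln N.+2%:R)) _ rho_meas.
by under eq_fun do rewrite in_itv /=.
Qed.

Lemma L1_wzk (w : R -> R) (x : R) (y : R) (ph : R) : wt w -> 0<x -> L1 mu (@hl R) (fun v => w v*zk x y ph v).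
Proof.
move=> ww x0; have mh := @hl_meas R.
have := L1B mh (L1Z (zA x y) mh (L1_lk 0 y ph ww x0)) (L1Z (zB x y) mh (L1_lk 0 y (ph+pi/2) ww x0)).
by apply: L1_ext => v; rewrite /zk; ring.
Qed.

Lemma wH0E (w : R -> R) (x : R) (y : R) (ph : R) : wt w -> 0<x -> wH w ph 0 x y = \int[mu]_(v in @hl R) (w v*zk x y ph v).
Proof.
move=> ww x0; have mh := @hl_meas R; rewrite /wH /= !mul0r !addr0.
have l1 := L1_lk 0 y ph ww x0; have l2 := L1_lk 0 y (ph+pi/2) ww x0.
have E1 := RintegralZl (zA x y) mh l1; have E2 := RintegralZl (zB x y) mh l2.
have E3 := RintegralB mh (L1Z (zA x y) mh l1) (L1Z (zB x y) mh l2).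
rewrite /Lp -E1 -E2 -E3; apply: Rint_ext => v _; rewrite /zk; ring.
Qed.

Lemma ln_succ N : ln (N.+1%:R : R)<=ln N.+2%:R.
Proof. by rewrite ler_ln ?posrE// ler_nat. Qed.

Lemma ln_nat_ge0 N : 0<=ln (N.+1%:R : R).
Proof. by rewrite ln_ge0// ler1n. Qed.

Lemma rho_piece N v : ln N.+1%:R<=v<ln N.+2%:R -> rho v = N.+2%:R-expR v :> R.
Proof.
move=> /andP[h1 h2]; rewrite /rho (@truncn_def _ _ N.+1) ?nat1r//.
by rewrite -[X in X <= _]lnK ?posrE// -[X in _<X]lnK ?posrE// ler_expR ltr_expR h1.
Qed.

Lemma wp_int (N : nat) (x : R) (y : R) (ph : R) : \int[mu]_(v in @hl R) (wp N v*zk x y ph v) =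
 zG N.+1 ph x y (ln N.+2%:R)-zG N.+1 ph x y (ln N.+1%:R).
Proof.
rewrite -(ftc (ln_succ N) (fun v _ => zG_dv N.+1 ph x y v)); last first.
 move=> v _; apply: cvgM; last exact: zk_cont.
 by apply: cvgB; [exact: cvg_cst|exact: continuous_expR].
set I := `[ln N.+1%:R, ln N.+2%:R[%classic : set R.
have L: L1 mu I (fun v => (N.+2%:R-expR v)*zk x y ph v).
 apply: (@integrableS _ _ _ mu `[ln N.+1%:R, ln N.+2%:R]).
 - exact: measurable_itv.
 - exact: measurable_itv.
 - by move=> v; rewrite /I /= !in_itv /= => /andP[-> /ltW].
 apply: cont_on_L1 => v _; apply: cvgM; last exact: zk_cont.
 by apply: cvgB; [exact: cvg_cst|exact: continuous_expR].
rewrite -(Rintegral_itv_bndo_bndc L) Rint_mkcond [RHS]Rint_mkcond; apply: Rint_ext => v _.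
rewrite !indicE /wp; case: ifP => h; last by rewrite mul0r mulr0 memNset ?mul0r// /= in_itv /= h.
have h1: (@hl R) v by rewrite hlE; move: h => /andP[h _]; exact: le_trans (ln_nat_ge0 N) h.
have h2: `[ln N.+1%:R, ln N.+2%:R[%classic v by rewrite /= in_itv.
by rewrite (rho_piece h) (mem_set h1) (mem_set h2).
Qed.

Lemma zG_diff (N : nat) (x : R) (y : R) (ph : R) : zG N.+1 ph x y (ln N.+2%:R)-zG N.+1 ph x y (ln N.+1%:R) =
 N.+2%:R*nk N.+2 x y ph-N.+1%:R*nk N.+1 x y ph+((x-1)*nk N.+1 x y ph-y*nk N.+1 x y (ph+pi/2)).
Proof.
rewrite /zG /nk !lnK ?posrE// !addrA !cosDpihalf' -!natr1.
by move: (expR _) (expR _) (cos _) (sin _) (cos _) (sin _) => a b c e f g; ring.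
Qed.

(** Partial summation at a finite stage. The term with [N+1] is the boundary term, which tends to 0
    for [x > 1]. *)
Lemma zid (N : nat) (x : R) (y : R) (ph : R) : 0<x -> wH (wN N) ph 0 x y+cos ph =
 N.+1%:R*nk N.+1 x y ph+((x-1)*Zs N x y ph-y*Zs N x y (ph+pi/2)).
Proof.
move=> x0; rewrite wH0E//; last exact: wN_wt.
elim: N => [|N IH].
 rewrite (_ : \int[mu]_(v in _) _ = 0); last first.
  rewrite -(@Rint_0 _ _ _ mu (@hl R)); apply: Rint_ext => v; rewrite hlE => v0.
  by rewrite /wN ln1 ltNge v0 /= mul0r.
 by rewrite /Zs !big_nil /nk ln1 !mulr0 expR0 !add0r; ring.
have E := RintegralD (@hl_meas R) (L1_wzk y ph (wN_wt N) x0) (L1_wzk y ph (wp_wt N) x0).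
rewrite (_ : \int[mu]_(v in _) _ = \int[mu]_(v in @hl R) (wN N v*zk x y ph v) + \int[mu]_(v in @hl R) (wp N v*zk x y ph v)).
 rewrite wp_int zG_diff addrAC IH /Zs !(big_nat_recr N.+1)//=.
 by move: (\sum_(_ <= _ < _) _) (\sum_(_ <= _ < _) _) => a b; ring.
rewrite -E; apply: Rint_ext => v _; rewrite -mulrDl; congr (_*_); rewrite /wN /wp.
have := ln_succ N; case: (ltP v (ln N.+1%:R)) => h1 h2; case: (ltP v (ln N.+2%:R)) => h3; rewrite ?addr0 ?add0r//.
by move: (lt_le_trans h1 (le_trans h2 h3)); rewrite ltxx.
Qed.

Lemma pow_cvg0 (c : R) : 0<c -> expR (- c * ln N.+1%:R) @[N --> \oo] --> (0 : R).
Proof.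
move=> c0; apply/cvgrPdist_le => e e0; near=> N.
rewrite sub0r normrN ger0_norm ?expR_ge0// -[leRHS](@lnK _ e) ?posrE// ler_expR mulNr lerNl.
rewrite mulrC -ler_pdivrMr// -[leLHS]expRK ler_ln ?posrE ?expR_gt0//.
near: N; exists (Num.truncn (expR (- ln e/c))) => // n /= hn.
have /andP[_ /ltW h] := truncn_itv (expR_ge0 (- ln e/c)).
by apply: (le_trans h); rewrite ler_nat ltnS.
Unshelve. all: by end_near.
Qed.

Lemma absexp_cos (a t : R) : `|expR a*cos t| <= expR a.
Proof. by rewrite normrM ger0_norm ?expR_ge0// ler_piMr ?expR_ge0// ncos_le1. Qed.

Lemma bnd_cvg0 (u : nat -> R) (w : nat -> R) : (forall n, `|u n| <= w n) -> w @ \oo --> (0 : R) -> u @ \oo --> (0 : R).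
Proof.
move=> h /cvgrPdist_le w0; apply/cvgrPdist_le => e e0; near=> n.
rewrite sub0r normrN (le_trans (h n))// (le_trans (ler_norm _))// -normrN -sub0r.
by near: n; exact: w0.
Unshelve. all: by end_near.
Qed.

Lemma nk_end (x y ph : R) : 1<x -> N.+1%:R*nk N.+1 x y ph @[N --> \oo] --> (0 : R).
Proof.
move=> x1; have x10: 0<x-1 by lra.
apply: (bnd_cvg0 _ (pow_cvg0 x10)) => N; rewrite /nk mulrA -{1}[N.+1%:R]lnK ?posrE// -expRD.
apply: (le_trans (absexp_cos _ _)); rewrite ler_expR le_eqVlt; apply/orP; left; apply/eqP; ring.
Qed.

Lemma wN_cvg v : wN N v @[N --> \oo] --> rho v.
Proof.
apply: cvg_near_cst; near=> N; rewrite /wN ifT//.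
rewrite -[X in X < _]expRK ltr_ln ?posrE ?expR_gt0//.
near: N; exists (Num.truncn (expR v)) => // n /= hn.
have /andP[_ h] := truncn_itv (expR_ge0 v).
by apply: (lt_le_trans h); rewrite ler_nat ltnS.
Unshelve. all: by end_near.
Qed.

Lemma wH_cvg ph n x y : 0<x -> wH (wN N) ph n x y @[N --> \oo] --> wH (@rho R) ph n x y.
Proof.
move=> x0; have c k p : Lp (wN N) k x y p @[N --> \oo] --> Lp (@rho R) k x y p.
 by apply: Lp_cvg => //; [exact: wN_wt|move=> v _; exact: wN_cvg].
apply: cvgD; last by apply: cvgM; [exact: cvg_cst|exact: c].
apply: cvgD; first by apply: cvgB; apply: cvgM; (try exact: cvg_cst); exact: c.
apply: cvgM; first exact: cvg_cst.
by apply: cvgB; apply: cvgM; (try exact: cvg_cst); exact: c.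
Qed.

Lemma Rs_cvg x y ph : 1<x -> ((x-1)*Zs N x y ph-y*Zs N x y (ph+pi/2)) @[N --> \oo] --> zH ph 0 x y.
Proof.
move=> x1; have x0: 0<x by lra.
have h: (wH (wN N) ph 0 x y+cos ph-N.+1%:R*nk N.+1 x y ph) @[N --> \oo] --> wH (@rho R) ph 0 x y+cos ph-0.
 by apply: cvgB; [apply: cvgD; [exact: wH_cvg|exact: cvg_cst]|exact: nk_end].
rewrite subr0 addrC in h; rewrite /zH mul1r.
by apply: seq_ext h => N; rewrite zid//; ring.
Qed.

Definition zr2 (x y : R) := (x-1)^+2+y^+2.
(** Division of the continued function by [s - 1], carried out by multiplying with the conjugate. *)
Definition zetap ph x y := ((x-1)*zH ph 0 x y+y*zH (ph+pi/2) 0 x y)/zr2 x y.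

Lemma zr2_gt0 (x y : R) : x != 1 -> 0<zr2 x y.
Proof. by move=> x1; rewrite /zr2 ltr_wpDr ?sqr_ge0// lt_neqAle sqr_ge0 andbT eq_sym sqrf_eq0 subr_eq0. Qed.

Lemma zr2_gt0' (x y : R) : y != 0 -> 0<zr2 x y.
Proof. by move=> y1; rewrite /zr2 ltr_wpDl ?sqr_ge0// lt_neqAle sqr_ge0 andbT eq_sym sqrf_eq0. Qed.

Lemma Zs_cvg x y ph : 1<x -> Zs N x y ph @[N --> \oo] --> zetap ph x y.
Proof.
move=> x1; have r0: zr2 x y != 0 by rewrite gt_eqF// zr2_gt0// gt_eqF.
have h: ((x-1)*((x-1)*Zs N x y ph-y*Zs N x y (ph+pi/2)) +
  y*((x-1)*Zs N x y (ph+pi/2)-y*Zs N x y (ph+pi/2+pi/2)))/zr2 x y @[N --> \oo] --> zetap ph x y.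
 apply: cvgM; last exact: cvg_cst.
 by apply: cvgD; (apply: cvgM; first exact: cvg_cst); exact: Rs_cvg.
apply: seq_ext h => N.
rewrite Zs_pi; move: r0; rewrite /zr2 => r0; by field.
Qed.

Lemma zH_zeta x y ph : x != 1 \/ y != 0 -> 0<x -> zH ph 0 x y = (x-1)*zetap ph x y-y*zetap (ph+pi/2) x y.
Proof.
move=> h x0; have r0: zr2 x y != 0 by case: h => h; rewrite gt_eqF//; [exact: zr2_gt0|exact: zr2_gt0'].
have e: zH (ph+pi/2+pi/2) 0 x y = - zH ph 0 x y.
 by have := @zH_pi R 0 x y (ph+pi/2) x0; rewrite addrK => ->; rewrite opprK.
by rewrite /zetap e; move: r0; rewrite /zr2 => r0; field.
Qed.

Lemma nsq_zeta x y : x != 1 \/ y != 0 -> 0<x ->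
 nsq (@zP R) (@zQ R) x y = zr2 x y*(zetap 0 x y^+2+zetap (pi/2) x y^+2).
Proof.
move=> h x0; have e: zetap (pi/2+pi/2) x y = - zetap 0 x y.
 rewrite /zetap.
 have e0: zH (pi/2+pi/2) 0 x y = - zH 0 0 x y.
  by have := @zH_pi R 0 x y (pi/2) x0; rewrite subrr => ->; rewrite opprK.
 have e1: zH (pi/2+pi/2+pi/2) 0 x y = - zH (pi/2) 0 x y.
  by have := @zH_pi R 0 x y (pi/2+pi/2) x0; rewrite addrK => ->; rewrite opprK.
 by rewrite e0 e1 add0r; ring.
by rewrite /nsq /zP /zQ !zH_zeta// e add0r /zr2; ring.
Qed.

Lemma nk_cube n (x y ph : R) : 3<=x -> `|nk n.+1 x y ph| <= (n.+1%:R^+3)^-1.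
Proof.
move=> x3; apply: (le_trans (absexp_cos _ _)).
rewrite -[X in _<=X^-1](@lnK _ (n.+1%:R^+3)) ?posrE ?exprn_gt0// -expRN ler_expR lnXn// -(mulr_natl (ln _) 3).
by rewrite mulNr lerN2 ler_wpM2r// ln_nat_ge0.
Qed.

(** The terms from the second on are at most [n^(-3)], and [1/(k+1)^3 <= 1/(k (k+1) (k+2))]
    telescopes. The correction kept in the bound makes the induction work. *)
Lemma Zs_low N x y : 3<=x -> 3/4+(2*N.+1%:R*N.+2%:R)^-1<=Zs N.+1 x y 0.
Proof.
move=> x3; elim: N => [|N IH].
 by rewrite /Zs big_nat1 /nk ln1 !mulr0 expR0 addr0 cos0; lra.
rewrite /Zs big_nat_recr//= -/(Zs N.+1 x y 0).
have := nk_cube N.+1 y 0 x3; rewrite ler_norml => /andP[+ _].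
have k1: 1<=N.+1%:R :> R by rewrite ler1n.
rewrite -!(natr1 N.+2) -!(natr1 N.+1) in IH *; move: IH; set k : R := N.+1%:R in k1 *; move=> IH h.
suff : ((k+1)^+3)^-1<=(2*k*(k+1))^-1-(2*(k+1)*(k+1+1))^-1
 by move: h IH; set a := (_^+3)^-1; set b := (2*k*_)^-1; set c := (2*(k+1)*_)^-1; set z := Zs _ _ _ _; set n := nk _ _ _ _; clear; move=> *; lra.
rewrite (_ : _ - _ = (k*(k+1)*(k+1+1))^-1); last by field; do ?[apply/andP; split]; apply: lt0r_neq0; lra.
by rewrite lef_pV2 ?posrE; [nra|rewrite exprn_gt0//; lra|rewrite !mulr_gt0//; lra].
Qed.

(** [|s-1|^2 >= 4] and Re zeta >= 3/4. This anchors both the mean bound [mass] and the argument for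
    non-vanishing on Re s >= 1. *)
Lemma z_low x y : 3<=x -> 1<=nsq (@zP R) (@zQ R) x y.
Proof.
move=> x3; have x1: 1<x by lra.
have h: 3/4<=zetap 0 x y.
 have := @Zs_cvg x y 0 x1; rewrite -(cvg_shiftS (fun N => Zs N x y 0)) => c.
 by apply: (seq_ge c) => N; apply: le_trans (Zs_low N y x3); rewrite lerDl invr_ge0 !mulr_ge0.
rewrite nsq_zeta; [|by left; rewrite gt_eqF|by lra].
have : 4<=zr2 x y by rewrite /zr2; have := sqr_ge0 y; nra.
have := sqr_ge0 (zetap (pi/2) x y); have : 9/16<=zetap 0 x y^+2 by nra.
by move: (zetap 0 x y^+2) (zetap _ x y^+2) (zr2 x y) => a b r; nra.
Qed.

End zeta2.

(** * Von Mangoldt's function and the identity Lambda * 1 = ln *)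

Section mangoldt.
Variable R : realType.
Notation vm := (@von_mangoldt R).

Lemma vm_ge0 n : 0<=vm n.
Proof.
rewrite /von_mangoldt; case E: (primes n) => [|p [|q s]]//.
have : p \in primes n by rewrite E mem_head.
by rewrite mem_primes => /and3P[/prime_gt0 p0 _ _]; rewrite ln_ge0// ler1n.
Qed.

Lemma vm_pp p k : prime p -> vm (p ^ k.+1) = ln p%:R.
Proof. by move=> pp; rewrite /von_mangoldt primesX// primes_prime. Qed.

(** At most one pair of an exponent and a prime contributes. The common cut-off [M] keeps both sums
    finite and lets them be exchanged freely. *)
Lemma vm_sum n M : (0<n<M)%N -> vm n =
 \sum_(1<=k<M) \sum_(0<=p<M | prime p) (n == p ^ k)%N%:R * ln p%:R.
Proof.
move=> /andP[n0 nM].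
have pk k p : (0<k)%N -> prime p -> primes (p ^ k) = [:: p].
 by move=> k0 pp; case: k k0 => // k _; rewrite primesX// primes_prime.
have zero: (forall p, primes n <> [:: p]) -> \sum_(1<=k<M) \sum_(0<=p<M | prime p) (n == p ^ k)%N%:R * ln p%:R = 0 :> R.
 move=> h; rewrite big_nat_cond big1// => k /andP[/andP[k1 _] _].
 rewrite big1// => p pp; case: eqP => [E|_]; last by rewrite mul0r.
 by case: (h p); rewrite E pk.
rewrite /von_mangoldt; case E: (primes n) => [|p [|q s]].
- by rewrite zero// => p; rewrite E.
- have pin: p \in primes n by rewrite E mem_head.
 have pp: prime p by move: pin; rewrite mem_primes => /and3P[].
 have pn: n = (p ^ logn p n)%N by rewrite {1}(prod_prime_decomp n0) prime_decompE E/= big_seq1.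
 have l0: (0<logn p n)%N by rewrite logn_gt0.
 have lM: (logn p n<M)%N by apply: leq_trans nM; rewrite ltnS; exact: ltnW (ltn_logl _ n0).
 have pM: (p<M)%N by apply: leq_ltn_trans nM; apply: dvdn_leq => //; move: pin; rewrite mem_primes => /and3P[].
 rewrite (bigD1_seq (logn p n)) ?mem_index_iota ?iota_uniq ?l0 ?lM//=.
 rewrite [X in _ = X + _]big_mkcond (bigD1_seq p) ?mem_index_iota ?iota_uniq//= pp -pn eqxx mul1r big1 ?addr0.
  rewrite big_seq_cond big1 ?addr0// => k /andP[]; rewrite mem_index_iota => /andP[k1 _] kl.
  rewrite big1// => q qq; case: eqP => [Eq|_]; last by rewrite mul0r.
  have : primes n = [:: q] by rewrite Eq pk.
  rewrite E => -[pq]; case/negP: kl; rewrite pq Eq pfactorK//.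
 move=> q qp; case: ifP => // qq; case: eqP => [Eq|_]; last by rewrite mul0r.
 have : primes n = [:: q] by rewrite Eq pk.
 by rewrite E => -[pq]; rewrite pq eqxx in qp.
- by rewrite zero// => r; rewrite E.
Qed.

Lemma sum_vm (c : nat -> R) M : \sum_(1<=n<M) vm n*c n =
 \sum_(1<=k<M) \sum_(0<=p<M | prime p) ((p ^ k<M)%N)%:R*(ln p%:R*c (p ^ k)%N).
Proof.
rewrite (eq_big_nat _ _ (F2 := fun n => \sum_(1<=k<M) \sum_(0<=p<M | prime p) ((n == p ^ k)%N%:R * ln p%:R*c n))); last first.
 move=> n nM; rewrite (@vm_sum n M)// mulr_suml; apply: eq_bigr => k _.
 by rewrite mulr_suml.
rewrite exchange_big/=; apply: eq_big_nat => k /andP[k1 kM].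
rewrite exchange_big/=; apply: eq_bigr => p pp.
case: ltnP => [pkM|pkM]; rewrite ?mul1r ?mul0r.
 rewrite (bigD1_seq (p ^ k)%N) ?mem_index_iota ?iota_uniq ?expn_gt0 ?prime_gt0 ?pkM//=.
 rewrite eqxx mul1r big1 ?addr0// => n /negbTE ->; by rewrite !mul0r.
rewrite big_nat_cond big1// => n /andP[/andP[_ nM] _].
by case: eqP => [E|_]; [rewrite E ltnNge pkM in nM|rewrite !mul0r].
Qed.

Lemma ln_primes n : (0<n)%N -> ln (n%:R : R) = \sum_(p <- primes n) (logn p n)%:R * ln p%:R.
Proof.
move=> n0; rewrite {1}(prod_prime_decomp n0) prime_decompE big_map/=.
have : {in primes n, forall p, (0<p)%N} by move=> p; rewrite mem_primes => /and3P[/prime_gt0].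
elim: (primes n) => [|p s IH] ps; first by rewrite !big_nil ln1.
have s0: {in s, forall p, (0<p)%N} by move=> q qs; apply: ps; rewrite inE qs orbT.
have p0: (0<p)%N by apply: ps; rewrite mem_head.
rewrite !big_cons natrM lnM ?posrE ?ltr0n ?expn_gt0 ?p0//; last first.
 by rewrite big_seq prodn_cond_gt0// => q qs; rewrite expn_gt0 s0.
by rewrite IH// natrX lnXn ?ltr0n// mulr_natl.
Qed.

Lemma count_pow p n M : prime p -> (0<n<M)%N -> \sum_(1<=k<M) ((p ^ k %| n)%N)%:R = (logn p n)%:R :> R.
Proof.
move=> pp /andP[n0 nM].
have lM: (logn p n<M)%N by apply: leq_trans nM; rewrite ltnS; exact: ltnW (ltn_logl _ n0).
rewrite (@big_cat_nat _ _ _ (logn p n).+1)//=.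
rewrite [X in _+X](_ : _ = 0) ?addr0; last first.
 by rewrite big_nat big1// => k /andP[lk _]; rewrite pfactor_dvdn// leqNgt lk.
rewrite (eq_big_nat _ _ (F2 := fun=> 1)).
 by rewrite big_const_nat subn1/= iter_addr addr0.
by move=> k /andP[_]; rewrite ltnS => kl; rewrite pfactor_dvdn// kl.
Qed.

(** Each prime [p] is counted once for every positive [k] with [p^k] dividing [n], hence [logn p n]
    times. *)
Lemma vm_div n M : (0<n<M)%N -> \sum_(1<=d<M) vm d*((d %| n)%N)%:R = ln n%:R.
Proof.
move=> nM; have /andP[n0 nM'] := nM; rewrite sum_vm exchange_big/=.
rewrite (eq_bigr (fun p => ln p%:R*(logn p n)%:R)); last first.
 move=> p pp; rewrite -(@count_pow p n M)// mulr_sumr; apply: eq_bigr => k _.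
 case: ltnP => h; first by rewrite mul1r.
 rewrite mul0r; case: (boolP (p ^ k %| n)%N) => [/(dvdn_leq n0)|_]; last by rewrite mulr0.
 by move=> h2; move: (leq_trans h h2); rewrite leqNgt nM'.
rewrite ln_primes//.
transitivity (\sum_(p <- primes n) ln p%:R*(logn p n)%:R : R); last by apply: eq_bigr => p _; rewrite mulrC.
rewrite (bigID (fun p => p %| n)%N)/= addrC big1 ?add0r; last first.
 move=> p /andP[pp pn]; have -> : logn p n = 0%N by apply/eqP; rewrite lognE pp n0 (negbTE pn).
 by rewrite mulr0.
rewrite -big_filter; apply: perm_big; apply: uniq_perm.
- by rewrite filter_uniq// iota_uniq.
- exact: primes_uniq.
move=> p; rewrite mem_filter mem_primes n0 mem_index_iota/=.
case: (boolP (prime p)) => //= pp; case: (boolP (p %| n)%N) => //= pn.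
by rewrite (leq_ltn_trans (dvdn_leq n0 pn)).
Qed.

Lemma vm_le n : vm n.+1<=ln n.+1%:R.
Proof.
rewrite -(@vm_div n.+1 n.+2)//= (bigD1_seq n.+1) ?mem_index_iota ?iota_uniq//= dvdnn mulr1.
by rewrite lerDl; apply: sumr_ge0 => d _; rewrite mulr_ge0// vm_ge0.
Qed.

(* Truncated form of the convolution identity [Lambda * 1 = ln]. *)
Lemma vm_conv (c : nat -> R) M :
 `|\sum_(1<=d<M) \sum_(1<=k<M) vm d*c (d*k)%N - \sum_(1<=n<M) ln n%:R*c n|
  <= \sum_(M<=n<M * M) ln n%:R * `|c n|.
Proof.
case: M => [|M]; first by rewrite !big_geq// subrr normr0.
(* The truncated convolution: it equals [ln n] below the cut-off and lies between 0 and [ln n]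
   beyond, so that the discrepancy is a tail. *)
set g := fun n => \sum_(1<=d<M.+1) \sum_(1<=k<M.+1) vm d*((d*k)%N == n)%:R.
have gE n : (0<n)%N -> g n = \sum_(1<=d<M.+1) vm d*((d %| n)%N && (n %/ d<M.+1)%N)%:R.
 move=> n0; apply: eq_big_nat => d /andP[d0 _]; rewrite -mulr_sumr; congr (_*_).
 case: (boolP (d %| n)%N) => dn /=; last first.
  rewrite big1// => k _; case: eqP => // E; case/negP: dn; rewrite -E; exact: dvdn_mulr.
 have q0: (0<n %/ d)%N by rewrite divn_gt0// dvdn_leq.
 case: ltnP => nd.
  rewrite (bigD1_seq (n %/ d)%N) ?mem_index_iota ?iota_uniq ?q0//= mulnC divnK// eqxx big1 ?addr0//.
  by move=> k kn; case: eqP => // E; case/negP: kn; rewrite -E mulnC mulnK.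
 rewrite big_nat big1// => k /andP[_ kM]; case: eqP => // E.
 by move: nd; rewrite -E mulKn// leqNgt kM.
have g0 n : 0<=g n.
 by apply: sumr_ge0 => d _; apply: sumr_ge0 => k _; rewrite mulr_ge0// vm_ge0.
have gle n : (0<n)%N -> g n<=ln n%:R.
 move=> n0; rewrite gE// -(@vm_div n (maxn n M).+1); last by rewrite n0 ltnS leq_maxl.
 rewrite [X in _<=X](@big_cat_nat _ _ _ M.+1)//=; last by rewrite ltnS leq_maxr.
 rewrite -[X in X <= _]addr0; apply: lerD.
  apply: ler_sum => d _; rewrite ler_wpM2l ?vm_ge0// ler_nat.
  by case: (d %| n)%N => //=; case: (_ < _)%N.
 by apply: sumr_ge0 => d _; rewrite mulr_ge0// vm_ge0.
have geq n : (0<n<M.+1)%N -> g n = ln n%:R.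
 move=> nM; have /andP[n0 nM'] := nM; rewrite gE// -(@vm_div n M.+1)//.
 apply: eq_big_nat => d /andP[d0 _]; rewrite (leq_ltn_trans _ nM') ?andbT//.
 exact: leq_div.
have H: \sum_(1<=d<M.+1) \sum_(1<=k<M.+1) vm d*c (d*k)%N = \sum_(1<=n<(M.+1 * M.+1)) g n*c n.
 transitivity (\sum_(1<=n<M.+1 * M.+1) \sum_(1<=d<M.+1) \sum_(1<=k<M.+1) vm d*((d*k)%N == n)%:R*c n); last first.
  by apply: eq_bigr => n _; rewrite mulr_suml; apply: eq_bigr => d _; rewrite mulr_suml.
 rewrite [RHS]exchange_big/=; apply: eq_big_nat => d /andP[d0 dM].
 rewrite [RHS]exchange_big/=; apply: eq_big_nat => k /andP[k0 kM].
 have [dk|dk] := ltnP (d*k)%N (M.+1 * M.+1)%N.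
  rewrite (bigD1_seq (d*k)%N) ?mem_index_iota ?iota_uniq ?muln_gt0 ?d0 ?k0//= eqxx mulr1 big1 ?addr0//.
  by move=> n nn; rewrite eq_sym (negbTE nn) mulr0 mul0r.
 by exfalso; move: dk; rewrite leqNgt; rewrite ltn_mul.
have MM: (M.+1<=M.+1 * M.+1)%N by rewrite leq_pmulr.
rewrite H (@big_cat_nat _ _ _ M.+1)//= [X in X + _ - _](_ : _ = \sum_(1<=n<M.+1) ln n%:R*c n); last first.
 by apply: eq_big_nat => n nM; rewrite geq.
rewrite addrAC subrr add0r; apply: (le_trans (ler_norm_sum _ _ _)).
apply: ler_sum_nat => n /andP[nM _].
by rewrite normrM ler_wpM2r// ger0_norm// gle// (leq_trans _ nM).
Qed.

End mangoldt.

(** * The logarithmic derivative and its Dirichlet series *)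

Section logder.
Variable R : realType.
Notation vm := (@von_mangoldt R).
Notation zp := (@zP R).
Notation zq := (@zQ R).

Definition Ds N (x y ph : R) := \sum_(1<=n<N.+1) vm n*nk n x y ph.
Definition Es N (x y ph : R) := \sum_(1<=n<N.+1) ln n%:R*nk n x y ph.

Lemma nk_mul d k (x y ph : R) : (0<d)%N -> (0<k)%N ->
 nk (d*k) x y ph = nk d x y 0*nk k x y ph-nk d x y (pi/2)*nk k x y (ph+pi/2).
Proof.
move=> d0 k0; rewrite /nk natrM lnM ?posrE ?ltr0n// addr0 addrA !cosDpihalf'.
rewrite !mulrDr expRD -addrA cosD.
by move: (expR _) (expR _) (cos _) (sin _) (cos _) (sin _) => a b p q r s; ring.
Qed.

Lemma nk_le n (x y ph : R) : `|nk n x y ph| <= nk n x 0 0.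
Proof. by rewrite /nk mul0r add0r cos0 mulr1; exact: absexp_cos. Qed.

(** Half of the excess [x - 1] pays for the logarithm; the new abscissa [(x+1)/2] still exceeds
    1. *)
Lemma ln_nk_le n (x : R) : 1<x -> ln n.+1%:R*nk n.+1 x 0 0<=2/(x-1)*nk n.+1 ((x+1)/2) 0 0.
Proof.
move=> x1; have c0: 0<(x-1)/2 by lra.
have := pow_exp 1 c0 (ln_nat_ge0 R n); rewrite expr1 (_ : 1`!%:R = 1 :> R)// => h.
rewrite /nk !mul0r !add0r cos0 !mulr1; apply: (le_trans (ler_wpM2r (expR_ge0 _) h)).
rewrite -[leLHS]mulrA -expRD le_eqVlt; apply/orP; left; apply/eqP; congr (_*_); first by field; lra.
by congr expR; field.
Qed.

Lemma Zs0_le N (x : R) : 1<x -> Zs N x 0 0<=zetap 0 x 0.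
Proof.
move=> x1; have c := @Zs_cvg R x 0 0 x1.
rewrite -(cvg_lim _ c)//; apply: nondecreasing_cvgn_le; last exact: cvgP c.
apply/nondecreasing_seqP => n; rewrite /Zs [leRHS]big_nat_recr//= lerDl.
by apply: le_trans (nk_le _ _ 0 0).
Qed.

(** The product of the partial sums of Lambda and 1 differs from the partial sum of their
    convolution by a tail, dominated by the tail of zeta at [(x+1)/2]. *)
Lemma conv_cvg (x y ph : R) : 1<x ->
 Ds N x y 0*Zs N x y ph-Ds N x y (pi/2)*Zs N x y (ph+pi/2)-Es N x y ph @[N --> \oo] --> (0 : R).
Proof.
move=> x1; have x'1 : 1<(x+1)/2 by lra.
have cz := @Zs_cvg R ((x+1)/2) 0 0 x'1.
have c1: 2/(x-1)*(zetap 0 ((x+1)/2) 0-Zs N ((x+1)/2) 0 0) @[N --> \oo] --> (0 : R).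
 have := cvgM (@cvg_cst _ (2/(x-1)) nat \oo _) (cvgB (@cvg_cst _ (zetap 0 ((x+1)/2) 0) nat \oo _) cz).
 by rewrite subrr mulr0; apply.
apply: (bnd_cvg0 _ c1) => N.
have := @vm_conv R (fun n => nk n x y ph) N.+1.
rewrite (_ : \sum_(1<=d<N.+1) _ = Ds N x y 0*Zs N x y ph-Ds N x y (pi/2)*Zs N x y (ph+pi/2)); last first.
 rewrite /Ds !mulr_suml -sumrB; apply: eq_big_nat => d /andP[d0 _].
 rewrite /Zs !mulr_sumr -sumrB; apply: eq_big_nat => k /andP[k0 _].
 by rewrite nk_mul//; ring.
move=> h; apply: (le_trans h).
apply: (@le_trans _ _ (\sum_(N.+1<=n<N.+1*N.+1) 2/(x-1)*nk n ((x+1)/2) 0 0)).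
 apply: ler_sum_nat => -[|n] // _; apply: le_trans (ln_nk_le n x1).
 by rewrite ler_wpM2l ?ln_nat_ge0// nk_le.
rewrite -mulr_sumr ler_wpM2l ?divr_ge0//; first by lra.
rewrite lerBrDl; have := Zs0_le (N.+1*N.+1).-1 x'1.
rewrite /Zs prednK ?muln_gt0// (@big_cat_nat _ _ _ N.+1 1 (N.+1*N.+1))//=.
by rewrite leq_pmulr.
Qed.

(** The component with phase [ph] of the sum of [Lambda(n) n^(-s)], that is of [- zeta'/zeta]. *)
Definition Dl (x y ph : R) := limn (fun N => Ds N x y ph).

Lemma Ds_cvg (x y ph : R) : 1<x -> Ds N x y ph @[N --> \oo] --> Dl x y ph.
Proof.
move=> x1; have x'1 : 1<(x+1)/2 by lra.
pose u n := vm n.+1*nk n.+1 x y ph.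
pose v n := 2/(x-1)*nk n.+1 ((x+1)/2) 0 0.
have DE N : Ds N x y ph = series u N by rewrite /Ds big_add1.
suff : cvgn (series u) by rewrite /Dl; under [in X in _ -> X]eq_fun do rewrite DE.
have nv n : 0<=v n by rewrite /v mulr_ge0 ?divr_ge0//; [lra|exact: le_trans (nk_le _ _ 0 0)].
apply: normed_cvg; apply: (@series_le_cvg _ _ v).
- by move=> n; exact: normr_ge0.
- exact: nv.
- move=> n; rewrite /= /u normrM ger0_norm ?vm_ge0//; apply: le_trans (ln_nk_le n x1).
 by apply: ler_pM => //; [exact: vm_ge0|exact: vm_le|exact: nk_le].
have c: 2/(x-1)*Zs N ((x+1)/2) 0 0 @[N --> \oo] --> 2/(x-1)*zetap 0 ((x+1)/2) 0.
 by apply: cvgM; [exact: cvg_cst|exact: Zs_cvg].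
apply: (@cvgP _ _ (2/(x-1)*zetap 0 ((x+1)/2) 0)).
by apply: seq_ext c => N; rewrite /series/= /Zs big_add1 mulr_sumr.
Qed.

Lemma dv_near (f g : R -> R) x a : (\forall z \near x, f z = g z) -> dv f x a -> dv g x a.
Proof. by move=> h; apply: near_eq_is_derive; rewrite ?oner_eq0//; near do apply: esym. Qed.

Lemma dv_uniq (f : R -> R) x a b : dv f x a -> dv f x b -> a = b.
Proof. by move=> [_ <-] [_ <-]. Qed.

Lemma dv_sum (r : seq nat) (f g : nat -> R -> R) x : (forall n, dv (f n) x (g n x)) ->
 dv (fun x => \sum_(n <- r) f n x) x (\sum_(n <- r) g n x).
Proof.
move=> h; elim: r => [|n r IH].
 by rewrite big_nil; under eq_fun do rewrite big_nil; exact: dv_cst.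
by rewrite big_cons; under eq_fun do rewrite big_cons; exact: dvD.
Qed.

Lemma nk_dx n (x y ph : R) : dv (fun x => nk n x y ph) x (- ln n%:R*nk n x y ph).
Proof.
have h: dv (fun x => - x * ln n%:R) x (- ln n%:R).
 by apply: (dv_eq (dvM (dvN (dv_id x)) (dv_cst (ln n%:R) x))); ring.
by apply: (dv_eq (dvM (dv_expR h) (dv_cst (cos (y * ln n%:R+ph)) x))); rewrite /nk; ring.
Qed.

Lemma Zs_dx N (x y ph : R) : dv (fun x => Zs N x y ph) x (- Es N x y ph).
Proof.
apply: (dv_eq (dv_sum (index_iota 1 N.+1) (f := fun n x => nk n x y ph) (g := fun n x => - ln n%:R*nk n x y ph) (fun n => nk_dx n x y ph))).
by rewrite /Es -sumrN; apply: eq_bigr => n _; rewrite mulNr.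
Qed.

(** The x-derivative of [zid]: both sides of that identity are differentiated and derivatives are
    unique. *)
Lemma wH1E N (x y ph : R) : 0<x -> wH (@wN R N) ph 1 x y =
 - (N.+1%:R * ln N.+1%:R*nk N.+1 x y ph)+Zs N x y ph-((x-1)*Es N x y ph-y*Es N x y (ph+pi/2)).
Proof.
move=> x0; have e: dv (fun x => N.+1%:R*nk N.+1 x y ph+((x-1)*Zs N x y ph-y*Zs N x y (ph+pi/2))-cos ph) x
  (- (N.+1%:R * ln N.+1%:R*nk N.+1 x y ph)+Zs N x y ph-((x-1)*Es N x y ph-y*Es N x y (ph+pi/2))).
 have d1: dv (fun x => x-1) x 1 by apply: (dv_eq (dvD (dv_id x) (dv_cst (- 1) x))); ring.
 have := dvD (dvD (dvM (dv_cst N.+1%:R x) (nk_dx N.+1 x y ph)) (dvD (dvM d1 (Zs_dx N x y ph)) (dvN (dvM (dv_cst y x) (Zs_dx N x y (ph+pi/2)))))) (dv_cst (- cos ph) x).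
 by move=> h; apply: (dv_eq h); ring.
apply: (@dv_uniq (fun x => wH (@wN R N) ph 0 x y) x); first by apply: wH_x => //; exact: wN_wt.
apply: dv_near e; near=> z; rewrite -zid; first by ring.
by near: z; exact: lt_nbhsr.
Unshelve. all: by end_near.
Qed.

Lemma nk_end_ln (x y ph : R) : 1<x -> N.+1%:R * ln N.+1%:R*nk N.+1 x y ph @[N --> \oo] --> (0 : R).
Proof.
move=> x1; have c0: 0<(x-1)/2 by lra.
have c: ((x-1)/2)^-1*expR (- ((x-1)/2) * ln N.+1%:R) @[N --> \oo] --> (0 : R).
 by rewrite -(mulr0 ((x-1)/2)^-1); apply: cvgM; [exact: cvg_cst|exact: pow_cvg0].
apply: (bnd_cvg0 _ c) => N; rewrite /nk.
have := pow_exp 1 c0 (ln_nat_ge0 R N); rewrite expr1 (_ : 1`!%:R = 1 :> R)// mul1r => h.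
rewrite normrM (ger0_norm (mulr_ge0 _ (ln_nat_ge0 R N)))//.
apply: (le_trans (ler_wpM2l (mulr_ge0 (ler0n _ _) (ln_nat_ge0 R N)) (absexp_cos _ _))).
rewrite mulrAC -{1}[N.+1%:R]lnK ?posrE// -expRD mulrC.
apply: (le_trans (ler_wpM2r (expR_ge0 _) h)); rewrite expr1 -[leLHS]mulrA -expRD ler_wpM2l ?invr_ge0 ?(ltW c0)//.
by rewrite ler_expR le_eqVlt; apply/orP; left; apply/eqP; field.
Qed.

(** The derivative of [(s-1) zeta] is [zeta + (s-1) zeta'], with [zeta' = - Dl zeta] from the
    convolution; the limit is taken in [wH1E]. *)
Lemma zH1E (x y ph : R) : 1<x ->
 zH ph 1 x y = zetap ph x y-(Dl x y 0*zH ph 0 x y-Dl x y (pi/2)*zH (ph+pi/2) 0 x y).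
Proof.
move=> x1; have x0: 0<x by lra.
have c1 := @wH_cvg R ph 1 x y x0.
have zp2 p : zetap (p+pi/2+pi/2) x y = - zetap p x y.
 apply: (seq_uniq (@Zs_cvg R x y _ x1)).
 by apply: (@seq_ext _ (fun N => - Zs N x y p)) => [N|]; [rewrite Zs_pi|apply: cvgN; exact: Zs_cvg].
have cE p : Es N x y p @[N --> \oo] --> Dl x y 0*zetap p x y-Dl x y (pi/2)*zetap (p+pi/2) x y.
 have h: (Ds N x y 0*Zs N x y p-Ds N x y (pi/2)*Zs N x y (p+pi/2)) -
   (Ds N x y 0*Zs N x y p-Ds N x y (pi/2)*Zs N x y (p+pi/2)-Es N x y p) @[N --> \oo] -->
   Dl x y 0*zetap p x y-Dl x y (pi/2)*zetap (p+pi/2) x y-0.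
  apply: cvgB; last exact: conv_cvg.
  by apply: cvgB; apply: cvgM; first [exact: Ds_cvg|exact: Zs_cvg].
 by rewrite subr0 in h; apply: seq_ext h => N; ring.
have c2: - (N.+1%:R * ln N.+1%:R*nk N.+1 x y ph)+Zs N x y ph-((x-1)*Es N x y ph-y*Es N x y (ph+pi/2)) @[N --> \oo] -->
  - 0+zetap ph x y-((x-1)*(Dl x y 0*zetap ph x y-Dl x y (pi/2)*zetap (ph+pi/2) x y) -
   y*(Dl x y 0*zetap (ph+pi/2) x y-Dl x y (pi/2)*zetap (ph+pi/2+pi/2) x y)).
 apply: cvgB.
  by apply: cvgD; [apply: cvgN; exact: nk_end_ln|exact: Zs_cvg].
 by apply: cvgB; (apply: cvgM; first exact: cvg_cst); exact: cE.
have -> : zH ph 1 x y = wH (@rho R) ph 1 x y by rewrite /zH mul0r add0r.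
have c2' := seq_ext (fun N => esym (@wH1E N x y ph x0)) c2.
rewrite (seq_uniq c1 c2') !zH_zeta ?zp2; [ring| | | |]; try (by left; rewrite gt_eqF); exact: x0.
Qed.

(** [f'/f = 1/(s-1) - Dl]. The signs of the second equation differ because [ldi] is minus the
    imaginary part. *)
Lemma ldr_Dl (x y : R) : 1<x -> 0<nsq zp zq x y ->
 ldr zp zq x y = (x-1)/zr2 x y-Dl x y 0 /\ ldi zp zq x y = y/zr2 x y+Dl x y (pi/2).
Proof.
move=> x1 n0; have x0: 0<x by lra.
have xy: x != 1 \/ y != 0 by left; rewrite gt_eqF.
have r0: zr2 x y != 0 by rewrite gt_eqF// zr2_gt0// gt_eqF.
have zp2 p : zetap (p+pi/2+pi/2) x y = - zetap p x y.
 apply: (seq_uniq (@Zs_cvg R x y _ x1)).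
 by apply: (@seq_ext _ (fun N => - Zs N x y p)) => [N|]; [rewrite Zs_pi|apply: cvgN; exact: Zs_cvg].
have zp0: zetap (pi/2+pi/2) x y = - zetap 0 x y by have := zp2 0; rewrite add0r.
have nE := nsq_zeta xy x0; have n0' := lt0r_neq0 n0.
have hp: zH (pi/2+pi/2) 0 x y = - zH 0 0 x y.
 by have := @zH_pi R 0 x y (pi/2) x0; rewrite subrr => ->; rewrite opprK.
have E0: zH 0 0 x y = (x-1)*zetap 0 x y-y*zetap (pi/2) x y by rewrite zH_zeta// add0r.
have E1: zH (pi/2) 0 x y = (x-1)*zetap (pi/2) x y+y*zetap 0 x y by rewrite zH_zeta// zp0; ring.
have nD: nsq zp zq x y = zH 0 0 x y^+2+zH (pi/2) 0 x y^+2 by [].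
have n1: zetap 0 x y^+2+zetap (pi/2) x y^+2 != 0 by apply: contraNneq n0' => e; rewrite nE e mulr0.
have m0 := mulf_neq0 r0 n1.
rewrite /ldr /ldi nE /zP /zQ !zH1E// hp add0r E0 E1.
split; apply: (mulIf m0); rewrite divfK//; move: r0; rewrite /zr2 => r0; by field.
Qed.

End logder.

(** * Non-vanishing on Re s >= 1 *)

Section nonvanishing.
Variable R : realType.
Notation vm := (@von_mangoldt R).
Notation zp := (@zP R).
Notation zq := (@zQ R).
Notation nz2 := (nsq (@zP R) (@zQ R)).

(* The classical inequality [3 + 4 cos + cos 2 >= 0]. *)
Lemma Dl_341 (x t : R) : 1<x -> 0<=3*Dl x 0 0+4*Dl x t 0+Dl x (2 * t) 0.
Proof.
move=> x1; have c: 3*Ds N x 0 0+4*Ds N x t 0+Ds N x (2 * t) 0 @[N --> \oo] --> 3*Dl x 0 0+4*Dl x t 0+Dl x (2 * t) 0.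
 apply: cvgD; last exact: Ds_cvg.
 by apply: cvgD; (apply: cvgM; first exact: cvg_cst); exact: Ds_cvg.
apply: (seq_ge c) => N; rewrite /Ds !mulr_sumr -!big_split/=; apply: sumr_ge0 => n _.
rewrite (_ : _ + _ = vm n*(expR (- x * ln n%:R)*(2*(1+cos (t * ln n%:R))^+2))).
 by rewrite mulr_ge0 ?vm_ge0// mulr_ge0 ?expR_ge0// mulr_ge0// sqr_ge0.
rewrite /nk mul0r !addr0 cos0 (_ : 2 * t * ln n%:R = t * ln n%:R+t * ln n%:R); last by ring.
rewrite cosD; have := cos2Dsin2 (t * ln n%:R).
move: (cos _) (sin _) (expR _) => a b e h; have {h} h : b*b = 1-a*a by rewrite -h; ring.
by rewrite h; ring.
Qed.

Definition zn (t x : R) := nz2 x t/zr2 x t.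

(** A possible zero is treated apart: there both sides vanish. This matters, since the lemma serves
    to prove that there are no zeros. *)
Lemma zn_dv t x : 1<x -> dv (zn t) x (- 2*Dl x t 0*zn t x).
Proof.
move=> x1; have x0: 0<x by lra.
have r0: zr2 x t != 0 by rewrite gt_eqF// zr2_gt0// gt_eqF.
have d1 := dvD (dvX 2 (zPx 0 t x0)) (dvX 2 (zQx 0 t x0)).
have d2: dv (fun x => zr2 x t) x (2*(x-1)).
 have e: dv (fun x => x-1) x 1 by apply: (dv_eq (dvD (dv_id x) (dv_cst (- 1) x))); ring.
 by apply: (dv_eq (dvD (dvX 2 e) (dv_cst (t^+2) x))); rewrite /=; ring.
apply: (dv_eq (dvM d1 (dvV (f := fun x => zr2 x t) r0 d2))).
rewrite /= /zn !expr1.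
have E: zp 0 x t*zp 1 x t+zq 0 x t*zq 1 x t = ((x-1)/zr2 x t-Dl x t 0)*nz2 x t.
 have [n0|n0] := eqVneq (nz2 x t) 0.
  have : zp 0 x t^+2+zq 0 x t^+2 == 0 by apply/eqP; exact: n0.
  by rewrite paddr_eq0 ?sqr_ge0// !sqrf_eq0 => /andP[/eqP -> /eqP ->]; rewrite n0 !mul0r mulr0 addr0.
 have n0' : 0<nz2 x t by rewrite lt_neqAle eq_sym n0 nsq_ge0.
 by have [<- _] := ldr_Dl x1 n0'; rewrite /ldr divfK.
transitivity (2*(zp 0 x t*zp 1 x t+zq 0 x t*zq 1 x t)/zr2 x t-(zp 0 x t^+2+zq 0 x t^+2)*(2*(x-1))/zr2 x t^+2).
 by field.
by rewrite E -/(nz2 x t); field.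
Qed.

Lemma zn_ge0 t x : 0<=zn t x.
Proof. by rewrite /zn divr_ge0 ?nsq_ge0// addr_ge0 ?sqr_ge0. Qed.

(** The product form of the 3-4-1 inequality, in squared moduli of zeta: its monotonicity in [x]
    expresses the inequality without logarithms. *)
Definition zY t x := zn 0 x^+3*(zn t x^+4*zn (2 * t) x).

Lemma zY_ge0 t x : 0<=zY t x.
Proof. by apply: mulr_ge0; [|apply: mulr_ge0]; try apply: exprn_ge0; exact: zn_ge0. Qed.

Lemma zY_decr t x x' : 1<x -> x<=x' -> zY t x'<=zY t x.
Proof.
move=> x1 xx.
apply: (@dv_le0_le _ (zY t) (fun x => - 2*(3*Dl x 0 0+4*Dl x t 0+Dl x (2 * t) 0)*zY t x) x x' xx) => z /andP[z1 z2].
 have z0: 1<z by exact: lt_le_trans z1.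
 have := dvM (dvX 3 (zn_dv 0 z0)) (dvM (dvX 4 (zn_dv t z0)) (zn_dv (2 * t) z0)).
 by move=> h; apply: (dv_eq h); rewrite /zY /=; ring.
have z0: 1<z by exact: lt_le_trans z1.
rewrite mulNr mulNr oppr_le0; apply: mulr_ge0; first by apply: mulr_ge0 => //; exact: Dl_341.
exact: zY_ge0.
Qed.

Lemma zn_gt0_3 t x : 3<=x -> 0<zn t x.
Proof.
move=> x3; rewrite /zn divr_gt0//; first exact: lt_le_trans (z_low t x3).
by apply: zr2_gt0; rewrite gt_eqF//; lra.
Qed.

Lemma zY_gt0 t x : 1<x -> x<=3 -> 0<zY t 3<=zY t x.
Proof.
move=> x1 x3; rewrite zY_decr// andbT /zY.
by apply: mulr_gt0; [|apply: mulr_gt0]; try apply: exprn_gt0; exact: zn_gt0_3.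
Qed.

Lemma nz_gt1 x t : 1<x -> 0<nz2 x t.
Proof.
move=> x1; have [x3|/ltW x3] := lerP 3 x; first exact: lt_le_trans (z_low t x3).
rewrite lt_neqAle nsq_ge0 andbT eq_sym; apply/eqP => e.
have /andP[y0 y1] := zY_gt0 t x1 x3; have := lt_le_trans y0 y1.
by rewrite /zY /zn e mul0r expr0n /= mul0r mulr0 ltxx.
Qed.

(** A zero at [1 + i t] would make [zn t] of order [(x-1)^2], its fourth power [(x-1)^8], against a
    pole of order [(x-1)^(-6)] from [zn 0]. Then [zY] would tend to 0 at 1, although it is at least
    its value at 3. The hypothesis RH speaks of the open strip, so the line Re s = 1 is handled
    here. *)
Lemma nz_eq1 t : 0<nz2 1 t.
Proof.
have [->|t0] := eqVneq t 0.
 have -> : nz2 1 0 = 1+(zq 0 1 0)^+2.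
  by rewrite /nsq; congr (_ + _); rewrite /zP /zH /wH /zA /zB /= cos0; ring.
 by rewrite ltr_wpDr// sqr_ge0.
rewrite lt_neqAle nsq_ge0 andbT eq_sym; apply/eqP => e.
have z2: zp 0 1 t = 0 /\ zq 0 1 t = 0.
 have : zp 0 1 t^+2+zq 0 1 t^+2 == 0 by apply/eqP; exact: e.
 by rewrite paddr_eq0 ?sqr_ge0// !sqrf_eq0 => /andP[/eqP -> /eqP ->].
have [p0 q0] := z2; have o: 0<1 :> R by [].
pose Y := `|t| + `|2 * t|.
have [B1 HB1] := zPQ_bnd 1 3 (- Y) Y o.
have [B0 HB0] := zPQ_bnd 0 3 (- Y) Y o.
have inY y : `|y| <= Y -> - Y<=y<=Y by rewrite ler_norml.
have tY: - Y<=t<=Y by apply: inY; rewrite /Y lerDl.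
have t2Y: - Y<=2 * t<=Y by apply: inY; rewrite /Y lerDr.
have B10: 0<=B1 by apply: (le_trans (normr_ge0 (zp 1 1 t))); apply: (HB1 1 t _ tY).1; lra.
have sq (u U : R) : `|u| <= U -> u^+2<=U^+2.
 by move=> h; rewrite -real_normK ?num_real// lerXn2r// nnegrE// (le_trans _ h).
have nb x y : 1<=x<=3 -> - Y<=y<=Y -> nz2 x y<=2*B0^+2.
 by move=> xr yr; have [h1 h2] := HB0 x y xr yr; rewrite mulr_natl mulr2n; apply: lerD; exact: sq.
have nt x : 1<=x<=3 -> nz2 x t<=2*B1^+2*(x-1)^+2.
 move=> /andP[x1 x3].
 have lip (f f' : R -> R) : (forall z, 0<z -> dv f z (f' z)) -> f 1 = 0 ->
   (forall z, 1<=z<=3 -> `|f' z| <= B1) -> f x^+2<=B1^+2*(x-1)^+2.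
  move=> df f1 bf; rewrite -exprMn; apply: sq; rewrite -[f x]subr0 -f1.
  apply: (@dv_lip _ f f' 1 x B1 x1) => z /andP[u1 u2]; first by apply: df; lra.
  by apply: bf; rewrite u1 (le_trans u2).
 rewrite -mulrA mulr_natl mulr2n; apply: lerD.
  by apply: (@lip (fun z => zp 0 z t) (fun z => zp 1 z t)); [move=> z; exact: zPx|exact: p0|move=> z zr; exact: (HB1 z t zr tY).1].
 by apply: (@lip (fun z => zq 0 z t) (fun z => zq 1 z t)); [move=> z; exact: zQx|exact: q0|move=> z zr; exact: (HB1 z t zr tY).2].
pose C := (2*B0^+2)^+3*((2*B1^+2/t^+2)^+4*(2*B0^+2/(2 * t)^+2)).
have t2: 0<t^+2 by rewrite lt_neqAle sqr_ge0 andbT eq_sym sqrf_eq0.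
have t4: 0<(2 * t)^+2 by rewrite exprMn mulr_gt0// exprn_gt0.
have YC x : 1<x<=3 -> zY t x<=C*(x-1)^+2.
 move=> /andP[x1 x3]; have xr: 1<=x<=3 by rewrite (ltW x1).
 have xp: 0<(x-1)^+2 by rewrite exprn_gt0//; lra.
 have zY0: - Y<=(0 : R)<=Y by apply: inY; rewrite normr0 /Y addr_ge0.
 have a1: zn 0 x<=2*B0^+2/(x-1)^+2.
  rewrite /zn /zr2 expr0n/= addr0 ler_wpM2r ?invr_ge0 ?(ltW xp)//; exact: nb.
 have a2: zn t x<=2*B1^+2/t^+2*(x-1)^+2.
  rewrite /zn mulrAC; apply: ler_pM; rewrite ?nsq_ge0 ?invr_ge0 ?addr_ge0 ?sqr_ge0 ?nt//.
  by rewrite lef_pV2 ?posrE//; [rewrite /zr2 lerDr sqr_ge0|rewrite /zr2 ltr_wpDl// sqr_ge0].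
 have a3: zn (2 * t) x<=2*B0^+2/(2 * t)^+2.
  rewrite /zn; apply: ler_pM; rewrite ?nsq_ge0 ?invr_ge0 ?addr_ge0 ?sqr_ge0 ?nb//.
  by rewrite lef_pV2 ?posrE//; [rewrite /zr2 lerDr sqr_ge0|rewrite /zr2 ltr_wpDl// sqr_ge0].
 have nn k z u : 0<=z -> z<=u -> z^+k<=u^+k :> R by move=> z0 zu; rewrite lerXn2r// nnegrE// (le_trans z0).
 apply: (@le_trans _ _ ((2*B0^+2/(x-1)^+2)^+3*((2*B1^+2/t^+2*(x-1)^+2)^+4*(2*B0^+2/(2 * t)^+2)))).
  have E k z := @exprn_ge0 _ k z; apply: ler_pM.
  - exact/E/zn_ge0.
  - by apply: mulr_ge0; [exact/E/zn_ge0|exact: zn_ge0].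
  - exact: nn (zn_ge0 _ _) a1.
  - by apply: ler_pM; [exact/E/zn_ge0|exact: zn_ge0|exact: nn (zn_ge0 _ _) a2|exact: a3].
 rewrite le_eqVlt; apply/orP; left; apply/eqP; rewrite /C.
 have x10: x-1 != 0 by lra.
 by field; rewrite t0 x10.
have q0' : 0<=2*B0^+2 by rewrite mulr_ge0 ?sqr_ge0.
have q1' : 0<=2*B1^+2 by rewrite mulr_ge0 ?sqr_ge0.
have C0: 0<=C.
 apply: mulr_ge0; first exact: exprn_ge0.
 by apply: mulr_ge0; [apply: exprn_ge0; exact: divr_ge0 q1' (sqr_ge0 t)|exact: divr_ge0 q0' (sqr_ge0 _)].
have /andP[y0 _] := @zY_gt0 t 3 ltac:(lra) (lexx _).
pose d := Num.min 1 (zY t 3/(2*(C+1))).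
have d0: 0<d by rewrite /d lt_min ltr01 divr_gt0// mulr_gt0// ltr_wpDl.
have d1: d<=1 by rewrite /d ge_min lexx.
have d2: d*(2*(C+1))<=zY t 3 by rewrite -ler_pdivlMr ?mulr_gt0 ?ltr_wpDl// /d ge_min lexx orbT.
have dr: 1<1+d<=3 by lra.
have := YC _ dr; have /andP[_ ] := @zY_gt0 t (1+d) ltac:(lra) ltac:(lra).
rewrite (_ : 1+d-1 = d); last by ring.
move=> h1 h2; have {h1 h2} h := le_trans h1 h2.
have : C * d^+2<=C * d by rewrite ler_wpM2l// expr2 ler_piMr// ltW.
move: h d2 d0 C0 y0; set z := zY t 3; set w := C * d^+2; clear; nra.
Qed.

End nonvanishing.

(** * From the Riemann hypothesis to zero-freeness right of 1/2 *)

Section riemann.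
Variable R : realType.
Notation zp := (@zP R).
Notation zq := (@zQ R).
Local Notation C := (R[i]).

Lemma normC_le (a b : R) : `|a +i* b : C| <= (`|a| + `|b|)%:C.
Proof.
rewrite normc_def lecR -[leRHS]ger0_norm ?addr_ge0// -sqrtr_sqr ler_wsqrtr//=.
rewrite sqrrD !real_normK ?num_real// -addrA [X in _ <= _+X]addrC lerD2l lerDl.
by rewrite mulrn_wge0// mulr_ge0.
Qed.

Lemma cvgC (u w : nat -> R) (a b : R) : u @ \oo --> a -> w @ \oo --> b ->
 (fun N => u N +i* w N : C^o) @ \oo --> (a +i* b : C^o).
Proof.
move=> ua wb; apply/cvgrPdist_lt => e e0.
have [e1 e2] : 0<complex.Re e /\ e = (complex.Re e)%:C.
 by move: e0; rewrite ltcE/= => /andP[/eqP i0 r0]; split=> //; case: e i0 r0 => x y /= -> _.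
have r2: 0<complex.Re e/2 by rewrite divr_gt0.
near=> N.
have h1: `|a-u N| < complex.Re e/2 by near: N; move/cvgrPdist_lt: ua; exact.
have h2: `|b-w N| < complex.Re e/2 by near: N; move/cvgrPdist_lt: wb; exact.
rewrite e2; apply: (@le_lt_trans _ _ ((`|a-u N| + `|b-w N|)%:C)); first exact: normC_le.
by rewrite ltcR; lra.
Unshelve. all: by end_near.
Qed.

Definition zF (s : C^o) : C^o := zp 0 (complex.Re s) (complex.Im s) +i* zq 0 (complex.Re s) (complex.Im s).
Definition zzeta (s : C^o) : C^o := zF s/(s-1).

Lemma normC_ge_Re (a b : R) : `|a|%:C <= `|a +i* b : C|.
Proof. exact: (normc_ge_Re (a +i* b)). Qed.

Lemma normC_ge_Im (a b : R) : `|b|%:C <= `|a +i* b : C|.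
Proof. by rewrite normc_def lecR -sqrtr_sqr ler_wsqrtr//= lerDr sqr_ge0. Qed.

(** The increment is split into a horizontal and a vertical one; the cross term uses the mixed
    derivative, which the Cauchy-Riemann equations identify with a derivative of the other
    component. *)
Lemma zF_taylor (x y : R) : 0<x -> exists2 K : R, 0<=K & forall h1 h2 : R, `|h1| <= x/2 -> `|h2| <= 1 ->
 `|zp 0 (x+h1) (y+h2)-zp 0 x y-(h1*zp 1 x y-h2*zq 1 x y)| <= K*(`|h1| + `|h2|)^+2 /\
 `|zq 0 (x+h1) (y+h2)-zq 0 x y-(h1*zq 1 x y+h2*zp 1 x y)| <= K*(`|h1| + `|h2|)^+2.
Proof.
move=> x0; have x2: 0<x/2 by rewrite divr_gt0.
have [K HK] := zPQ_bnd 2 (x+x/2) (y-1) (y+1) x2.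
have inx (t h1 : R) : `|h1| <= x/2 -> `|t-x| <= `|h1| -> x/2<=t<=x+x/2.
 by move=> a b; move: (le_trans b a); rewrite ler_norml; clear; lra.
have iny (t h2 : R) : `|h2| <= 1 -> `|t-y| <= `|h2| -> y-1<=t<=y+1.
 by move=> a b; move: (le_trans b a); rewrite ler_norml; clear; lra.
have K0: 0<=K.
 have [|h _] := HK x y _ ltac:(lra); first by lra.
 exact: le_trans (normr_ge0 _) h.
exists K => // h1 h2 a1 a2.
have core (f fx fxx fy fyy fyx : R -> R -> R) :
 (forall x y, 0<x -> dv (f^~ y) x (fx x y)) -> (forall x y, 0<x -> dv (fx^~ y) x (fxx x y)) ->
 (forall x y, 0<x -> dv (f x) y (fy x y)) -> (forall x y, 0<x -> dv (fy x) y (fyy x y)) ->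
 (forall x y, 0<x -> dv (fy^~ y) x (fyx x y)) ->
 (forall t s, x/2<=t<=x+x/2 -> y-1<=s<=y+1 -> [/\ `|fxx t s| <= K, `|fyy t s| <= K & `|fyx t s| <= K]) ->
 `|f (x+h1) (y+h2)-f x y-(h1*fx x y+h2*fy x y)| <= K*(`|h1| + `|h2|)^+2.
 move=> dx dxx dy dyy dyx bb.
 have yy: y-1<=y<=y+1 by lra.
 have pos t : x/2<=t<=x+x/2 -> 0<t by move=> /andP[+ _]; exact: lt_le_trans.
 have xx: x/2<=x+h1<=x+x/2 by apply: (inx _ h1) => //; rewrite addrC addKr.
 have T1 := @taylor1 R (f (x+h1)) (fy (x+h1)) (fyy (x+h1)) y h2 K
   (fun t _ => dy _ t (pos _ xx)) (fun t _ => dyy _ t (pos _ xx))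
   (fun t th => let: And3 _ b _ := bb _ _ xx (iny t h2 a2 th) in b).
 have T2 := @taylor1 R (f^~ y) (fx^~ y) (fxx^~ y) x h1 K
   (fun t th => dx t y (pos _ (inx _ _ a1 th))) (fun t th => dxx t y (pos _ (inx _ _ a1 th)))
   (fun t th => let: And3 b _ _ := bb _ _ (inx _ _ a1 th) yy in b).
 have T3 := @dv_lip2 R (fy^~ y) (fyx^~ y) x h1 K (fun t th => dyx t y (pos _ (inx _ _ a1 th)))
   (fun t th => let: And3 _ _ b := bb _ _ (inx _ _ a1 th) yy in b).
 have T3' : `|h2*(fy (x+h1) y-fy x y)| <= `|h2| * (K * `|h1|) by rewrite normrM ler_wpM2l.
 move: T1 T2 T3' => /=; rewrite -!(real_normK (num_real h1)) -!(real_normK (num_real h2)) => T1 T2 T3'.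
 rewrite (_ : _ - _ - _ = (f (x+h1) (y+h2)-f (x+h1) y-h2*fy (x+h1) y) +
   (f (x+h1) y-f x y-h1*fx x y)+h2*(fy (x+h1) y-fy x y)); last by ring.
 apply: (le_trans (nleD (nleD T1 T2) T3')).
 have := normr_ge0 h1; have := normr_ge0 h2; move: K0; set u := `|h1|; set w := `|h2|; clear.
 by move=> K0 w0 u0; have := mulr_ge0 K0 (mulr_ge0 w0 u0); lra.
split.
- have := core (zp 0) (zp 1) (zp 2) (fun x y => - zq 1 x y) (fun x y => - zp 2 x y) (fun x y => - zq 2 x y).
 rewrite mulrN; apply; try (by move=> *; first [exact: zPx|exact: zPy|apply: dvN; exact: zQy|apply: dvN; exact: zQx]).
 by move=> t s tt ss; have [b1 b2] := HK t s tt ss; rewrite !normrN.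
- apply: (core (zq 0) (zq 1) (zq 2) (zp 1) (fun x y => - zq 2 x y) (zp 2)); try (by move=> *; first [exact: zQx|exact: zQy|exact: zPy|exact: zPx]).
 by move=> t s tt ss; have [b1 b2] := HK t s tt ss; rewrite !normrN.
Qed.

(* A quadratic Taylor bound gives complex differentiability. *)
Lemma Cderiv (F : C^o -> C^o) (s L : C^o) (K r : R) : 0<r -> 0<=K ->
 (forall h : C, `|h| <= r%:C -> `|F (h+s)-F s-h*L| <= K%:C * `|h| ^+ 2) -> derivable F s 1.
Proof.
move=> r0 K0 H; apply/cvg_ex; exists L; apply/cvgrPdist_lt => e e0.
have rC: 0<r%:C :> C by rewrite ltcR.
have KC: 0<(K+1)%:C :> C by rewrite ltcR ltr_wpDl.
near=> h.
have hr: `|h| < r%:C by near: h; apply: dnbhs0_lt.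
have h0: h != 0 by near: h; exact: nbhs_dnbhs_neq.
have he: `|h| < e/(K+1)%:C by near: h; apply: dnbhs0_lt; rewrite divr_gt0.
rewrite /GRing.scale /= mulr1.
have -> : L-h^-1*(F (h+s)-F s) = - h^-1*(F (h+s)-F s-h*L) by field.
rewrite normrM normrN normfV ltr_pdivrMl ?normr_gt0//.
apply: (le_lt_trans (H _ (ltW hr))).
rewrite (_ : K%:C * `|h| ^+ 2 = `|h| * (`|h| * K%:C)); last by ring.
rewrite ltr_pM2l ?normr_gt0//.
have le1: `|h| * K%:C <= `|h| * (K+1)%:C by rewrite ler_wpM2l// lecR lerDl.
by apply: (le_lt_trans le1); rewrite -ltr_pdivlMr.
Unshelve. all: by end_near.
Qed.

Lemma zF_deriv (s : C^o) : 0<complex.Re s -> derivable zF s 1.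
Proof.
case: s => x y /= x0; have [K K0 HK] := zF_taylor y x0.
pose r := Num.min (x/2) 1.
have r0: 0<r by rewrite /r lt_min divr_gt0 ?ltr01.
apply: (@Cderiv _ _ (zp 1 x y +i* zq 1 x y) (2*K*4) r r0); first by rewrite !mulr_ge0.
move=> [h1 h2] hr.
have a1: `|h1| <= r by rewrite -lecR; exact: le_trans (normC_ge_Re _ _) hr.
have a2: `|h2| <= r by rewrite -lecR; exact: le_trans (normC_ge_Im _ _) hr.
have b1: `|h1| <= x/2 by apply: (le_trans a1); rewrite /r ge_min lexx.
have b2: `|h2| <= 1 by apply: (le_trans a2); rewrite /r ge_min lexx orbT.
have [T1 T2] := HK h1 h2 b1 b2.
have -> : zF ((h1 +i* h2)+(x +i* y))-zF (x +i* y)-(h1 +i* h2)*(zp 1 x y +i* zq 1 x y) =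
 (zp 0 (x+h1) (y+h2)-zp 0 x y-(h1*zp 1 x y-h2*zq 1 x y)) +i*
 (zq 0 (x+h1) (y+h2)-zq 0 x y-(h1*zq 1 x y+h2*zp 1 x y)).
 by rewrite /zF /= (addrC h1) (addrC h2).
apply: (le_trans (normC_le _ _)); rewrite normc_def /= -rmorphXn -rmorphM lecR.
apply: (le_trans (lerD T1 T2)); rewrite sqr_sqrtr ?addr_ge0 ?sqr_ge0//.
rewrite -!(real_normK (num_real h1)) -!(real_normK (num_real h2)).
have := normr_ge0 h1; have := normr_ge0 h2; move: K0; set u := `|h1|; set w := `|h2|; clear => K0 w0 u0.
have := mulr_ge0 K0 (sqr_ge0 (u-w)); have := mulr_ge0 K0 (sqr_ge0 u); have := mulr_ge0 K0 (sqr_ge0 w); lra.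
Qed.

Lemma csum (r : seq nat) (a b : nat -> R) :
 \sum_(n <- r) (a n +i* b n : C) = (\sum_(n <- r) a n) +i* (\sum_(n <- r) b n).
Proof. by elim: r => [|n r IH]; rewrite ?big_nil// !big_cons IH. Qed.

(** [riemann_hypothesis] speaks of every function with the properties of zeta; exhibiting one is
    what makes it apply to the concrete continuation [zF]. *)
Lemma zzeta_P : is_riemann_zeta zzeta.
Proof.
split=> [[x y] /= x1|s s0 s1].
 have s1: (x +i* y : C)-1 != 0.
  by rewrite subr_eq0 eq_complex/= negb_and gt_eqF.
 rewrite (_ : (fun N : nat => _) = fun N => (Zs N x y 0 +i* Zs N x y (pi/2) : C^o)); last first.
  apply/funext => N; rewrite -csum; apply: eq_bigr => n _.
  have e1: complex.Re (- (x +i* y)*(ln n%:R)%:C) = - x * ln n%:R by rewrite /= mulr0 subr0.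
  have e2: complex.Im (- (x +i* y)*(ln n%:R)%:C) = - (y * ln n%:R) by rewrite /= mulr0 add0r mulNr.
  by rewrite /npowN /cexp e1 e2 /nk cosN sinN addr0 cosDpihalf'.
 have -> : zzeta (x +i* y) = (zetap 0 x y +i* zetap (pi/2) x y).
  rewrite /zzeta; apply: (mulIf s1); rewrite divfK//.
  have x0: 0<x by lra.
  have xy: x != 1 \/ y != 0 by left; rewrite gt_eqF.
  have e: zetap (pi/2+pi/2) x y = - zetap 0 x y.
   apply: (seq_uniq (@Zs_cvg R x y _ x1)).
   apply: (@seq_ext _ (fun N => - Zs N x y 0)) => [N|]; last by apply: cvgN; exact: Zs_cvg.
   by have := Zs_pi N x y 0; rewrite add0r => ->.
  rewrite /zF /= /zP /zQ !zH_zeta// e add0r.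
  by apply/eqP; rewrite eq_complex /=; apply/andP; split; apply/eqP; ring.
 by apply: cvgC; exact: Zs_cvg.
apply: derivableM; first exact: zF_deriv.
apply: derivableV; first by rewrite subr_eq0.
apply: (@Cderiv (fun y : C^o => y-1) s 1 0 1) => // h _.
by rewrite (_ : _ - _ = 0) ?normr0 ?mul0r//; ring.
Qed.

Lemma z_nz : riemann_hypothesis R -> forall x y, 1/2<x -> 0<nsq zp zq x y.
Proof.
move=> RH x y x2; case: (ltgtP 1 x) => [x1|x1|x1]; [exact: nz_gt1| |by rewrite -x1; exact: nz_eq1].
rewrite lt_neqAle nsq_ge0 andbT eq_sym; apply/eqP => e.
have [p0 q0] : zp 0 x y = 0 /\ zq 0 x y = 0.
 have : zp 0 x y^+2+zq 0 x y^+2 == 0 by apply/eqP; exact: e.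
 by rewrite paddr_eq0 ?sqr_ge0// !sqrf_eq0 => /andP[/eqP -> /eqP ->].
have x0: 0<x<1 by lra.
have := RH _ zzeta_P (x +i* y) x0; rewrite /zzeta /zF /= p0 q0 mul0r => /(_ erefl); lra.
Qed.

End riemann.

(** * Shifting lines of integration against Gaussians *)

Section line.
Variable R : realType.
Notation mu := (@lebesgue_measure R).
Notation RT := (setT : set (measurableTypeR R)).

(** [(1+|y|)^(-3/2)]: integrable, yet large enough to dominate [ell y / (1+y^2)]. *)
Definition Wt (y : R) := expR (- (3/2) * ln (1 + `|y|)).

Lemma p1_gt0 (y : R) : 0<1 + `|y|. Proof. by rewrite ltr_pwDl. Qed.

Lemma Wt_gt0 y : 0<Wt y. Proof. exact: expR_gt0. Qed.

Lemma Wt_cont : continuous Wt.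
Proof.
move=> y; apply: continuous_comp; last exact: continuous_expR.
apply: cvgM; first exact: cvg_cst.
apply: continuous_comp; last by apply: continuous_ln; exact: p1_gt0.
by apply: cvgD; [exact: cvg_cst|exact: norm_continuous].
Qed.

Lemma Wt_le1 y : Wt y<=1.
Proof.
rewrite /Wt -expR0 ler_expR mulNr oppr_le0; apply: mulr_ge0; first by rewrite divr_ge0.
by rewrite expR0 ln_ge0// lerDl.
Qed.

Definition WF (y : R) := - 2*expR (- (1/2) * ln (1+y)).

Lemma WF_dv y : -1<y -> dv WF y (expR (- (3/2) * ln (1+y))).
Proof.
move=> y1; have p: 0<1+y by lra.
have h := dvM (dv_cst (- 2) y) (dv_expR (dvM (dv_cst (- (1/2)) y) (dv_ln p (dvD (dv_cst 1 y) (dv_id y))))).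
apply: (dv_eq h); rewrite (_ : - (3/2) * ln (1+y) = - (1/2) * ln (1+y)-ln (1+y)); last by field.
by rewrite expRD expRN lnK ?posrE//; field; exact: lt0r_neq0.
Qed.

Lemma WF_cvg : WF y @[y --> +oo%R] --> (0 : R).
Proof.
apply/cvgrPdist_le => e e0; near=> y.
have y0: 0<=y by near: y; apply: nbhs_pinfty_ge; rewrite num_real.
have yb: expR (- 2 * ln (e/2))<=y by near: y; apply: nbhs_pinfty_ge; rewrite num_real.
rewrite sub0r normrN /WF normrM normrN (ger0_norm (ler0n R 2)) ger0_norm ?expR_ge0//.
have e2: 0<e/2 by rewrite divr_gt0.
rewrite -ler_pdivlMl// (mulrC 2^-1) -[leRHS](@lnK _ (e/2)) ?posrE// ler_expR.
have : - 2 * ln (e/2)<=ln (1+y).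
 by rewrite -[leLHS]expRK ler_ln ?posrE ?expR_gt0//; lra.
by lra.
Unshelve. all: by end_near.
Qed.

Lemma L1_Wt : L1 mu RT Wt.
Proof.
have mW: measurable_fun RT Wt by exact: continuous_measurable_fun Wt_cont.
apply/integrableP; split; first exact/measurable_EFinP.
have -> : (\int[mu]_x `|(EFin \o Wt) x|)%E = (\int[mu]_x (Wt x)%:E)%E.
 by apply: eq_integral => x _ /=; rewrite ger0_norm// ltW// Wt_gt0.
rewrite ge0_symfun_integralT; [|by move=> x; exact/ltW/Wt_gt0|exact: Wt_cont|by move=> x; rewrite /Wt/= normrN].
rewrite -set_itvcy (@ge0_continuous_FTC2y _ Wt WF 0 0).
- by rewrite sub0e -EFinN -EFinM ltry.
- by move=> x _; exact/ltW/Wt_gt0.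
- by apply: continuous_subspaceT; exact: Wt_cont.
- exact: WF_cvg.
- by move=> x x0; have [] := WF_dv (lt_trans (ltrN10 R) x0).
- by apply: cvg_at_right_filter; exact: dv_cont (WF_dv (ltrN10 R)).
- move=> x; rewrite in_itv /= andbT => x0; rewrite derive1E.
 by have [_ ->] := WF_dv (lt_trans (ltrN10 R) x0); rewrite /Wt gtr0_norm.
Qed.

(** [2 + |a+b| <= (2+|a|)(2+|b|)], and both values of [ell] are at least 1. The product form lets
    the dependence on a centre be factored out of integrals. *)
Lemma ell_add (a b : R) : ell (a+b)<=ell a*ell b.
Proof.
have := ell_ge1 a; have := ell_ge1 b; rewrite /ell.
have na := normr_ge0 a; have nb := normr_ge0 b.
have : ln (2 + `|a+b|)<=ln (2 + `|a|)+ln (2 + `|b|).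
 rewrite -lnM ?posrE; [|lra|lra]; rewrite ler_ln ?posrE; [|have := normr_ge0 (a+b); lra|].
  have := ler_normD a b; have := mulr_ge0 na nb.
  by move: na nb; set u := `|a|; set w := `|b|; set s := `|a+b|; clear; nra.
 by rewrite mulr_gt0//; lra.
by set x := ln _; set y := ln _; set z := ln _; clear; nra.
Qed.

Lemma ell_le (z : R) : ell z<=2*(1 + `|z|).
Proof.
have nz := normr_ge0 z.
have h: ln (2 + `|z|)<=1 + `|z| by have := @le_ln1Dx R (1 + `|z|); rewrite addrA; apply; lra.
by rewrite /ell; lra.
Qed.

Lemma ell_mono (a b : R) : `|a| <= `|b| -> ell a<=ell b.
Proof.
move=> ab; have na := normr_ge0 a; have nb := normr_ge0 b.
by rewrite /ell lerD2l ler_ln ?posrE ?lerD2l//; lra.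
Qed.

Lemma ell_Wt (y : R) : ell y/(1+y^+2)<=8*Wt y.
Proof.
have p0 := p1_gt0 y; have ny := normr_ge0 y.
have l0: 0<=ln (1 + `|y|) by rewrite ln_ge0// lerDl.
have h1: ell y<=4*expR (1/2 * ln (1 + `|y|)).
 have := expR_ge1Dx (1/2 * ln (1 + `|y|)).
 have : ln (2 + `|y|)<=1+ln (1 + `|y|).
  apply: (@le_trans _ _ (ln (2*(1 + `|y|)))); first by rewrite ler_ln ?posrE//; lra.
  rewrite lnM ?posrE// lerD2r; have := @le_ln1Dx R 1; rewrite (_ : 1+1 = 2 :> R)//; apply; lra.
 by rewrite /ell; move: l0; set a := ln (2 + _); set b := ln (1 + _); set c := expR _; clear; move=> *; lra.
have h2: (1+y^+2)^-1<=2*expR (- 2 * ln (1 + `|y|)).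
 rewrite mulNr expRN (_ : 2 * ln (1 + `|y|) = ln ((1 + `|y|)^+2)); last by rewrite lnXn// mulr_natl.
 rewrite lnK ?posrE ?exprn_gt0// -[leLHS]mul1r ler_pdivrMr; last by rewrite ltr_pwDl// sqr_ge0.
 rewrite -mulrA mulrCA -[leLHS]mulr1; have p2: 0<(1 + `|y|)^+2 by rewrite exprn_gt0.
 rewrite mulr1 ler_pdivlMl// mulr1 -(real_normK (num_real y)).
 by have := sqr_ge0 (1 - `|y|); set u := `|y|; clear; nra.
have y2: 0<=(1+y^+2)^-1 by rewrite invr_ge0 addr_ge0// sqr_ge0.
have e0: 0<=ell y by rewrite (le_trans _ (ell_ge1 y)).
apply: (le_trans (ler_pM e0 y2 h1 h2)).
rewrite (_ : 4*expR (1/2 * ln (1 + `|y|))*(2*expR (- 2 * ln (1 + `|y|))) = 8*(expR (1/2 * ln (1 + `|y|))*expR (- 2 * ln (1 + `|y|)))); last by ring.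
by rewrite -expRD /Wt le_eqVlt; apply/orP; left; apply/eqP; congr (_*expR _); field.
Qed.

(** 192 = 8 * 4 * 6: [(1+u)^6 <= 8 (1+u^2)^3 <= 32 (1+u^6)], and the exponential of [u^2] exceeds
    [1 + u^6/6]. *)
Lemma gauss_Wt (z : R) : (1 + `|z|)^+4*expR (- z^+2)<=192*Wt z.
Proof.
have p0 := p1_gt0 z; have nz := normr_ge0 z.
have l0: 0<=ln (1 + `|z|) by rewrite ln_ge0// lerDl.
have h1: (1 + `|z|)^+6<=192*expR (z^+2).
 have := @expR_ge1Dxn R (z^+2) 2 (sqr_ge0 z).
 rewrite (_ : 3`!%:R = 6 :> R); last by rewrite !factS fact0.
 rewrite -(real_normK (num_real z)); move: nz; set u := `|z|; set e := expR _ => nz h.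
 apply: (@le_trans _ _ (192*(1+(u^+2)^+3/6))); last by rewrite ler_pM2l.
 rewrite -exprM.
 have c2: (1+u)^+2<=2*(1+u^+2) by have := sqr_ge0 (1-u); clear; nra.
 have c3: (1+u^+2)^+3<=4*(1+(u^+2)^+3).
  have := sqr_ge0 u; move: (u^+2) => w w0.
  have := mulr_ge0 (_ : 0<=1+w) (sqr_ge0 (1-w)); move/(_ ltac:(lra)).
  by clear -w0; nra.
 apply: (@le_trans _ _ ((2*(1+u^+2))^+3)).
  by rewrite (_ : 6%N = (2*3)%N)// exprM lerXn2r ?nnegrE ?mulr_ge0 ?exprn_ge0 ?addr_ge0 ?sqr_ge0.
 rewrite exprMn (_ : 2^+3 = 8 :> R); last by rewrite -natrX.
 apply: (@le_trans _ _ (8*(4*(1+(u^+2)^+3)))); first by rewrite ler_pM2l.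
 have : 0<=u^+6 by rewrite exprn_ge0.
 by rewrite -exprM; move: (u ^+ _) => w; lra.
have h2: ((1 + `|z|)^+2)^-1<=Wt z.
 rewrite -[X in X^-1](@lnK _ ((1 + `|z|)^+2)) ?posrE ?exprn_gt0// -expRN /Wt ler_expR lnXn// -(mulr_natl (ln _) 2).
 by move: l0; set a := ln _; clear; lra.
have p2: 0<(1 + `|z|)^+2 by rewrite exprn_gt0.
rewrite expRN ler_pdivrMr ?expR_gt0// mulrAC.
have : 192*expR (z^+2)*((1 + `|z|)^+2)^-1<=192*expR (z^+2)*Wt z.
 by rewrite ler_wpM2l// mulr_ge0// expR_ge0.
apply: le_trans; rewrite ler_pdivlMr// -exprD; exact: h1.
Qed.

Lemma gauss1_Wt (z : R) : (1 + `|z|)*expR (- z^+2)<=192*Wt z.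
Proof.
apply: le_trans (gauss_Wt z); rewrite ler_wpM2r ?expR_ge0//.
by rewrite -[leLHS]expr1 ler_weXn2l// lerDl.
Qed.

Lemma gauss0_Wt (z : R) : expR (- z^+2)<=192*Wt z.
Proof.
apply: le_trans (gauss1_Wt z); rewrite -[leLHS]mul1r ler_wpM2r ?expR_ge0// lerDl.
exact: normr_ge0.
Qed.

Lemma L1_domW (f : R -> R) c : measurable_fun RT f -> (forall y, `|f y| <= c*Wt y) -> L1 mu RT f.
Proof. by move=> mf h; apply: (L1_dom measurableT mf _ (L1Z c measurableT L1_Wt)) => y _; exact: h. Qed.

Lemma Rint_lim (f : R -> R) : L1 mu RT f -> \int[mu]_(x in `[(- n%:R), n%:R]) f x @[n --> \oo] --> \int[mu]_x f x.
Proof.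
move=> Lf; under eq_fun do rewrite Rint_mkcond.
have mf := L1_meas Lf.
apply: (proj2 (@Rint_dct _ _ _ mu RT (fun n x => \1_(`[(- n%:R), n%:R]%classic) x*f x) f (fun x => `|f x|) measurableT _ _ (L1_abs measurableT Lf) _)).
- by move=> n; apply: measurable_funM => //; exact: measurable_indic.
- move=> x _; apply: cvg_near_cst; near=> n.
 rewrite indicE mem_set ?mul1r//= in_itv /= -ler_norml.
 near: n; exists (Num.truncn `|x|).+1 => // n /= hn.
 have /andP[_ /ltW h] := truncn_itv (normr_ge0 x).
 by apply: (le_trans h); rewrite ler_nat.
- by move=> n x _; rewrite normrM indicE; case: (x \in _); rewrite ?normr1 ?normr0 ?mul1r// mul0r.
Unshelve. all: by end_near.
Qed.

Lemma Rint_odd (f : R -> R) : L1 mu RT f -> continuous f -> (forall x, f (- x) = - f x) -> \int[mu]_x f x = 0.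
Proof.
move=> Lf cf of'; apply: (seq_uniq (Rint_lim Lf)).
apply: (@seq_ext _ (fun=> 0)) => [n|]; last exact: cvg_cst.
by rewrite odd_int// => x _; exact: cf.
Qed.

(** Cauchy's theorem on a strip. The derivative of [A] in [x] is [l] times that of [B] in [z], so
    the difference of the two vertical integrals up to height [n] reduces to [B] on the horizontal
    edges, where [G] tends to 0. *)
Lemma strip (a b l : R) (A Ax B : R -> R -> R) (G : R -> R) : a<=b -> 0<l ->
 (forall x z, a<=x<=b -> dv (A^~ z) x (Ax x z)) ->
 (forall x z, a<=x<=b -> dv (B x) z (Ax x z/l)) ->
 (forall c e, good2 a b c e Ax) -> (forall z, cont_on a b (B^~ z)) ->
 (forall x z, a<=x<=b -> `|A x z| <= G z /\ `|B x z| <= G z) ->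
 L1 mu RT G -> G n%:R @[n --> \oo] --> (0 : R) -> G (- n%:R) @[n --> \oo] --> (0 : R) ->
 continuous (A a) -> continuous (A b) ->
 \int[mu]_z A b z = \int[mu]_z A a z.
Proof.
move=> ab l0 dA dB gA cB bG LG G1 G2 ca cb.
have aa: a<=a<=b by rewrite lexx.
have bb: a<=b<=b by rewrite lexx andbT.
have La: L1 mu RT (A a) by apply: (L1_dom measurableT _ _ LG) => [|z _]; [exact: continuous_measurable_fun|case: (bG a z aa)].
have Lb: L1 mu RT (A b) by apply: (L1_dom measurableT _ _ LG) => [|z _]; [exact: continuous_measurable_fun|case: (bG b z bb)].
suff c2 : (\int[mu]_(x in `[(- n%:R), n%:R]) A b x - \int[mu]_(x in `[(- n%:R), n%:R]) A a x) @[n --> \oo] --> (0 : R).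
 apply/eqP; rewrite -subr_eq0; apply/eqP; apply: (seq_uniq _ c2).
 exact: cvgB (Rint_lim Lb) (Rint_lim La).
have c3: l*((G n%:R+G (- n%:R))*(b-a)) @[n --> \oo] --> (0 : R).
 have := cvgM (@cvg_cst _ l nat \oo _) (cvgM (cvgD G1 G2) (@cvg_cst _ (b-a) nat \oo _)).
 by rewrite addr0 mul0r mulr0; apply.
apply: (bnd_cvg0 _ c3) => n.
have nn: - n%:R<=n%:R :> R by rewrite (@le_trans _ _ 0)// oppr_le0.
have gn := gA (- n%:R) n%:R.
have Li (f : R -> R) : continuous f -> L1 mu `[- n%:R, n%:R] f by move=> cf; apply: cont_on_L1 => x _; exact: cf.
rewrite -RintegralB//; [|exact: Li|exact: Li].
have -> : \int[mu]_(x in `[(- n%:R), n%:R]) (A b x-A a x) = I2 a b (- n%:R) n%:R Ax.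
 rewrite (I2_yx ab nn gn); apply: Rint_ext => z zn.
 rewrite -(@ftc _ (A^~ z) (Ax^~ z) a b ab)//; first by move=> x xab; exact: dA.
 by case: gn => + _ _; apply; move: zn; rewrite /= in_itv.
rewrite (I2_xy ab nn gn).
have -> : \int[mu]_(x in `[a, b]) \int[mu]_(z in `[(- n%:R), n%:R]) Ax x z = \int[mu]_(x in `[a, b]) (l*(B x n%:R-B x (- n%:R))).
 apply: Rint_ext => x; rewrite /= in_itv /= => xab.
 rewrite (@ftc _ (fun z => l*B x z) (Ax x) (- n%:R) n%:R nn); first by ring.
  move=> z _; apply: (dv_eq (dvM (dv_cst l z) (dB x z xab))); field; exact: lt0r_neq0.
 by case: gn => _ + _; apply.
have LB: L1 mu `[a, b] (fun x => l*(B x n%:R-B x (- n%:R))).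
 by apply: cont_on_L1 => x xab; apply: cvgM; [exact: cvg_cst|apply: cvgB; exact: cB].
have LC: L1 mu `[a, b] (fun=> l*(G n%:R+G (- n%:R))).
 by apply: cont_on_L1 => x xab; exact: cvg_cst.
rewrite mulrA -(Rint_itv_cst _ ab); apply: Rint_abs_le => //.
move=> x; rewrite /= in_itv /= => xab; rewrite normrM gtr0_norm// ler_wpM2l ?(ltW l0)//.
by apply: nleB; [case: (bG x n%:R xab)|case: (bG x (- n%:R) xab)].
Qed.

Lemma good2_scale (h : R -> R -> R) (a b k l : R) : 0<l -> (forall c e, good2 a b c e h) ->
 forall c e, good2 a b c e (fun x z => h x (k+z/l)).
Proof.
move=> l0 gh c e; have [h1 h2 [M hM]] := gh (k+c/l) (k+e/l).
have r z : c<=z<=e -> k+c/l<=k+z/l<=k+e/l.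
 by move=> /andP[z1 z2]; rewrite !lerD2l !ler_wpM2r// invr_ge0 ltW.
split.
- by move=> z ze; apply: (h1 (k+z/l)); exact: r.
- move=> x xab z ze; apply: (@continuous_comp R R R (fun z => k+z/l) (h x)); last by apply: h2 => //; exact: r.
 by apply: cvgD; [exact: cvg_cst|apply: cvgM; [exact: cvg_id|exact: cvg_cst]].
- by exists M => x z xab ze; apply: hM => //; exact: r.
Qed.

(** Real part, with [gQ] as imaginary part, of [exp((lam (x-a) + i z)^2)]. On [x = a] this is the
    real Gaussian [exp(- z^2)]; further right it grows at most by the factor
    [exp((lam (b-a))^2)]. *)
Definition gP (lam a x z : R) := expR ((lam*(x-a))^+2-z^+2)*cos (2 * lam*(x-a)*z).
Definition gQ (lam a x z : R) := expR ((lam*(x-a))^+2-z^+2)*sin (2 * lam*(x-a)*z).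
Definition gP1 lam a x z := 2 * lam*(lam*(x-a)*gP lam a x z-z*gQ lam a x z).
Definition gQ1 lam a x z := 2 * lam*(lam*(x-a)*gQ lam a x z+z*gP lam a x z).

Lemma g_dv lam a x z : [/\ dv (fun x => gP lam a x z) x (gP1 lam a x z), dv (fun x => gQ lam a x z) x (gQ1 lam a x z),
  lam != 0 -> dv (gP lam a x) z (- gQ1 lam a x z/lam) & lam != 0 -> dv (gQ lam a x) z (gP1 lam a x z/lam)].
Proof.
have d1: dv (fun x => (lam*(x-a))^+2-z^+2) x (2 * lam^+2*(x-a)).
 have := dvD (dvX 2 (dvM (dv_cst lam x) (dvD (dv_id x) (dv_cst (- a) x)))) (dv_cst (- z^+2) x).
 by move=> h; apply: (dv_eq h); rewrite /=; ring.
have d2: dv (fun x => 2 * lam*(x-a)*z) x (2 * lam*z).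
 have := dvM (dvM (dv_cst (2 * lam) x) (dvD (dv_id x) (dv_cst (- a) x))) (dv_cst z x).
 by move=> h; apply: (dv_eq h); rewrite /=; ring.
have d3: dv (fun z => (lam*(x-a))^+2-z^+2) z (- (2*z)).
 by apply: (dv_eq (dvD (dv_cst ((lam*(x-a))^+2) z) (dvN (dvX 2 (dv_id z))))); rewrite /=; ring.
have d4: dv (fun z => 2 * lam*(x-a)*z) z (2 * lam*(x-a)).
 by apply: (dv_eq (dvM (dv_cst (2 * lam*(x-a)) z) (dv_id z))); rewrite /=; ring.
split.
- by apply: (dv_eq (dvM (dv_expR d1) (dv_cos d2))); rewrite /gP1 /gP /gQ; ring.
- by apply: (dv_eq (dvM (dv_expR d1) (dv_sin d2))); rewrite /gQ1 /gP /gQ; ring.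
- by move=> l0; apply: (dv_eq (dvM (dv_expR d3) (dv_cos d4))); rewrite /gQ1 /gP /gQ; field.
- by move=> l0; apply: (dv_eq (dvM (dv_expR d3) (dv_sin d4))); rewrite /gP1 /gP /gQ; field.
Qed.

Lemma good2_dvxy (h hx hy : R -> R -> R) (a b c e M : R) :
 (forall x z, dv (h^~ z) x (hx x z)) -> (forall x z, dv (h x) z (hy x z)) ->
 (forall x z, a<=x<=b -> c<=z<=e -> `|h x z| <= M) -> good2 a b c e h.
Proof.
move=> dx dz hM; split; last by exists M.
- by move=> z _ x _; exact: dv_cont (dx x z).
- by move=> x _ z _; exact: dv_cont (dz x z).
Qed.

Lemma g_le lam a x z : 0<=lam -> `|gP lam a x z| <= expR ((lam*(x-a))^+2-z^+2) /\
 `|gQ lam a x z| <= expR ((lam*(x-a))^+2-z^+2).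
Proof.
move=> l0; split; first exact: absexp_cos.
by rewrite normrM ger0_norm ?expR_ge0// ler_piMr ?expR_ge0// nsin_le1.
Qed.

Lemma sq_mono (u w : R) : 0<=u -> u<=w -> u^+2<=w^+2.
Proof. by move=> u0 uw; rewrite lerXn2r// nnegrE// (le_trans u0). Qed.

Lemma g_good lam a x0 b c e : 0<lam -> a<=x0 -> good2 x0 b c e (gP lam a) /\ good2 x0 b c e (gQ lam a).
Proof.
move=> l0 ax; have ln0 := lt0r_neq0 l0.
have M x z : x0<=x<=b -> c<=z<=e -> expR ((lam*(x-a))^+2-z^+2)<=expR ((lam*(b-a))^+2).
 move=> /andP[x1 x2] _; rewrite ler_expR lerBlDr ler_wpDr ?sqr_ge0//.
 by apply: sq_mono; [rewrite mulr_ge0 ?(ltW l0)//; lra|rewrite ler_wpM2l ?(ltW l0)// lerB].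
split.
- apply: (@good2_dvxy _ (gP1 lam a) (fun x z => - gQ1 lam a x z/lam)) => [x z|x z|x z xr zr].
 + by have [] := g_dv lam a x z.
 + by have [_ _ h _] := g_dv lam a x z; exact: h.
 + by apply: le_trans (M x z xr zr); have [] := g_le a x z (ltW l0).
- apply: (@good2_dvxy _ (gQ1 lam a) (fun x z => gP1 lam a x z/lam)) => [x z|x z|x z xr zr].
 + by have [] := g_dv lam a x z.
 + by have [_ _ _ h] := g_dv lam a x z; exact: h.
 + by apply: le_trans (M x z xr zr); have [] := g_le a x z (ltW l0).
Qed.

(* Shift of the line of integration against the Gaussian weight
   [exp ((lam (s - a - i tau)) ^ 2)], written in the variable [z = lam (y - tau)]. *)
Lemma gshift (U V U1 V1 : R -> R -> R) (a b lam tau C0 eta : R) : a<=b -> 1<=lam -> 0<=C0 -> 0<=eta ->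
 (forall x y, a<=x<=b -> [/\ dv (U^~ y) x (U1 x y), dv (U x) y (- V1 x y), dv (V^~ y) x (V1 x y) & dv (V x) y (U1 x y)]) ->
 (forall c e, good2 a b c e U1 /\ good2 a b c e V1) ->
 (forall x y, a<=x<=b -> `|U x y| <= C0*ell y /\ `|V x y| <= C0*ell y) ->
 (forall y, `|U b y| <= eta /\ `|V b y| <= eta) ->
 `|\int[mu]_z (U a (tau+z/lam)*expR (- z^+2))| <=
  2*eta*expR ((lam*(b-a))^+2) * \int[mu]_z expR (- z^+2).
Proof.
move=> ab l1 C00 eta0 dUV gUV bUV bb.
have l0: 0<lam by lra.
have ln0 := lt0r_neq0 l0.
pose A x z := U x (tau+z/lam)*gP lam a x z-V x (tau+z/lam)*gQ lam a x z.
pose B x z := U x (tau+z/lam)*gQ lam a x z+V x (tau+z/lam)*gP lam a x z.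
pose Ax x z := U1 x (tau+z/lam)*gP lam a x z+U x (tau+z/lam)*gP1 lam a x z
 - (V1 x (tau+z/lam)*gQ lam a x z+V x (tau+z/lam)*gQ1 lam a x z).
have dsc (z : R) : dv (fun z => tau+z/lam) z lam^-1.
 by apply: (dv_eq (dvD (dv_cst tau z) (dvM (dv_id z) (dv_cst lam^-1 z)))); ring.
have aa: a<=a<=b by rewrite lexx.
have bab: a<=b<=b by rewrite lexx andbT.
have gU c e : good2 a b c e U.
 have [_ _ [M1 _]] := (gUV c e).1; split.
 - by move=> y _ x xab; have [h _ _ _] := dUV x y xab; exact: dv_cont h.
 - by move=> x xab y _; have [_ h _ _] := dUV x y xab; exact: dv_cont h.
 - exists (C0*(ell c*ell e+ell e+ell c)) => x y xab /andP[y1 y2]; have [h _] := bUV x y xab; apply: (le_trans h).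
  rewrite ler_wpM2l//; have hc := ell_ge1 c; have he := ell_ge1 e.
  have : ell y<=ell c \/ ell y<=ell e.
   have [y0|y0] := lerP 0 y; [right|left]; apply: ell_mono.
    by rewrite !ger0_norm// (le_trans y0).
   by rewrite !ltr0_norm ?lerN2// (le_lt_trans y1).
  by move: hc he; set u := ell c; set w := ell e; set t := ell y; clear => hc he [] h; nra.
have gV c e : good2 a b c e V.
 split.
 - by move=> y _ x xab; have [_ _ h _] := dUV x y xab; exact: dv_cont h.
 - by move=> x xab y _; have [_ _ _ h] := dUV x y xab; exact: dv_cont h.
 - exists (C0*(ell c*ell e+ell e+ell c)) => x y xab /andP[y1 y2]; have [_ h] := bUV x y xab; apply: (le_trans h).
  rewrite ler_wpM2l//; have hc := ell_ge1 c; have he := ell_ge1 e.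
  have : ell y<=ell c \/ ell y<=ell e.
   have [y0|y0] := lerP 0 y; [right|left]; apply: ell_mono.
    by rewrite !ger0_norm// (le_trans y0).
   by rewrite !ltr0_norm ?lerN2// (le_lt_trans y1).
  by move: hc he; set u := ell c; set w := ell e; set t := ell y; clear => hc he [] h; nra.
have sc h : (forall c e, good2 a b c e h) -> forall c e, good2 a b c e (fun x z => h x (tau+z/lam)) by exact: good2_scale.
have gP_ c e := (g_good b c e l0 (lexx a)).1; have gQ_ c e := (g_good b c e l0 (lexx a)).2.
have gx c e : good2 a b c e (fun x _ => lam*(x-a)).
 split; first by move=> _ _ x _; apply: cvgM; [exact: cvg_cst|apply: cvgB; [exact: cvg_id|exact: cvg_cst]].
  by move=> x _ z _; exact: cvg_cst.
 exists (lam*(b-a)) => x z /andP[x1 x2] _; rewrite ger0_norm; last by rewrite mulr_ge0 ?(ltW l0)// subr_ge0.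
 by rewrite ler_wpM2l ?(ltW l0)// lerB.
have gz c e : good2 a b c e (fun _ z => z).
 split; first by move=> z _ x _; exact: cvg_cst.
  by move=> x _ z _; exact: cvg_id.
 exists (`|c| + `|e|) => x z _ /andP[z1 z2]; rewrite ler_norml.
 have := ler_norm e; have := ler_norm (- c); have := normr_ge0 e; have := normr_ge0 c; rewrite normrN.
 by set nc := `|c|; set ne := `|e|; move: z1 z2; clear => *; apply/andP; split; lra.
have gP1_ c e : good2 a b c e (gP1 lam a).
 apply: good2_M; first exact: good2_cst.
 by apply: good2_D; [exact: good2_M|apply: good2_N; exact: good2_M].
have gQ1_ c e : good2 a b c e (gQ1 lam a).
 apply: good2_M; first exact: good2_cst.
 by apply: good2_D; exact: good2_M.
pose E := expR ((lam*(b-a))^+2).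
have E0: 0<=E := expR_ge0 _.
have gE x z : a<=x<=b -> `|gP lam a x z| <= E*expR (- z^+2) /\ `|gQ lam a x z| <= E*expR (- z^+2).
 move=> /andP[x1 x2]; have [h1 h2] := g_le a x z (ltW l0).
 have M: expR ((lam*(x-a))^+2-z^+2)<=E*expR (- z^+2).
  rewrite expRD ler_wpM2r ?expR_ge0// ler_expR.
  by apply: sq_mono; [rewrite mulr_ge0 ?(ltW l0)// subr_ge0|rewrite ler_wpM2l ?(ltW l0)// lerB].
 by split; [exact: le_trans h1 M|exact: le_trans h2 M].
have elz z : ell (tau+z/lam)<=ell tau*(2*(1 + `|z|)).
 apply: (le_trans (ell_add _ _)); rewrite ler_wpM2l ?(le_trans _ (ell_ge1 tau))//.
 apply: le_trans (ell_le z); apply: ell_mono; rewrite normrM (ger0_norm (_ : 0<=lam^-1)) ?invr_ge0 ?(ltW l0)//.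
 by rewrite ler_piMr// invf_le1.
pose C1 := 2*(C0*(ell tau*2))*E.
have C10: 0<=C1 by rewrite /C1 !mulr_ge0// (le_trans _ (ell_ge1 tau)).
pose G z := C1*((1 + `|z|)*expR (- z^+2)).
have bG x z : a<=x<=b -> `|A x z| <= G z /\ `|B x z| <= G z.
 move=> xab; have [u w] := bUV x (tau+z/lam) xab; have [p q] := gE x z xab.
 have K: C0*ell (tau+z/lam)*(E*expR (- z^+2))+C0*ell (tau+z/lam)*(E*expR (- z^+2))<=G z.
  apply: (@le_trans _ _ (2*(C0*(ell tau*(2*(1 + `|z|)))*(E*expR (- z^+2))))); last first.
   by rewrite /G /C1 le_eqVlt; apply/orP; left; apply/eqP; ring.
  rewrite (_ : forall t : R, t+t = 2 * t); last by move=> t; ring.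
  rewrite ler_pM2l// ler_wpM2r//; last by rewrite ler_wpM2l.
  by rewrite mulr_ge0 ?expR_ge0.
 by split; apply: le_trans K; [apply: nleB; exact: nleM|apply: nleD; exact: nleM].
have mexp: continuous (fun z : R => expR (- z^+2)).
 by move=> z; exact: dv_cont (dv_expR (dvN (dvX 2 (dv_id z)))).
have mG: measurable_fun RT G.
 apply: continuous_measurable_fun => z; apply: cvgM; first exact: cvg_cst.
 apply: cvgM; last exact: mexp.
 by apply: cvgD; [exact: cvg_cst|exact: norm_continuous].
have G0 z : 0<=G z by rewrite /G mulr_ge0// mulr_ge0 ?expR_ge0// ltW// p1_gt0.
have LG: L1 mu RT G.
 apply: (@L1_domW _ (C1*192) mG) => z; rewrite ger0_norm// /G -mulrA ler_wpM2l//; exact: gauss1_Wt.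
have Gn (s : nat -> R) : (forall n, `|s n| = n%:R) -> G (s n) @[n --> \oo] --> (0 : R).
 move=> hs; have c: C1*192*n.+1%:R^-1 @[n --> \oo] --> (0 : R).
  by rewrite -(mulr0 (C1*192)); apply: cvgM; [exact: cvg_cst|exact: cvg_harmonic].
 apply: (bnd_cvg0 _ c) => n; rewrite ger0_norm// /G -mulrA ler_wpM2l// ler_pdivlMr//.
 rewrite -natr1 addrC -hs; have := gauss_Wt (s n); have := Wt_le1 (s n).
 have e0 := expR_ge0 (- s n^+2); have n0 := normr_ge0 (s n).
 have : (1 + `|s n|)^+2<=(1 + `|s n|)^+4 by rewrite ler_weXn2l// lerDl.
 move: e0 n0; set e := expR _; set u := `|s n|; set w := Wt _; clear => e0 n0 h1 h2 h3.
 by have := ler_wpM2r e0 h1; rewrite expr2; lra.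
have cV (h : R -> R -> R) x : a<=x<=b -> (forall c e, good2 a b c e h) -> continuous (h x).
 by move=> xab gh z; have [_ + _] := gh (z-1) (z+1); apply => //; lra.
have gA c e : good2 a b c e A.
 by apply: good2_D; [apply: good2_M => //; exact: sc|apply: good2_N; apply: good2_M => //; exact: sc].
have gB c e : good2 a b c e B by apply: good2_D; apply: good2_M => //; exact: sc.
have gAx c e : good2 a b c e Ax.
 have gU1 c' e' := (gUV c' e').1; have gV1 c' e' := (gUV c' e').2.
 apply: good2_D; first by apply: good2_D; apply: good2_M => //; exact: sc.
 by apply: good2_N; apply: good2_D; apply: good2_M => //; exact: sc.
have S: \int[mu]_z A b z = \int[mu]_z A a z.
 apply: (@strip a b lam A Ax B G ab l0) => //.
 - move=> x z xab; have [d1 _ d2 _] := dUV x (tau+z/lam) xab; have [e1 e2 _ _] := g_dv lam a x z.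
  by apply: (dv_eq (dvD (dvM d1 e1) (dvN (dvM d2 e2)))); rewrite /Ax; ring.
 - move=> x z xab; have [_ d1 _ d2] := dUV x (tau+z/lam) xab; have [_ _ e1 e2] := g_dv lam a x z.
  have D1 := dv_comp (f := U x) (g := fun z => tau+z/lam) d1 (dsc z).
  have D2 := dv_comp (f := V x) (g := fun z => tau+z/lam) d2 (dsc z).
  by apply: (dv_eq (dvD (dvM D1 (e2 ln0)) (dvM D2 (e1 ln0)))); rewrite /Ax /=; field.
 - by move=> z x xab; have [+ _ _] := gB (z-1) (z+1); apply => //; lra.
 - by apply: Gn => n; rewrite ger0_norm.
 - by apply: Gn => n; rewrite normrN ger0_norm.
 - exact: (cV A a aa gA).
 - exact: (cV A b bab gA).
have -> : \int[mu]_z (U a (tau+z/lam)*expR (- z^+2)) = \int[mu]_z A a z.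
 apply: Rint_ext => z _; rewrite /A /gP /gQ (_ : 2 * lam*(a-a)*z = 0); last by ring.
 by rewrite cos0 sin0 (_ : (lam*(a-a))^+2-z^+2 = - z^+2); ring.
rewrite -S.
have mexp' : measurable_fun RT (fun z : R => expR (- z^+2)) by exact: continuous_measurable_fun.
have Lexp: L1 mu RT (fun z : R => expR (- z^+2)).
 by apply: (L1_domW mexp') => z; rewrite ger0_norm ?expR_ge0//; exact: gauss0_Wt.
rewrite -/E -(RintegralZl (2*eta*E) measurableT Lexp); apply: Rint_abs_le.
- exact: measurableT.
- by apply: (L1_dom measurableT _ _ LG) => [|z _]; [apply: continuous_measurable_fun; exact: (cV A b bab gA)|case: (bG b z bab)].
- exact: L1Z.
move=> z _; have [p q] := gE b z bab; have [u w] := bb (tau+z/lam).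
by apply: (le_trans (nleB (nleM u p) (nleM w q))); rewrite le_eqVlt; apply/orP; left; apply/eqP; ring.
Qed.

Lemma L1_gauss : L1 mu RT (fun z : R => expR (- z^+2)).
Proof.
have mexp: continuous (fun z : R => expR (- z^+2)).
 by move=> z; exact: dv_cont (dv_expR (dvN (dvX 2 (dv_id z)))).
by apply: (L1_domW (continuous_measurable_fun mexp)) => z; rewrite ger0_norm ?expR_ge0//; exact: gauss0_Wt.
Qed.

End line.

(** * An upper bound for smoothed partial sums *)

Section KL.
Variable R : realType.
Notation mu := (@lebesgue_measure R).
Notation RT := (setT : set (measurableTypeR R)).
Notation vm := (@von_mangoldt R).
Notation P := (@zP R).
Notation Q := (@zQ R).
Notation nz2 := (nsq (@zP R) (@zQ R)).
Notation lr := (ldr (@zP R) (@zQ R)).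
Notation li := (ldi (@zP R) (@zQ R)).

(** Components of [(f'/f)' = f''/f - (f'/f)^2], where [f'/f = lr - i li]. *)
Definition lr1 x y := (P 0 x y*P 2 x y+Q 0 x y*Q 2 x y)/nz2 x y-(lr x y^+2-li x y^+2).
Definition li1 x y := (P 0 x y*Q 2 x y-Q 0 x y*P 2 x y)/nz2 x y+2 * lr x y * li x y.

Lemma ld_dv (x y : R) : 0<x -> 0<nz2 x y ->
 [/\ dv (lr^~ y) x (lr1 x y), dv (lr x) y (- li1 x y),
   dv (fun x => - li x y) x (li1 x y) & dv (fun y => - li x y) y (lr1 x y)].
Proof.
move=> x0 n0; have nn := lt0r_neq0 n0.
have [px0 py0 qx0 qy0] := And4 (zPx 0 y x0) (zPy 0 y x0) (zQx 0 y x0) (zQy 0 y x0).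
have [px1 py1 qx1 qy1] := And4 (zPx 1 y x0) (zPy 1 y x0) (zQx 1 y x0) (zQy 1 y x0).
have nx := dvV (f := fun x => nz2 x y) nn (dvD (dvX 2 px0) (dvX 2 qx0)).
have ny := dvV (f := fun y => nz2 x y) nn (dvD (dvX 2 py0) (dvX 2 qy0)).
have A1 := dvM (dvD (dvM px0 px1) (dvM qx0 qx1)) nx.
have A2 := dvM (dvD (dvM py0 py1) (dvM qy0 qy1)) ny.
have A3 := dvN (dvM (dvD (dvM (dvN px0) qx1) (dvM qx0 px1)) nx).
have A4 := dvN (dvM (dvD (dvM (dvN py0) qy1) (dvM qy0 py1)) ny).
by split; [apply: (dv_eq A1)|apply: (dv_eq A2)|apply: (dv_eq A3)|apply: (dv_eq A4)];
 rewrite /lr1 /li1 /ldr /ldi /=; move: nn; rewrite /nsq => nn; field.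
Qed.

(** Scaled so as to be at most 1. After multiplication by [exp N] its Laplace transform is the
    integral of [exp((1-s) v)] over [[0, N]], a substitute for [1/(s-1)] that is regular at 1. *)
Definition wB N (v : R) : R := if v<=N%:R then expR (v-N%:R) else 0.

Lemma wB_wt N : wt (wB N).
Proof.
split; last first.
 move=> v; rewrite /wB; case: ifP => h; rewrite ?normr0//.
 by rewrite ger0_norm ?expR_ge0// -[leRHS]expR0 ler_expR subr_le0.
apply: measurable_funTS.
have m: measurable_fun (setT : set (measurableTypeR R)) (fun v : R => expR (v-N%:R)).
 apply: continuous_measurable_fun => v; apply: continuous_comp; last exact: continuous_expR.
 by apply: cvgB; [exact: cvg_id|exact: cvg_cst].
have := @meas_if R -oo%O (BRight (N%:R)) _ m.
by under eq_fun do rewrite in_itv /=.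
Qed.

Lemma wB_int N (x y ph : R) : expR N%:R*Lp (wB N) 0 x y ph =
 \int[mu]_(v in `[0, N%:R]) (expR ((1-x)*v)*cos (y*v+ph)).
Proof.
have c: continuous (fun v : R => expR ((1-x)*v)*cos (y*v+ph)).
 move=> v; have h1: dv (fun v => (1-x)*v) v (1-x) by apply: (dv_eq (dvM (dv_cst (1-x) v) (dv_id v))); ring.
 have h2: dv (fun v => y*v+ph) v y by apply: (dv_eq (dvD (dvM (dv_cst y v) (dv_id v)) (dv_cst ph v))); ring.
 exact: dv_cont (dvM (dv_expR h1) (dv_cos h2)).
have e: \int[mu]_(v in @hl R) (wB N v * lk 0 x y ph v) = \int[mu]_(v in `[0, N%:R]) (expR (- N%:R)*(expR ((1-x)*v)*cos (y*v+ph))).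
 rewrite Rint_mkcond [RHS]Rint_mkcond; apply: Rint_ext => v _.
 rewrite !indicE /hl; case: (boolP (0<=v)) => v0; last first.
  by rewrite !memNset ?mul0r//= in_itv/= ?andbT (negbTE v0).
 rewrite mem_set ?mul1r; last by rewrite /= in_itv /= andbT.
 rewrite /wB; case: (boolP (v<=N%:R)) => vN; last by rewrite memNset ?mul0r//= in_itv/= v0 (negbTE vN).
 rewrite mem_set ?mul1r; last by rewrite /= in_itv /= v0.
 rewrite /lk expr0 mul1r !mulrA -!expRD; congr (expR _*_); ring.
rewrite /Lp e RintegralZl ?mulrA -?expRD ?subrr ?expR0 ?mul1r//.
by apply: cont_on_L1 => v _; exact: c.
Qed.

Definition Ds1 N (x y ph : R) := \sum_(1<=n<N.+1) vm n*(- ln n%:R*nk n x y ph).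

Lemma nk_dy n (x y ph : R) : dv (fun y => nk n x y ph) y (- ln n%:R*nk n x y (ph-pi/2)).
Proof.
have h: dv (fun y => y * ln n%:R+ph) y (ln n%:R).
 by apply: (dv_eq (dvD (dvM (dv_id y) (dv_cst (ln n%:R) y)) (dv_cst ph y))); ring.
apply: (dv_eq (dvM (dv_cst (expR (- x * ln n%:R)) y) (dv_cos h))).
by rewrite /nk addrA cosBpihalf; ring.
Qed.

Lemma nk_piN n (x y ph : R) : nk n x y (ph-pi/2) = - nk n x y (ph+pi/2).
Proof. by rewrite -[in RHS](subrK (pi/2) ph) nk_pi opprK. Qed.

Lemma Ds_dx N (x y ph : R) : dv (fun x => Ds N x y ph) x (Ds1 N x y ph).
Proof.
apply: (dv_sum (index_iota 1 N.+1) (f := fun n x => vm n*nk n x y ph) (g := fun n x => vm n*(- ln n%:R*nk n x y ph))) => n.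
by apply: (dv_eq (dvM (dv_cst (vm n) x) (nk_dx n x y ph))); ring.
Qed.

Lemma Ds_dy N (x y ph : R) : dv (fun y => Ds N x y ph) y (Ds1 N x y (ph-pi/2)).
Proof.
apply: (dv_sum (index_iota 1 N.+1) (f := fun n y => vm n*nk n x y ph) (g := fun n y => vm n*(- ln n%:R*nk n x y (ph-pi/2)))) => n.
by apply: (dv_eq (dvM (dv_cst (vm n) y) (nk_dy n x y ph))); ring.
Qed.

Lemma Ds1_pi N (x y ph : R) : Ds1 N x y (ph-pi/2) = - Ds1 N x y (ph+pi/2).
Proof. by rewrite /Ds1 -sumrN; apply: eq_bigr => n _; rewrite nk_piN; ring. Qed.

Lemma Ds1_dx N (x y ph : R) : exists d, dv (fun x => Ds1 N x y ph) x d.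
Proof.
eexists; apply: (dv_sum (index_iota 1 N.+1) (f := fun n x => vm n*(- ln n%:R*nk n x y ph))
 (g := fun n x => vm n*(- ln n%:R*(- ln n%:R*nk n x y ph)))) => n.
by apply: (dv_eq (dvM (dv_cst (vm n) x) (dvM (dv_cst (- ln n%:R) x) (nk_dx n x y ph)))); ring.
Qed.

Lemma Ds1_dy N (x y ph : R) : exists d, dv (fun y => Ds1 N x y ph) y d.
Proof.
eexists; apply: (dv_sum (index_iota 1 N.+1) (f := fun n y => vm n*(- ln n%:R*nk n x y ph))
 (g := fun n y => vm n*(- ln n%:R*(- ln n%:R*nk n x y (ph-pi/2))))) => n.
by apply: (dv_eq (dvM (dv_cst (vm n) y) (dvM (dv_cst (- ln n%:R) y) (nk_dy n x y ph)))); ring.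
Qed.

Lemma nk_le1 n (x y ph : R) : 0<=x -> `|nk n.+1 x y ph| <= 1.
Proof.
move=> x0; apply: (le_trans (absexp_cos _ _)); rewrite -[leRHS]expR0 ler_expR mulNr oppr_le0.
by rewrite mulr_ge0// ln_nat_ge0.
Qed.

Lemma Ds_le N (x y ph : R) : 0<=x -> `|Ds N x y ph| <= \sum_(1<=n<N.+1) vm n.
Proof.
move=> x0; apply: (le_trans (ler_norm_sum _ _ _)); apply: ler_sum_nat => -[|n]// _.
by rewrite normrM (ger0_norm (vm_ge0 _ _)) ler_piMr ?vm_ge0// nk_le1.
Qed.

Lemma Ds1_le N (x y ph : R) : 0<=x -> `|Ds1 N x y ph| <= \sum_(1<=n<N.+1) vm n * ln n%:R.
Proof.
move=> x0; apply: (le_trans (ler_norm_sum _ _ _)); apply: ler_sum_nat => -[|n]// _.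
rewrite normrM (normrM (- ln _)) (ger0_norm (vm_ge0 _ _)) normrN (ger0_norm (ln_nat_ge0 R n)) ler_wpM2l ?vm_ge0//.
by rewrite ler_piMr ?ln_nat_ge0// nk_le1.
Qed.

(** A truncation of [f'/f = 1/(s-1) - sum Lambda(n) n^(-s)] that makes sense on the whole
    half-plane, across the pole and the abscissa of convergence. *)
Definition HN N (x y ph : R) := expR N%:R*Lp (wB N) 0 x y ph-Ds N x y ph.
Definition HN1 N (x y ph : R) := expR N%:R*Lp (wB N) 1 x y ph-Ds1 N x y ph.

Lemma HN_dx N (x y ph : R) : 0<x -> dv (fun x => HN N x y ph) x (HN1 N x y ph).
Proof.
move=> x0; apply: (dv_eq (dvD (dvM (dv_cst (expR N%:R) x) (Lp_x 0 y ph (wB_wt N) x0)) (dvN (Ds_dx N x y ph)))).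
by rewrite /HN1; ring.
Qed.

Lemma HN_dy N (x y ph : R) : 0<x -> dv (fun y => HN N x y ph) y (HN1 N x y (ph-pi/2)).
Proof.
move=> x0; apply: (dv_eq (dvD (dvM (dv_cst (expR N%:R) y) (Lp_y 0 y ph (wB_wt N) x0)) (dvN (Ds_dy N x y ph)))).
by rewrite /HN1; ring.
Qed.

Lemma HN1_pi N (x y ph : R) : 0<x -> HN1 N x y (ph-pi/2) = - HN1 N x y (ph+pi/2).
Proof. by move=> x0; rewrite /HN1 Ds1_pi (Lp_pi _ _ _ (wB_wt N) x0); ring. Qed.

Lemma HN_bnd N (a : R) : 0<a -> exists2 M, 0<=M & forall x y ph, a<=x -> `|HN N x y ph| <= M /\ `|HN1 N x y ph| <= M.
Proof.
move=> a0; have [B0 B00 H0] := Lp_bnd 0 a0; have [B1 B10 H1] := Lp_bnd 1 a0.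
pose M0 := expR N%:R*B0 + \sum_(1<=n<N.+1) vm n.
pose M1 := expR N%:R*B1 + \sum_(1<=n<N.+1) vm n * ln n%:R.
have s0: 0 <= \sum_(1<=n<N.+1) vm n by apply: sumr_ge0 => n _; exact: vm_ge0.
have s1: 0 <= \sum_(1<=n<N.+1) vm n * ln n%:R.
 by rewrite big_nat; apply: sumr_ge0 => -[|n]// _; rewrite mulr_ge0 ?vm_ge0 ?ln_nat_ge0.
have M00: 0<=M0 by rewrite addr_ge0// mulr_ge0// expR_ge0.
have M10: 0<=M1 by rewrite addr_ge0// mulr_ge0// expR_ge0.
exists (M0+M1) => [|x y ph ax]; first exact: addr_ge0.
have x0: 0<=x by rewrite (le_trans (ltW a0)).
have eN: `|expR (N%:R : R)| <= expR N%:R by rewrite ger0_norm ?expR_ge0.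
split.
 apply: (@le_trans _ _ M0); last by rewrite lerDl.
 by apply: nleB; [apply: nleM => //; exact: H0 (wB_wt N) ax|exact: Ds_le].
apply: (@le_trans _ _ M1); last by rewrite lerDr.
by apply: nleB; [apply: nleM => //; exact: H1 (wB_wt N) ax|exact: Ds1_le].
Qed.

Lemma HN1_good N (a b c e ph : R) : 0<a -> good2 a b c e (fun x y => HN1 N x y ph).
Proof.
move=> a0; split.
- move=> y _ x /andP[ax _]; have x0: 0<x by exact: lt_le_trans ax.
 have [d hd] := Ds1_dx N x y ph.
 exact: dv_cont (dvD (dvM (dv_cst (expR N%:R) x) (Lp_x 1 y ph (wB_wt N) x0)) (dvN hd)).
- move=> x /andP[ax _] y _; have x0: 0<x by exact: lt_le_trans ax.
 have [d hd] := Ds1_dy N x y ph.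
 exact: dv_cont (dvD (dvM (dv_cst (expR N%:R) y) (Lp_y 1 y ph (wB_wt N) x0)) (dvN hd)).
- have [M _ HM] := HN_bnd N a0; exists M => x y /andP[ax _] _.
 by have [_] := HM x y ph ax.
Qed.

(** On Re s = 2 the truncation error is the remainder of an elementary integral plus the tail of an
    absolutely convergent series, uniformly in [y]. *)
Lemma HN_2 N (y ph : R) : `|HN N 2 y ph+(Dl 2 y ph-(cos ph-y*sin ph)/(1+y^+2))| <=
 2*expR (- N%:R)+(Dl 2 0 0-Ds N 2 0 0).
Proof.
have y1: 0<1+y^+2 by rewrite ltr_pwDl// sqr_ge0.
have yn := lt0r_neq0 y1.
pose F v := expR (- v)*(y*sin (y*v+ph)-cos (y*v+ph))/(1+y^+2).
have dF v : dv F v (expR ((1-2)*v)*cos (y*v+ph)).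
 have h2: dv (fun v => y*v+ph) v y by apply: (dv_eq (dvD (dvM (dv_cst y v) (dv_id v)) (dv_cst ph v))); ring.
 have := dvM (dvM (dv_expR (dvN (dv_id v))) (dvD (dvM (dv_cst y v) (dv_sin h2)) (dvN (dv_cos h2)))) (dv_cst (1+y^+2)^-1 v).
 move=> h; apply: (dv_eq h); rewrite (_ : (1-2)*v = - v); last by ring.
 by field.
have nN: 0<=N%:R :> R by [].
have cF: cont_on 0 N%:R (fun v => expR ((1-2)*v)*cos (y*v+ph)).
 move=> v _; have h2: dv (fun v => y*v+ph) v y by apply: (dv_eq (dvD (dvM (dv_cst y v) (dv_id v)) (dv_cst ph v))); ring.
 exact: dv_cont (dvM (dv_expR (dvM (dv_cst (1-2) v) (dv_id v))) (dv_cos h2)).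
have bF: `|F N%:R| <= 2*expR (- N%:R).
 rewrite /F normrM normrM (ger0_norm (expR_ge0 _)) (gtr0_norm (_ : 0<(1+y^+2)^-1)) ?invr_gt0//.
 rewrite -mulrA [leRHS]mulrC ler_wpM2l ?expR_ge0// ler_pdivrMr//.
 apply: (le_trans (nleB (nleM (lexx `|y|) (nsin_le1 _)) (ncos_le1 _))).
 rewrite -(real_normK (num_real y)); have := sqr_ge0 (1 - `|y|); have := sqr_ge0 `|y|.
 by set u := `|y|; clear; rewrite !expr2; lra.
have cD p := @Ds_cvg R 2 y p (ltr1n R 2).
have tail: `|Dl 2 y ph-Ds N 2 y ph| <= Dl 2 0 0-Ds N 2 0 0.
 have c2 := @Ds_cvg R 2 0 0 ltac:(by rewrite ltr1n).
 have c1 := @Ds_cvg R 2 y ph ltac:(by rewrite ltr1n).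
 rewrite ler_norml; apply/andP; split.
 - have c: (Ds k 2 y ph+Ds k 2 0 0) @[k --> \oo] --> Dl 2 y ph+Dl 2 0 0 by apply: cvgD.
  suff : Ds N 2 y ph+Ds N 2 0 0<=Dl 2 y ph+Dl 2 0 0 by lra.
  rewrite -(cvg_lim _ c)//; apply: (nondecreasing_cvgn_le _ (cvgP _ c)).
  apply/nondecreasing_seqP => n; rewrite /Ds !(big_nat_recr n.+1)//=.
  have := nk_le n.+1 2 y ph; rewrite ler_norml => /andP[h _].
  by have := vm_ge0 R n.+1; move: h; set u := nk n.+1 2 y ph; set w := nk n.+1 2 0 0; set m := vm _; set s := \sum_(_ <= _ < _) _; set s' := \sum_(_ <= _ < _) _; clear; nra.
 - have c: (Ds k 2 0 0-Ds k 2 y ph) @[k --> \oo] --> Dl 2 0 0-Dl 2 y ph by apply: cvgB.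
  suff : Ds N 2 0 0-Ds N 2 y ph<=Dl 2 0 0-Dl 2 y ph by lra.
  rewrite -(cvg_lim _ c)//; apply: (nondecreasing_cvgn_le _ (cvgP _ c)).
  apply/nondecreasing_seqP => n; rewrite /Ds !(big_nat_recr n.+1)//=.
  have := nk_le n.+1 2 y ph; rewrite ler_norml => /andP[_ h].
  by have := vm_ge0 R n.+1; move: h; set u := nk n.+1 2 y ph; set w := nk n.+1 2 0 0; set m := vm _; set s := \sum_(_ <= _ < _) _; set s' := \sum_(_ <= _ < _) _; clear; nra.
have -> : HN N 2 y ph+(Dl 2 y ph-(cos ph-y*sin ph)/(1+y^+2)) = F N%:R+(Dl 2 y ph-Ds N 2 y ph).
 rewrite /HN wB_int (ftc nN (fun v _ => dF v) cF) /F !mulr0 !add0r oppr0 expR0; by field.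
exact: nleD.
Qed.

Definition Sf (s : R) N t := Ds N s t 0 - \int[mu]_(v in `[0, N%:R]) (expR ((1-s)*v)*cos (t*v)).

Lemma Sf_HN s N t : Sf s N t = - HN N s t 0.
Proof. rewrite /Sf /HN wB_int opprB; congr (_ - _).
by apply: Rint_ext => v _; rewrite addr0. Qed.

(** [f'/f - HN] is holomorphic between the lines Re s = [s] and Re s = 2 and tends to 0 on the
    latter; by [gshift] its Gaussian means on the former are negligible. There Re f'/f is bounded
    below by [ldr_ge]. [A] is uniform in [s] and [lam], while [err] may depend on them badly: [N]
    tends to infinity first. *)
Theorem KL : riemann_hypothesis R -> exists2 A, 0<=A & forall s lam, 1/2<s<=1 -> 1<=lam ->
 exists2 err : nat -> R, err @ \oo --> (0 : R) & forall N tau,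
 \int[mu]_z (Sf s N (tau+z/lam)*expR (- z^+2))<=A*ell tau+err N.
Proof.
move=> RH; have nz := z_nz RH; have [CG CG0 gr] := z_growth R.
have low x y : 3<=x<=20 -> 1<=nz2 x y by move=> /andP[x3 _]; exact: z_low.
have [A A0 HA] := ldr_ge (@zPx R) (@zPy R) (@zQx R) (@zQy R) (@zPQ_bnd R) CG0 gr low nz.
have Lg := @L1_gauss R.
have mexp: continuous (fun z : R => expR (- z^+2)).
 by move=> z; exact: dv_cont (dv_expR (dvN (dvX 2 (dv_id z)))).
have cell: continuous (@ell R).
 move=> y; apply: cvgD; first exact: cvg_cst.
 apply: continuous_comp; last by apply: continuous_ln; rewrite ltr_pwDl.
 by apply: cvgD; [exact: cvg_cst|exact: norm_continuous].
have Lell: L1 mu RT (fun z : R => ell z*expR (- z^+2)).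
 apply: (@L1_domW _ _ (2*192)) => [|z].
  by apply: continuous_measurable_fun => z; apply: cvgM; [exact: cell|exact: mexp].
 rewrite ger0_norm ?mulr_ge0 ?expR_ge0 ?(le_trans _ (ell_ge1 z))//.
 apply: (@le_trans _ _ (2*((1 + `|z|)*expR (- z^+2)))); last by rewrite -mulrA ler_pM2l// gauss1_Wt.
 by rewrite mulrA ler_wpM2r ?expR_ge0// ell_le.
exists (A * \int[mu]_z (ell z*expR (- z^+2))).
 by apply: mulr_ge0 => //; apply: Rintegral_ge0 => z _; rewrite mulr_ge0 ?expR_ge0// (le_trans _ (ell_ge1 z)).
move=> s lam /andP[s1 s2] l1.
have d0: 0<s-1/2 by lra.
have [A2 A20 HA2] := ld_le (@zPx R) (@zPy R) (@zQx R) (@zQy R) (@zPQ_bnd R) CG0 gr low nz d0.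
have s0: 0<s by lra.
have sle2: s<=2 by lra.
have l0: 0<lam by lra.
pose eta N := 2*expR (- N%:R)+(Dl 2 0 0-Ds N 2 0 0) : R.
have eta0 N : 0<=eta N by apply: le_trans (HN_2 N 0 0); exact: normr_ge0.
pose G := \int[mu]_z expR (- z^+2) : R.
exists (fun N => 2*eta N*expR ((lam*(2-s))^+2)*G).
 have c: 2*(2*expR (- 1 * ln (expR N%:R))+(Dl 2 0 0-Ds N 2 0 0))*expR ((lam*(2-s))^+2)*G @[N --> \oo] -->
   2*(2*0+(Dl 2 0 0-Dl 2 0 0))*expR ((lam*(2-s))^+2)*G.
  apply: cvgM; last exact: cvg_cst.
  apply: cvgM; last exact: cvg_cst.
  apply: cvgM; first exact: cvg_cst.
  apply: cvgD; last by apply: cvgB; [exact: cvg_cst|apply: Ds_cvg; rewrite ltr1n].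
  apply: cvgM; first exact: cvg_cst.
  apply: (@bnd_cvg0 _ _ (fun n => expR (- 1 * ln n.+1%:R))); last exact: pow_cvg0.
  move=> n; rewrite ger0_norm ?expR_ge0// ler_expR !mulN1r lerN2 ler_ln ?posrE ?expR_gt0//.
  by rewrite -natr1 addrC; exact: expR_ge1Dx.
 rewrite subrr mulr0 addr0 mulr0 !mul0r in c; apply: seq_ext c => N.
 by rewrite expRK mulN1r.
move=> N tau.
have [M M0 HM] := HN_bnd N s0.
(* The imaginary part of [f'/f] is [- li], whence the sign in [V]. *)
pose U x y := lr x y-HN N x y 0; pose V x y := - li x y-HN N x y (pi/2).
have xpos x : s<=x<=2 -> 0<x by move=> /andP[h _]; exact: lt_le_trans h.
have xh x : s<=x<=2 -> 1/2<x by move=> /andP[h _]; exact: lt_le_trans h.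
have gs := @gshift R U V (fun x y => lr1 x y-HN1 N x y 0) (fun x y => li1 x y-HN1 N x y (pi/2)) s 2 lam tau (A2+M) (eta N)
 sle2 l1 (addr_ge0 A20 M0) (eta0 N).
have {}gs : `|\int[mu]_z (U s (tau+z/lam)*expR (- z^+2))| <= 2*eta N*expR ((lam*(2-s))^+2)*G.
 apply: gs.
 - move=> x y xr; have x0 := xpos x xr; have [e1 e2 e3 e4] := ld_dv x0 (nz x y (xh x xr)).
  split.
  + exact: (dvD e1 (dvN (HN_dx N y 0 x0))).
  + apply: (dv_eq (dvD e2 (dvN (HN_dy N y 0 x0)))).
   by rewrite HN1_pi// add0r; ring.
  + exact: (dvD e3 (dvN (HN_dx N y (pi/2) x0))).
  + by apply: (dv_eq (dvD e4 (dvN (HN_dy N y (pi/2) x0)))); rewrite subrr.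
 - move=> c e; have h2: 1/2<0+s by rewrite add0r.
  have gP n := Pgood (@zPx R) (@zPy R) (@zPQ_bnd R) n 2 c e s0.
  have gQ n := Qgood (@zQx R) (@zQy R) (@zPQ_bnd R) n 2 c e s0.
  have gn: good2 s 2 c e (fun x y => (nz2 x y)^-1).
   split.
   + move=> y _ x xr; have x0 := xpos x xr.
    exact: dv_cont (dvV (f := fun x => nz2 x y) (lt0r_neq0 (nz x y (xh x xr))) (dvD (dvX 2 (zPx 0 y x0)) (dvX 2 (zQx 0 y x0)))).
   + move=> x xr y _; have x0 := xpos x xr.
    exact: dv_cont (dvV (f := fun y => nz2 x y) (lt0r_neq0 (nz x y (xh x xr))) (dvD (dvX 2 (zPy 0 y x0)) (dvX 2 (zQy 0 y x0)))).
   + have [ce|ce] := lerP c e; last first.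
     exists 0 => x y _ /andP[c1 c2]; have := le_trans c1 c2; by rewrite leNgt ce.
    have [q q0 Hq] := nsq_min (@zPx R) (@zPy R) (@zQx R) (@zQy R) (@zPQ_bnd R) nz 0 sle2 ce h2.
    exists q^-1 => x y xr yr; have := Hq x y xr yr; rewrite !add0r => h.
    by rewrite ger0_norm ?invr_ge0 ?nsq_ge0// lef_pV2 ?posrE// (lt_le_trans q0).
  have glr: good2 s 2 c e lr by apply: good2_M => //; apply: good2_D; exact: good2_M.
  have gli: good2 s 2 c e li.
   by apply: good2_M => //; apply: good2_D; apply: good2_M => //; exact: good2_N.
  have gsq h : good2 s 2 c e h -> good2 s 2 c e (fun x y => h x y^+2).
   by move=> gh; under eq_fun do under eq_fun do rewrite expr2; exact: good2_M.
  split; apply: good2_D; try (by apply: good2_N; exact: HN1_good).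
  + apply: good2_D; first by apply: good2_M => //; apply: good2_D; exact: good2_M.
   by apply: good2_N; apply: good2_D; [exact: gsq|apply: good2_N; exact: gsq].
  + apply: good2_D; first by apply: good2_M => //; apply: good2_D; [exact: good2_M|apply: good2_N; exact: good2_M].
   by apply: good2_M => //; apply: good2_M => //; exact: good2_cst.
 - move=> x y xr; have /andP[x1 x2] := xr.
  have [e1 e2] := HA2 x y ltac:(by apply/andP; split; [lra|]).
  have K (u w : R) : `|u| <= A2*ell y -> `|w| <= M -> `|u-w| <= (A2+M)*ell y.
   move=> hu hw; apply: (le_trans (nleB hu hw)); rewrite mulrDl lerD2l ler_peMr//; exact: ell_ge1.
  by split; apply: K => //; rewrite ?normrN//; [case: (HM x y 0 x1)|case: (HM x y (pi/2) x1)].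
 - move=> y; have [e1 e2] := @ldr_Dl R 2 y ltac:(by rewrite ltr1n) (nz 2 y ltac:(lra)).
  have z2: zr2 2 y = 1+y^+2 by rewrite /zr2; ring.
  have H p := HN_2 N y p; have H0 := H 0; have H1 := H (pi/2).
  split.
   rewrite /U e1 z2 -normrN; apply: le_trans H0; rewrite cos0 sin0 mulr0 subr0 le_eqVlt; apply/orP; left; apply/eqP; congr `|_|; ring.
  rewrite /V e2 z2 -normrN; apply: le_trans H1; rewrite cos_pihalf sin_pihalf mulr1 le_eqVlt; apply/orP; left; apply/eqP; congr `|_|; ring.
have dsc (z : R) : dv (fun z => tau+z/lam) z lam^-1.
 by apply: (dv_eq (dvD (dv_cst tau z) (dvM (dv_id z) (dv_cst lam^-1 z)))); ring.
have clr: continuous (fun z : R => lr s (tau+z/lam)).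
 move=> z; have [_ h _ _] := ld_dv s0 (nz s (tau+z/lam) s1).
 exact: dv_cont (dv_comp (f := lr s) (g := fun z => tau+z/lam) h (dsc z)).
have cHN: continuous (fun z : R => HN N s (tau+z/lam) 0).
 by move=> z; exact: dv_cont (dv_comp (f := fun y => HN N s y 0) (g := fun z => tau+z/lam) (HN_dy N _ 0 s0) (dsc z)).
have elz (z : R) : ell (tau+z/lam)<=ell tau*ell z.
 apply: (le_trans (ell_add _ _)); rewrite ler_wpM2l ?(le_trans _ (ell_ge1 tau))//.
 apply: ell_mono; rewrite normrM (ger0_norm (_ : 0<=lam^-1)) ?invr_ge0 ?(ltW l0)//.
 by rewrite ler_piMr// invf_le1.
have L1' : L1 mu RT (fun z : R => lr s (tau+z/lam)*expR (- z^+2)).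
 apply: (L1_dom measurableT _ _ (L1Z (A2*ell tau) measurableT Lell)).
  by apply: continuous_measurable_fun => z; apply: cvgM; [exact: clr|exact: mexp].
 move=> z _; rewrite normrM (ger0_norm (expR_ge0 _)) mulrA ler_wpM2r ?expR_ge0//.
 have [h _] := HA2 s (tau+z/lam) ltac:(lra); apply: (le_trans h).
 by rewrite -mulrA ler_wpM2l.
have L2' : L1 mu RT (fun z : R => HN N s (tau+z/lam) 0*expR (- z^+2)).
 apply: (L1_dom measurableT _ _ (L1Z M measurableT Lg)).
  by apply: continuous_measurable_fun => z; apply: cvgM; [exact: cHN|exact: mexp].
 move=> z _; rewrite normrM (ger0_norm (expR_ge0 _)) ler_wpM2r ?expR_ge0//.
 by case: (HM s (tau+z/lam) 0 (lexx s)).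
have EU: \int[mu]_z (U s (tau+z/lam)*expR (- z^+2)) = \int[mu]_z (lr s (tau+z/lam)*expR (- z^+2)) -
  \int[mu]_z (HN N s (tau+z/lam) 0*expR (- z^+2)).
 rewrite -RintegralB//; apply: Rint_ext => z _; rewrite /U; ring.
have ES: \int[mu]_z (Sf s N (tau+z/lam)*expR (- z^+2)) = - \int[mu]_z (HN N s (tau+z/lam) 0*expR (- z^+2)).
 rewrite -mulN1r -RintegralZl//; apply: Rint_ext => z _; rewrite Sf_HN; ring.
have lower: - (A*(\int[mu]_z (ell z*expR (- z^+2)))*ell tau) <= \int[mu]_z (lr s (tau+z/lam)*expR (- z^+2)).
 rewrite mulrAC -mulNr -RintegralZl//; apply: le_Rintegral => //; first exact: L1Z.
 move=> z _; rewrite mulrA ler_wpM2r ?expR_ge0//.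
 apply: le_trans (HA s (tau+z/lam) _); last by lra.
 by rewrite mulNr lerN2 -mulrA ler_wpM2l.
rewrite ES; move: gs lower; rewrite ler_norml EU => /andP[_].
set a := \int[mu]_z (lr _ _*_); set b := \int[mu]_z (HN _ _ _ _*_); set e := 2*_*_*_; set f := A*_*_; clear.
by move=> *; lra.
Qed.

End KL.

(** * Inversion of cosine transforms *)

Section inv.
Variable R : realType.
Notation mu := (@lebesgue_measure R).
Notation RT := (setT : set (measurableTypeR R)).

Lemma lip_cont (g : R -> R) C : (forall x y : R, `|g x-g y| <= C * `|x-y|) -> continuous g.
Proof.
move=> h x; apply/cvgrPdist_le => e e0.
have C0: 0 < `|C| + 1 by rewrite ltr_wpDl.
near=> y; apply: (le_trans (h x y)); apply: (@le_trans _ _ ((`|C| + 1) * `|x-y|)).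
 by rewrite ler_wpM2r// (le_trans (ler_norm C))// lerDl.
rewrite -ler_pdivlMl//; near: y; apply: cvgr_dist_le; first exact: cvg_id.
by rewrite mulr_gt0// invr_gt0.
Unshelve. all: by end_near.
Qed.

Lemma cos_lip (a b : R) : `|cos a-cos b| <= `|a-b|.
Proof.
wlog ab : a b/b<=a.
 move=> h; case: (leP b a) => [/h//|/ltW /h]; by rewrite distrC (distrC b a).
rewrite (ger0_norm (_ : 0<=a-b)) ?subr_ge0// -[leRHS]mul1r.
apply: (@dv_lip R (@cos R) (fun x => - sin x)) => // x _.
 by apply: (dv_eq (dv_cos (dv_id x))); rewrite mulr1.
by rewrite normrN; exact: nsin_le1.
Qed.

Lemma sin_lip (a b : R) : `|sin a-sin b| <= `|a-b|.
Proof.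
wlog ab : a b/b<=a.
 move=> h; case: (leP b a) => [/h//|/ltW /h]; by rewrite distrC (distrC b a).
rewrite (ger0_norm (_ : 0<=a-b)) ?subr_ge0// -[leRHS]mul1r.
apply: (@dv_lip R (@sin R) (fun x => cos x)) => // x _.
 by apply: (dv_eq (dv_sin (dv_id x))); rewrite mulr1.
exact: ncos_le1.
Qed.

Lemma cosl_cont (a b : R) : continuous (fun x : R => cos (a+b*x)).
Proof.
apply: (@lip_cont _ `|b|) => x y; apply: (le_trans (cos_lip _ _)).
by rewrite opprD addrACA subrr add0r -mulrBr normrM.
Qed.

Lemma cosm_cont (a : R) : continuous (fun x : R => cos (a*x)).
Proof.
by apply: (@lip_cont _ `|a|) => x y; apply: (le_trans (cos_lip _ _)); rewrite -mulrBr normrM.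
Qed.

Lemma RZ (D : set (measurableTypeR R)) (f : R -> R) c : measurable D -> L1 mu D f ->
 \int[mu]_(x in D) (c*f x) = c * \int[mu]_(x in D) f x.
Proof. by move=> mD Lf; rewrite -(RintegralZl _ mD Lf). Qed.

Lemma RD (D : set (measurableTypeR R)) (f g : R -> R) : measurable D -> L1 mu D f -> L1 mu D g ->
 \int[mu]_(x in D) (f x+g x) = \int[mu]_(x in D) f x + \int[mu]_(x in D) g x.
Proof. by move=> mD Lf Lg; rewrite -(RintegralD mD Lf Lg). Qed.

Lemma RB (D : set (measurableTypeR R)) (f g : R -> R) : measurable D -> L1 mu D f -> L1 mu D g ->
 \int[mu]_(x in D) (f x-g x) = \int[mu]_(x in D) f x - \int[mu]_(x in D) g x.
Proof. by move=> mD Lf Lg; rewrite -(RintegralB mD Lf Lg). Qed.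

Lemma L1_mulbnd (D : set (measurableTypeR R)) (p h : R -> R) B : measurable D -> L1 mu D p ->
 measurable_fun D h -> (forall x, D x -> `|h x| <= B) -> L1 mu D (fun x => p x*h x).
Proof.
move=> mD Lp mh bh; apply: (L1_dom mD _ _ (L1Z B mD (L1_abs mD Lp))).
 by apply: measurable_funM => //; exact: L1_meas Lp.
by move=> x Dx; rewrite normrM mulrC ler_wpM2r// bh.
Qed.

(** Multiplying [p] and [q] by the indicators of their domains makes the integrand jointly
    measurable on the plane; the factor [h] is Caratheodory and bounded by 1. *)
Lemma fub_cos (D1 D2 : set (measurableTypeR R)) (p q : R -> R) (h : R -> R -> R) :
 measurable D1 -> measurable D2 -> L1 mu D1 p -> L1 mu D2 q ->
 (forall u, continuous (h^~ u)) -> (forall x, continuous (h x)) ->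
 (forall x u, `|h x u| <= 1) ->
 \int[mu]_(x in D1) (p x * \int[mu]_(u in D2) (q u*h x u)) =
 \int[mu]_(u in D2) (q u * \int[mu]_(x in D1) (p x*h x u)).
Proof.
move=> m1 m2 Lp Lq c1 c2 h1.
have Lh1 x : L1 mu D2 (fun u => q u*h x u).
 by apply: (@L1_mulbnd _ _ _ 1) => //; exact: cont_meas.
have Lh2 u : L1 mu D1 (fun x => p x*h x u).
 by apply: (@L1_mulbnd _ _ (h^~ u) 1) => //; exact: cont_meas.
pose p' x := (\1_D1 x : R) * p x; pose q' u := (\1_D2 u : R)*q u.
have mp: measurable_fun RT p' by have := L1_meas (proj1 (L1_mkcond mu p m1) Lp).
have mq: measurable_fun RT q' by have := L1_meas (proj1 (L1_mkcond mu q m2) Lq).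
have E1: \int[mu]_(x in D1) (p x * \int[mu]_(u in D2) (q u*h x u)) =
  \int[mu]_(x in D1) \int[mu]_(u in D2) (p' x*q' u*h x u).
 apply: Rint_ext => x Dx; rewrite -(RintegralZl _ m2 (Lh1 x)); apply: Rint_ext => u Du.
 by rewrite /p' /q' !indicE !mem_set// !mul1r mulrA.
have E2: \int[mu]_(u in D2) (q u * \int[mu]_(x in D1) (p x*h x u)) =
  \int[mu]_(u in D2) \int[mu]_(x in D1) (p' x*q' u*h x u).
 apply: Rint_ext => u Du; rewrite -(RintegralZl _ m1 (Lh2 u)); apply: Rint_ext => x Dx.
 by rewrite /p' /q' !indicE !mem_set// !mul1r mulrA (mulrC (q u)).
rewrite E1 E2.
have mf: measurable_fun setT (fun z : measurableTypeR R * measurableTypeR R => p' z.1*q' z.2*h z.1 z.2).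
 apply: measurable_funM; last by apply: caratheodory_meas => // x; exact: cont_meas.
 apply: measurable_funM; [exact: (measurableT_comp mp)|exact: (measurableT_comp mq)].
apply: (Rint_fubini m1 m2 mf (L1_abs m1 Lp) (L1_abs m2 Lq)) => x u Dx Du.
rewrite /p' /q' !indicE !mem_set// !mul1r !normrM -[leRHS]mulr1.
by rewrite ler_wpM2l// mulr_ge0.
Qed.

Lemma hl_sub : L1 mu RT `<=` L1 mu (@hl R).
Proof. by move=> f Lf; apply: integrableS Lf => //; exact: hl_meas. Qed.

Lemma itv_meas (a b : R) : measurable (`[a, b]%classic : set (measurableTypeR R)).
Proof. by []. Qed.

Lemma itvE (a b x : R) : `[a, b]%classic x = (a<=x<=b) :> Prop.
Proof. by rewrite /= in_itv. Qed.

Lemma hl_lim (f : R -> R) : L1 mu (@hl R) f ->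
 \int[mu]_(x in `[0, n%:R]) f x @[n --> \oo] --> \int[mu]_(x in @hl R) f x.
Proof.
move=> Lf; rewrite (Rint_mkcond mu (@hl R)).
have L' := proj1 (L1_mkcond mu f (@hl_meas R)) Lf.
apply: seq_ext (Rint_lim L') => n.
rewrite Rint_mkcond [RHS]Rint_mkcond; apply: Rint_ext => x _.
rewrite mulrA; congr (_*_); rewrite !indicE -natrM mulnb; congr (_%:R); congr nat_of_bool.
apply/idP/idP; rewrite !inE /= !in_itv /=.
 by move=> /andP[]; rewrite !inE itvE hlE => /andP[_ ->] ->.
move=> /andP[x0 xn]; apply/andP; split; rewrite inE ?itvE ?hlE//.
by rewrite xn andbT (le_trans _ x0)// oppr_le0.
Qed.

Lemma Rint_supp (D E : set (measurableTypeR R)) (f : R -> R) : D `<=` E ->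
 (forall x, E x -> ~ D x -> f x = 0) -> \int[mu]_(x in E) f x = \int[mu]_(x in D) f x.
Proof.
move=> DE h; rewrite Rint_mkcond [RHS]Rint_mkcond; apply: Rint_ext => x _; rewrite !indicE.
case: (pselect (D x)) => Dx; first by rewrite !mem_set//; exact: DE.
rewrite (memNset Dx) mul0r; case: (pselect (E x)) => Ex; last by rewrite memNset ?mul0r.
by rewrite h// mulr0.
Qed.

Lemma expn_cvg0 (c : R) : 0<c -> expR (- c*n%:R) @[n --> \oo] --> (0 : R).
Proof.
move=> c0; apply: (bnd_cvg0 _ (pow_cvg0 c0)) => n.
rewrite ger0_norm ?expR_ge0// ler_expR !mulNr lerN2 ler_wpM2l ?(ltW c0)//.
have := @le_ln1Dx R n%:R; rewrite nat1r; apply.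
by rewrite (lt_le_trans (ltrN10 R)).
Qed.

Lemma poisson (e u : R) : 0<e ->
 \int[mu]_(x in @hl R) (expR (- e*x)*cos (u*x)) = e/(e^+2+u^+2).
Proof.
move=> e0; have d0: 0<e^+2+u^+2 by rewrite ltr_wpDr ?sqr_ge0// exprn_gt0.
have ec: continuous (fun x : R => expR (- e*x)).
 by move=> x; exact: dv_cont (dv_expR (dvM (dv_cst (- e) x) (dv_id x))).
have cc: continuous (fun x : R => cos (u*x)).
 exact: cosm_cont.
have L: L1 mu (@hl R) (fun x => expR (- e*x)*cos (u*x)).
 apply: (@L1_mulbnd _ _ _ 1); [exact: hl_meas|exact: L1_exp|by apply: cont_meas => //; exact: hl_meas|].
 by move=> x _; exact: ncos_le1.
apply: (seq_uniq (hl_lim L)).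
pose F x := expR (- e*x)*(u*sin (u*x)-e*cos (u*x))/(e^+2+u^+2).
apply: (@seq_ext _ (fun n => F n%:R+e/(e^+2+u^+2))) => [n|].
 rewrite (@ftc _ F) ?ler0n//.
 - rewrite {3}/F !mulr0 expR0 sin0 cos0 mulr0 mulr1 sub0r mul1r mulNr opprK //.
 - move=> x _.
  have du := dvM (dv_cst u x) (dv_id x); have de := dv_expR (dvM (dv_cst (- e) x) (dv_id x)).
  apply: (dv_eq (dvM (dvM de (dvD (dvM (dv_cst u x) (dv_sin du)) (dvN (dvM (dv_cst e x) (dv_cos du))))) (dv_cst (e^+2+u^+2)^-1 x))).
  field; exact: lt0r_neq0.
 - by move=> x _; apply: cvgM; [exact: ec|exact: cc].
rewrite -[X in _ --> X]add0r; apply: cvgD; last exact: cvg_cst.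
have c: (`|u| + e)/(e^+2+u^+2)*expR (- e*n%:R) @[n --> \oo] --> (0 : R).
 by rewrite -(mulr0 ((`|u| + e)/(e^+2+u^+2))); apply: cvgM; [exact: cvg_cst|exact: expn_cvg0].
apply: (bnd_cvg0 _ c) => n; rewrite /F !normrM (ger0_norm (expR_ge0 _)) (ger0_norm (_ : 0<=(_ + _)^-1)) ?invr_ge0 ?(ltW d0)//.
rewrite -mulrA mulrC ler_wpM2r ?expR_ge0// ler_wpM2r ?invr_ge0 ?(ltW d0)//.
apply: (le_trans (ler_normB _ _)); apply: lerD; rewrite normrM ?(gtr0_norm e0).
 by rewrite -[leRHS]mulr1 ler_wpM2l// nsin_le1.
by rewrite -[leRHS]mulr1 ler_wpM2l ?(ltW e0)// ncos_le1.
Qed.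

Definition p2 (x : R) := (1+x^+2)^-1.

Lemma p2_gt0 x : 0<p2 x.
Proof. by rewrite invr_gt0 ltr_pwDl// sqr_ge0. Qed.

Lemma p2_cont : continuous p2.
Proof.
move=> x; have n0: 1+x^+2 != 0 by rewrite lt0r_neq0// -invr_gt0; exact: p2_gt0.
exact: dv_cont (dvV (f := fun x : R => 1+x^+2) n0 (dvD (dv_cst 1 x) (dvX 2 (dv_id x)))).
Qed.

Lemma L1_p2 : L1 mu RT p2.
Proof.
apply: (@L1_domW _ _ 8); first exact: cont_meas p2_cont.
move=> y; rewrite gtr0_norm ?p2_gt0//; apply: le_trans (ell_Wt y).
by rewrite -[leLHS]mul1r ler_wpM2r ?ell_ge1// ltW// p2_gt0.
Qed.

Lemma itv_bounded (M : R) (w : R -> R) : 0<=M -> continuous w ->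
 exists2 B, 0<=B & forall u, 0<=u<=M -> `|w u| <= B.
Proof.
move=> M0 cw; have c' : cont_on 0 M (fun u => - `|w u|).
 by move=> x _; apply: cvgN; apply: cvg_norm; exact: cw.
have [c _ H] := EVT_min_on M0 c'; exists `|w c| => // u /H; by rewrite lerN2.
Qed.

(** The first absolute moment of [f] is a Lipschitz constant. *)
Lemma cosint_cont (D : set (measurableTypeR R)) (f : R -> R) : measurable D -> L1 mu D f ->
 L1 mu D (fun u => u*f u) -> continuous (fun x : R => \int[mu]_(u in D) (f u*cos (x*u))).
Proof.
move=> mD Lf Luf; have Lc x : L1 mu D (fun u => f u*cos (x*u)).
 apply: (@L1_mulbnd _ _ _ 1) => //; last by move=> *; exact: ncos_le1.
 by apply: cont_meas => //; exact: cosm_cont.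
apply: (@lip_cont _ (\int[mu]_(u in D) `|u*f u|)) => x y.
rewrite [leRHS]mulrC -(RB mD (Lc x) (Lc y)) -(RZ _ mD (L1_abs mD Luf)).
apply: Rint_abs_le => //; first exact: L1B.
 by apply: L1Z => //; exact: L1_abs.
move=> u _; rewrite -mulrBr normrM normrM (mulrC `|u|) mulrCA ler_wpM2l//.
by apply: (le_trans (cos_lip _ _)); rewrite -mulrBl normrM mulrC.
Qed.

(** The Fourier transform of the even extension of [w], for [w] supported in [[0, M]]. *)
Definition hat (M : R) (w : R -> R) x := 2 * \int[mu]_(u in `[0, M]) (w u*cos (x*u)).

Lemma hat_cont M w : continuous w -> continuous (hat M w).
Proof.
move=> cw x; apply: cvgM; first exact: cvg_cst.
apply: (@cosint_cont `[0, M]%classic) => //; first by apply: cont_on_L1 => u _; exact: cw.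
by apply: cont_on_L1 => u _; apply: cvgM; [exact: cvg_id|exact: cw].
Qed.

Lemma atan_cvg (c : R) : 0<c -> atan (c*n.+1%:R) @[n --> \oo] --> (pi/2 : R).
Proof.
move=> c0; apply: (@cvg_comp _ _ _ (fun n => c*n.+1%:R) atan _ (+oo%R)); last exact: cvgy_atan.
apply/cvgryPge => A; near=> n; rewrite mulrC -ler_pdivrMr//.
apply: (@le_trans _ _ n%:R); last by rewrite ler_nat.
by near: n; exact: nbhs_infty_ger.
Unshelve. all: by end_near.
Qed.

Lemma atan_le (x : R) : atan x<=pi/2.
Proof. exact/ltW/atan_ltpi2. Qed.

Lemma ccpair (e x u v : R) : 2*(e*cos (v*x)*cos (x*u)) = e*cos ((u-v)*x)+e*cos ((u+v)*x).
Proof.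
have -> : (u-v)*x = x*u-v*x by ring.
have -> : (u+v)*x = x*u+v*x by ring.
by rewrite cosB cosD; ring.
Qed.

(* Abel summation of the Fourier integral: the factor expR (- e x) turns the
   double integral into a Poisson kernel, an approximate identity. *)
Lemma inversion (w : R -> R) (M c : R) : 0<=M -> continuous w -> (forall u, M<u -> w u = 0) ->
 (forall x, `|hat M w x| <= c * p2 x) ->
 forall v, 0<=v -> w v = pi^-1 * \int[mu]_(x in @hl R) (hat M w x*cos (v*x)).
Proof.
move=> M0 cw wM bw v v0; have hm := @hl_meas R.
(* The interval must reach beyond both the support of [w] and the point [v], so that the two
   arctangents in [AE] tend to [pi/2]. *)
pose M' := M+v+1; have M'0 : 0<=M' by rewrite /M'; lra.
have hatE x : hat M w x = \int[mu]_(u in `[0, M']) (2*w u*cos (x*u)).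
 rewrite /hat (@Rint_supp `[0, M]%classic `[0, M']%classic); first last.
 - move=> u; rewrite !itvE => /andP[u0 _] h; rewrite wM ?mulr0 ?mul0r//.
  by rewrite ltNge; apply/negP => h'; apply: h; rewrite u0.
 - by move=> u; rewrite !itvE => /andP[-> h]; rewrite (le_trans h)// /M'; lra.
 rewrite -RintegralZl//; first by apply: Rint_ext => u _; rewrite mulrA.
 apply: cont_on_L1 => u _; apply: cvgM; first exact: cw.
 exact: cosm_cont.
have ccos := cosm_cont.
have Lhat: L1 mu (@hl R) (hat M w).
 apply: (L1_dom hm _ _ (L1Z c hm (hl_sub L1_p2))) => [|x _]; last exact: bw.
 by apply: cont_meas => //; exact: hat_cont.
have LI: L1 mu (@hl R) (fun x => hat M w x*cos (v*x)).
 by apply: (@L1_mulbnd _ _ _ 1) => // [|x _]; [exact: cont_meas|exact: ncos_le1].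
pose ep (k : nat) : R := k.+1%:R^-1.
have ep0 k : 0<ep k by rewrite invr_gt0.
have ce k : continuous (fun x : R => expR (- ep k*x)).
 by move=> x; exact: dv_cont (dv_expR (dvM (dv_cst (- ep k) x) (dv_id x))).
pose I k := \int[mu]_(x in @hl R) (expR (- ep k*x)*cos (v*x)*hat M w x).
have cI: I k @[k --> \oo] --> \int[mu]_(x in @hl R) (hat M w x*cos (v*x)).
 apply: (proj2 (@Rint_dct _ _ _ mu (@hl R) (fun k x => expR (- ep k*x)*cos (v*x)*hat M w x) _ (fun x => `|hat M w x|) hm _ _ (L1_abs hm Lhat) _)).
 - move=> k; apply: measurable_funM; last exact: L1_meas Lhat.
  by apply: measurable_funM; apply: cont_meas.
 - move=> x _; rewrite (mulrC (hat M w x)); apply: cvgM; last exact: cvg_cst.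
  rewrite -[X in _ --> X]mul1r; apply: cvgM; last exact: cvg_cst.
  have c0: (- x*ep k) @[k --> \oo] --> (0 : R).
   by rewrite -(mulr0 (- x)); apply: cvgM; [exact: cvg_cst|exact: cvg_harmonic].
  have c1: (- ep k*x) @[k --> \oo] --> (0 : R) by apply: seq_ext c0 => k; rewrite !mulNr mulrC.
  by rewrite -[X in _ --> X](@expR0 R); exact: (cvg_comp _ _ c1 (@continuous_expR R 0)).
 - move=> k x; rewrite hlE => x0; rewrite -[leRHS]mul1r !normrM ler_wpM2r// -[leRHS]mulr1.
  apply: ler_pM => //; last exact: ncos_le1.
  rewrite ger0_norm ?expR_ge0// -[leRHS]expR0 ler_expR mulNr oppr_le0.
  by rewrite mulr_ge0// ltW.
pose P k u := ep k/(ep k^+2+(u-v)^+2)+ep k/(ep k^+2+(u+v)^+2).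
have Le k : L1 mu (@hl R) (fun x => expR (- ep k*x)) by exact: L1_exp.
have IE k : I k = \int[mu]_(u in `[0, M']) (w u*P k u).
 have Lev: L1 mu (@hl R) (fun x => expR (- ep k*x)*cos (v*x)).
  by apply: (@L1_mulbnd _ _ _ 1) => // [|x _]; [exact: cont_meas|exact: ncos_le1].
 have Lw2: L1 mu `[0, M'] (fun u => 2*w u).
  by apply: cont_on_L1 => u _; apply: cvgM; [exact: cvg_cst|exact: cw].
 rewrite /I; under Rint_ext do rewrite hatE.
 rewrite (@fub_cos (@hl R) `[0, M']%classic _ _ (fun x u => cos (x*u)))//; first last.
 - by move=> *; exact: ncos_le1.
 - by move=> u x; under eq_fun do rewrite mulrC; exact: ccos.
 apply: Rint_ext => u _; rewrite -mulrA mulrCA; congr (_*_).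
 have La (a : R) : L1 mu (@hl R) (fun x => expR (- ep k*x)*cos (a*x)).
  by apply: (@L1_mulbnd _ _ _ 1) => // [|x _]; [exact: cont_meas|exact: ncos_le1].
 have L3: L1 mu (@hl R) (fun x => expR (- ep k*x)*cos (v*x)*cos (x*u)).
  apply: (@L1_mulbnd _ _ _ 1) => // [|x _]; last exact: ncos_le1.
  by apply: cont_meas => // x; under eq_fun do rewrite mulrC; exact: ccos.
 rewrite /P -!poisson// -RD// -(RZ _ hm L3); apply: Rint_ext => x _.
 exact: ccpair.
pose G k u := atan ((u-v)/ep k)+atan ((u+v)/ep k).
have dG k u : dv (G k) u (P k u).
 have d1 (a : R) : dv (fun u : R => atan ((u+a)/ep k)) u (ep k/(ep k^+2+(u+a)^+2)).
  have n2: ep k^+2+(u+a)^+2 != 0 by rewrite lt0r_neq0// ltr_pwDl ?sqr_ge0// exprn_gt0.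
  apply: (dv_eq (dv_comp (f := @atan R) (g := fun u : R => (u+a)/ep k) (is_derive1_atan _) (dvM (dvD (dv_id u) (dv_cst a u)) (dv_cst (ep k)^-1 u)))).
  have e0 := lt0r_neq0 (ep0 k).
  have -> : 1+((u+a)/ep k)^+2 = (ep k^+2+(u+a)^+2)/ep k^+2.
   by rewrite expr_div_n mulrDl divff ?expf_neq0.
  by rewrite invf_div; field; rewrite e0 n2.
 exact: dvD (d1 (- v)) (d1 v).
have cP k : continuous (P k).
 have c1 (a : R) : continuous (fun u : R => ep k/(ep k^+2+(u+a)^+2)).
  move=> u; have n2: ep k^+2+(u+a)^+2 != 0 by rewrite lt0r_neq0// ltr_pwDl ?sqr_ge0// exprn_gt0.
  exact: dv_cont (dvM (dv_cst (ep k) u) (dvV (f := fun u : R => ep k^+2+(u+a)^+2) n2 (dvD (dv_cst _ u) (dvX 2 (dvD (dv_id u) (dv_cst a u)))))).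
 by move=> u; apply: cvgD; exact: c1.
have P0 k u : 0<=P k u by rewrite addr_ge0// divr_ge0 ?(ltW (ep0 k))// addr_ge0 ?sqr_ge0.
pose A k := \int[mu]_(u in `[0, M']) P k u.
have AE k : A k = atan ((M'-v)*k.+1%:R)+atan ((M'+v)*k.+1%:R).
 rewrite /A (@ftc _ (G k))//; last by move=> u _; exact: cP.
 by rewrite /G /ep !invrK sub0r add0r mulNr atanN addNr subr0.
have cA: A k @[k --> \oo] --> pi.
 apply: (@seq_ext _ (fun k => atan ((M'-v)*k.+1%:R)+atan ((M'+v)*k.+1%:R))) => [k|]; first by rewrite AE.
 have -> : pi = pi/2+pi/2 :> R by field.
 by apply: cvgD; apply: atan_cvg; rewrite /M'; lra.
have A_le k : A k<=pi by rewrite AE; have := atan_le ((M'-v)*k.+1%:R); have := atan_le ((M'+v)*k.+1%:R); lra.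
have [B B0 wB] := itv_bounded M'0 cw.
have vM' : 0<=v<=M' by rewrite v0 /M'; lra.
have key eta : 0<eta -> exists C, forall k, `|I k-w v*A k| <= eta * pi+C*ep k.
 move=> eta0.
 have [d /= d0 hd] : exists2 d, 0<d & forall u, `|u-v| < d -> `|w u-w v| <= eta.
  have /cvgrPdist_le /(_ eta eta0) [d /= d0 hd] := cw v.
  by exists d => // u hu; rewrite distrC; apply: hd; rewrite /ball /= distrC.
 (* Away from [v] the oscillation [2 B] of [w] is at most [C0 (u-v)^2], and [(u-v)^2] times a
    Poisson kernel is at most [ep k]. *)
 pose C0 := 2*B/d^+2.
 have C00: 0<=C0 by apply: divr_ge0; [exact: mulr_ge0|exact: sqr_ge0].
 have wb u : 0<=u<=M' -> `|w u-w v| <= eta+C0*(u-v)^+2.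
  move=> hu; case: (ltP `|u-v| d) => h.
   by apply: (le_trans (hd _ h)); rewrite lerDl mulr_ge0 ?sqr_ge0.
  apply: (@le_trans _ _ (2*B)).
   by apply: (le_trans (ler_normB _ _)); have := wB _ hu; have := wB _ vM'; lra.
  apply: (@le_trans _ _ (C0*(u-v)^+2)); last by rewrite lerDr ltW.
  rewrite /C0 -mulrA ler_peMr ?mulr_ge0// mulrC ler_pdivlMr ?exprn_gt0// mul1r -(real_normK (num_real (u-v))).
  by apply: sq_mono => //; exact: ltW.
 exists (2*C0 * M') => k.
 have LP: L1 mu `[0, M'] (P k) by apply: cont_on_L1 => u _; exact: cP.
 have LwP: L1 mu `[0, M'] (fun u => w u*P k u) by apply: cont_on_L1 => u _; apply: cvgM; [exact: cw|exact: cP].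
 have Lc: L1 mu `[0, M'] (fun=> C0*(2*ep k)) by apply: L1_cst => //; exact: mu_itv_fin.
 rewrite IE /A -RintegralZl// -RintegralB//; last exact: L1Z.
 have -> : 2*C0 * M'*ep k = \int[mu]_(u in `[0, M']) (C0*(2*ep k)) by rewrite Rint_itv_cst//; ring.
 apply: (@le_trans _ _ (\int[mu]_(u in `[0, M']) (eta*P k u+C0*(2*ep k)))).
  apply: Rint_abs_le => //; first by apply: L1B => //; exact: L1Z.
   by apply: L1D => //; exact: L1Z.
  move=> u; rewrite itvE => hu; rewrite -mulrBl normrM (ger0_norm (P0 k u)).
  apply: (le_trans (ler_wpM2r (P0 k u) (wb u hu))); rewrite mulrDl lerD2l -mulrA ler_wpM2l//.
  case/andP: hu => u0 _.
  have q1: (u-v)^+2*(ep k/(ep k^+2+(u-v)^+2))<=ep k.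
   rewrite mulrCA -[leRHS]mulr1 ler_wpM2l ?(ltW (ep0 k))// ler_pdivrMr ?mul1r ?lerDr ?sqr_ge0//.
   by rewrite ltr_pwDl ?sqr_ge0// exprn_gt0.
  have q2: (u-v)^+2*(ep k/(ep k^+2+(u+v)^+2))<=ep k.
   rewrite mulrCA -[leRHS]mulr1 ler_wpM2l ?(ltW (ep0 k))// ler_pdivrMr ?mul1r; last by rewrite ltr_pwDl ?sqr_ge0// exprn_gt0.
   have := sqr_ge0 (ep k); move: u0 v0; clear; nra.
  by rewrite /P mulrDr; lra.
 rewrite RD//; last exact: L1Z.
 by rewrite RZ//; apply: lerD => //; rewrite ler_wpM2l ?(ltW eta0)//; exact: A_le.
have p0 := @pi_gt0 R.
suff : \int[mu]_(x in @hl R) (hat M w x*cos (v*x))-w v * pi = 0.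
 by move/eqP; rewrite subr_eq0 => /eqP ->; rewrite mulrCA mulVf ?mulr1// lt0r_neq0.
apply/eqP; rewrite -normr_eq0 eq_le normr_ge0 andbT; apply/ler_addgt0Pr => e e0; rewrite add0r.
have [C hC] := key (e/pi) (divr_gt0 e0 p0).
have c1: (e/pi * pi+C*ep k - `|I k-w v*A k|) @[k --> \oo] --> e/pi * pi+C*0 - `|\int[mu]_(x in @hl R) (hat M w x*cos (v*x))-w v * pi|.
 apply: cvgB.
  by apply: cvgD; [exact: cvg_cst|apply: cvgM; [exact: cvg_cst|exact: cvg_harmonic]].
 by apply: cvg_norm; apply: cvgB => //; apply: cvgM => //; exact: cvg_cst.
have := @seq_ge _ _ _ 0 c1; rewrite mulr0 addr0 divfK ?lt0r_neq0// subr_ge0; apply => k.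
by rewrite subr_ge0; have := hC k; rewrite divfK ?lt0r_neq0.
Qed.

End inv.

(** * Prime sums with a nonnegative cosine transform *)

Section key1.
Variable R : realType.
Notation mu := (@lebesgue_measure R).
Notation RT := (setT : set (measurableTypeR R)).
Notation vm := (@von_mangoldt R).

Lemma Rle (D : set (measurableTypeR R)) (f g : R -> R) : measurable D -> L1 mu D f -> L1 mu D g ->
 (forall x, D x -> f x<=g x) -> \int[mu]_(x in D) f x <= \int[mu]_(x in D) g x.
Proof.
move=> mD Lf Lg h; rewrite -subr_ge0 -RB//; apply: Rintegral_ge0 => x Dx.
by rewrite subr_ge0; exact: h.
Qed.

Lemma eq_le_ (x y : R) : x = y -> x<=y.
Proof. by move->. Qed.

(** The sum over prime powers minus the main term produced by the pole, as a linear functional of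
    the test function. *)
Definition Lam N (F : R -> R) := \sum_(1<=n<N.+1) vm n*F (ln n%:R) -
 \int[mu]_(v in `[0, N%:R]) (expR v*F v).

Lemma Lam_ext N F G : (forall v, 0<=v -> F v = G v) -> Lam N F = Lam N G.
Proof.
move=> h; rewrite /Lam; congr (_ - _).
 by apply: eq_big_nat => n /andP[n1 _]; rewrite h// ln_ge0// ler1n.
by apply: Rint_ext => v; rewrite itvE => /andP[v0 _]; rewrite h.
Qed.

Lemma expm_cont (F : R -> R) : continuous F -> continuous (fun v : R => expR v*F v).
Proof. by move=> cF v; apply: cvgM; [exact: continuous_expR|exact: cF]. Qed.

Lemma contL (f : R -> R) (a b : R) : continuous f -> L1 mu `[a, b] f.
Proof. by move=> cf; apply: cont_on_L1 => v _; exact: cf. Qed.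

Lemma Lam_lin N (F G : R -> R) c : continuous F -> continuous G ->
 Lam N (fun v => F v+c*G v) = Lam N F+c*Lam N G.
Proof.
move=> cF cG; have LF := contL 0 N%:R (expm_cont cF); have LG := contL 0 N%:R (expm_cont cG).
have -> : Lam N (fun v => F v+c*G v) = \sum_(1<=n<N.+1) (vm n*F (ln n%:R)+c*(vm n*G (ln n%:R))) -
  \int[mu]_(v in `[0, N%:R]) (expR v*F v+c*(expR v*G v)).
 rewrite /Lam; congr (_ - _); first by apply: eq_bigr => n _; ring.
 by apply: Rint_ext => v _; rewrite mulrDr (mulrCA c).
by rewrite big_split/= -mulr_sumr RD ?RZ//; [rewrite /Lam; ring|exact: L1Z].
Qed.

(** The functional is a finite sum minus an integral over a compact interval, so averaging it over
    frequencies is an instance of Fubini. *)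
Lemma Lam_mix (D : set (measurableTypeR R)) (k W : R -> R) (a b : R) N : measurable D -> L1 mu D k ->
 continuous W ->
 L1 mu D (fun z => k z*Lam N (fun v => W v*cos ((a+b*z)*v))) /\
 \int[mu]_(z in D) (k z*Lam N (fun v => W v*cos ((a+b*z)*v))) =
 Lam N (fun v => W v * \int[mu]_(z in D) (k z*cos ((a+b*z)*v))).
Proof.
move=> mD Lk cW.
have cc v : continuous (fun z : R => cos ((a+b*z)*v)).
 move=> z; under eq_fun do rewrite mulrDl mulrAC; exact: cosl_cont.
have cv z : continuous (fun v : R => cos ((a+b*z)*v)) by exact: cosm_cont.
have cq: continuous (fun v => expR v*W v) := expm_cont cW.
have Lq := contL 0 N%:R cq.
have Lkc v : L1 mu D (fun z => k z*cos ((a+b*z)*v)).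
 by apply: (@L1_mulbnd _ _ _ _ 1) => // [|z _]; [exact: cont_meas|exact: ncos_le1].
pose J z := \int[mu]_(v in `[0, N%:R]) (expR v*W v*cos ((a+b*z)*v)).
have Lqc z : L1 mu `[0, N%:R] (fun v => expR v*W v*cos ((a+b*z)*v)).
 by apply: contL => v; apply: cvgM; [exact: cq|exact: cv].
have LJ: L1 mu D (fun z => k z*J z).
 apply: (@L1_mulbnd _ _ _ _ (\int[mu]_(v in `[0, N%:R]) `|expR v*W v|)) => //.
  apply: cont_meas => // z; apply: (@continuous_comp _ _ _ (fun z : R => a+b*z) (fun x : R => \int[mu]_(v in `[0, N%:R]) (expR v*W v*cos (x*v)))).
   by apply: cvgD; [exact: cvg_cst|apply: cvgM; [exact: cvg_cst|exact: cvg_id]].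
  apply: (@cosint_cont _ `[0, N%:R]%classic (fun v => expR v*W v)) => //.
  by apply: contL => v; apply: cvgM; [exact: cvg_id|exact: cq].
 move=> z _; apply: Rint_abs_le => //; first exact: L1_abs.
 by move=> v _; rewrite normrM -[leRHS]mulr1 ler_wpM2l// ncos_le1.
have LS: L1 mu D (fun z => \sum_(1<=n<N.+1) vm n*W (ln n%:R)*(k z*cos ((a+b*z) * ln n%:R))).
 by apply: L1_sum => // n _; apply: L1Z.
have E z : k z*Lam N (fun v => W v*cos ((a+b*z)*v)) =
  \sum_(1<=n<N.+1) vm n*W (ln n%:R)*(k z*cos ((a+b*z) * ln n%:R))-k z*J z.
 rewrite /Lam mulrBr mulr_sumr; congr (_ - _); first by apply: eq_bigr => n _; ring.
 by congr (_*_); apply: Rint_ext => v _; rewrite mulrA.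
split; first by apply: L1_ext (L1B mD LS LJ) => z; rewrite E.
have -> : \int[mu]_(z in D) (k z*Lam N (fun v => W v*cos ((a+b*z)*v))) = \int[mu]_(z in D)
  (\sum_(1<=n<N.+1) vm n*W (ln n%:R)*(k z*cos ((a+b*z) * ln n%:R))-k z*J z) by apply: Rint_ext => z _; exact: E.
rewrite RB// Rint_sum//; last by move=> n _; exact: L1Z.
rewrite /Lam; congr (_ - _).
 by apply: eq_bigr => n _; rewrite RZ// mulrA.
rewrite /J (@fub_cos _ D `[0, N%:R]%classic k (fun v => expR v*W v) (fun z v => cos ((a+b*z)*v)))//.
 by apply: Rint_ext => v _; rewrite mulrA.
by move=> *; exact: ncos_le1.
Qed.

(** The Fourier transform of the Gaussian. Its value at 0 is positive and bounds all others; the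
    final estimate is divided by it. *)
Definition gs (u : R) := \int[mu]_z (expR (- z^+2)*cos (u*z)).

Lemma gz_cont : continuous (fun z : R => expR (- z^+2)).
Proof. by move=> z; exact: dv_cont (dv_expR (dvN (dvX 2 (dv_id z)))). Qed.

Lemma gs_cont : continuous gs.
Proof.
apply: (@cosint_cont _ RT (fun z => expR (- z^+2))) => //; first exact: L1_gauss.
apply: (@L1_domW _ _ 192).
 by apply: cont_meas => // z; apply: cvgM; [exact: cvg_id|exact: gz_cont].
move=> z; rewrite normrM (ger0_norm (expR_ge0 _)); apply: le_trans (gauss1_Wt z).
by rewrite ler_wpM2r ?expR_ge0// lerDr.
Qed.

Lemma gs_le u : `|gs u| <= gs 0.
Proof.
apply: Rint_abs_le => //.
- apply: (@L1_mulbnd _ _ _ _ 1) => //; first exact: L1_gauss.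
  by apply: cont_meas => //; exact: cosm_cont.
 by move=> z _; exact: ncos_le1.
- by apply: L1_ext (@L1_gauss R) => z; rewrite mul0r cos0 mulr1.
- by move=> z _; rewrite mul0r cos0 mulr1 normrM (ger0_norm (expR_ge0 _)) -[leRHS]mulr1 ler_wpM2l ?expR_ge0// ncos_le1.
Qed.

Lemma gs0_gt0 : 0<gs 0.
Proof.
have L: L1 mu RT (fun x => \1_`[0, 1]%classic x*expR (- 1)).
 by apply/(L1_mkcond mu (fun=> expR (- 1)) (itv_meas 0 1)); apply: L1_cst => //; exact: mu_itv_fin.
apply: (@lt_le_trans _ _ (expR (- 1))); first exact: expR_gt0.
rewrite -[leLHS]mulr1 -[X in _*X]subr0 -(@Rint_itv_cst R 0 1 (expR (- 1)))// Rint_mkcond.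
apply: Rle => //; first by apply: L1_ext (@L1_gauss R) => z; rewrite mul0r cos0 mulr1.
move=> z _; rewrite mul0r cos0 mulr1 indicE; case: (boolP (z \in _)) => h; last by rewrite mul0r expR_ge0.
rewrite mul1r ler_expR lerN2; move: h; rewrite inE itvE => /andP[z0 z1].
by rewrite expr_le1.
Qed.

Lemma gauss_cos (t b v : R) : \int[mu]_z (expR (- z^+2)*cos ((t+b*z)*v)) = cos (t*v)*gs (b*v).
Proof.
have Lc: L1 mu RT (fun z => expR (- z^+2)*cos (b*v*z)).
 apply: (@L1_mulbnd _ _ _ _ 1) => //; [exact: L1_gauss| |by move=> z _; exact: ncos_le1].
 by apply: cont_meas => //; exact: cosm_cont.
have cs: continuous (fun z : R => expR (- z^+2)*sin (b*v*z)).
 move=> z; apply: cvgM; first exact: gz_cont.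
 exact: dv_cont (dv_sin (dvM (dv_cst (b*v) z) (dv_id z))).
have Ls: L1 mu RT (fun z => expR (- z^+2)*sin (b*v*z)).
 apply: (@L1_mulbnd _ _ _ _ 1) => //; [exact: L1_gauss| |by move=> z _; exact: nsin_le1].
 by apply: cont_meas => // z; exact: dv_cont (dv_sin (dvM (dv_cst (b*v) z) (dv_id z))).
have s0: \int[mu]_z (expR (- z^+2)*sin (b*v*z)) = 0.
 by apply: Rint_odd => // z; rewrite sqrrN mulrN sinN mulrN.
have E (z : R) : expR (- z^+2)*cos ((t+b*z)*v) =
  cos (t*v)*(expR (- z^+2)*cos (b*v*z))-sin (t*v)*(expR (- z^+2)*sin (b*v*z)).
 by rewrite (_ : (t+b*z)*v = t*v+b*v*z) ?cosD; ring.
have -> : \int[mu]_z (expR (- z^+2)*cos ((t+b*z)*v)) = \int[mu]_z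
  (cos (t*v)*(expR (- z^+2)*cos (b*v*z))-sin (t*v)*(expR (- z^+2)*sin (b*v*z))) by apply: Rint_ext => z _; exact: E.
rewrite RB//; [|exact: L1Z|exact: L1Z].
by rewrite !RZ// s0 mulr0 subr0.
Qed.

(** The substitution of [L x]; 2 is the integral of [(1+u)^(-3/2)] over the half-line. *)
Lemma scaleWt (L : R) : 1/2<=L -> L1 mu (@hl R) (fun x => L*Wt (L*x)) /\
 \int[mu]_(x in @hl R) (L*Wt (L*x))<=2.
Proof.
move=> L2; have L0: 0<L by lra.
have cW: continuous (fun x : R => L*Wt (L*x)).
 move=> x; apply: cvgM; first exact: cvg_cst.
 apply: (@continuous_comp _ _ _ (fun x : R => L*x)); last exact: Wt_cont.
 by apply: cvgM; [exact: cvg_cst|exact: cvg_id].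
have LW: L1 mu (@hl R) (fun x => L*Wt (L*x)).
 have hm := @hl_meas R.
 apply: (L1_dom hm _ _ (L1Z (L*expR (3/2 * ln 2)) hm (hl_sub (@L1_Wt R)))); first exact: cont_meas.
 move=> x; rewrite hlE => x0; rewrite ger0_norm ?mulr_ge0 ?(ltW L0) ?(ltW (Wt_gt0 _))// -mulrA ler_wpM2l ?(ltW L0)//.
 have Lx: 0<=L*x by rewrite mulr_ge0// ltW.
 rewrite /Wt -expRD ler_expR (ger0_norm x0) (ger0_norm Lx).
 have : ln (1+x)<=ln 2+ln (1+L*x).
  rewrite -lnM ?posrE//; last by lra.
  rewrite ler_ln ?posrE; [|lra|by rewrite mulr_gt0//; lra].
  by move: L2 x0; clear; nra.
 by set a := ln _; set b := ln _; set c := ln _; lra.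
split=> //; apply: (seq_le (hl_lim LW)) => n.
have dW x : 0<=x<=n%:R -> dv (fun x => WF (L*x)) x (L*Wt (L*x)).
 move=> /andP[x0 _]; have Lx: 0<=L*x by rewrite mulr_ge0// ltW.
 apply: (dv_eq (dv_comp (f := @WF R) (g := fun x : R => L*x) (WF_dv _) (dvM (dv_cst L x) (dv_id x)))); first by lra.
 by rewrite /Wt (ger0_norm Lx) mul0r add0r mulr1 mulrC.
have cW' : cont_on 0 n%:R (fun x => L*Wt (L*x)) by move=> x _; exact: cW.
rewrite (ftc (ler0n R n) dW cW') mulr0 /WF addr0 ln1 mulr0 expR0 mulr1.
by have := expR_gt0 (- (1/2) * ln (1+L*n%:R) : R); lra.
Qed.

Lemma ell_scale (L x : R) : 1/2<=L -> ell x<=2*ell (L*x).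
Proof.
move=> L2; have L0: 0<L by lra.
have n0 := normr_ge0 x.
rewrite /ell normrM (gtr0_norm L0).
have l2: ln 2<=1 :> R by have := @le_ln1Dx R 1; have -> : 1+1 = 2 :> R by []; apply; lra.
have : ln (2 + `|x|)<=ln 2+ln (2+L * `|x|).
 rewrite -lnM ?posrE//; last by rewrite ltr_pwDl// mulr_ge0// ltW.
 rewrite ler_ln ?posrE; [|lra|by rewrite mulr_gt0// ltr_pwDl// mulr_ge0// ltW].
 by move: L2 n0; set y := `|x|; clear; nra.
have : 0<=ln (2+L * `|x|) by rewrite ln_ge0// -[leLHS]addr0 lerD ?ler1n// mulr_ge0// ltW.
by move: l2; set a := ln _; set b := ln _; set c := ln _; lra.
Qed.

Lemma sum_cvg (F : nat -> nat -> R) (G : nat -> R) M : (forall n, F^~ n @ \oo --> G n) ->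
 \sum_(1<=n<M.+1) F k n @[k --> \oo] --> \sum_(1<=n<M.+1) G n.
Proof.
move=> h; elim: M => [|M IH].
 by rewrite big_geq//; apply: (seq_ext (u := fun=> 0)) => [k|]; [rewrite big_geq|exact: cvg_cst].
rewrite big_nat_recr//=; apply: (seq_ext (u := fun k => \sum_(1<=n<M.+1) F k n+F k M.+1)) => [k|].
 by rewrite [RHS]big_nat_recr.
by apply: cvgD => //; exact: h.
Qed.

(** By inversion, [w] is a superposition of cosines with nonnegative density [K = hat L w / pi].
    Averaging the one-sided bound of [KL] against [K] inserts [w], and the decay of [hat L w] makes
    [K ell] integrable. *)
Theorem KEY1 : riemann_hypothesis R -> exists2 A, 0<=A & forall (C L : R) (w : R -> R) (N0 : nat),
 0<=C -> 1/2<=L -> L<ln N0.+1%:R -> continuous w -> (forall u, L<u -> w u = 0) ->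
 (forall x, 0<=hat L w x<=C*(L * p2 (L*x))) -> forall t : R,
 \sum_(1<=n<N0.+1) vm n*(expR (- (1/2) * ln n%:R)*w (ln n%:R)*cos (t * ln n%:R)) <=
 A*C*ell t + \int[mu]_(v in `[0, L]) (expR (v/2)*w v*cos (t*v)).
Proof.
move=> /KL [A A0 KLA]; have g0 := gs0_gt0; have hm := @hl_meas R.
have p0 := @pi_gt0 R.
exists (A*(pi^-1*32)/gs 0); first by rewrite divr_ge0 ?(ltW g0)// mulr_ge0// mulr_ge0// invr_ge0 ltW.
move=> C L w N0 C0 L2 LN cw wL hw t.
have L0: 0<L by lra.
pose K x := pi^-1*hat L w x.
have K0 x : 0<=K x by case/andP: (hw x) => h _; rewrite mulr_ge0// invr_ge0 ltW.
have Kc: continuous K by move=> x; apply: cvgM; [exact: cvg_cst|exact: hat_cont].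
have [LWt IWt] := scaleWt L2.
have Kell x : K x*ell x<=pi^-1*(16*C)*(L*Wt (L*x)).
 rewrite /K -[leLHS]mulrA -[leRHS]mulrA ler_wpM2l ?invr_ge0 ?(ltW p0)//.
 case/andP: (hw x) => h0 h1.
 have e1 := ell_scale x L2; have e2 := ell_Wt (L*x); have e3 := ell_ge1 x.
 apply: (le_trans (ler_pM h0 (le_trans ler01 e3) h1 e1)).
 have -> : C*(L * p2 (L*x))*(2*ell (L*x)) = 2*C*L*(ell (L*x)/(1+(L*x)^+2)) by rewrite /p2; ring.
 have -> : 16*C*(L*Wt (L*x)) = 2*C*L*(8*Wt (L*x)) by ring.
 by rewrite ler_wpM2l// mulr_ge0 ?(ltW L0)// mulr_ge0.
have mKe: measurable_fun (@hl R : set (measurableTypeR R)) (fun x => K x*ell x).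
 apply: cont_meas => // x; apply: cvgM; first exact: Kc.
 have c2: continuous (fun x : R => 2 + `|x|) by move=> y; apply: cvgD; [exact: cvg_cst|exact: norm_continuous].
 apply: cvgD; first exact: cvg_cst.
 apply: (@continuous_comp _ _ _ (fun x : R => 2 + `|x|) (@ln R)); first exact: c2.
 by apply: continuous_ln; rewrite ltr_pwDl.
have Ke0 x : 0<=K x*ell x by rewrite mulr_ge0// (le_trans ler01)// ell_ge1.
have LKe: L1 mu (@hl R) (fun x => K x*ell x).
 apply: (L1_dom hm mKe _ (L1Z (pi^-1*(16*C)) hm LWt)) => x _.
 by rewrite ger0_norm//; exact: Kell.
have IKe: \int[mu]_(x in @hl R) (K x*ell x)<=pi^-1*32*C.
 apply: (@le_trans _ _ (\int[mu]_(x in @hl R) (pi^-1*(16*C)*(L*Wt (L*x))))).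
  by apply: Rle => //; exact: L1Z.
 rewrite RZ// (_ : pi^-1*32*C = pi^-1*(16*C)*2); last by ring.
 by rewrite ler_wpM2l// mulr_ge0 ?mulr_ge0// invr_ge0 ltW.
have LK: L1 mu (@hl R) K.
 apply: (L1_dom hm _ _ LKe) => [|x _]; first exact: cont_meas.
 by rewrite ger0_norm// -[leLHS]mulr1 ler_wpM2l// ell_ge1.
have LhL: L1 mu (@hl R) (hat L w).
 by apply: L1_ext (L1Z pi hm LK) => x; rewrite /K mulrA divff ?mul1r// lt0r_neq0.
have inv v : 0<=v -> \int[mu]_(x in @hl R) (K x*cos (v*x)) = w v.
 move=> v0; rewrite (@inversion _ w L (C*L*(1+L^-1^+2)) (ltW L0) cw wL _ v v0); last first.
  move=> x; case/andP: (hw x) => h0 h1; rewrite ger0_norm//; apply: (le_trans h1).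
  have -> : C*(L * p2 (L*x)) = C*L * p2 (L*x) by ring.
  rewrite -[leRHS]mulrA ler_wpM2l ?mulr_ge0 ?(ltW L0)//.
  rewrite /p2 -[leLHS]div1r ler_pdivrMr ?ltr_pwDl ?sqr_ge0// mulrAC ler_pdivlMr ?ltr_pwDl ?sqr_ge0// mul1r.
  have -> : (1+L^-1^+2)*(1+(L*x)^+2) = 1+L^-1^+2+(L*x)^+2+x^+2 by field; exact: lt0r_neq0.
  by have := sqr_ge0 (L*x); have := sqr_ge0 (L^-1); lra.
 have Lhc: L1 mu (@hl R) (fun x => hat L w x*cos (v*x)).
  apply: (@L1_mulbnd _ _ _ _ 1) => // [|x _]; last exact: ncos_le1.
  by apply: cont_meas => //; exact: cosm_cont.
 by rewrite -(RZ _ hm Lhc); apply: Rint_ext => x _; exact/esym/mulrA.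
(* The abscissa approaches 1/2 from the right while the Gaussian, with [lam = k+1], narrows: its
   factor [gs (v/(k+1))] tends to the constant [gs 0]. *)
pose s k : R := 1/2+1/2/k.+1%:R.
pose W k v := expR (- s k*v)*gs (k.+1%:R^-1*v).
have cW k : continuous (W k).
 move=> v; apply: cvgM; first exact: dv_cont (dv_expR (dvM (dv_cst (- s k) v) (dv_id v))).
 apply: (@continuous_comp _ _ _ (fun v : R => k.+1%:R^-1*v)); last exact: gs_cont.
 by apply: cvgM; [exact: cvg_cst|exact: cvg_id].
have ctc (b : R) : continuous (fun v : R => cos (b*v)) by exact: cosm_cont.
pose F k v := W k v*cos (t*v)*w v.
have lin_pos v (x : R) : cos ((t+x)*v)+cos ((t-x)*v) = 2*(cos (t*v)*cos (x*v)).
 by rewrite mulrDl mulrBl cosD cosB; ring.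
have step k : exists2 err : nat -> R, err @ \oo --> (0 : R) &
  forall N, Lam N (F k)<=A*ell t*(pi^-1*32*C)+err N * \int[mu]_(x in @hl R) K x.
 have sk: 1/2<s k<=1.
  rewrite /s ltrDl divr_gt0//=; have : 1/2/k.+1%:R<=1/2 :> R.
   by rewrite ler_pdivrMr// ler_peMr// ler1n.
  by move=> h; apply: (le_trans (lerD (lexx (1/2)) h)); lra.
 have lk: 1<=k.+1%:R :> R by rewrite ler1n.
 have [err cerr herr] := KLA _ _ sk lk; exists err => // N.
 have ces: continuous (fun v : R => expR (- s k*v)).
  by move=> v; exact: dv_cont (dv_expR (dvM (dv_cst (- s k) v) (dv_id v))).
 have hS tau : Lam N (fun v => W k v*cos (tau*v))<=A*ell tau+err N.
  apply: le_trans (herr N tau).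
  have [_ E] := Lam_mix tau k.+1%:R^-1 N measurableT (@L1_gauss R) ces.
  have -> : \int[mu]_z (Sf (s k) N (tau+z/k.+1%:R)*expR (- z^+2)) = \int[mu]_z
    (expR (- z^+2)*Lam N (fun v => expR (- s k*v)*cos ((tau+k.+1%:R^-1*z)*v))).
   apply: Rint_ext => z _; rewrite mulrC (mulrC z); congr (_*_); rewrite /Sf /Lam /Ds; congr (_ - _).
    by apply: eq_bigr => n _; rewrite /nk addr0.
   by apply: Rint_ext => v _; rewrite mulrBl mul1r expRD mulrA mulNr.
  rewrite E; apply: eq_le_; apply: Lam_ext => v _.
  by rewrite gauss_cos /W -mulrA (mulrC (cos _)).
 have cWt: continuous (fun v : R => W k v*cos (t*v)) by move=> v; apply: cvgM; [exact: cW|exact: ctc].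
 have [LM EM] := Lam_mix 0 1 N hm LK cWt.
 have cWc (b : R) : continuous (fun v : R => W k v*cos (b*v)) by move=> v; apply: cvgM; [exact: cW|exact: ctc].
 have -> : Lam N (F k) = \int[mu]_(z in @hl R) (K z*Lam N (fun v => W k v*cos (t*v)*cos ((0+1*z)*v))).
  rewrite EM; apply: Lam_ext => v v0; rewrite /F; congr (_*_); rewrite -inv//.
  by apply: Rint_ext => x _; rewrite add0r mul1r (mulrC x).
 have -> : A*ell t*(pi^-1*32*C)+err N * \int[mu]_(x in @hl R) K x =
   A*ell t*(pi^-1*32*C) + \int[mu]_(x in @hl R) (err N*K x) by rewrite RZ.
 apply: (@le_trans _ _ (\int[mu]_(x in @hl R) (A*ell t*(K x*ell x)+err N*K x))); last first.
  rewrite RD//; [|exact: L1Z|exact: L1Z]; rewrite lerD2r RZ// ler_wpM2l// mulr_ge0//.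
  by rewrite (le_trans ler01)// ell_ge1.
 suff ptw (x : R) : K x*Lam N (fun v => W k v*cos (t*v)*cos ((0+1*x)*v))<=A*ell t*(K x*ell x)+err N*K x.
  by apply: Rle => //; apply: L1D => //; exact: L1Z.
 rewrite add0r mul1r (_ : A*ell t*(K x*ell x)+err N*K x = K x*(A*(ell t*ell x)+err N)); last by ring.
 rewrite ler_wpM2l//.
 (* The product of two cosines splits into the frequencies [t+x] and [t-x], at each of which [KL]
    applies with a loss of at most [ell t * ell x]. *)
 have E2: 2*Lam N (fun v => W k v*cos (t*v)*cos (x*v)) =
   Lam N (fun v => W k v*cos ((t+x)*v))+Lam N (fun v => W k v*cos ((t-x)*v)).
  have := Lam_lin N 1 (cWc (t+x)) (cWc (t-x)); rewrite mul1r => <-.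
  have cW2: continuous (fun v : R => W k v*cos (t*v)*cos (x*v)) by move=> v; apply: cvgM; [exact: cWt|exact: ctc].
  have E0 := Lam_lin N 1 cW2 cW2; rewrite mul1r in E0; rewrite mulr_natl mulr2n -E0.
  by apply: Lam_ext => v _; rewrite (mulrDl t x v) (mulrBl v t x) cosD cosB; ring.
 have e1 := ell_add t x; have e2: ell (t-x)<=ell t*ell x.
  by rewrite -(_ : ell (- x) = ell x); [exact: ell_add|rewrite /ell normrN].
 have := hS (t+x); have := hS (t-x); have := ler_wpM2l A0 e1; have := ler_wpM2l A0 e2.
 by move: E2; lra.
have Fv k v : L<v -> F k v = 0 by move=> /wL h; rewrite /F h mulr0.
have [M M1 M2] : exists2 M, (N0<=M)%N & L<=M%:R.
 exists (maxn N0 (Num.truncn L).+1); first exact: leq_maxl.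
 have /andP[_ h] := truncn_itv (ltW L0).
 by apply: (le_trans (ltW h)); rewrite ler_nat leq_maxr.
pose Lk k := \sum_(1<=n<N0.+1) vm n*F k (ln n%:R) - \int[mu]_(v in `[0, L]) (expR v*F k v).
(* [F k] vanishes beyond [L], so the functional no longer depends on [N]; letting [N] grow then
   removes [err] alone. *)
have LamE k j : Lam (M+j)%N (F k) = Lk k.
 rewrite /Lam /Lk; congr (_ - _).
  rewrite (@big_cat_nat _ _ _ N0.+1)//=; last by rewrite ltnS (leq_trans M1)// leq_addr.
  rewrite [X in _+X]big1_seq ?addr0// => n /andP[_]; rewrite mem_index_iota => /andP[n1 _].
  rewrite Fv ?mulr0//; apply: (lt_le_trans LN); rewrite ler_ln ?posrE ?ltr0n// ?ler_nat//.
  exact: leq_trans n1.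
 apply: Rint_supp => v; rewrite !itvE.
  by move=> /andP[-> h]; rewrite (le_trans h)// natrD (le_trans M2)// lerDl.
 move=> /andP[v0 _] h; rewrite Fv ?mulr0// ltNge; apply/negP => h'; apply: h.
 by rewrite v0.
have LkB k : Lk k<=A*ell t*(pi^-1*32*C).
 have [err cerr herr] := step k.
 have c1: A*ell t*(pi^-1*32*C)+err (M+j)%N * \int[mu]_(x in @hl R) K x @[j --> \oo] -->
   A*ell t*(pi^-1*32*C)+0 * \int[mu]_(x in @hl R) K x.
  apply: cvgD; first exact: cvg_cst; apply: cvgM; last exact: cvg_cst.
  exact: (cvg_comp _ _ (cvg_addnl M) cerr).
 by have := @seq_ge _ _ _ (Lk k) c1; rewrite mul0r addr0; apply => j; rewrite -(LamE k j).
have cs0: s k @[k --> \oo] --> (1/2 : R).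
 rewrite -[X in _ --> X]addr0; apply: cvgD; first exact: cvg_cst.
 by rewrite -(mulr0 (1/2)); apply: cvgM; [exact: cvg_cst|exact: cvg_harmonic].
have cWk v : W k v @[k --> \oo] --> expR (- (1/2)*v)*gs 0.
 apply: cvgM.
  have c1: (- s k*v) @[k --> \oo] --> (- (1/2)*v) by apply: cvgM; [exact: cvgN|exact: cvg_cst].
  exact: (cvg_comp _ _ c1 (@continuous_expR R _)).
 have c1: (k.+1%:R^-1*v) @[k --> \oo] --> (0 : R).
  by rewrite -(mul0r v); apply: cvgM; [exact: cvg_harmonic|exact: cvg_cst].
 exact: (cvg_comp _ _ c1 (@gs_cont 0)).
have cFk v : F k v @[k --> \oo] --> expR (- (1/2)*v)*gs 0*cos (t*v)*w v.
 by apply: cvgM; [apply: cvgM|]; [exact: cWk|exact: cvg_cst|exact: cvg_cst].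
have cF k : continuous (F k) by move=> v; apply: cvgM; [apply: cvgM; [exact: cW|exact: ctc]|exact: cw].
have Lew: L1 mu `[0, L] (fun v => expR v*w v) by apply: contL; exact: expm_cont.
have dom k (v : R) : `[0, L]%classic v -> `|expR v*F k v| <= gs 0 * `|expR v*w v|.
 rewrite itvE => /andP[v0 _]; rewrite /F /W !normrM.
 have h1: `|expR (- s k*v)| <= 1.
  rewrite ger0_norm ?expR_ge0// -[leRHS]expR0 ler_expR mulNr oppr_le0 mulr_ge0// /s.
  by rewrite addr_ge0// divr_ge0.
 have h2 := gs_le (k.+1%:R^-1*v); have h3 := ncos_le1 (t*v).
 have h4: `|expR (- s k*v)| * `|gs (k.+1%:R^-1*v)| <= 1*gs 0 by apply: ler_pM.
 have h5: `|expR (- s k*v)| * `|gs (k.+1%:R^-1*v)| * `|cos (t*v)| <= 1*gs 0*1.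
  by apply: ler_pM => //; rewrite mulr_ge0.
 rewrite mul1r mulr1 in h5.
 have -> : gs 0*(`|expR v| * `|w v|) = `|expR v| * (gs 0 * `|w v|) by ring.
 by rewrite ler_wpM2l// ler_wpM2r.
have [_ cI] := @Rint_dct _ _ _ mu `[0, L]%classic (fun k v => expR v*F k v)
  (fun v => expR v*(expR (- (1/2)*v)*gs 0*cos (t*v)*w v)) (fun v => gs 0 * `|expR v*w v|)
  (itv_meas 0 L) (fun k => L1_meas (contL 0 L (expm_cont (cF k))))
  (fun v _ => cvgM (cvg_cst (expR v)) (cFk v)) (L1Z (gs 0) (itv_meas 0 L) (L1_abs (itv_meas 0 L) Lew)) dom.
have cLk: Lk k @[k --> \oo] --> \sum_(1<=n<N0.+1) vm n*(expR (- (1/2) * ln n%:R)*gs 0*cos (t * ln n%:R)*w (ln n%:R)) -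
  \int[mu]_(v in `[0, L]) (expR v*(expR (- (1/2)*v)*gs 0*cos (t*v)*w v)).
 apply: cvgB; last exact: cI.
 by apply: (@sum_cvg (fun k n => vm n*F k (ln n%:R))) => n; apply: cvgM; [exact: cvg_cst|exact: cFk].
have := seq_le cLk LkB.
have -> : \int[mu]_(v in `[0, L]) (expR v*(expR (- (1/2)*v)*gs 0*cos (t*v)*w v)) =
  gs 0 * \int[mu]_(v in `[0, L]) (expR (v/2)*w v*cos (t*v)).
 rewrite -RZ//; last first.
  apply: contL => v; apply: cvgM; last exact: ctc.
  by apply: cvgM; [exact: dv_cont (dv_expR (dvM (dv_id v) (dv_cst 2^-1 v)))|exact: cw].
 apply: Rint_ext => v _; rewrite (_ : expR (v/2) = expR v*expR (- (1/2)*v)); first by ring.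
 by rewrite -expRD; congr expR; field.
have -> : \sum_(1<=n<N0.+1) vm n*(expR (- (1/2) * ln n%:R)*gs 0*cos (t * ln n%:R)*w (ln n%:R)) =
  gs 0 * \sum_(1<=n<N0.+1) vm n*(expR (- (1/2) * ln n%:R)*w (ln n%:R)*cos (t * ln n%:R)).
 by rewrite mulr_sumr; apply: eq_bigr => n _; ring.
rewrite -mulrBr mulrC -ler_pdivlMr// lerBlDr => h; apply: (le_trans h).
by rewrite lerD2r; apply: eq_le_; ring.
Qed.

End key1.

(** * Positive kernels with compactly supported transform *)

Section kernels.
Variable R : realType.
Notation mu := (@lebesgue_measure R).
Notation RT := (setT : set (measurableTypeR R)).

(** The base point lies at -1 so that the derivative at 0 is two-sided. *)
Lemma prim (f : R -> R) : continuous f -> exists G : R -> R, forall x, 0<=x -> dv G x (f x).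
Proof.
move=> cf; exists (fun x => \int[mu]_(t in `[-1, x]) f t) => x x0.
have [d E] := @continuous_FTC1 R f (BLeft (-1)) x (x+1) (ltr_pwDr ltr01 (lexx x)) (contL (-1) (x+1) cf)
 (lt_le_trans (ltrN10 R) x0) (cf x).
by apply: DeriveDef; [exact: d|rewrite -derive1E; exact: E].
Qed.

Definition tri (u : R) := Num.max 0 (1 - `|u|).
(** The modulation adds to the Fejer kernel two half-weight translates by [pi] and [- pi], which
    fill its zeros; the support stays in [[-1, 1]]. *)
Definition kap (u : R) := tri u*(1+cos (pi*u)).

Lemma tri_cont : continuous tri.
Proof.
move=> u; apply: (@continuous_comp _ _ _ (fun u : R => 1 - `|u|) (Num.max 0)).
 by apply: cvgB; [exact: cvg_cst|exact: norm_continuous].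
apply: (@lip_cont _ _ 1) => x y; rewrite mul1r.
have := ler_norm (x-y); have := ler_norm (y-x); rewrite distrC.
by case: (leP 0 x) => hx; case: (leP 0 y) => hy; move=> h1 h2; rewrite ler_norml; lra.
Qed.

Lemma kap_cont : continuous kap.
Proof.
move=> u; apply: cvgM; first exact: tri_cont.
by apply: cvgD; [exact: cvg_cst|exact: cosm_cont].
Qed.

Lemma triE u : 0<=u<=1 -> tri u = 1-u.
Proof. by move=> /andP[u0 u1]; rewrite /tri ger0_norm// max_r// subr_ge0. Qed.

Lemma tri0 u : 1 < `|u| -> tri u = 0.
Proof. by move=> h; rewrite /tri max_l// subr_le0 ltW. Qed.

Lemma kap_ge0 u : 0<=kap u.
Proof.
apply: mulr_ge0; first by rewrite /tri le_max lexx.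
by have := ncos_le1 (pi*u); rewrite ler_norml => /andP[]; lra.
Qed.

(** The Fejer kernel. Multiplied by [x^2], its closed form also covers [x = 0]. *)
Lemma hat_tri (x : R) : 0<=hat 1 tri x<=1 /\ x^+2*hat 1 tri x = 2*(1-cos x).
Proof.
have E: hat 1 tri x = 2 * \int[mu]_(u in `[0, 1]) ((1-u)*cos (x*u)).
 by congr (_*_); apply: Rint_ext => u; rewrite itvE => hu; rewrite triE.
have c1: continuous (fun u : R => (1-u)*cos (x*u)).
 move=> u; apply: cvgM; last exact: cosm_cont.
 by apply: cvgB; [exact: cvg_cst|exact: cvg_id].
have c2: continuous (fun u : R => 1-u) by move=> u; apply: cvgB; [exact: cvg_cst|exact: cvg_id].
have I1: \int[mu]_(u in `[0, 1]) (1-u) = 1/2.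
 rewrite (@ftc _ (fun u : R => u-u^+2/2))//; first by field.
  move=> u _; apply: (dv_eq (dvD (dv_id u) (dvN (dvM (dvX 2 (dv_id u)) (dv_cst 2^-1 u))))).
  by rewrite /= expr1 mulr0 addr0 mulr1; field.
 by move=> u _; exact: c2.
have up: hat 1 tri x<=1.
 have h: \int[mu]_(u in `[0, 1]) ((1-u)*cos (x*u))<=1/2.
  have pw (u : R) : 0<=u<=1 -> (1-u)*cos (x*u)<=1-u.
   by move=> /andP[_ u1]; rewrite -[leRHS]mulr1 ler_wpM2l ?subr_ge0// cos_le1.
  by rewrite -I1; apply: Rle; [exact: itv_meas|exact: contL|exact: contL|move=> u; rewrite itvE; exact: pw].
 by rewrite E; apply: (le_trans (ler_wpM2l (ler0n R 2) h)); rewrite mul1r divff// pnatr_eq0.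
have sq: x^+2*hat 1 tri x = 2*(1-cos x).
 have [->|x0] := eqVneq x 0; first by rewrite cos0 subrr expr0n/= mul0r mulr0.
 pose F u := (1-u)*sin (x*u)/x-cos (x*u)/x^+2.
 have dF u : 0<=u<=1 -> dv F u ((1-u)*cos (x*u)).
  move=> _; have dx := dvM (dv_cst x u) (dv_id u).
  apply: (dv_eq (dvD (dvM (dvM (dvD (dv_cst 1 u) (dvN (dv_id u))) (dv_sin dx)) (dv_cst x^-1 u)) (dvN (dvM (dv_cos dx) (dv_cst (x^+2)^-1 u))))).
  by field.
 have cF: cont_on 0 1 (fun u : R => (1-u)*cos (x*u)) by move=> u _; exact: c1.
 rewrite E (ftc ler01 dF cF) /F !mulr0 sin0 cos0 mulr1 subrr.
 by field.
split=> //; rewrite up andbT.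
have [x0|x0] := eqVneq x 0.
 rewrite E x0 mulr_ge0//; apply: Rintegral_ge0 => u; rewrite itvE => /andP[_ u1].
 by rewrite mul0r cos0 mulr1 subr_ge0.
have : 0<=x^+2*hat 1 tri x.
 by rewrite sq mulr_ge0// subr_ge0 cos_le1.
by rewrite pmulr_rge0// exprn_even_gt0.
Qed.

Definition Ek (x : R) := hat 1 kap x.

Lemma EkE x : Ek x = hat 1 tri x+(hat 1 tri (x+pi)+hat 1 tri (x-pi))/2.
Proof.
have ct (a : R) : continuous (fun u : R => tri u*cos (a*u)).
 by move=> u; apply: cvgM; [exact: tri_cont|exact: cosm_cont].
have E (u : R) : kap u*cos (x*u) = tri u*cos (x*u)+2^-1*(tri u*cos ((x+pi)*u)+tri u*cos ((x-pi)*u)).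
 by rewrite mulrDl mulrBl cosD cosB /kap; field.
rewrite /Ek /hat.
have -> : \int[mu]_(u in `[0, 1]) (kap u*cos (x*u)) = \int[mu]_(u in `[0, 1])
  (tri u*cos (x*u)+2^-1*(tri u*cos ((x+pi)*u)+tri u*cos ((x-pi)*u))) by apply: Rint_ext => u _; exact: E.
have L (a : R) := contL 0 1 (ct a).
rewrite RD//; last by apply: L1Z => //; exact: L1D.
by rewrite RZ ?RD//; [field|exact: L1D].
Qed.

Lemma pi_le4 : pi<=4 :> R.
Proof. by have /andP[_ h] := @pihalf_02 R; have := ltW h; lra. Qed.

(** 170 = 5 + (5 * 33 + 5 * 33)/2: a Fejer kernel is at most [5 p2], and a translation by at most 4,
    hence by [pi], changes [p2] by a factor at most 33. *)
Lemma Ek_le x : Ek x<=170 * p2 x.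
Proof.
have tb (y : R) : hat 1 tri y<=5 * p2 y.
 rewrite /p2 ler_pdivlMr ?ltr_pwDl ?sqr_ge0// mulrC mulrDl mul1r.
 have [/andP[_ h1] ->] := hat_tri y; have := ncos_le1 y; rewrite ler_norml => /andP[h2 _]; lra.
have sb (y a : R) : `|a| <= 4 -> p2 (y+a)<=33 * p2 y.
 move=> ha; rewrite /p2 ler_pdivlMr ?ltr_pwDl ?sqr_ge0// mulrC ler_pdivrMr ?ltr_pwDl ?sqr_ge0//.
 have : a^+2<=16 by rewrite -(real_normK (num_real a)) (_ : 16 = 4^+2) ?sq_mono//; ring.
 by have := sqr_ge0 (y+a+a); have := sqr_ge0 (y+a); clear; nra.
have p0 := @pi_gt0 R; have p4 := pi_le4.
have h1 := sb x pi; rewrite (gtr0_norm p0) in h1; have h2 := sb x (- pi); rewrite normrN (gtr0_norm p0) in h2.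
have := tb x; have := tb (x+pi); have := tb (x-pi); have := h1 p4; have := h2 p4.
rewrite EkE; have := p2_gt0 x.
by set a := p2 x; set b := p2 (x+pi); set c := p2 (x-pi); set d := hat _ _ _; set e := hat _ _ _; set f := hat _ _ _; clear; lra.
Qed.

(** The numerators [2 (1 - cos x)] and [2 (1 + cos x)] of the original and the translated kernels
    add up to 4, so [Ek] has no zeros and is comparable to [p2]. *)
Lemma Ek_ge x : p2 x<=8*Ek x.
Proof.
have n0 := normr_ge0 x; have p0 := @pi_gt0 R; have p4 := pi_le4.
have sb (a : R) : `|a| <= 4 -> (x+a)^+2<=(`|x| + 4)^+2.
 move=> ha; rewrite -(real_normK (num_real (x+a))) sq_mono//.
 by apply: (le_trans (ler_normD _ _)); rewrite lerD2l.
have h0 := sb 0; rewrite normr0 addr0 in h0.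
have h1 := sb pi; rewrite (gtr0_norm p0) in h1; have h2 := sb (- pi); rewrite normrN (gtr0_norm p0) in h2.
have [/andP[a0 _] e0] := hat_tri x; have [/andP[a1 _] e1] := hat_tri (x+pi); have [/andP[a2 _] e2] := hat_tri (x-pi).
have k0 := ler_wpM2r a0 (h0 (ler0n _ 4)); have k1 := ler_wpM2r a1 (h1 p4); have k2 := ler_wpM2r a2 (h2 p4).
rewrite e0 in k0; rewrite e1 cosDpi in k1; rewrite e2 cosB cospi sinpi in k2.
have x2: `|x| ^+ 2 = x^+2 by rewrite real_normK// num_real.
have key: 4<=(`|x| + 4)^+2*Ek x.
 rewrite EkE; move: k0 k1 k2; set q := (`|x| + 4)^+2; clear; lra.
have qb: (`|x| + 4)^+2<=32*(1+x^+2) by rewrite -x2; move: n0; set y := `|x|; clear; nra.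
rewrite /p2 -[leLHS]mul1r ler_pdivrMr ?ltr_pwDl ?sqr_ge0//.
have E0: 0<=Ek x by rewrite EkE addr_ge0// divr_ge0// addr_ge0.
have := ler_wpM2r E0 qb; move: key; set q := _^+2; set e := Ek x; set y := x^+2; clear; lra.
Qed.

Lemma Ek_gt0 x : 0<Ek x.
Proof. by have := Ek_ge x; have := p2_gt0 x; lra. Qed.

Lemma Ek_cont : continuous Ek.
Proof. exact: hat_cont kap_cont. Qed.

Lemma Ekn_cont n : continuous (fun x => Ek x^+n).
Proof. by move=> x; apply: (@continuous_comp _ _ _ Ek (fun y : R => y^+n)); [exact: Ek_cont|exact: exprn_continuous]. Qed.

Lemma p2_le1 (x : R) : p2 x<=1.
Proof. by rewrite /p2 invf_le1 ?ltr_pwDl ?sqr_ge0// lerDl sqr_ge0. Qed.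

Lemma Ekn_le n x : Ek x^+n.+1<=170^+n.+1 * p2 x.
Proof.
have h: Ek x^+n.+1<=(170 * p2 x)^+n.+1.
 by rewrite lerXn2r// ?nnegrE ?(ltW (Ek_gt0 x)) ?mulr_ge0// ?(ltW (p2_gt0 x))//; exact: Ek_le.
apply: (le_trans h); rewrite exprMn ler_wpM2l ?exprn_ge0// exprS -[leRHS]mulr1.
by rewrite ler_wpM2l ?(ltW (p2_gt0 x))// exprn_ile1 ?(ltW (p2_gt0 x)) ?p2_le1.
Qed.

Lemma Ekn_L1 n : L1 mu RT (fun x => Ek x^+n.+1).
Proof.
apply: (L1_dom measurableT _ _ (L1Z (170^+n.+1) measurableT (@L1_p2 R))) => [|x _].
 by apply: cont_meas => //; exact: Ekn_cont.
by rewrite ger0_norm ?exprn_ge0 ?(ltW (Ek_gt0 x))//; exact: Ekn_le.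
Qed.

Lemma p2_mom (x : R) n : 0<=x -> p2 x^+n*(1+x)^+n<=2^+n.
Proof.
move=> x0; rewrite -exprMn lerXn2r// ?nnegrE ?mulr_ge0 ?(ltW (p2_gt0 x)) ?addr_ge0//.
rewrite mulrC /p2 ler_pdivrMr ?ltr_pwDl ?sqr_ge0//.
by have := sqr_ge0 (x-1); move: x0; clear; nra.
Qed.

(** [n] of the [n+1] factors absorb the growth, each through [p2 x * (1+x) <= 2]; the last one is
    kept for integrability. 340 is twice 170. *)
Lemma Ekn_mom n (x : R) : 0<=x -> Ek x^+n.+1*(1+x)^+n<=340^+n.+1 * p2 x.
Proof.
move=> x0; have p0 := ltW (p2_gt0 x); have e0 := ltW (Ek_gt0 x).
have h: Ek x^+n.+1<=(170 * p2 x)^+n.+1.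
 by rewrite lerXn2r// ?nnegrE ?mulr_ge0//; exact: Ek_le.
have x1: 0<=(1+x)^+n by rewrite exprn_ge0// addr_ge0.
apply: (le_trans (ler_wpM2r x1 h)); rewrite exprMn (exprS (p2 x)).
have := p2_mom n x0; rewrite -!mulrA => h2.
apply: (@le_trans _ _ (170^+n.+1*(p2 x*2^+n))).
 by rewrite ler_wpM2l ?exprn_ge0// ler_wpM2l.
rewrite mulrCA mulrC ler_wpM2r// (_ : 340 = 170*2); last by ring.
by rewrite [leRHS]exprMn ler_wpM2l ?exprn_ge0// ler_weXn2l// ler1n.
Qed.

Lemma Ekn_momL1 n : L1 mu (@hl R) (fun x => Ek x^+n.+1*(1+x)^+n).
Proof.
have hm := @hl_meas R.
apply: (L1_dom hm _ _ (L1Z (340^+n.+1) hm (hl_sub (@L1_p2 R)))) => [|x].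
 apply: cont_meas => // x; apply: cvgM; first exact: Ekn_cont.
 apply: (@continuous_comp _ _ _ (fun x : R => 1+x) (fun y : R => y^+n)); last exact: exprn_continuous.
 by apply: cvgD; [exact: cvg_cst|exact: cvg_id].
rewrite hlE => x0; rewrite ger0_norm; first exact: Ekn_mom.
by rewrite mulr_ge0 ?exprn_ge0 ?(ltW (Ek_gt0 x))// addr_ge0.
Qed.

(** The Fourier transform of the n-th power of [Ek]. It is a convolution power of [kap] up to
    constants, hence nonnegative and supported in [[-n, n]]. *)
Definition be n (u : R) := 2 * \int[mu]_(x in @hl R) (Ek x^+n*cos (u*x)).

Lemma EcL n (u : R) : L1 mu (@hl R) (fun x => Ek x^+n.+1*cos (u*x)).
Proof.
have hm := @hl_meas R.
apply: (@L1_mulbnd _ _ _ _ 1) => // [| |x _]; [exact: hl_sub (Ekn_L1 n)| |exact: ncos_le1].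
by apply: cont_meas => //; exact: cosm_cont.
Qed.

Lemma be_even n u : be n (- u) = be n u.
Proof. by congr (_*_); apply: Rint_ext => x _; rewrite mulNr cosN. Qed.

Lemma be1 u : be 1 u = 2 * pi*kap u.
Proof.
wlog u0 : u/0<=u.
 move=> h; case: (leP 0 u) => [/h//|u0]; rewrite -be_even h; last by rewrite oppr_ge0 ltW.
 by rewrite /kap /tri normrN mulrN cosN.
have H (x : R) : `|hat 1 kap x| <= 170 * p2 x by rewrite ger0_norm ?(ltW (Ek_gt0 x))//; exact: Ek_le.
have K0 (w : R) : 1<w -> kap w = 0.
 by move=> h; rewrite /kap tri0 ?mul0r// gtr0_norm// (lt_trans ltr01).
rewrite [in RHS](inversion ler01 kap_cont K0 H u0) /be.
by rewrite mulrA -[2 * pi * pi^-1]mulrA divff ?lt0r_neq0 ?pi_gt0// mulr1; congr (_*_).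
Qed.

Lemma be_cont n : continuous (be n.+1).
Proof.
have hm := @hl_meas R.
case: n => [|n].
 move=> u; have -> : be 1 = fun u => 2 * pi*kap u by apply/funext => x; exact: be1.
 by apply: cvgM; [exact: cvg_cst|exact: kap_cont].
move=> u; apply: cvgM; first exact: cvg_cst.
apply: (@cosint_cont _ (@hl R) (fun x => Ek x^+n.+2)) => //; first exact: hl_sub (Ekn_L1 n.+1).
have hb (x : R) : 0<=x -> `|x*Ek x^+n.+2| <= 340^+n.+2 * p2 x.
 move=> x0; have e0 := ltW (Ek_gt0 x); have e1: 0<=Ek x^+n.+2 by exact: exprn_ge0.
 have e2: 0<=x*Ek x^+n.+2 by exact: mulr_ge0.
 rewrite (ger0_norm e2) (mulrC x); apply: le_trans (Ekn_mom n.+1 x0).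
 rewrite ler_wpM2l//; apply: (@le_trans _ _ (1+x)); first by rewrite lerDr.
 by rewrite -[leLHS]expr1 ler_weXn2l// lerDl.
apply: (L1_dom hm _ _ (L1Z (340^+n.+2) hm (hl_sub (@L1_p2 R)))) => [|x].
 by apply: cont_meas => // x; apply: cvgM; [exact: cvg_id|exact: Ekn_cont].
by rewrite hlE => x0; exact: hb.
Qed.

(** One factor [Ek] is expanded as the transform of [kap] and the integrals are exchanged; the
    outcome is the convolution with [kap], folded to [[0, 1]] by evenness. *)
Lemma beS n u : be n.+2 u = \int[mu]_(w in `[0, 1]) (kap w*(be n.+1 (u+w)+be n.+1 (u-w))).
Proof.
have hm := @hl_meas R.
have E (x : R) : Ek x^+n.+2*cos (u*x) = Ek x^+n.+1*cos (u*x)*(2 * \int[mu]_(w in `[0, 1]) (kap w*cos (x*w))).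
 by rewrite exprSr mulrAC /Ek /hat.
have Lk := contL 0 1 kap_cont.
rewrite {1}/be.
have -> : \int[mu]_(x in @hl R) (Ek x^+n.+2*cos (u*x)) =
  2 * \int[mu]_(x in @hl R) (Ek x^+n.+1*cos (u*x) * \int[mu]_(w in `[0, 1]) (kap w*cos (x*w))).
 have L: L1 mu (@hl R) (fun x => Ek x^+n.+1*cos (u*x) * \int[mu]_(w in `[0, 1]) (kap w*cos (x*w))).
  apply: L1_ext (L1Z 2^-1 hm (EcL n.+1 u)) => x; rewrite E.
  by rewrite (mulrCA 2^-1) (mulrA 2^-1) mulVf ?mul1r// pnatr_eq0.
 by rewrite -(RZ _ hm L); apply: Rint_ext => x _; rewrite E mulrCA.
rewrite (@fub_cos _ (@hl R) `[0, 1]%classic _ _ (fun x w => cos (x*w)))//; first last.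
- by move=> *; exact: ncos_le1.
- by move=> x; exact: cosm_cont.
- by move=> w x; under eq_fun do rewrite mulrC; exact: cosm_cont.
- exact: EcL.
have E3 (w : R) : 2*(2*(kap w * \int[mu]_(x in @hl R) (Ek x^+n.+1*cos (u*x)*cos (x*w)))) = kap w*(be n.+1 (u+w)+be n.+1 (u-w)).
 have L2: L1 mu (@hl R) (fun x => Ek x^+n.+1*cos (u*x)*cos (x*w)).
  apply: (@L1_mulbnd _ _ _ _ 1) => // [| |x _]; [exact: EcL| |exact: ncos_le1].
  by apply: cont_meas => // x; under eq_fun do rewrite mulrC; exact: cosm_cont.
 have P (x : R) : 2*(Ek x^+n.+1*cos (u*x)*cos (x*w)) = Ek x^+n.+1*cos ((u+w)*x)+Ek x^+n.+1*cos ((u-w)*x).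
  by rewrite (mulrDl u w x) (mulrBl x u w) cosD cosB (mulrC x w); ring.
 rewrite (mulrCA 2 (kap w)) -(RZ _ hm L2).
 have -> : \int[mu]_(x in @hl R) (2*(Ek x^+n.+1*cos (u*x)*cos (x*w))) =
   \int[mu]_(x in @hl R) (Ek x^+n.+1*cos ((u+w)*x)+Ek x^+n.+1*cos ((u-w)*x)) by apply: Rint_ext => x _; exact: P.
 rewrite (RD hm (EcL n (u+w)) (EcL n (u-w))) /be; ring.
have cb (w : R) : {for w, continuous (fun w : R => be n.+1 (u+w)+be n.+1 (u-w))}.
 apply: cvgD.
  apply: (@continuous_comp _ _ _ (fun w : R => u+w) (be n.+1)); last exact: be_cont.
  by apply: cvgD; [exact: cvg_cst|exact: cvg_id].
 apply: (@continuous_comp _ _ _ (fun w : R => u-w) (be n.+1)); last exact: be_cont.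
 by apply: cvgB; [exact: cvg_cst|exact: cvg_id].
have L4: L1 mu `[0, 1] (fun w => kap w*(be n.+1 (u+w)+be n.+1 (u-w))).
 by apply: contL => w; apply: cvgM; [exact: kap_cont|exact: cb].
have L5: L1 mu `[0, 1] (fun w => kap w * \int[mu]_(x in @hl R) (Ek x^+n.+1*cos (u*x)*cos (x*w))).
 have m01 := itv_meas (0 : R) 1.
 by apply: L1_ext (L1Z 4^-1 m01 L4) => w; rewrite -E3; field.
have L6 := L1Z 2 (itv_meas (0 : R) 1) L5.
by rewrite -(RZ 2 (itv_meas (0 : R) 1) L5) -(RZ 2 (itv_meas (0 : R) 1) L6); apply: Rint_ext => w _; exact: E3.
Qed.

Lemma be_ge0 n u : 0<=be n.+1 u.
Proof.
elim: n u => [|n IH] u; first by rewrite be1 mulr_ge0 ?kap_ge0// mulr_ge0// ltW// pi_gt0.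
by rewrite beS; apply: Rintegral_ge0 => w _; rewrite mulr_ge0 ?kap_ge0// addr_ge0.
Qed.

Lemma be_supp n u : n.+1%:R < `|u| -> be n.+1 u = 0.
Proof.
elim: n u => [|n IH] u hu; first by rewrite be1 /kap tri0// mul0r mulr0.
rewrite beS; transitivity (\int[mu]_(w in `[0, 1]) (0 : R)); last exact: Rint_0.
apply: Rint_ext => w; rewrite itvE => /andP[w0 w1].
have hw: `|w| <= 1 by rewrite ger0_norm.
rewrite -natr1 in hu.
have t1 := ler_normB (u+w) w; rewrite addrK in t1.
have t2 := ler_normD (u-w) w; rewrite subrK in t2.
by rewrite !IH ?addr0 ?mulr0//; lra.
Qed.

Lemma be0E n : be n 0 = 2 * \int[mu]_(x in @hl R) (Ek x^+n).
Proof. by congr (_*_); apply: Rint_ext => x _; rewrite mul0r cos0 mulr1. Qed.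

Lemma hlEk n : L1 mu (@hl R) (fun x => Ek x^+n.+1).
Proof. exact: hl_sub (Ekn_L1 n). Qed.

Lemma be_le n u : `|be n.+1 u| <= be n.+1 0.
Proof.
have hm := @hl_meas R.
rewrite be0E /be normrM ger0_norm// ler_wpM2l//; apply: Rint_abs_le => //; [exact: EcL|exact: hlEk|].
move=> x _; have e0: 0<=Ek x^+n.+1 by rewrite exprn_ge0// ltW// Ek_gt0.
by rewrite normrM (ger0_norm e0) -[leRHS]mulr1 ler_wpM2l// ncos_le1.
Qed.

Lemma be0_gt0 n : 0<be n.+1 0.
Proof.
have hm := @hl_meas R.
rewrite be0E mulr_gt0//.
have L: L1 mu (@hl R) (fun x => \1_`[0, 1]%classic x*16^-1^+n.+1).
 apply: hl_sub; apply/(L1_mkcond mu (fun=> 16^-1^+n.+1) (itv_meas 0 1)); apply: L1_cst => //; exact: mu_itv_fin.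
apply: (@lt_le_trans _ _ (16^-1^+n.+1)); first by rewrite exprn_gt0// invr_gt0.
have -> : 16^-1^+n.+1 = \int[mu]_(x in @hl R) (\1_`[0, 1]%classic x*16^-1^+n.+1) :> R.
 rewrite (@Rint_supp _ `[0, 1]%classic (@hl R)); first last.
 - by move=> x _ h; rewrite indicE memNset ?mul0r.
 - by move=> x; rewrite itvE hlE => /andP[].
 rewrite -[LHS]mulr1 -[X in _*X]subr0 -(@Rint_itv_cst R 0 1 (16^-1^+n.+1))//.
 by apply: Rint_ext => x h; rewrite indicE mem_set// mul1r.
apply: Rle => //; first exact: hlEk.
move=> x; rewrite hlE => x0; rewrite indicE; case: (boolP (x \in _)) => h.
 rewrite mul1r lerXn2r// ?nnegrE ?invr_ge0// ?(ltW (Ek_gt0 x))//.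
 move: h; rewrite inE itvE => /andP[_ x1].
 have : 1/2<=p2 x.
  rewrite /p2 -[leRHS]div1r ler_wpM2l// lef_pV2 ?posrE ?ltr_pwDl ?sqr_ge0//.
  by rewrite -[leRHS](_ : 1+1 = 2) ?lerD2l ?expr_le1.
 by have := Ek_ge x; lra.
by rewrite mul0r exprn_ge0// ltW// Ek_gt0.
Qed.

Section sums.
Variables (I : Type) (r : seq I) (a vv : I -> R).
Hypothesis vv0 : forall i, 0<vv i.
Definition Tc (t : R) := \sum_(i <- r) a i*cos (t*vv i).

Lemma Tc_pair t x : Tc (t+x)+Tc (t-x) = 2 * \sum_(i <- r) a i*cos (t*vv i)*cos (x*vv i).
Proof.
rewrite /Tc -big_split/= mulr_sumr; apply: eq_bigr => i _.
by rewrite mulrDl mulrBl cosD cosB; ring.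
Qed.

Lemma Tc_pairB t x : Tc (t+x)-Tc (t-x) = - (2 * \sum_(i <- r) a i*sin (t*vv i)*sin (x*vv i)).
Proof.
rewrite /Tc -sumrB mulr_sumr -sumrN; apply: eq_bigr => i _.
by rewrite mulrDl mulrBl cosD cosB; ring.
Qed.

Lemma Tc_cont : continuous Tc.
Proof.
apply: (@lip_cont _ _ (\sum_(i <- r) `|a i| * vv i)) => x y.
rewrite /Tc -sumrB mulr_suml; apply: (le_trans (ler_norm_sum _ _ _)); apply: ler_sum => i _.
rewrite -mulrBr normrM -mulrA ler_wpM2l//; apply: (le_trans (cos_lip _ _)).
by rewrite -mulrBl normrM mulrC (gtr0_norm (vv0 i)).
Qed.

End sums.

End kernels.

(** * Replacing 1/log n by weights of short support *)

Section smooth.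
Variable R : realType.
Notation mu := (@lebesgue_measure R).
Notation RT := (setT : set (measurableTypeR R)).

Definition Mo n := \int[mu]_(x in @hl R) (Ek x^+n.+1*(1+x)^+n).

Lemma Mo_ge0 n : 0<=Mo n.
Proof.
apply: Rintegral_ge0 => x; rewrite hlE => x0.
by rewrite mulr_ge0 ?exprn_ge0 ?(ltW (Ek_gt0 x))// addr_ge0.
Qed.

(** The cosine sum is averaged over the shifts by [rho z / l] and [- rho z / l] against a
    nonnegative kernel. Since [rho <= 1], the growth hypothesis at [z] still covers them. *)
Lemma mixRe n (r : seq nat) (a vv : nat -> R) (t B l rho : R) : (forall i, 0<vv i) -> 0<=B -> 0<l ->
 (forall z, Tc r a vv (t+z/l)<=B*(1 + `|z|)^+n) -> 0<=rho<=1 ->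
 \sum_(i <- r) a i*cos (t*vv i)*be n.+1 (rho*(vv i/l))<=2*B * Mo n.
Proof.
move=> v0 B0 l0 hT /andP[r0 r1]; have hm := @hl_meas R.
have E (z : R) : Ek z^+n.+1*(Tc r a vv (t+rho*z/l)+Tc r a vv (t-rho*z/l)) =
  \sum_(i <- r) (a i*cos (t*vv i)*2)*(Ek z^+n.+1*cos (rho*(vv i/l)*z)).
 rewrite Tc_pair !mulr_sumr; apply: eq_bigr => i _.
 by rewrite (_ : rho*z/l*vv i = rho*(vv i/l)*z); ring.
have LS: L1 mu (@hl R) (fun z => \sum_(i <- r) (a i*cos (t*vv i)*2)*(Ek z^+n.+1*cos (rho*(vv i/l)*z))).
 by apply: L1_sum => // i _; apply: L1Z => //; exact: EcL.
have -> : \sum_(i <- r) a i*cos (t*vv i)*be n.+1 (rho*(vv i/l)) =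
  \int[mu]_(z in @hl R) \sum_(i <- r) (a i*cos (t*vv i)*2)*(Ek z^+n.+1*cos (rho*(vv i/l)*z)).
 rewrite Rint_sum//; last by move=> i _; apply: L1Z => //; exact: EcL.
 by apply: eq_bigr => i _; rewrite (RZ _ hm (EcL n _)) /be; exact: mulrA.
rewrite /Mo -(RZ _ hm (@Ekn_momL1 R n)); apply: Rle => //; first exact: L1Z (@Ekn_momL1 R n).
have pw (z : R) : 0<=z -> Ek z^+n.+1*(Tc r a vv (t+rho*z/l)+Tc r a vv (t-rho*z/l))<=2*B*(Ek z^+n.+1*(1+z)^+n).
 move=> z0; rewrite (mulrCA (2*B)) ler_wpM2l ?exprn_ge0 ?(ltW (Ek_gt0 z))//.
 have b1: (1 + `|rho*z|)^+n<=(1+z)^+n.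
  have rz: 0<=rho*z by exact: mulr_ge0.
  by rewrite (ger0_norm rz) lerXn2r// ?nnegrE ?addr_ge0// lerD2l ler_piMl.
 have := hT (rho*z); have := hT (- (rho*z)); rewrite normrN mulNr.
 by have := ler_wpM2l B0 b1; lra.
by move=> z; rewrite hlE => z0; rewrite -E; exact: pw.
Qed.

(** Integrating [mixRe] over [rho] in [[0, 1]] replaces [be y] by [(G y - G 0)/y], with [G] a
    primitive of [be]. Beyond the support this is exactly [c/y], so it reproduces [1/vv i]; the
    deviation from it for small arguments is the weight [q]. *)
Theorem outRe n : exists (C : R) (q : R -> R), [/\ 0<=C, forall u, 0<=u -> 0<=q u<=1,
 forall u, n.+2%:R<=u -> q u = 0 & forall (r : seq nat) (a vv : nat -> R) (t B l : R),
 (forall i, 0<vv i) -> 0<=B -> 0<l -> (forall z, Tc r a vv (t+z/l)<=B*(1 + `|z|)^+n) ->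
 \sum_(i <- r) a i/vv i*cos (t*vv i) <=
 \sum_(i <- r) a i/vv i*q (vv i/l)*cos (t*vv i)+C*B/l].
Proof.
have [G dG] := prim (@be_cont R n).
pose D : R := n.+2%:R; have D0: 0<=D by [].
have Gm x y : 0<=x -> x<=y -> G x<=G y.
 move=> x0 xy; apply: (@dv_ge0_le _ G (be n.+1)) => // z /andP[xz _]; last exact: be_ge0.
 by apply: dG; exact: le_trans xz.
have Gc u : D<=u -> G u = G D.
 move=> Du; apply/eqP; rewrite -subr_eq0 -normr_le0 -(mul0r (u-D)).
 apply: (@dv_lip _ G (be n.+1)) => // z /andP[Dz _].
  by apply: dG; exact: le_trans Dz.
 rewrite be_supp ?normr0// ger0_norm ?(le_trans D0 Dz)//.
 by apply: lt_le_trans Dz; rewrite ltr_nat.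
pose c := G D-G 0.
(* [be] is nonnegative, continuous and positive at 0, so its primitive rises strictly near 0. *)
have c0: 0<c.
 have b0 := be0_gt0 R n; have b2: 0<be n.+1 0/2 :> R by rewrite divr_gt0.
 have [d /= d0 hd] : exists2 d, 0<d & forall u : R, `|u| < d -> be n.+1 0/2<=be n.+1 u.
  have /cvgrPdist_le /(_ _ b2) [d /= d0 hd] := @be_cont R n 0.
  exists d => // u hu; have := hd u; rewrite /ball /= sub0r normrN => /(_ hu).
  by move=> h; have := le_trans (ler_norm _) h; lra.
 pose e := Num.min (d/2) 1.
 have e0: 0<e by rewrite lt_min ltr01 divr_gt0.
 have eD: e<=D by rewrite ge_min /D ler1n orbT.
 have ed: e<d by rewrite gt_min; apply/orP; left; rewrite ltr_pdivrMr// ltr_pMr// ltr1n.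
 have h: G 0-be n.+1 0/2*0<=G e-be n.+1 0/2*e.
  apply: (@dv_ge0_le _ (fun u => G u-be n.+1 0/2*u) (fun u => be n.+1 u-be n.+1 0/2)).
  - exact: ltW.
  - move=> x /andP[x0 _]; apply: (dv_eq (dvD (dG x x0) (dvN (dvM (dv_cst _ x) (dv_id x))))).
   by rewrite mul0r add0r mulr1.
  - by move=> x /andP[x0 xe]; rewrite subr_ge0 hd// ger0_norm// (le_lt_trans xe).
 have h1 := Gm _ _ (ltW e0) eD; have h2 := mulr_gt0 b2 e0; rewrite mulr0 subr0 in h.
 by rewrite /c; lra.
exists (2 * Mo n/c), (fun u => 1-(G u-G 0)/c); split.
- by rewrite divr_ge0 ?(ltW c0)// mulr_ge0// Mo_ge0.
- move=> u u0; have g1 := Gm _ _ (lexx 0) u0.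
 have g2: G u<=G D by case: (leP u D) => [/(Gm _ _ u0)//|/ltW /Gc ->].
 have h1: 0<=(G u-G 0)/c by rewrite divr_ge0 ?(ltW c0)// subr_ge0.
 have h2: (G u-G 0)/c<=1 by rewrite ler_pdivrMr// mul1r /c lerD2r.
 by lra.
- by move=> u /Gc ->; rewrite divff ?subrr// lt0r_neq0.
move=> r a vv t B l v0 B0 l0 hT.
have vl i : 0<vv i/l by rewrite divr_gt0.
have cb (y : R) : continuous (fun rho : R => be n.+1 (rho*y)).
 move=> rho; apply: (@continuous_comp _ _ _ (fun rho : R => rho*y) (be n.+1)); last exact: be_cont.
 by apply: cvgM; [exact: cvg_id|exact: cvg_cst].
have Iy (y : R) : 0<y -> \int[mu]_(rho in `[0, 1]) be n.+1 (rho*y) = (G y-G 0)/y.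
 move=> y0; have dF rho : 0<=rho<=1 -> dv (fun rho => G (rho*y)/y) rho (be n.+1 (rho*y)).
  move=> /andP[h0 _]; have y1: 0<=rho*y by rewrite mulr_ge0// ltW.
  apply: (dv_eq (dvM (dv_comp (f := G) (g := fun rho : R => rho*y) (dG _ y1) (dvM (dv_id rho) (dv_cst y rho))) (dv_cst y^-1 rho))).
  by field; exact: lt0r_neq0.
 have cF: cont_on 0 1 (fun rho => be n.+1 (rho*y)) by move=> rho _; exact: cb.
 by rewrite (ftc ler01 dF cF) mul1r mul0r; field; exact: lt0r_neq0.
have Li i : L1 mu `[0, 1] (fun rho => a i*cos (t*vv i)*be n.+1 (rho*(vv i/l))).
 by apply: L1Z => //; exact: contL.
have H: \sum_(i <- r) a i*cos (t*vv i)*((G (vv i/l)-G 0)/(vv i/l))<=2*B * Mo n.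
 have -> : \sum_(i <- r) a i*cos (t*vv i)*((G (vv i/l)-G 0)/(vv i/l)) =
   \int[mu]_(rho in `[0, 1]) \sum_(i <- r) a i*cos (t*vv i)*be n.+1 (rho*(vv i/l)).
  rewrite Rint_sum//; apply: eq_bigr => i _; rewrite -Iy// RZ//; exact: contL.
 apply: (@le_trans _ _ (\int[mu]_(rho in `[0, 1]) (2*B * Mo n))).
  apply: Rle => //; [exact: L1_sum|by apply: L1_cst => //; exact: mu_itv_fin|].
  by move=> rho; rewrite itvE; exact: mixRe.
 by rewrite Rint_itv_cst// subr0 mulr1.
rewrite -lerBlDl -sumrB.
have -> : \sum_(i <- r) (a i/vv i*cos (t*vv i)-a i/vv i*(1-(G (vv i/l)-G 0)/c)*cos (t*vv i)) =
  (\sum_(i <- r) a i*cos (t*vv i)*((G (vv i/l)-G 0)/(vv i/l)))/(l*c).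
 rewrite mulr_suml; apply: eq_bigr => i _; field.
 by rewrite !lt0r_neq0.
rewrite ler_pdivrMr ?mulr_gt0//; apply: (le_trans H); apply: eq_le_; field.
by rewrite !lt0r_neq0.
Qed.

Section im.
Variable n : nat.
(** Normalized to mass 1/2 on the half-line, so that its transform [sk] equals 1 at 0. *)
Definition Jk (z : R) := Ek z^+n.+2/be n.+2 0.
Definition sk (u : R) := be n.+2 u/be n.+2 0.

Lemma Jk_gt0 z : 0<Jk z.
Proof. by rewrite divr_gt0 ?be0_gt0// exprn_gt0// Ek_gt0. Qed.

Lemma Jk_cont : continuous Jk.
Proof. by move=> z; apply: cvgM; [exact: Ekn_cont|exact: cvg_cst]. Qed.

Lemma Jcos_L1 (u : R) : L1 mu (@hl R) (fun z => Jk z*cos (u*z)).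
Proof.
have hm := @hl_meas R.
by apply: L1_ext (L1Z (be n.+2 0)^-1 hm (EcL n.+1 u)) => z; rewrite /Jk; ring.
Qed.

Lemma Jcos (u : R) : \int[mu]_(z in @hl R) (Jk z*cos (u*z)) = sk u/2.
Proof.
have hm := @hl_meas R.
have -> : \int[mu]_(z in @hl R) (Jk z*cos (u*z)) = \int[mu]_(z in @hl R) ((be n.+2 0)^-1*(Ek z^+n.+2*cos (u*z))).
 by apply: Rint_ext => z _; rewrite /Jk -mulrA mulrCA.
rewrite (RZ _ hm (EcL n.+1 u)) /sk {2}/be; field.
by rewrite lt0r_neq0// be0_gt0.
Qed.

Lemma J_L1 : L1 mu (@hl R) Jk.
Proof. by apply: L1_ext (Jcos_L1 0) => z; rewrite mul0r cos0 mulr1. Qed.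

Lemma J_int : \int[mu]_(z in @hl R) Jk z = 1/2.
Proof.
transitivity (\int[mu]_(z in @hl R) (Jk z*cos (0*z))).
 by apply: Rint_ext => z _; rewrite mul0r cos0 mulr1.
by rewrite Jcos /sk divff// lt0r_neq0// be0_gt0.
Qed.

(** [Q x] is the mass of [Jk] beyond [x]. [Jk] has one more factor [Ek] than the majorant: the
    additional [p2] is integrated away, and the others are compared at [x] by monotonicity of
    [p2]. *)
Lemma Q_ex : exists (c1 : R) (Q : R -> R), [/\ 0<=c1, forall x, 0<=x -> dv Q x (- Jk x),
 forall x, 0<=x -> 0<=Q x<=c1*Ek x^+n.+1 & 0<=c1].
Proof.
have hm := @hl_meas R; have b0 := be0_gt0 R n.+1.
have [G dG] := prim Jk_cont.
pose Q x := 1/2-(G x-G 0).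
pose k := 170^+n.+2/be n.+2 0 : R.
have k0: 0<=k by rewrite divr_ge0 ?exprn_ge0// ltW.
pose P := \int[mu]_(z in @hl R) p2 z.
have LP: L1 mu (@hl R) (@p2 R) := hl_sub (@L1_p2 R).
have P0: 0<=P by apply: Rintegral_ge0 => z _; rewrite ltW// p2_gt0.
exists (k*P*8^+n.+1), Q; split.
- by rewrite mulr_ge0 ?exprn_ge0// mulr_ge0.
- move=> x x0; apply: (dv_eq (dvD (dv_cst (1/2) x) (dvN (dvD (dG x x0) (dv_cst (- G 0) x))))).
 by rewrite addr0 add0r.
- move=> x x0.
 have QE: Q x = \int[mu]_(z in @hl R) (Jk z - \1_`[0, x]%classic z*Jk z).
  have L2: L1 mu (@hl R) (fun z => \1_`[0, x]%classic z*Jk z).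
   apply: hl_sub; apply/(L1_mkcond mu Jk (itv_meas 0 x)); exact: contL Jk_cont.
  rewrite RB//; last exact: J_L1.
  rewrite J_int /Q; congr (_ - _).
  have dG' z : 0<=z<=x -> dv G z (Jk z) by move=> /andP[z0 _]; exact: dG.
  have cJ: cont_on 0 x Jk by move=> z _; exact: Jk_cont.
  rewrite -(ftc x0 dG' cJ) (@Rint_supp _ `[0, x]%classic (@hl R)); first last.
  + by move=> z _ h; rewrite indicE memNset ?mul0r.
  + by move=> z; rewrite itvE hlE => /andP[].
  by apply: Rint_ext => z h; rewrite indicE mem_set// mul1r.
 have pw z : 0<=z -> 0<=Jk z - \1_`[0, x]%classic z*Jk z<=k * p2 x^+n.+1 * p2 z.
  move=> z0; rewrite indicE; case: (boolP (z \in _)) => h.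
   by rewrite mul1r subrr lexx/= mulr_ge0 ?(ltW (p2_gt0 z))// mulr_ge0// exprn_ge0// ltW// p2_gt0.
  rewrite mul0r subr0 (ltW (Jk_gt0 z))/=.
  have xz: x<=z by rewrite leNgt; apply/negP => zx; move/negP: h; apply; rewrite inE itvE z0 ltW.
  have pxz: p2 z<=p2 x.
   by rewrite lef_pV2 ?posrE ?ltr_pwDl ?sqr_ge0// lerD2l sq_mono.
  have e1: Ek z^+n.+2<=(170 * p2 z)^+n.+2.
   rewrite lerXn2r// ?nnegrE ?(ltW (Ek_gt0 z))//; last exact: Ek_le.
   by rewrite mulr_ge0// ltW// p2_gt0.
  have e2: p2 z^+n.+1<=p2 x^+n.+1 by rewrite lerXn2r// nnegrE ltW// p2_gt0.
  rewrite /Jk /k ler_pdivrMr//; apply: (le_trans e1).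
  have -> : 170^+n.+2/be n.+2 0 * p2 x^+n.+1 * p2 z*be n.+2 0 = 170^+n.+2*(p2 z * p2 x^+n.+1) :> R.
   by field; exact: lt0r_neq0.
  rewrite exprMn ler_wpM2l ?exprn_ge0// exprS ler_wpM2l//.
  by rewrite ltW// p2_gt0.
 have LB: L1 mu (@hl R) (fun z => k * p2 x^+n.+1 * p2 z) by exact: L1Z.
 have LA: L1 mu (@hl R) (fun z => Jk z - \1_`[0, x]%classic z*Jk z).
  apply: (L1_dom hm _ _ LB) => [|z]; last by rewrite hlE => /pw /andP[h1 h2]; rewrite ger0_norm.
  apply: measurable_funB; first by apply: cont_meas => //; exact: Jk_cont.
  apply: measurable_funM; first exact: measurable_indic.
  by apply: cont_meas => //; exact: Jk_cont.
 apply/andP; split.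
  by rewrite QE; apply: Rintegral_ge0 => z; rewrite hlE => /pw /andP[].
 rewrite QE; apply: (@le_trans _ _ (k * p2 x^+n.+1*P)).
  by rewrite /P -(RZ _ hm LP); apply: Rle => // z; rewrite hlE => /pw /andP[].
 have -> : k*P*8^+n.+1*Ek x^+n.+1 = k*(8*Ek x)^+n.+1*P by rewrite -mulrA mulrAC -exprMn.
 rewrite ler_wpM2r// ler_wpM2l// lerXn2r// ?nnegrE ?(ltW (p2_gt0 x))//; last exact: Ek_ge.
 by rewrite mulr_ge0// ltW// Ek_gt0.
by rewrite mulr_ge0 ?exprn_ge0// mulr_ge0.
Qed.

Variables (c1 : R) (Q : R -> R).
Hypothesis c10 : 0<=c1.
Hypothesis dQ : forall x, 0<=x -> dv Q x (- Jk x).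
Hypothesis Qb : forall x, 0<=x -> 0<=Q x<=c1*Ek x^+n.+1.

Lemma Q_meas : measurable_fun (@hl R : set (measurableTypeR R)) Q.
Proof.
suff h : measurable_fun (@hl R : set (measurableTypeR R)) (fun x => Q (Num.max 0 x)).
 by apply: eq_measurable_fun h => x; rewrite inE hlE => x0; rewrite max_r.
have ch: continuous (fun x : R => Q (Num.max 0 x)).
 have cm: continuous (fun x : R => Num.max 0 x).
  apply: (@lip_cont _ _ 1) => u w; rewrite mul1r.
  have := ler_norm (u-w); have := ler_norm (w-u); rewrite distrC.
  by case: (leP 0 u) => hx; case: (leP 0 w) => hy; move=> h1 h2; rewrite ler_norml; lra.
 move=> x; apply: (@continuous_comp R R R (fun x : R => Num.max 0 x) Q x (cm x)).
 by apply: dv_cont (dQ _); rewrite le_max lexx.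
by apply: cont_meas ch; exact: hl_meas.
Qed.

Lemma Qsin_L1 (u : R) : L1 mu (@hl R) (fun z => Q z*sin (u*z)).
Proof.
have hm := @hl_meas R.
apply: (@L1_mulbnd _ _ _ _ 1) => //.
- apply: (L1_dom hm Q_meas _ (L1Z c1 hm (@hlEk R n))) => z.
 by rewrite hlE => /Qb /andP[h1 h2]; rewrite ger0_norm.
- apply: cont_meas => // z; exact: dv_cont (dv_sin (dvM (dv_cst u z) (dv_id z))).
- by move=> z _; exact: nsin_le1.
Qed.

(** Integration by parts against [1 - cos]. The sine transform of [Q] is exactly [1/(2u)] beyond the
    support of [sk], which is what reproduces [1/vv i]. *)
Lemma Qsin (u : R) : 0<u -> \int[mu]_(z in @hl R) (Q z*sin (u*z)) = (1-sk u)/(2*u).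
Proof.
move=> u0; have un0 := lt0r_neq0 u0; have hm := @hl_meas R.
have LJ1: L1 mu (@hl R) (fun z => Jk z-Jk z*cos (u*z)) by apply: L1B => //; [exact: J_L1|exact: Jcos_L1].
have LJ2 := L1Z u^-1 hm LJ1.
have LD := L1B hm (Qsin_L1 u) LJ2.
have E0: \int[mu]_(z in @hl R) (Q z*sin (u*z)-u^-1*(Jk z-Jk z*cos (u*z))) = 0.
 apply: (seq_uniq (hl_lim LD)).
 have step k : \int[mu]_(z in `[0, k%:R]) (Q z*sin (u*z)-u^-1*(Jk z-Jk z*cos (u*z))) = Q k%:R*(1-cos (u*k%:R))/u.
  have dF z : 0<=z<=k%:R -> dv (fun z => Q z*(1-cos (u*z))/u) z (Q z*sin (u*z)-u^-1*(Jk z-Jk z*cos (u*z))).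
   move=> /andP[z0 _].
   apply: (dv_eq (dvM (dvM (dQ z0) (dvD (dv_cst 1 z) (dvN (dv_cos (dvM (dv_cst u z) (dv_id z)))))) (dv_cst u^-1 z))).
   by field.
  have cF: cont_on 0 k%:R (fun z => Q z*sin (u*z)-u^-1*(Jk z-Jk z*cos (u*z))).
   move=> z /andP[z0 _]; apply: cvgB.
    apply: cvgM; first exact: dv_cont (dQ z0).
    exact: dv_cont (dv_sin (dvM (dv_cst u z) (dv_id z))).
   apply: cvgM; first exact: cvg_cst.
   by apply: cvgB; [exact: Jk_cont|apply: cvgM; [exact: Jk_cont|exact: cosm_cont]].
  by rewrite (ftc (ler0n R k) dF cF) mulr0 cos0 subrr mulr0 mul0r subr0.
 apply: (seq_ext (fun k => esym (step k))).
 have c2: c1*170^+n.+1*(2/u)*k.+1%:R^-1 @[k --> \oo] --> (0 : R).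
  by rewrite -(mulr0 (c1*170^+n.+1*(2/u))); apply: cvgM; [exact: cvg_cst|exact: cvg_harmonic].
 apply: (bnd_cvg0 _ c2) => k; have k0: 0<=k%:R :> R by [].
 have /andP[q0 q1] := Qb k0.
 have cb: 0<=1-cos (u*k%:R)<=2.
  by have := ncos_le1 (u*k%:R); rewrite ler_norml => /andP[]; lra.
 case/andP: cb => cb0 cb1; rewrite ger0_norm; last by rewrite divr_ge0 ?(ltW u0)// mulr_ge0.
 have e1: Q k%:R<=c1*170^+n.+1*k.+1%:R^-1.
  apply: (le_trans q1); rewrite -mulrA ler_wpM2l//; apply: (le_trans (Ekn_le n _)).
  rewrite ler_wpM2l ?exprn_ge0// /p2 lef_pV2 ?posrE ?ltr_pwDl ?sqr_ge0//.
  rewrite -nat1r lerD2l; case: k {k0 q0 q1 cb0 cb1} => [|k]; first by rewrite expr0n.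
  by rewrite -[leLHS]expr1 ler_weXn2l// ler1n.
 have -> : c1*170^+n.+1*(2/u)/k.+1%:R = c1*170^+n.+1*k.+1%:R^-1*2/u.
  by move: (170^+n.+1) (k.+1%:R^-1) => x y; ring.
 by rewrite ler_wpM2r ?invr_ge0 ?(ltW u0)// ler_pM.
move: E0; rewrite (RB hm (Qsin_L1 u) LJ2) => /eqP; rewrite subr_eq0 => /eqP ->.
rewrite (RZ _ hm LJ1) (RB hm J_L1 (Jcos_L1 u)) J_int Jcos; field.
by rewrite un0.
Qed.

(** The odd kernel built from [Q] may not be used with a one-sided bound. Adding [c1 Ek^(n+1)] makes
    the weights at [z] and [- z] both nonnegative, at the price of the cosine term. *)
Lemma mixIm (r : seq nat) (a vv : nat -> R) (t B l e : R) : (forall i, 0<vv i) -> 0<=B -> 0<l ->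
 `|e| = 1 -> (forall z, Tc r a vv (t+z/l)<=B*(1 + `|z|)^+n) ->
 \sum_(i <- r) a i*(c1*cos (t*vv i)*be n.+1 (vv i/l)-e*sin (t*vv i)*((1-sk (vv i/l))/(vv i/l)))<=2*c1*B * Mo n.
Proof.
move=> v0 B0 l0 e1 hT; have hm := @hl_meas R.
have vl i : 0<vv i/l by rewrite divr_gt0.
pose g i (z : R) := a i*(2*c1*cos (t*vv i))*(Ek z^+n.+1*cos (vv i/l*z)) -
  a i*(2*e*sin (t*vv i))*(Q z*sin (vv i/l*z)).
have Lg i : L1 mu (@hl R) (g i).
 apply: (L1B hm); first exact: (L1Z _ hm (EcL n _)).
 exact: (L1Z _ hm (Qsin_L1 _)).
have gE i : \int[mu]_(z in @hl R) g i z = a i*(c1*cos (t*vv i)*be n.+1 (vv i/l)-e*sin (t*vv i)*((1-sk (vv i/l))/(vv i/l))).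
 rewrite (RB hm (L1Z _ hm (EcL n _)) (L1Z _ hm (Qsin_L1 _))) (RZ _ hm (EcL n _)) (RZ _ hm (Qsin_L1 _)) Qsin// /be.
 by field; rewrite !lt0r_neq0.
have -> : \sum_(i <- r) a i*(c1*cos (t*vv i)*be n.+1 (vv i/l)-e*sin (t*vv i)*((1-sk (vv i/l))/(vv i/l))) =
  \int[mu]_(z in @hl R) \sum_(i <- r) g i z.
 by rewrite Rint_sum//; apply: eq_bigr => i _; rewrite gE.
rewrite /Mo -(RZ _ hm (@Ekn_momL1 R n)); apply: Rle => //; [exact: L1_sum|exact: L1Z (@Ekn_momL1 R n)|].
have pw (z : R) : 0<=z -> \sum_(i <- r) g i z<=2*c1*B*(Ek z^+n.+1*(1+z)^+n).
 move=> z0.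
 have -> : \sum_(i <- r) g i z = (c1*Ek z^+n.+1+e*Q z)*Tc r a vv (t+z/l)+(c1*Ek z^+n.+1-e*Q z)*Tc r a vv (t-z/l).
  have -> (A D x y : R) : (A+D)*x+(A-D)*y = A*(x+y)+D*(x-y) by ring.
  rewrite Tc_pair Tc_pairB mulrN !mulr_sumr -sumrB; apply: eq_bigr => i _; rewrite /g.
  rewrite (_ : z/l*vv i = vv i/l*z); last by ring.
  by move: (Ek z^+n.+1) => E1; ring.
 have /andP[q0 q1] := Qb z0.
 have eb: `|e*Q z| <= c1*Ek z^+n.+1 by rewrite normrM e1 mul1r ger0_norm.
 have k1: 0<=c1*Ek z^+n.+1+e*Q z by move: eb; rewrite ler_norml => /andP[]; lra.
 have k2: 0<=c1*Ek z^+n.+1-e*Q z by move: eb; rewrite ler_norml => /andP[]; lra.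
 have t1 := hT z; have t2 := hT (- z); rewrite normrN (ger0_norm z0) mulNr in t2; rewrite (ger0_norm z0) in t1.
 have := ler_wpM2l k1 t1; have := ler_wpM2l k2 t2.
 move: (Ek z^+n.+1) ((1+z)^+n) (e*Q z) (Tc _ _ _ (t + _)) (Tc _ _ _ (t - _)); clear.
 by move=> x y w p q; lra.
by move=> z; rewrite hlE; exact: pw.
Qed.

End im.

(** The two signs [e = 1] and [e = -1] turn the one-sided hypothesis into a two-sided conclusion.
    [s] is the part of the sine transform not yet equal to [1/u]; [w] comes from the even majorant
    and is [O(u)] at the origin. *)
Theorem outIm n : exists (C : R) (s w : R -> R), [/\ 0<=C, forall u, `|s u| <= 1,
 forall u, n.+3%:R<=u -> s u = 0 /\ w u = 0, forall u, 0<=u -> `|w u| <= C /\ `|w u| <= C*u &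
 forall (r : seq nat) (a vv : nat -> R) (t B l : R),
 (forall i, 0<vv i) -> 0<=B -> 0<l -> (forall z, Tc r a vv (t+z/l)<=B*(1 + `|z|)^+n) ->
 `|\sum_(i <- r) a i/vv i*sin (t*vv i)| <=
 `|\sum_(i <- r) a i/vv i*s (vv i/l)*sin (t*vv i)| +
 `|\sum_(i <- r) a i/vv i*w (vv i/l)*cos (t*vv i)| + C*B/l].
Proof.
have [c1 [Q [c10 dQ Qb _]]] := Q_ex n.
have b1 := be0_gt0 R n; have b2 := be0_gt0 R n.+1.
pose C := 2*c1 * Mo n+c1*be n.+1 0*n.+3%:R.
have m0 := Mo_ge0 n.
have C1: 0<=c1*be n.+1 0*n.+3%:R by apply: mulr_ge0 => //; apply: mulr_ge0 => //; exact: ltW.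
have C2: 0<=2*c1 * Mo n by apply: mulr_ge0 => //; exact: mulr_ge0.
have supp1 u : n.+3%:R<=u -> be n.+1 u = 0 :> R.
 by move=> h; apply: be_supp; apply: (@lt_le_trans _ _ n.+3%:R); [rewrite ltr_nat ltnS leqnSn|exact: le_trans (ler_norm u)].
exists C, (sk n), (fun u => c1*u*be n.+1 u); split.
- exact: addr_ge0.
- move=> u; rewrite /sk normrM normfV (gtr0_norm b2) ler_pdivrMr// mul1r; exact: be_le.
- move=> u hu; rewrite supp1// mulr0 /sk be_supp ?mul0r//.
 by apply: (@lt_le_trans _ _ n.+3%:R); [rewrite ltr_nat|exact: le_trans (ler_norm u)].
- move=> u u0; have c1b: 0<=c1*be n.+1 0 by apply: mulr_ge0 => //; exact: ltW.
 have hb: `|c1*u*be n.+1 u| <= c1*be n.+1 0*u.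
  rewrite (normrM (c1*u)) (normrM c1) (ger0_norm c10) (ger0_norm u0) [leRHS]mulrAC; apply: ler_wpM2l; [exact: mulr_ge0|exact: be_le].
 have n3: 1<=n.+3%:R :> R by rewrite ler1n.
 have hC: c1*be n.+1 0<=C by have := ler_peMr c1b n3; rewrite /C; lra.
 split; last by apply: (le_trans hb); rewrite ler_wpM2r.
 case: (leP n.+3%:R u) => h; first by rewrite supp1// mulr0 normr0 addr_ge0.
 have h' := ler_wpM2l c1b (ltW h); apply: (le_trans hb); apply: (le_trans h').
 by rewrite /C lerDr.
move=> r a vv t B l v0 B0 l0 hT.
set S := \sum_(i <- r) a i/vv i*sin _.
set S1 := \sum_(i <- r) a i/vv i*sk n _*_.
set S2 := \sum_(i <- r) _.
have key e : `|e| = 1 -> S2-e*(S-S1)<=2*c1 * Mo n*B/l.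
 move=> e1; have := mixIm c10 dQ Qb v0 B0 l0 e1 hT; rewrite -(ler_pM2r (_ : 0<l^-1)) ?invr_gt0//.
 have -> : 2*c1*B * Mo n/l = 2*c1 * Mo n*B/l by ring.
 apply: le_trans; apply: eq_le_.
 rewrite /S2 /S /S1 -sumrB !mulr_sumr -sumrB mulr_suml; apply: eq_bigr => i _.
 by field; rewrite !lt0r_neq0.
have h1 := key 1 (normr1 R); have h2 := key (-1) (normrN1 R).
have hB: 2*c1 * Mo n*B/l<=C*B/l.
 by rewrite ler_wpM2r ?invr_ge0 ?(ltW l0)// ler_wpM2r// lerDl.
have h3: `|S-S1| <= `|S2| + C*B/l.
 have := ler_norm (- S2); rewrite normrN.
 rewrite ler_norml; move: h1 h2 hB; set y := C*B/l; set x := 2*_*_*_/l; lra.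
by rewrite -(subrK S1 S) (le_trans (ler_normD _ _))//; lra.
Qed.

End smooth.

(** * Use of the conditions on V_X *)

Section key2.
Variable R : realType.
Notation mu := (@lebesgue_measure R).
Notation RT := (setT : set (measurableTypeR R)).
Notation vm := (@von_mangoldt R).

Lemma prim_from (f : R -> R) a : continuous f -> exists G : R -> R, forall x, a<=x -> dv G x (f x).
Proof.
move=> cf; exists (fun x => \int[mu]_(t in `[a-1, x]) f t) => x x0.
have [|d E] := @continuous_FTC1 R f (BLeft (a-1)) x (x+1) (ltr_pwDr ltr01 (lexx x)) (contL (a-1) (x+1) cf) _ (cf x).
 have h: a-1<x by lra.
 by first [exact: h|exact: (ltW h)].
by apply: DeriveDef; [exact: d|rewrite -derive1E; exact: E].
Qed.

Lemma sym_int (L : R) (f : R -> R) : 0<=L -> continuous f ->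
 \int[mu]_(x in `[- L, L]) f x = \int[mu]_(x in `[0, L]) (f x+f (- x)).
Proof.
move=> L0 cf; have [G dG] := prim_from (- L) cf.
have d1 x : - L<=x<=L -> dv G x (f x) by move=> /andP[h _]; exact: dG.
have c1: cont_on (- L) L f by move=> x _; exact: cf.
rewrite (ftc _ d1 c1); last by lra.
have d2 x : 0<=x<=L -> dv (fun x => G x-G (- x)) x (f x+f (- x)).
 move=> /andP[x0 xL]; apply: (dv_eq (dvD (dG x _) (dvN (dv_opp (dG (- x) _))))); [by lra|by lra|by rewrite opprK].
have c2: cont_on 0 L (fun x => f x+f (- x)).
 move=> x _; apply: cvgD; first exact: cf.
 by apply: (@continuous_comp R R R (fun x : R => - x) f x); [exact: cvgN cvg_id|exact: cf].
by rewrite (ftc L0 d2 c2) oppr0 subrr subr0.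
Qed.

Lemma ReM_real (z : R[i]) (x : R) : complex.Re (z*x%:C) = complex.Re z*x.
Proof. by case: z => a b /=; rewrite mulr0 subr0. Qed.

Lemma Re_le_cnorm (z : R[i]) : `|complex.Re z| <= cnorm z.
Proof. by have := normc_ge_Re z; rewrite lecE => /andP[_]. Qed.

Lemma cexp_ReE (x s t : R) : complex.Re (cexp ('i*x%:C*((s +i* t) / 'i))) = expR (s*x)*cos (t*x).
Proof.
have -> : 'i*x%:C*((s +i* t) / 'i) = (s*x) +i* (t*x).
 apply/eqP; rewrite eq_complex /=; apply/andP; split; apply/eqP.
  by rewrite !(expr0n, expr1n)/= add0r !divr1; ring.
 by rewrite !(expr0n, expr1n)/= add0r !divr1; ring.
by [].
Qed.

Lemma cexp_ReE0 (x y : R) : complex.Re (cexp ('i*x%:C*y%:C)) = cos (y*x).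
Proof.
have -> : 'i*x%:C*y%:C = 0 +i* (y*x).
 by apply/eqP; rewrite eq_complex /= !(mul0r, mulr0, mul1r, mulr1, add0r, addr0, subr0, subrr, oppr0) (mulrC x) !eqxx.
by rewrite /= expR0 mul1r.
Qed.

Lemma Re_cint (f : R -> R[i]) : complex.Re (cintegral f) = \int[mu]_x complex.Re (f x).
Proof. by []. Qed.

Section w.
Variables (L : R) (w : R -> R).
Hypothesis L0 : 0<=L.
Hypothesis cw : continuous w.
Hypothesis we : forall x, w (- x) = w x.
Hypothesis ws : forall x, L < `|x| -> w x = 0.

Lemma supp_int (f : R -> R) : \int[mu]_x (f x*w x) = \int[mu]_(x in `[- L, L]) (f x*w x).
Proof.
apply: Rint_supp => // x _; rewrite itvE => h; rewrite ws ?mulr0// ltNge; apply/negP => h'.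
by apply: h; rewrite -ler_norml.
Qed.

Lemma four_hat y : complex.Re (fourier w y%:C) = hat L w y.
Proof.
have cc: continuous (fun x : R => cos (y*x)*w x) by move=> x; apply: cvgM; [exact: cosm_cont|exact: cw].
rewrite /fourier Re_cint.
transitivity (\int[mu]_x (cos (y*x)*w x)).
 by apply: Rint_ext => x _; rewrite ReM_real cexp_ReE0.
have E (x : R) : cos (y*x)*w x+cos (y * - x)*w (- x) = 2*(w x*cos (y*x)).
 by rewrite mulrN cosN we; ring.
rewrite supp_int sym_int// /hat -RZ; first by apply: Rint_ext => x _; exact: E.
- exact: itv_meas.
- by apply: contL => x; apply: cvgM; [exact: cw|exact: cosm_cont].
Qed.

(** Condition (ii) controls the two-sided transform; the half with the decaying exponential is
    bounded trivially, which isolates the pole term of [KEY1]. *)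
Lemma four_pole t : complex.Re (fourier w (((1/2) +i* t) / 'i)) =
 \int[mu]_(v in `[0, L]) (expR (v/2)*w v*cos (t*v)) + \int[mu]_(v in `[0, L]) (expR (- v/2)*w v*cos (t*v)).
Proof.
have ce (a : R) : continuous (fun x : R => expR (a*x)).
 by move=> x; exact: dv_cont (dv_expR (dvM (dv_cst a x) (dv_id x))).
have cc (a : R) : continuous (fun x : R => expR (a*x)*cos (t*x)*w x).
 by move=> x; apply: cvgM; [apply: cvgM; [exact: ce|exact: cosm_cont]|exact: cw].
rewrite /fourier Re_cint.
transitivity (\int[mu]_x (expR (1/2*x)*cos (t*x)*w x)).
 by apply: Rint_ext => x _; rewrite ReM_real cexp_ReE.
rewrite (supp_int (fun x => expR (1/2*x)*cos (t*x))) (sym_int L0 (cc (1/2))).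
have E (x : R) : expR (1/2*x)*cos (t*x)*w x+expR (1/2 * - x)*cos (t * - x)*w (- x) =
  expR (x/2)*w x*cos (t*x)+expR (- x/2)*w x*cos (t*x).
 have e1: 1/2*x = x/2 by rewrite mul1r mulrC.
 have e2: 1/2 * - x = - x/2 by rewrite mul1r mulrC.
 by rewrite e1 e2 (mulrN t x) cosN we; congr (_ + _); exact: mulrAC.
transitivity (\int[mu]_(x in `[0, L]) (expR (x/2)*w x*cos (t*x)+expR (- x/2)*w x*cos (t*x))).
 by apply: Rint_ext => x _; exact: E.
have c2 (a : R) : continuous (fun x : R => expR (x*a)*w x*cos (t*x)).
 move=> x; apply: cvgM; last exact: cosm_cont.
 by apply: cvgM; [exact: dv_cont (dv_expR (dvM (dv_id x) (dv_cst a x)))|exact: cw].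
apply: RD; [exact: itv_meas|exact: contL|].
by apply: contL => x; under eq_fun do rewrite mulNr -mulrN; exact: c2.
Qed.

End w.

Lemma exp_int_bnd (L : R) (w : R -> R) (a t : R) : 0<=L -> continuous w -> (forall u, `|w u| <= w 0) -> a != 0 -> `|\int[mu]_(v in `[0, L]) (expR (a*v)*w v*cos (t*v))| <= w 0*((expR (a*L)-1)/a).
Proof.
move=> L0 cw wb a0; have ce: continuous (fun x : R => expR (a*x)).
 by move=> x; exact: dv_cont (dv_expR (dvM (dv_cst a x) (dv_id x))).
have dF x : 0<=x<=L -> dv (fun x => expR (a*x)/a) x (expR (a*x)).
 by move=> _; apply: (dv_eq (dvM (dv_expR (dvM (dv_cst a x) (dv_id x))) (dv_cst a^-1 x))); field.
have cF: cont_on 0 L (fun x => expR (a*x)) by move=> x _; exact: ce.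
have -> : (expR (a*L)-1)/a = \int[mu]_(v in `[0, L]) expR (a*v).
 by rewrite (ftc L0 dF cF) mulr0 expR0; field.
rewrite -RZ//; last exact: contL.
apply: Rint_abs_le => //.
- by apply: contL => v; apply: cvgM; [apply: cvgM; [exact: ce|exact: cw]|exact: cosm_cont].
- by apply: L1Z => //; exact: contL.
have pw (v : R) : `|expR (a*v)*w v*cos (t*v)| <= w 0*expR (a*v).
 rewrite normrM -[leRHS]mulr1; apply: ler_pM => //; last exact: ncos_le1.
 by rewrite normrM mulrC (ger0_norm (expR_ge0 _)) ler_wpM2r ?expR_ge0.
by move=> v _; exact: pw.
Qed.

Lemma aux1 (v x y : R) : 0<=v -> x<=y -> v*((x-1)/(1/2))<=2*v*y.
Proof.
move=> v0 xy; have -> : v*((x-1)/(1/2)) = 2*(v*x)-2*v by field.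
by have := ler_wpM2l v0 xy; lra.
Qed.

Lemma aux2 (i v e : R) : 0<=v -> 0<=e -> `|i| <= v*((e-1) / - (1/2)) -> - (2*v)<=i.
Proof.
move=> v0 e0; have -> : v*((e-1) / - (1/2)) = 2*v-2*(v*e) by field.
by rewrite ler_norml => /andP[h _]; have := mulr_ge0 v0 e0; lra.
Qed.

Lemma aux3 (a b c d e : R) : a+b<=c -> - e<=b -> c<=d -> a<=d+e.
Proof. by move=> *; lra. Qed.

(** [KEY1] with [w = V X] and [L = ln X]: positivity of the transform and condition (iii) are its
    hypotheses on [hat]. The pole term is estimated by condition (ii), and [X <= T^(2m)] gives
    [X^(1/2) <= T^m]. *)
Theorem KEY2 (RH : riemann_hypothesis R)
  (m : R) (m_ge2 : 2<=m) (V : R -> R -> R)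
  (V_cont : forall X : R, 2<=X -> continuous (V X))
  (Vi : condition_i V) (Vii : condition_ii m V) (Viii : condition_iii V)
  (Vhat_gt0 : forall X y : R, 2<=X -> 0<fourier (V X) y%:C) :
 exists (n : nat) (C0 B0 T0 : R), [/\ 0<=C0, 0<=B0, 3<=T0 &
  (forall X u, 2<=X -> `|V X u| <= V X 0 /\ V X 0<=C0) /\
  forall T X t z : R, T0<=T -> 2<=X -> X<=T `^ (2 * m) -> T<=t<=2*T ->
  \sum_(1<=k<(Num.truncn X).+1) vm k*(expR (- (1/2) * ln k%:R)*V X (ln k%:R)*cos ((t+z) * ln k%:R))
   <= B0 * ln T*(1 + `|z|)^+n].
Proof.
have [A A0 HA] := KEY1 RH.
have [Ct hCt] := Viii.
have h12: 0<=1/2 :> R by rewrite divr_ge0.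
have [C2 [t0 hC2]] := Vii (1/2) h12.
pose C := `|Ct|; have C00: 0<=C := normr_ge0 Ct.
have p0 := @pi_gt0 R; have hm := @hl_meas R.
have ln2: 1/2<=ln 2 :> R.
 have e: 1-1/2 = 2^-1 :> R by field.
 have l1: ln (1-1/2) <= - (1/2) :> R by apply: le_ln1Dx; lra.
 by rewrite e lnV ?posrE// in l1; lra.
have LX (X : R) : 2<=X -> 1/2<=ln X.
 by move=> X2; apply: (le_trans ln2); rewrite ler_ln// posrE; lra.
have Vs X : 2<=X -> forall x, ln X < `|x| -> V X x = 0 by move=> X2; have [] := Vi X X2.
have Ve X : 2<=X -> forall x, V X (- x) = V X x by move=> X2; have [] := Vi X X2.
have Vh X x : 2<=X -> 0<=hat (ln X) (V X) x<=C*(ln X * p2 (ln X*x)).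
 move=> X2; have L2 := LX _ X2; have L0: 0<ln X by lra.
 rewrite -(four_hat (ltW L0) (V_cont _ X2) (Ve _ X2) (Vs _ X2)).
 have := Vhat_gt0 X x X2; rewrite ltcE => /andP[_ /ltW h0]; rewrite h0/=.
 have := hCt X (ln X*x) X2; rewrite (mulrAC (ln X)) divff ?lt0r_neq0// mul1r => h1.
 have := le_trans (Re_le_cnorm _) h1; rewrite mulrC ReM_real normrM (ger0_norm (ltW (_ : 0<(ln X)^-1))) ?invr_gt0//.
 rewrite ler_pdivrMr// => h2; apply: (le_trans (ler_norm _)); apply: (le_trans h2).
 have -> : C*(ln X * p2 (ln X*x)) = C * p2 (ln X*x) * ln X by ring.
 by rewrite ler_wpM2r ?(ltW L0)// ler_wpM2r ?ler_norm// ltW// p2_gt0.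
have Lh X : 2<=X -> L1 mu (@hl R) (hat (ln X) (V X)) /\ \int[mu]_(x in @hl R) hat (ln X) (V X) x<=C*16.
 move=> X2; have L2 := LX _ X2; have [LW IW] := scaleWt L2; have L0: 0<ln X by lra.
 have pb x : hat (ln X) (V X) x<=C*8*(ln X*Wt (ln X*x)).
  have /andP[_ h] := Vh X x X2; apply: (le_trans h); rewrite -mulrA ler_wpM2l// mulrCA ler_wpM2l ?(ltW L0)//.
  apply: le_trans (ell_Wt _); rewrite -/(p2 _) -[leLHS]mul1r.
  by apply: ler_wpM2r; [exact/ltW/p2_gt0|exact: ell_ge1].
 have L: L1 mu (@hl R) (hat (ln X) (V X)).
  apply: (L1_dom hm _ _ (L1Z (C*8) hm LW)) => [|x _]; first by apply: cont_meas => //; exact: hat_cont (V_cont _ X2).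
  by have /andP[h _] := Vh X x X2; rewrite ger0_norm.
 split=> //; apply: (@le_trans _ _ (\int[mu]_(x in @hl R) (C*8*(ln X*Wt (ln X*x))))).
  by apply: Rle => //; exact: L1Z.
 rewrite RZ// (_ : C*16 = C*8*2); last by ring.
 by rewrite ler_wpM2l// mulr_ge0.
have inv X v : 2<=X -> 0<=v -> V X v = pi^-1 * \int[mu]_(x in @hl R) (hat (ln X) (V X) x*cos (v*x)).
 move=> X2 v0; have L2 := LX _ X2; have L0: 0<ln X by lra.
 have wL u : ln X<u -> V X u = 0 by move=> h; apply: Vs => //; apply: lt_le_trans h (ler_norm u).
 apply: (@inversion _ _ _ (C * ln X*(1+(ln X)^-1^+2)) (ltW L0) (V_cont _ X2) wL) => // x.
 have /andP[h0 h1] := Vh X x X2; rewrite ger0_norm//; apply: (le_trans h1).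
 have -> : C*(ln X * p2 (ln X*x)) = C * ln X * p2 (ln X*x) by ring.
 rewrite -[leRHS]mulrA ler_wpM2l ?mulr_ge0 ?(ltW L0)//.
 rewrite /p2 -[leLHS]div1r ler_pdivrMr ?ltr_pwDl ?sqr_ge0// mulrAC ler_pdivlMr ?ltr_pwDl ?sqr_ge0// mul1r.
 have -> : (1+(ln X)^-1^+2)*(1+(ln X*x)^+2) = 1+(ln X)^-1^+2+(ln X*x)^+2+x^+2 by field; exact: lt0r_neq0.
 by have := sqr_ge0 (ln X*x); have := sqr_ge0 ((ln X)^-1); lra.
(* [V X] is the cosine transform of a nonnegative function, so its absolute value is largest at
   0. *)
have Vb X u : 2<=X -> `|V X u| <= V X 0.
 move=> X2; have [L _] := Lh X X2.
 wlog u0 : u/0<=u.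
  by move=> h; case: (leP 0 u) => [/h//|u0]; rewrite -Ve// h// oppr_ge0 ltW.
 rewrite (inv X u X2 u0) (inv X 0 X2 (lexx 0)) normrM (gtr0_norm (_ : 0<pi^-1)) ?invr_gt0//.
 rewrite ler_wpM2l ?invr_ge0 ?(ltW p0)//; apply: Rint_abs_le => //.
 - apply: (@L1_mulbnd _ _ _ _ 1) => // [|x _]; last exact: ncos_le1.
  by apply: cont_meas => //; exact: cosm_cont.
 - by apply: L1_ext L => x; rewrite mul0r cos0 mulr1.
 - move=> x _; have /andP[h _] := Vh X x X2; rewrite mul0r cos0 mulr1 normrM ger0_norm//.
  by rewrite -[leRHS]mulr1; apply: ler_wpM2l => //; exact: ncos_le1.
have pi1: pi^-1<=1 :> R by rewrite invf_le1// (le_trans _ (@pi_ge2 R))// ler1n.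
have V0b X : 2<=X -> V X 0<=C*16.
 move=> X2; have [L hL] := Lh X X2; rewrite (inv X 0 X2 (lexx 0)).
 have -> : \int[mu]_(x in @hl R) (hat (ln X) (V X) x*cos (0*x)) = \int[mu]_(x in @hl R) hat (ln X) (V X) x.
  by apply: Rint_ext => x _; rewrite mul0r cos0 mulr1.
 have I0: 0 <= \int[mu]_(x in @hl R) hat (ln X) (V X) x by apply: Rintegral_ge0 => x _; have /andP[] := Vh X x X2.
 by apply: le_trans hL; rewrite ler_piMl.
(* An integer exponent at least [m], so that [(1+|z|)^n] dominates the real power. *)
pose n := (Num.truncn m).+1.
have mn: m<=n%:R by have /andP[_ /ltW] := @truncn_itv R m (le_trans (ler0n R 2) m_ge2).
pose P2 : R := 2 `^ m.
have P20: 0<=P2 := powR_ge0 _ _.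
pose B0 := A*C*6+(`|C2| * P2+C*16*2*P2+C*16*2).
exists n, (C*16), B0, (3+2 * `|t0| + expR 1); split.
- exact: mulr_ge0.
- by rewrite /B0 !addr_ge0// ?mulr_ge0// !mulr_ge0.
- by rewrite -addrA lerDl addr_ge0 ?expR_ge0// mulr_ge0.
split=> [X u X2|T X t z hT X2 XT /andP[tT t2T]]; first by split; [exact: Vb|exact: V0b].
have nt0 := normr_ge0 t0; have e0 := expR_ge0 (1 : R).
have T3: 3<=T by lra.
have T0: 0<T by lra.
have lT: 1<=ln T by rewrite -[leLHS](@expRK R) ler_ln ?posrE ?expR_gt0//; lra.
have L2 := LX _ X2; have L0: 0<ln X by lra.
have X0: 0<X by lra.
have LN: ln X<ln (Num.truncn X).+1%:R.
 by have /andP[_ h] := truncn_itv (ltW X0); rewrite ltr_ln ?posrE.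
have wL u : ln X<u -> V X u = 0 by move=> h; apply: Vs => //; apply: lt_le_trans h (ler_norm u).
have := HA C (ln X) (V X) (Num.truncn X) C00 L2 LN (V_cont _ X2) wL (fun x => Vh X x X2) (t+z) => /le_trans; apply.
pose w := V X; rewrite -/w.
have w0: 0<=w 0 := le_trans (normr_ge0 _) (Vb X 0 X2).
have z0 := normr_ge0 z.
have z1: 1<=(1 + `|z|)^+n by rewrite exprn_ege1// lerDl.
have z2: 1 + `|z| <= (1 + `|z|)^+n by rewrite -[leLHS]expr1 ler_weXn2l// lerDl.
have Zm: (1 + `|z|) `^ m<=(1 + `|z|)^+n by rewrite -powR_mulrn ?addr_ge0// ler_powR// lerDl.
have ellb: ell (t+z)<=6 * ln T*(1 + `|z|)^+n.
 have h1: ell t<=3 * ln T.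
  rewrite /ell ger0_norm; last by lra.
  have : ln (2+t)<=ln (T*T) by rewrite ler_ln ?posrE ?mulr_gt0//; [nra|lra].
  by rewrite lnM ?posrE//; lra.
 have h2 := ell_le z; have h3 := ell_ge1 t; have h4 := ell_ge1 z.
 apply: (le_trans (ell_add t z)).
 apply: (@le_trans _ _ (3 * ln T*(2*(1 + `|z|)^+n))); last by apply: eq_le_; ring.
 by apply: ler_pM; [lra|lra|exact: h1|apply: (le_trans h2); rewrite ler_wpM2l].
have Xm: X `^ (1/2)<=T `^ m.
 have -> : T `^ m = (T `^ (2 * m)) `^ (1/2) by rewrite -powRrM; congr (_ `^ _); field.
 by rewrite ge0_ler_powR ?nnegrE ?powR_ge0// ltW.
have Xe: expR (1/2 * ln X) = X `^ (1/2) by rewrite /powR gt_eqF.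
have neven (s : R) : \int[mu]_(v in `[0, ln X]) (expR (v/2)*w v*cos (s*v)) = \int[mu]_(v in `[0, ln X]) (expR (v/2)*w v*cos (`|s| * v)).
 case: (leP 0 s) => [/ger0_norm->//|/ltr0_norm->].
 by apply: Rint_ext => v _; rewrite mulNr cosN.
have trivb (s : R) : \int[mu]_(v in `[0, ln X]) (expR (v/2)*w v*cos (s*v))<=2*w 0*T `^ m.
 have h := @exp_int_bnd (ln X) (V X) (1/2) s (ltW L0) (V_cont _ X2) (fun u => Vb X u X2).
 have -> : \int[mu]_(v in `[0, ln X]) (expR (v/2)*w v*cos (s*v)) = \int[mu]_(v in `[0, ln X]) (expR (1/2*v)*w v*cos (s*v)).
  by apply: Rint_ext => v _; rewrite mul1r (mulrC v).
 apply: (le_trans (ler_norm _)); apply: (le_trans (h _)); first by rewrite lt0r_neq0.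
 by rewrite Xe; exact: aux1.
have smallb (s : R) : 0<T/2 -> T/2<=s -> \int[mu]_(v in `[0, ln X]) (expR (v/2)*w v*cos (s*v)) <= `|C2| * P2+2*w 0.
 move=> T20 Ts; have s0: t0<=s by have := ler_norm t0; lra.
 have h1 := le_trans (ler_norm _) (le_trans (Re_le_cnorm _) (hC2 X s X2 s0)).
 rewrite (four_pole (ltW L0) (V_cont _ X2) (Ve _ X2) (Vs _ X2)) in h1.
 have h2 := @exp_int_bnd (ln X) (V X) (- (1/2)) s (ltW L0) (V_cont _ X2) (fun u => Vb X u X2).
 have h3: - (2*w 0) <= \int[mu]_(v in `[0, ln X]) (expR (- v/2)*w v*cos (s*v)).
  have -> : \int[mu]_(v in `[0, ln X]) (expR (- v/2)*w v*cos (s*v)) = \int[mu]_(v in `[0, ln X]) (expR (- (1/2)*v)*w v*cos (s*v)).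
   by apply: Rint_ext => v _; rewrite mul1r mulNr mulNr (mulrC v).
  by apply: (aux2 w0 (expR_ge0 (- (1/2) * ln X))); apply: h2; rewrite oppr_eq0 lt0r_neq0.
 have h4: C2*(X `^ (1/2) / `|s| `^ m) <= `|C2| * P2.
  apply: (@le_trans _ _ (`|C2| * (X `^ (1/2) / `|s| `^ m))).
   by rewrite ler_wpM2r ?ler_norm// divr_ge0// powR_ge0.
  have s1: 0<s := lt_le_trans T20 Ts.
  rewrite (gtr0_norm s1); apply: ler_wpM2l => //; rewrite ler_pdivrMr ?powR_gt0//.
  apply: (le_trans Xm); rewrite /P2 -powRM ?(ltW s1)//.
  have Ts2: T<=2*s by move: Ts; rewrite ler_pdivrMr// mulrC.
  by apply: ge0_ler_powR; rewrite ?nnegrE ?mulr_ge0 ?(ltW T0) ?(ltW s1)//; exact: le_trans m_ge2.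
 exact: aux3 h1 h3 h4.
have poleb: \int[mu]_(v in `[0, ln X]) (expR (v/2)*w v*cos ((t+z)*v))<=(`|C2| * P2+C*16*2*P2+C*16*2)*(1 + `|z|)^+n.
 have w16: w 0<=C*16 := V0b X X2.
 have c16: 0<=C*16 := le_trans w0 w16.
 (* For [|z| <= T/2] the height [t+z] is at least [T/2] and [X^(1/2)/(t+z)^m] is at most [2^m]. For
    larger [|z|] the trivial bound [T^m] is itself at most [2^m (1+|z|)^m]. *)
 case: (leP `|z| (T/2)) => hz.
  have Ts: T/2<=t+z by move: hz; rewrite ler_norml => /andP[]; lra.
  apply: (le_trans (smallb _ (divr_gt0 T0 (ltr0n R 2)) Ts)).
  have h5: 0 <= `|C2| * P2+C*16*2*P2+C*16*2 by rewrite !addr_ge0// !mulr_ge0.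
  have h6: 0<=C*16*2*P2 by rewrite !mulr_ge0.
  by apply: le_trans (ler_peMr h5 z1); lra.
 apply: (le_trans (trivb _)).
 have h7: T `^ m<=P2*(1 + `|z|)^+n.
  apply: (@le_trans _ _ (P2*(1 + `|z|) `^ m)); last by rewrite ler_wpM2l.
  rewrite /P2 -powRM ?addr_ge0// ge0_ler_powR ?nnegrE ?(ltW T0) ?mulr_ge0 ?addr_ge0//; lra.
 have Z0: 0<=(1 + `|z|)^+n := le_trans ler01 z1.
 apply: (@le_trans _ _ (C*16*2*(P2*(1 + `|z|)^+n))).
  by apply: ler_pM => //; [exact: mulr_ge0|exact: powR_ge0|lra].
 rewrite mulrA ler_wpM2r// -addrA addrCA lerDl addr_ge0// !mulr_ge0//.
have AC0: 0<=A*C by exact: mulr_ge0.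
have hE := ler_wpM2l AC0 ellb.
have hP: (`|C2| * P2+C*16*2*P2+C*16*2)*(1 + `|z|)^+n<=(`|C2| * P2+C*16*2*P2+C*16*2) * ln T*(1 + `|z|)^+n.
 rewrite ler_wpM2r ?(le_trans ler01 z1)// ler_peMr// !addr_ge0// !mulr_ge0//.
apply: (le_trans (lerD hE (le_trans poleb hP))); apply: eq_le_.
by rewrite /B0; ring.
Unshelve. all: by [].
Qed.

End key2.

(** * High moments of cosine polynomials over primes *)

Section moments.
Variable R : realType.
Notation mu := (@lebesgue_measure R).
Notation RT := (setT : set (measurableTypeR R)).

Definition cn2 (z : R[i]) := complex.Re z^+2+complex.Im z^+2.

Lemma cn2M (x y : R[i]) : cn2 (x*y) = cn2 x*cn2 y.
Proof. by case: x => a b; case: y => c d; rewrite /cn2 /=; ring. Qed.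

Lemma cn2X (x : R[i]) k : cn2 (x^+k) = cn2 x^+k.
Proof.
elim: k => [|k IH]; last by rewrite !exprS cn2M IH.
by rewrite !expr0 /cn2 /= expr0n expr1n /= addr0.
Qed.

Definition ee (x : R) : R[i] := cos x +i* sin x.

Lemma eeD x y : ee (x+y) = ee x*ee y.
Proof. by rewrite /ee cosD sinD; apply/eqP; rewrite eq_complex /= eqxx /=; apply/eqP; ring. Qed.

Lemma ee0 : ee 0 = 1.
Proof. by rewrite /ee cos0 sin0. Qed.

Lemma ReD (x y : R[i]) : complex.Re (x+y) = complex.Re x+complex.Re y.
Proof. by case: x => a b; case: y. Qed.

Lemma ImD (x y : R[i]) : complex.Im (x+y) = complex.Im x+complex.Im y.
Proof. by case: x => a b; case: y. Qed.

Lemma sum_ee (I : finType) (a th : I -> R) :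
 complex.Re (\sum_i (a i)%:C*ee (th i)) = \sum_i a i*cos (th i) /\
 complex.Im (\sum_i (a i)%:C*ee (th i)) = \sum_i a i*sin (th i).
Proof.
split.
 rewrite (big_morph (@complex.Re R) ReD (erefl : complex.Re (0 : R[i]) = 0)).
 by apply: eq_bigr => i _; rewrite /= mul0r subr0.
rewrite (big_morph (@complex.Im R) ImD (erefl : complex.Im (0 : R[i]) = 0)).
by apply: eq_bigr => i _; rewrite /= mul0r addr0.
Qed.

(** The polynomial is the real part of an exponential sum [F], so its power [2k] is at most the
    squared modulus of [F^k], which is expanded over k-tuples. *)
Lemma trig_pow (M k : nat) (c th : 'I_M -> R) :
 (\sum_i c i*cos (th i))^+(2*k) <=
 \sum_(s : {ffun 'I_k -> 'I_M}) \sum_(u : {ffun 'I_k -> 'I_M})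
  (\prod_j c (s j))*(\prod_j c (u j))*cos (\sum_j th (s j) - \sum_j th (u j)).
Proof.
pose F := \sum_i (c i)%:C*ee (th i).
have [FR _] := sum_ee c th.
apply: (@le_trans _ _ (cn2 (F^+k))).
 rewrite cn2X exprM -FR /cn2.
 by rewrite lerXn2r ?nnegrE ?addr_ge0 ?sqr_ge0// lerDl sqr_ge0.
have -> : F^+k = \sum_(s : {ffun 'I_k -> 'I_M}) (\prod_j c (s j))%:C*ee (\sum_j th (s j)).
 transitivity (\prod_(j<k) F); first by rewrite prodr_const card_ord.
 rewrite /F bigA_distr_bigA; apply: eq_bigr => s _.
 by rewrite big_split/= rmorph_prod (big_morph ee eeD ee0).
rewrite /cn2; have [-> ->] := sum_ee (fun s : {ffun 'I_k -> 'I_M} => \prod_j c (s j)) (fun s => \sum_j th (s j)).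
rewrite !expr2 !big_distrlr/= -big_split/=; apply: eq_le_; apply: eq_bigr => s _.
by rewrite -big_split/=; apply: eq_bigr => u _; rewrite cosB; ring.
Qed.

(** Schur's test: [|A s| |A u|] is at most half the sum of the squares, and the rows of [e] are
    bounded. *)
Lemma double_sum (I : finType) (e : I -> I -> R) (A : I -> R) (B : R) :
 (forall s u, e s u = e u s) -> (forall s u, 0<=e s u) -> (forall s, \sum_u e s u<=B) ->
 \sum_s \sum_u e s u*(`|A s| * `|A u|)<=B * \sum_s A s^+2.
Proof.
move=> es e0 eB.
have h: \sum_s \sum_u e s u*(`|A s| * `|A u|) <= \sum_s \sum_u (e s u*(A s^+2/2)+e s u*(A u^+2/2)).
 apply: ler_sum => s _; apply: ler_sum => u _; rewrite -mulrDr ler_wpM2l//.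
 rewrite -(real_normK (num_real (A s))) -(real_normK (num_real (A u))).
 by have := sqr_ge0 (`|A s| - `|A u|); set x := `|A s|; set y := `|A u|; clear; nra.
apply: (le_trans h).
have E: \sum_s \sum_u e s u*(A u^+2/2) = \sum_s \sum_u e s u*(A s^+2/2).
 by rewrite exchange_big/=; apply: eq_bigr => s _; apply: eq_bigr => u _; rewrite es.
have -> : \sum_s \sum_u (e s u*(A s^+2/2)+e s u*(A u^+2/2)) = \sum_s (\sum_u e s u)*A s^+2.
 transitivity (\sum_s \sum_u e s u*(A s^+2/2) + \sum_s \sum_u e s u*(A u^+2/2)).
  by rewrite -big_split/=; apply: eq_bigr => s _; rewrite big_split.
 rewrite E -big_split/=; apply: eq_bigr => s _; rewrite -!mulr_suml -mulrDr; congr (_*_); by field.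
by rewrite mulr_sumr; apply: ler_sum => s _; rewrite ler_wpM2r ?sqr_ge0.
Qed.

Lemma ln_gap (a b D : nat) : (0<a)%N -> (0<b)%N -> (a<=D)%N -> (b<=D)%N -> a != b ->
 D%:R^-1 <= `|ln a%:R-ln b%:R| :> R.
Proof.
wlog ba : a b/(b<a)%N.
 move=> h a0 b0 aD bD ab; case: (ltngtP a b) => c; last by rewrite c eqxx in ab.
  by rewrite distrC; apply: h; rewrite // eq_sym.
 exact: h.
move=> a0 b0 aD bD _.
have aR: 0<a%:R :> R by rewrite ltr0n.
have bR: 0<b%:R :> R by rewrite ltr0n.
have h: ln b%:R-ln a%:R<=b%:R/a%:R-1 :> R.
 rewrite -ln_div ?posrE//; have := @le_ln1Dx R (b%:R/a%:R-1); rewrite addrCA subrr addr0; apply.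
 by rewrite ltrBrDl subrr divr_gt0.
have h2: b%:R/a%:R-1 <= - a%:R^-1 :> R.
 have : b.+1%:R/a%:R<=1 :> R by rewrite ler_pdivrMr// mul1r ler_nat.
 by rewrite -natr1 mulrDl mul1r; lra.
apply: (@le_trans _ _ a%:R^-1).
 by rewrite lef_pV2 ?posrE ?ltr0n ?(leq_trans a0)// ler_nat.
by apply: le_trans (ler_norm _); lra.
Qed.

Lemma lnprod k (u : 'I_k -> nat) : (forall j, (0<u j)%N) ->
 ln (\prod_j u j)%N%:R = \sum_j ln (u j)%:R :> R.
Proof.
elim: k u => [|k IH] u h; first by rewrite !big_ord0 ln1.
rewrite !big_ord_recl natrM lnM ?posrE ?ltr0n ?h//; last by rewrite prodn_gt0// => j; rewrite h.
by rewrite IH.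
Qed.

Lemma logn_prod_count (s : seq nat) q : all prime s -> logn q (\prod_(p <- s) p)%N = count_mem q s.
Proof.
elim: s => [|p s IH] /=; first by rewrite big_nil logn1.
move=> /andP[pp ps]; have p0 := prime_gt0 pp.
have s0: (0 < \prod_(r <- s) r)%N.
 elim: s ps {IH} => [|r s IH] /=; first by rewrite big_nil.
 by move=> /andP[pr ps]; rewrite big_cons muln_gt0 prime_gt0// IH.
by rewrite big_cons lognM// IH// logn_prime// eq_sym.
Qed.

Lemma prime_perm (s u : seq nat) : all prime s -> all prime u ->
 (\prod_(p <- s) p = \prod_(p <- u) p)%N -> perm_eq s u.
Proof. by move=> ps pu E; apply/allP => q _; rewrite /= -!logn_prod_count// E. Qed.

Definition good M k (s : {ffun 'I_k -> 'I_M}) := [forall j, prime (s j)].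
Definition fprod_ M k (s : {ffun 'I_k -> 'I_M}) := (\prod_j (s j : nat))%N.

(** By unique factorization, tuples of primes with the same product are permutations of each
    other. *)
Lemma fiber_card M k (s : {ffun 'I_k -> 'I_M}) : good s ->
 (#|[pred u : {ffun 'I_k -> 'I_M} | good u && (fprod_ s == fprod_ u)]| <= k`!)%N.
Proof.
move=> gs; pose f (p : {perm 'I_k}) := [ffun j => s (p j)].
have h2: (#|[set f p | p : {perm 'I_k}]| <= k`!)%N.
 by apply: leq_trans (leq_imset_card _ _) _; rewrite card_Sn.
apply: leq_trans h2.
apply: fintype.subset_leq_card; apply/fintype.subsetP => u; rewrite inE => /andP[gu /eqP E].
pose ts := [tuple s j | j<k]; pose tu := [tuple u j | j<k].
have pe: perm_eq tu ts.
 apply: (perm_map_inj (f := @nat_of_ord M)); first exact: val_inj.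
 apply: prime_perm.
 - by rewrite all_map; apply/allP => x /mapP[j _ ->] /=; exact: (forallP gu).
 - by rewrite all_map; apply/allP => x /mapP[j _ ->] /=; exact: (forallP gs).
 - have EE (w : {ffun 'I_k -> 'I_M}) : (\prod_(p <- [seq nat_of_ord i | i <- [tuple w j | j<k]]) p)%N = fprod_ w.
   by rewrite big_map big_tuple; apply: eq_bigr => j _; rewrite tnth_mktuple.
  by rewrite !EE -E.
have /tuple_permP[p Ep] := pe.
apply/imsetP; exists p => //; apply/ffunP => j; rewrite ffunE.
have : tu = [tuple tnth ts (p i) | i<k] by exact: val_inj.
by move=> /(congr1 (fun t : k.-tuple 'I_M => tnth t j)); rewrite !tnth_mktuple.
Qed.

Lemma cos_int (a T : R) : 0<=T -> \int[mu]_(t in `[T, 2*T]) cos (a * t)<=T /\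
 (a != 0 -> `|\int[mu]_(t in `[T, 2*T]) cos (a * t)| <= 2 / `|a|).
Proof.
move=> T0; have TT: T<=2*T by lra.
split.
 apply: (@le_trans _ _ (\int[mu]_(t in `[T, 2*T]) 1)).
  apply: Rle; [exact: itv_meas|by apply: contL; exact: cosm_cont|by apply: L1_cst => //; exact: mu_itv_fin|].
  by move=> t _; exact: cos_le1.
 by rewrite Rint_itv_cst//; lra.
move=> a0.
have dF t : T<=t<=2*T -> dv (fun t => sin (a * t)/a) t (cos (a * t)).
 by move=> _; apply: (dv_eq (dvM (dv_sin (dvM (dv_cst a t) (dv_id t))) (dv_cst a^-1 t))); field.
have cF: cont_on T (2*T) (fun t => cos (a * t)) by move=> t _; exact: cosm_cont.
rewrite (ftc TT dF cF) -mulrBl normrM normfV ler_wpM2r ?invr_ge0//.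
apply: (le_trans (ler_normB _ _)); have := nsin_le1 (a*(2*T)); have := nsin_le1 (a*T); lra.
Qed.

(** The speed [b] is 1 for the primes and 2 for their squares; the phase treats sines and cosines
    together. *)
Definition trig M (c : nat -> R) (b ph t : R) := \sum_(i<M) c i*cos (b * t * ln i%:R+ph).

Lemma trig_cont M c b ph : continuous (trig M c b ph).
Proof.
apply: (@lip_cont _ _ (\sum_(i<M) `|c i| * `|b * ln i%:R|)) => x y.
rewrite /trig -sumrB mulr_suml; apply: (le_trans (ler_norm_sum _ _ _)); apply: ler_sum => i _.
rewrite -mulrBr (normrM (c i)) -[leRHS]mulrA ler_wpM2l//; apply: (le_trans (cos_lip _ _)).
rewrite -normrM; apply: eq_le_; congr `|_|; ring.
Qed.

(** The diagonal contributes [T k!] to each row. An off-diagonal pair has frequencies at least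
    [M^(-k)] apart and contributes at most [2 M^k]; the [M^k] of them in a row add up to at most
    [2 T]. *)
Theorem moment M k (c : nat -> R) (b ph T : R) : 1<=b -> 0<T -> (M ^ (2*k))%:R<=T ->
 (forall i, ~~ prime i -> c i = 0) ->
 \int[mu]_(t in `[T, 2*T]) trig M c b ph t^+(2*k)<=3*T*k`!%:R*(\sum_(i<M) c i^+2)^+k.
Proof.
move=> b1 T0 MT cp.
pose FF := {ffun 'I_k -> 'I_M}.
pose A (s : FF) := \prod_j c (s j).
pose Ls (s : FF) : R := \sum_j ln (s j : nat)%:R.
have Agood s : A s != 0 -> good s.
 move=> h; apply/forallP => j; apply: contraNT h => /cp h; rewrite /A (bigD1 j)//= h mul0r.
 by [].
pose g (s u : FF) (t : R) := A s*A u*cos (b*(Ls s-Ls u) * t).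
have gc s u : continuous (g s u) by move=> t; apply: cvgM; [exact: cvg_cst|exact: cosm_cont].
have step1: \int[mu]_(t in `[T, 2*T]) trig M c b ph t^+(2*k) <= \sum_s \sum_u \int[mu]_(t in `[T, 2*T]) g s u t.
 have Lg s u : L1 mu `[T, 2*T] (g s u) := contL _ _ (gc s u).
 have -> : \sum_s \sum_u \int[mu]_(t in `[T, 2*T]) g s u t = \int[mu]_(t in `[T, 2*T]) \sum_s \sum_u g s u t.
  rewrite Rint_sum//; last by move=> s _; exact: L1_sum.
  by apply: eq_bigr => s _; rewrite Rint_sum.
 apply: Rle; [exact: itv_meas| |apply: L1_sum => // s _; exact: L1_sum|].
  apply: contL => t; apply: (@continuous_comp R R R (trig M c b ph) (fun x => x^+(2*k))); [exact: trig_cont|exact: exprn_continuous].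
 have pw (t : R) : trig M c b ph t^+(2*k) <= \sum_s \sum_u g s u t.
  have h := @trig_pow M k (fun i => c i) (fun i => b * t * ln (i : nat)%:R+ph).
  apply: (le_trans h); apply: eq_le_; apply: eq_bigr => s _; apply: eq_bigr => u _.
  rewrite /g; congr (_*cos _); rewrite !big_split/= !sumr_const -!mulr_sumr /Ls.
  by move: (_ *+ _) => z; ring.
 by move=> t _; exact: pw.
(* The off-diagonal bound is added to all pairs, which keeps [e] simple and symmetric. *)
pose e (s u : FF) : R := T*(good s && good u && (fprod_ s == fprod_ u))%:R+2*(M ^ k)%:R.
have e0 s u : 0<=e s u by rewrite addr_ge0// mulr_ge0// ltW.
have es s u : e s u = e u s by rewrite /e (andbC (good s)) (eq_sym (fprod_ s)).
have gb s u : \int[mu]_(t in `[T, 2*T]) g s u t<=e s u*(`|A s| * `|A u|).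
 have [h0|h0] := eqVneq (A s*A u) 0.
  rewrite (_ : \int[mu]_(t in `[T, 2*T]) g s u t = 0); first by rewrite mulr_ge0// mulr_ge0.
  transitivity (\int[mu]_(t in `[T, 2*T]) (0 : R)); last exact: Rint_0.
  by apply: Rint_ext => t _; rewrite /g h0 mul0r.
 have [/Agood gs /Agood gu] : A s != 0 /\ A u != 0 by move: h0; rewrite mulf_eq0 negb_or => /andP[].
 rewrite /g RZ//; last by apply: contL; exact: cosm_cont.
 set a := b*_.
 apply: (le_trans (ler_norm _)); rewrite normrM normrM mulrC ler_wpM2r ?mulr_ge0//.
 have M0: 0<=2*(M ^ k)%:R :> R by rewrite mulr_ge0.
 have TT: T<=2*T by lra.
 rewrite /e gs gu /=; case: eqP => E.
  rewrite mulr1; apply: (@le_trans _ _ T); last by rewrite lerDl.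
  apply: (@le_trans _ _ (\int[mu]_(t in `[T, 2*T]) 1)); last by rewrite Rint_itv_cst//; lra.
  apply: Rint_abs_le => //; [by apply: contL; exact: cosm_cont|by apply: L1_cst => //; exact: mu_itv_fin|].
  by move=> t _; exact: ncos_le1.
 rewrite mulr0 add0r.
 have pos (w : FF) : good w -> forall j, (0<(w j : nat))%N by move=> gw j; apply: prime_gt0; exact: (forallP gw).
 have LE (w : FF) : good w -> Ls w = ln (fprod_ w)%:R by move=> gw; rewrite /Ls /fprod_ lnprod//; exact: pos.
 have fp (w : FF) : good w -> (0<fprod_ w<=M ^ k)%N.
  move=> gw; apply/andP; split; first by rewrite prodn_gt0// => j; exact: pos.
  rewrite /fprod_; apply: (@leq_trans (\prod_(j<k) M)%N); last by rewrite prod_nat_const card_ord.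
  by apply: leq_prod => j _; exact: ltnW.
 have /andP[s1 s2] := fp _ gs; have /andP[u1 u2] := fp _ gu.
 have gap: (M ^ k)%:R^-1 <= `|Ls s-Ls u| by rewrite !LE//; apply: ln_gap => //; exact/eqP.
 have Mk: 0<(M ^ k)%:R :> R by rewrite ltr0n (leq_trans s1).
 have ga: (M ^ k)%:R^-1 <= `|a|.
  apply: (le_trans gap); rewrite /a normrM ler_peMl// (le_trans b1)// ler_norm//.
 have a0: 0 < `|a| by apply: lt_le_trans ga; rewrite invr_gt0.
 have [_ h] := cos_int a (ltW T0); apply: (le_trans (h _)); first by rewrite -normr_gt0.
 by rewrite ler_wpM2l// -[leRHS]invrK lef_pV2 ?posrE ?invr_gt0.
have rows s : \sum_u e s u<=3*T*k`!%:R.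
 rewrite big_split/= -mulr_sumr sumr_const card_ffun !card_ord.
 have c1: \sum_(u : FF) (good s && good u && (fprod_ s == fprod_ u))%:R<=k`!%:R :> R.
  case gs : (good s); last by rewrite big1.
  rewrite -natr_sum ler_nat; apply: leq_trans (fiber_card gs).
  rewrite -sum1_card [leqRHS]big_mkcond/=; apply: leq_sum => u _; rewrite inE.
  by case: (_ && _).
 have k1: 1<=k`!%:R :> R by rewrite ler1n fact_gt0.
 have M2: 2*(M ^ k)%:R *+ M ^ k<=2*T*k`!%:R.
  rewrite -mulr_natr -mulrA -natrM -expnD addnn -mul2n -mulrA ler_wpM2l//.
  by apply: (le_trans MT); rewrite ler_peMr// ltW.
 by have := ler_wpM2l (ltW T0) c1; lra.
apply: (le_trans step1); apply: (@le_trans _ _ (\sum_s \sum_u e s u*(`|A s| * `|A u|))).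
 by apply: ler_sum => s _; apply: ler_sum => u _.
apply: (le_trans (double_sum A es e0 rows)); rewrite ler_wpM2l ?mulr_ge0 ?(ltW T0)//.
apply: eq_le_; transitivity (\prod_(j<k) \sum_(i<M) c i^+2); last by rewrite prodr_const card_ord.
by rewrite bigA_distr_bigA; apply: eq_bigr => s _; rewrite /A -prodrXl.
Qed.

Lemma cheb (f : R -> R) k (T y B : R) : continuous f -> 0<y ->
 \int[mu]_(t in `[T, 2*T]) f t^+(2*k)<=B ->
 (lebesgue_measure [set t : R | ((T<=t<=2*T) && (y <= `|f t|))%R] <= (B/y^+(2*k))%:E)%E.
Proof.
move=> cf y0 hB; set S := [set t : R | _].
have mS: measurable (S : set (measurableTypeR R)).
 rewrite (_ : S = `[T, 2*T]%classic `&` (fun t => `|f t|) @^-1` `[y, +oo[%classic); last first.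
  apply/seteqP; split => t.
   by move=> /andP[h1 h2]; split; rewrite /= in_itv/= ?h1// h2.
  by move=> [h1 h2]; move: h1 h2; rewrite /= !in_itv /= andbT /S /= => -> ->.
 have : measurable_fun RT (fun t => `|f t|).
  apply: cont_meas => // t; apply: (@continuous_comp R R R f (fun x => `|x|)); [exact: cf|exact: norm_continuous].
 move=> mf; apply: measurableI => //; rewrite -[X in measurable X]setTI.
 by apply: mf => //; exact: measurable_itv.
have SI: S `<=` `[T, 2*T]%classic by move=> t /andP[h _]; rewrite itvE.
pose I := `[T, 2*T]%classic : set (measurableTypeR R).
have muS: (lebesgue_measure S<=mu I)%E by apply: le_measure; [exact/mem_set|apply/mem_set; exact: itv_meas|exact: SI].
have fS: (lebesgue_measure S < +oo)%E by apply: le_lt_trans muS _; exact: mu_itv_fin.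
have fnum: lebesgue_measure S \is a fin_num by rewrite ge0_fin_numE.
rewrite -(fineK fnum) lee_fin ler_pdivlMr ?exprn_gt0//; apply: le_trans hB.
have cp: continuous (fun t => f t^+(2*k)).
 by move=> t; apply: (@continuous_comp R R R f (fun x => x^+(2*k))); [exact: cf|exact: exprn_continuous].
have Lp := contL T (2*T) cp.
have -> : fine (lebesgue_measure S)*y^+(2*k) = \int[mu]_(t in S) y^+(2*k) by rewrite Rintegral_cst// mulrC.
rewrite Rint_mkcond [leRHS]Rint_mkcond; apply: Rle => //.
- by apply/(L1_mkcond mu (fun=> y^+(2*k)) mS); exact: L1_cst.
- by apply/(L1_mkcond mu _ (itv_meas T (2*T))).
move=> t _; rewrite !indicE; case: (boolP (t \in S)) => h.
 rewrite mem_set ?mul1r; last by apply: SI; exact: set_mem.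
 have /andP[_ {}h] := set_mem h.
 rewrite (exprM (f t)) -(real_normK (num_real (f t))) -exprM.
 by rewrite lerXn2r// nnegrE ltW// (lt_le_trans y0).
rewrite mul0r mulr_ge0// exprM exprn_ge0// sqr_ge0//.
Qed.

End moments.

(** * Chebyshev and Mertens bounds *)

Section primes.
Variable R : realType.
Notation vm := (@von_mangoldt R).

Definition psi n : R := \sum_(1<=d<n.+1) vm d.
(** The logarithm of the factorial of [n]. *)
Definition LF n : R := \sum_(1<=j<n.+1) ln j%:R.

Lemma div_count d n : (0<d)%N -> \sum_(1<=j<n.+1) ((d %| j)%N)%:R = (n %/ d)%N%:R :> R.
Proof.
move=> d0; elim: n => [|n IH]; first by rewrite big_geq// div0n.
by rewrite big_nat_recr//= IH divnS// natrD addrC.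
Qed.

Lemma LFE n N : (n<=N)%N -> LF n = \sum_(1<=d<N.+1) vm d*(n %/ d)%N%:R.
Proof.
move=> nN; transitivity (\sum_(1<=j<n.+1) \sum_(1<=d<N.+1) vm d*((d %| j)%N)%:R).
 by apply: eq_big_nat => j /andP[j0 jn]; rewrite vm_div// j0 (leq_trans jn).
rewrite exchange_big/=; apply: eq_big_nat => d /andP[d0 _].
by rewrite -mulr_sumr div_count.
Qed.

Lemma LF_le n : LF n<=n%:R * ln n%:R.
Proof.
rewrite /LF (@le_trans _ _ (\sum_(1<=j<n.+1) ln n%:R))//.
 apply: ler_sum_nat => j /andP[j0 jn]; rewrite ltnS in jn; have n0 := leq_trans j0 jn.
 by rewrite ler_ln ?posrE ?ltr0n ?ler_nat.
by rewrite sumr_const_nat subn1 /= mulr_natl.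
Qed.

Lemma ln_step n : (0<n)%N -> ln n.+1%:R-ln n%:R<=n%:R^-1 :> R.
Proof.
move=> n0; have nR: 0<n%:R :> R by rewrite ltr0n.
rewrite -ln_div ?posrE//; have := @le_ln1Dx R n%:R^-1.
rewrite -natr1 mulrDl mul1r divff ?lt0r_neq0//; apply.
by rewrite (lt_trans (ltrN10 R))// invr_gt0.
Qed.

Lemma LF_ge n : n%:R * ln n%:R-n%:R<=LF n.
Proof.
elim: n => [|n IH]; first by rewrite mul0r subrr /LF big_geq.
have E: LF n.+1 = LF n+ln n.+1%:R by rewrite /LF big_nat_recr.
case: n IH E => [_ ->|n IH ->]; first by rewrite /LF big_geq// ln1 mulr0; lra.
have nR: 0<n.+1%:R :> R by rewrite ltr0n.
have h := ler_wpM2l (ltW nR) (ln_step (ltn0Sn n)); rewrite divff ?lt0r_neq0// in h.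
move: IH h; set l2 := ln n.+2%:R; set l1 := ln n.+1%:R; rewrite -[n.+2%:R]natr1 mulrDl mul1r mulrBr.
by move: (n.+1%:R * l2) (n.+1%:R * l1) (LF _) (n.+1%:R) => a b c d; clear; lra.
Qed.

(** The logarithm of the central binomial coefficient: the difference of the integer part of [2n/d]
    and twice that of [n/d] is nonnegative, and it is at least 1 for [n < d <= 2n]. *)
Lemma psi_double n : (0<n)%N -> psi n.*2<=psi n+4*n%:R.
Proof.
move=> n0; have nR: 0<n%:R :> R by rewrite ltr0n.
have h1: LF n.*2-2*LF n<=4*n%:R.
 have := LF_le n.*2; have := LF_ge n.
 have -> : n.*2%:R = 2*n%:R :> R by rewrite -mul2n natrM.
 rewrite lnM ?posrE//; have l2: ln 2<=1 :> R by have := @le_ln1Dx R 1; have -> : 1+1 = 2 :> R by []; apply; lra.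
 have := ler_wpM2l (ltW nR) l2; move: (n%:R) (ln n%:R) (ln 2) (LF _) (LF n) => a b c d e; clear; lra.
have h2: psi n.*2-psi n<=LF n.*2-2*LF n.
 have nn: (n<=n.*2)%N by rewrite -addnn leq_addr.
 have -> : psi n.*2-psi n = \sum_(1<=d<n.*2.+1) vm d*((n<d)%N)%:R.
  rewrite /psi [X in X - _](@big_cat_nat _ _ _ n.+1)//= addrAC subrr add0r [RHS](@big_cat_nat _ _ _ n.+1)//=.
  rewrite [X in _ = X + _]big1_seq ?add0r; last first.
   by move=> d /andP[_]; rewrite mem_index_iota ltnS => /andP[_ dn]; rewrite ltnNge dn mulr0.
  by apply: eq_big_nat => d /andP[nd _]; rewrite nd mulr1.
 rewrite (LFE (leqnn _)) (LFE nn) mulr_sumr -sumrB; apply: ler_sum_nat => d /andP[d0 dn].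
 rewrite mulrCA -mulrBr ler_wpM2l ?vm_ge0//.
 have h3: ((n %/ d).*2<=n.*2 %/ d)%N by rewrite leq_divRL// -doubleMl leq_double leq_divM.
 case: ltnP => nd.
  rewrite (divn_small nd) mulr0 subr0 ler_nat divn_gt0//.
 by rewrite subr_ge0 -natrM ler_nat mul2n.
by lra.
Qed.

(** Halving: [6 k + 4 k <= 12 k], and the [2 k] to spare pays for the last term when [n] is odd. *)
Lemma psi_le n : psi n<=6*n%:R.
Proof.
have [m] := ubnP n; elim: m n => // m IH n nm.
case: n nm => [|[|n]] nm; first by rewrite /psi big_geq// mulr0.
 by rewrite /psi big_nat1; have := @vm_le R 0; rewrite ln1; lra.
have k0: (0<n.+2./2)%N by [].
have kn: (n.+2./2<m)%N by rewrite ltnS in nm; apply: leq_trans nm; rewrite /= !ltnS -divn2 leq_div.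
have h1 := psi_double k0; have h2 := IH _ kn.
have E := odd_double_half n.+2; set k := n.+2./2 in E h1 h2 k0.
case: (odd n.+2) E => /= E.
 have -> : psi n.+2 = psi k.*2+vm n.+2.
  by rewrite /psi -E add1n big_nat_recr//.
 have h3: vm n.+2<=2*k%:R.
  apply: (le_trans (@vm_le R n.+1)); have := @le_ln1Dx R (2*k%:R); rewrite -natrM nat1r mul2n -add1n E; apply.
  by rewrite (lt_le_trans (ltrN10 R)).
 have -> : n.+2%:R = 1+2*k%:R :> R by rewrite -E -mul2n natrD natrM.
 by have : 0<=k%:R :> R by []; lra.
rewrite add0n in E; rewrite -E -mul2n natrM mul2n; have : 0<=k%:R :> R by []; lra.
Qed.

Definition ap n : R := (prime n)%:R*(ln n%:R/n%:R).
Definition AP n : R := \sum_(1<=d<n.+1) ap d.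

Lemma ap_ge0 n : 0<=ap n.
Proof.
rewrite /ap mulr_ge0//; case: n => [|n]; first by rewrite invr0 mulr0.
by rewrite divr_ge0// ln_ge0// ler1n.
Qed.

Lemma ap_vm n : ap n<=vm n/n%:R.
Proof.
rewrite /ap; case pn : (prime n); last by rewrite mul0r divr_ge0// vm_ge0.
by rewrite mul1r -{3}(expn1 n) vm_pp.
Qed.

(** After multiplication by [n], [n/d] exceeds its integer part by at most 1; the sum is then at
    most [LF n + psi n], and 6 is Chebyshev's constant. *)
Lemma AP_le n : (0<n)%N -> AP n<=ln n%:R+6.
Proof.
move=> n0; have nR: 0<n%:R :> R by rewrite ltr0n.
rewrite -(ler_pM2l nR); apply: (@le_trans _ _ (LF n+psi n)).
 rewrite (LFE (leqnn n)) /psi -big_split/= /AP mulr_sumr; apply: ler_sum_nat => d /andP[d0 _].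
 have dR: 0<d%:R :> R by rewrite ltr0n.
 apply: (le_trans (ler_wpM2l (ltW nR) (ap_vm d))).
 have -> : vm d*(n %/ d)%N%:R+vm d = vm d*((n %/ d)%N%:R+1) by rewrite mulrDr mulr1.
 rewrite mulrCA ler_wpM2l ?vm_ge0// ler_pdivrMr//.
 by rewrite natr1 -natrM ler_nat ltnW// -ltn_divLR.
by rewrite mulrDr lerD ?LF_le// mulrC psi_le.
Qed.

Definition ip n : R := (prime n)%:R/n%:R.

Lemma ip_ge0 n : 0<=ip n.
Proof. by rewrite /ip divr_ge0. Qed.

Lemma ipE n : ip n = ap n/ln n%:R.
Proof.
rewrite /ip /ap; case pn : (prime n); last by rewrite !mul0r.
have l0: 0<ln n%:R :> R by rewrite ln_gt0// ltr1n prime_gt1.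
by rewrite !mul1r mulrAC divff ?mul1r// lt0r_neq0.
Qed.

(** Partial summation in a form closed under induction on [N]: the increment of [1/ln N] is
    multiplied by [AP N], and [ln x <= x - 1] converts the main part into an increment of
    [ln (ln N)]. *)
Lemma abel M N : (2<=M)%N -> (M<=N)%N ->
 \sum_(M.+1<=n<N.+1) ip n<=AP N/ln N%:R+(ln (ln N%:R)-ln (ln M%:R))+6*((ln M%:R)^-1-(ln N%:R)^-1).
Proof.
move=> M2; have lp n : (2<=n)%N -> 0<ln n%:R :> R by move=> n2; rewrite ln_gt0// ltr1n.
elim: N => [|N IH] MN; first by rewrite leqn0 in MN; rewrite (eqP MN) in M2.
have A0 n : 0<=AP n by apply: sumr_ge0 => d _; exact: ap_ge0.
case: (eqVneq M N.+1) => [E|MnN].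
 by rewrite -E big_geq// !subrr mulr0 !addr0 divr_ge0// ltW// lp.
have MN' : (M<=N)%N by rewrite -ltnS ltn_neqAle MnN.
have N2 := leq_trans M2 MN'; have N3: (2<=N.+1)%N by rewrite ltnW.
rewrite big_nat_recr//=.
have E: AP N.+1 = AP N+ap N.+1 by rewrite /AP big_nat_recr.
have h := AP_le (leq_trans (ltn0Sn 1) N2 : (0<N)%N).
have l1 := lp _ N2; have l2 := lp _ N3.
have d0: 0<=(ln N%:R)^-1-(ln N.+1%:R)^-1 :> R.
 by rewrite subr_ge0 lef_pV2 ?posrE// ler_ln ?posrE ?ltr0n ?ler_nat// (leq_trans _ N2).
have h2 := ler_wpM2r d0 h.
have h3: ln (ln N%:R)-ln (ln N.+1%:R)<=ln N%:R/ln N.+1%:R-1 :> R.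
 rewrite -ln_div ?posrE//; have := @le_ln1Dx R (ln N%:R/ln N.+1%:R-1); rewrite addrCA subrr addr0; apply.
 by rewrite ltrBrDl subrr divr_gt0.
have h4: (ln N%:R+6)*((ln N%:R)^-1-(ln N.+1%:R)^-1) = 1-ln N%:R/ln N.+1%:R+6*((ln N%:R)^-1-(ln N.+1%:R)^-1) :> R.
 by field; rewrite !lt0r_neq0.
have h5 := IH MN'.
rewrite ipE E mulrDl; rewrite h4 mulrBr in h2.
by move: h5 h2 h3; clear; move: (ln (ln _)) => a; lra.
Qed.

Lemma ln2_ge : 1/2<=ln 2 :> R.
Proof.
have e: 1-1/2 = 2^-1 :> R by field.
have l1: ln (1-1/2) <= - (1/2) :> R by apply: le_ln1Dx; lra.
by rewrite e lnV ?posrE// in l1; lra.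
Qed.

Lemma ln_ge12 n : (2<=n)%N -> 1/2<=ln n%:R :> R.
Proof. by move=> n2; apply: (le_trans ln2_ge); rewrite ler_ln ?posrE ?ltr0n ?ler_nat// (leq_trans _ n2). Qed.

Lemma inv_ln n : (2<=n)%N -> 0<=(ln (n%:R : R))^-1<=2.
Proof.
move=> n2; have h := ln_ge12 n2; have h0: 0<ln n%:R :> R by lra.
by rewrite invr_ge0 (ltW h0)/= -[leRHS]invrK lef_pV2 ?posrE ?invr_gt0//; lra.
Qed.

(** 25 = 1 + 12 + 12, because inverse logarithms of integers from 2 on are at most 2. *)
Lemma ip_tail M N : (2<=M)%N -> (M<=N)%N ->
 \sum_(M.+1<=n<N.+1) ip n<=25+ln (ln N%:R/ln M%:R).
Proof.
move=> M2 MN; have N2 := leq_trans M2 MN.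
have N0: (0<N)%N := leq_trans (ltn0Sn 1) N2.
have lM: 0<ln M%:R :> R by have := ln_ge12 M2; lra.
have lN: 0<ln N%:R :> R by have := ln_ge12 N2; lra.
apply: (le_trans (abel M2 MN)); rewrite ln_div ?posrE//.
have /andP[i1 i2] := inv_ln M2; have /andP[i3 i4] := inv_ln N2.
have h := ler_wpM2r i3 (AP_le N0); rewrite mulrDl divff ?lt0r_neq0// in h.
by move: h i1 i2 i3 i4; set a := ln (ln M%:R); set b := ln (ln N%:R); lra.
Qed.

Lemma ip_all N : (2<=N)%N -> \sum_(1<=n<N.+1) ip n<=ln (ln N%:R)+27.
Proof.
move=> N2; have lN: 0<ln N%:R :> R by have := ln_ge12 N2; lra.
have l2 := ln2_ge; have l20: 0<ln 2 :> R by lra.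
have E: \sum_(1<=n<N.+1) ip n = 2^-1 + \sum_(3<=n<N.+1) ip n.
 rewrite (@big_cat_nat _ _ _ 3)//= 2?big_nat_recr//= big_geq// add0r; congr (_ + _).
 by rewrite /ip /= mul0r add0r mul1r.
have h := @ip_tail 2 N isT N2; rewrite ln_div ?posrE// in h.
have h2: - ln (ln 2)<=1 :> R.
 have := @le_ln1Dx R ((ln 2)^-1-1); rewrite addrCA subrr addr0 lnV ?posrE// => h3.
 apply: (le_trans (h3 _)); first by rewrite ltrBrDl subrr invr_gt0.
 by have /andP[_ h4] := inv_ln (leqnn 2); lra.
by rewrite E; move: h h2; move: (ln (ln 2)) (ln (ln _)) (\sum_(3<=n<N.+1) ip n); clear => *; lra.
Qed.

Lemma ip_sq N : (0<N)%N -> \sum_(1<=n<N.+1) ip n * ln n%:R^+2<=ln N%:R*(ln N%:R+6).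
Proof.
move=> N0; have lN: 0<=ln N%:R :> R by rewrite ln_ge0// ler1n.
apply: (@le_trans _ _ (ln N%:R*AP N)); last by rewrite ler_wpM2l// AP_le.
rewrite /AP mulr_sumr; apply: ler_sum_nat => n /andP[n0 nN].
have ln0: 0<=ln n%:R :> R by rewrite ln_ge0// ler1n.
have -> : ip n * ln n%:R^+2 = ln n%:R*ap n by rewrite /ip /ap; move: (n%:R^-1) => x; ring.
rewrite ler_wpM2r ?ap_ge0// ler_ln ?posrE ?ltr0n ?ler_nat//.
Qed.

End primes.

(** * Large deviations of prime polynomials *)

Section prob.
Variable R : realType.
Notation mu := (@lebesgue_measure R).
Notation vm := (@von_mangoldt R).

Definition ev (f : R -> R) (T y : R) : set R := [set t : R | ((T<=t<=2*T) && (y <= `|f t|))%R].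

Lemma fact_pow k : k`!%:R<=k%:R^+k :> R.
Proof.
rewrite -natrX ler_nat; elim: k => // k IH; rewrite factS expnS leq_mul2l /=.
by apply: (leq_trans IH); case: k {IH} => // k; rewrite leq_exp2r.
Qed.

Lemma powm (x y : R) k : 0<=x -> x<=y -> x^+k<=y^+k.
Proof. by move=> x0 xy; rewrite lerXn2r ?nnegrE// (le_trans x0). Qed.

(** With [k! <= k^k], Chebyshev's inequality gives the k-th power of [k sg / (eta W)^2], which is at
    most [W^(-1/2)] by hypothesis. Moments of order proportional to [W] thus give
    [exp(- c W ln W)]. *)
Lemma L_tail M (c : nat -> R) (b ph T W V0 eta sg : R) k : 1<=b -> 0<T -> (M ^ (2*k))%:R<=T ->
 (forall i, ~~ prime i -> c i = 0) -> 0<V0 -> 0<eta -> 1<=W ->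
 \sum_(i<M) c i^+2<=V0^+2*sg -> k%:R*sg<=eta^+2*W^+2*expR (- (1/2) * ln W) ->
 (mu (ev (trig M c b ph) T (eta*W*V0))<=(3*T*expR (- (k%:R/2) * ln W))%:E)%E.
Proof.
move=> b1 T0 MT cp V00 e0 W1 cs ks.
have W0: 0<W := lt_le_trans ltr01 W1.
have y0: 0<eta*W*V0 by rewrite !mulr_gt0.
apply: (le_trans (cheb (@trig_cont R M c b ph) y0 (moment ph b1 T0 MT cp))).
rewrite lee_fin ler_pdivrMr ?exprn_gt0//.
have -> : expR (- (k%:R/2) * ln W) = expR (- (1/2) * ln W)^+k.
 by rewrite -expRM_natl; congr expR; field.
set r := expR _ in ks *; have r0: 0<=r := expR_ge0 _.
have c0: 0 <= \sum_(i<M) c i^+2 by apply: sumr_ge0 => i _; exact: sqr_ge0.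
rewrite -!mulrA ler_wpM2l// ler_wpM2l ?(ltW T0)// exprM -exprMn.
apply: (@le_trans _ _ (k%:R^+k*(\sum_(i<M) c i^+2)^+k)).
 by rewrite ler_wpM2r ?exprn_ge0// fact_pow.
rewrite -exprMn; apply: powm; first exact: mulr_ge0.
apply: (@le_trans _ _ (k%:R*(V0^+2*sg))); first by rewrite ler_wpM2l.
have := ler_wpM2l (sqr_ge0 V0) ks.
have -> : V0^+2*(k%:R*sg) = k%:R*(V0^+2*sg) by ring.
by move/le_trans; apply; apply: eq_le_; ring.
Qed.

Lemma stirling k : (0<k)%N -> LF R k<=k%:R * ln k%:R-k%:R+ln k%:R+1.
Proof.
elim: k => // k IH _; case: k IH => [_|k IH].
 by rewrite /LF big_nat1 ln1; lra.
have -> : LF R k.+2 = LF R k.+1+ln k.+2%:R by rewrite /LF big_nat_recr.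
have h := IH isT.
have k1: 0<k.+1%:R :> R by [].
have k2: 0<k.+2%:R :> R by [].
have h2: ln k.+1%:R-ln k.+2%:R <= - k.+2%:R^-1 :> R.
 rewrite -ln_div ?posrE//; have := @le_ln1Dx R (- k.+2%:R^-1).
 have -> : 1-k.+2%:R^-1 = k.+1%:R/k.+2%:R :> R by rewrite (_ : k.+1%:R = k.+2%:R-1) ?mulrBl ?divff ?mul1r ?lt0r_neq0// -[k.+2%:R]natr1 addrK.
 by apply; rewrite ltrN2 invf_lt1// ltr1n.
have h3 := ler_wpM2l (ltW k2) h2; rewrite mulrN divff ?lt0r_neq0// mulrBr in h3.
move: h h3; set l1 := ln k.+1%:R; set l2 := ln k.+2%:R; rewrite -[k.+2%:R]natr1 !mulrDl !mul1r.
by move: (k.+1%:R * l1) (k.+1%:R * l2) (k.+1%:R) (LF R k.+1) => a b c d; clear; lra.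
Qed.

Lemma fact_exp k : k`!%:R = expR (LF R k).
Proof.
elim: k => [|k IH]; first by rewrite /LF big_geq// expR0.
by rewrite /LF big_nat_recr//= expRD factS natrM IH mulrC lnK ?posrE.
Qed.

(** The moment with [k] close to [a = y^2/sg] is optimal: [k!/a^k] is then about [k exp(- k)]. The
    linear factor is swallowed by [exp(eta a)/eta]. *)
Lemma L_main N (c : nat -> R) (ph T y eta V0 sg a : R) : 0<T -> 0<eta<=1 ->
 (N ^ (2*(Num.truncn a).+1))%:R<=T ->
 (forall i, ~~ prime i -> c i = 0) -> 0<V0 -> 0<y -> 0<sg ->
 \sum_(i<N) c i^+2<=V0^+2*sg -> 1/4<=a -> a*sg = y^+2 ->
 (mu (ev (trig N c 1 ph) T (y*V0))<=(3*T*(expR 6/eta*expR (- (1-eta)*a)))%:E)%E.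
Proof.
move=> T0 /andP[e0 e1] MT cp V00 y0 s0 cs a4 aE; set k := (Num.truncn a).+1 in MT *.
have a0: 0<a by lra.
have yV: 0<y*V0 by rewrite mulr_gt0.
apply: (le_trans (cheb (@trig_cont R N c 1 ph) yV (moment ph (lexx 1) T0 MT cp))).
rewrite lee_fin ler_pdivrMr ?exprn_gt0// -!mulrA ler_wpM2l// ler_wpM2l ?(ltW T0)//.
have c0: 0 <= \sum_(i<N) c i^+2 by apply: sumr_ge0 => i _; exact: sqr_ge0.
have /andP[ka ak] := truncn_itv (ltW a0); rewrite -/k in ak.
have k0: 0<k%:R :> R by [].
have ka1: k%:R<=a+1 by rewrite -natr1 lerD2r.
apply: (@le_trans _ _ (k`!%:R*(V0^+2*sg)^+k)).
 by apply: ler_wpM2l => //; apply: powm.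
have -> : (y*V0)^+(2*k) = a^+k*(V0^+2*sg)^+k.
 by rewrite exprM -exprMn; congr (_ ^+ _); rewrite exprMn -aE; ring.
have S0: 0<=(V0^+2*sg)^+k by rewrite exprn_ge0// mulr_ge0 ?sqr_ge0// ltW.
move: ((V0^+2*sg)^+k) S0 => S S0; rewrite !mulrA; apply: ler_wpM2r => //.
rewrite -[a in a^+k](@lnK R) ?posrE// -expRM_natl fact_exp.
have st := stirling (ltn0Sn (Num.truncn a)); rewrite -/k in st.
(* [k - a <= 1], so the left side is at most [k/a <= 1 + 1/a], and [a >= 1/4]. *)
have h1: k%:R * ln k%:R-k%:R * ln a<=5 :> R.
 rewrite -mulrBr -ln_div ?posrE//.
 have h2: ln (k%:R/a)<=k%:R/a-1.
  have := @le_ln1Dx R (k%:R/a-1); rewrite addrCA subrr addr0; apply.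
  by rewrite ltrBrDl subrr divr_gt0.
 apply: (le_trans (ler_wpM2l (ltW k0) h2)).
 have -> : k%:R*(k%:R/a-1) = k%:R*(k%:R-a)/a by field; exact: lt0r_neq0.
 rewrite ler_pdivrMr//; have : k%:R*(k%:R-a)<=k%:R*1 by rewrite ler_wpM2l ?(ltW k0)//; lra.
 by lra.
have h3: LF R k<=6+ln k%:R-k%:R+k%:R * ln a by lra.
apply: (@le_trans _ _ (expR (6+ln k%:R-k%:R+k%:R * ln a))); first by rewrite ler_expR.
have -> : expR (6+ln k%:R-k%:R+k%:R * ln a) = expR 6*(k%:R*expR (- k%:R))*expR (k%:R * ln a).
 have ek: expR (ln k%:R) = k%:R :> R by rewrite lnK ?posrE.
 by rewrite (expRD _ (k%:R * ln a)) (expRD _ (- k%:R)) (expRD 6) ek; ring.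
rewrite ler_wpM2r ?expR_ge0// -!mulrA ler_wpM2l ?expR_ge0//.
have h4: k%:R*expR (- k%:R)<=(a+1)*expR (- a).
 by apply: ler_pM; [exact: ltW|exact: expR_ge0|exact: ka1|rewrite ler_expR lerN2 ltW].
apply: (le_trans h4).
have -> : - (1-eta)*a = - a+eta*a by ring.
rewrite expRD mulrCA mulrC ler_wpM2l ?expR_ge0// ler_pdivlMl//.
have := @expR_ge1Dx R (eta*a); move: e1; move: (expR _) => x; lra.
Qed.

Definition h (n : nat) : R := expR (- (1/2) * ln n%:R).

Lemma h_gt0 n : 0<h n. Proof. exact: expR_gt0. Qed.

Lemma h_sq n : (0<n)%N -> h n^+2 = n%:R^-1.
Proof.
move=> n0; rewrite /h -expRM_natl mulrA (_ : 2 * - (1/2) = -1); last by field.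
by rewrite mulN1r expRN lnK ?posrE ?ltr0n.
Qed.

Lemma h_pow p j : (0<p)%N -> h (p ^ j) = h p^+j.
Proof.
move=> p0; rewrite /h natrX lnXn ?ltr0n// -expRM_natl; congr expR.
by rewrite -mulr_natl; ring.
Qed.

Lemma h_34 p : (2<=p)%N -> h p<=3/4.
Proof.
move=> p2; have p0: (0<p)%N := ltnW p2.
rewrite -(@ler_pXn2r _ 2)// ?nnegrE ?(ltW (h_gt0 p))//.
rewrite h_sq//; apply: (@le_trans _ _ 2^-1); last by rewrite expr2; lra.
by rewrite lef_pV2 ?posrE ?ltr0n// ler_nat.
Qed.

Lemma geom3 (x : R) M : 0<=x -> x<=3/4 -> \sum_(3<=j<M) x^+j<=4*x^+3.
Proof.
move=> x0 x1; have E: (1-x) * \sum_(3<=j<M) x^+j<=x^+3.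
 case: (leqP M 3) => [M3|M3]; first by rewrite big_geq// mulr0 exprn_ge0.
 have -> : (1-x) * \sum_(3<=j<M) x^+j = x^+3-x^+M.
  elim: M M3 => // M IH; rewrite ltnS leq_eqVlt => /orP[/eqP <-|M3].
   by rewrite big_nat1 [x^+4]exprS; ring.
  by rewrite big_nat_recr ?(ltnW M3)//= mulrDr IH// [x^+M.+1]exprS; ring.
 by rewrite lerBlDr lerDl exprn_ge0.
have s0: 0 <= \sum_(3<=j<M) x^+j by apply: sumr_ge0 => j _; exact: exprn_ge0.
by move: E s0; move: (\sum_(3<=j<M) x^+j) (x^+3) => s y; move: x0 x1; clear; nra.
Qed.

(** Comparison with the telescoping sum of [2 (p-1)^(-1/2) - 2 p^(-1/2)]. *)
Lemma h3_sum M : \sum_(2<=p<M) h p^+3<=2.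
Proof.
suff H : forall m, \sum_(2<=p<m.+2) h p^+3<=2*(1-h m.+1).
 case: M => [|[|M]]; [by rewrite big_geq|by rewrite big_geq|].
 by apply: (le_trans (H M)); have := h_gt0 M.+1; lra.
elim=> [|m IH]; first by rewrite big_geq// /h ln1 mulr0 expR0 subrr mulr0.
rewrite big_nat_recr//=.
suff : h m.+2^+3<=2*(h m.+1-h m.+2) by move: IH; lra.
have x0 := h_gt0 m.+2; have y0 := h_gt0 m.+1.
have ex := h_sq (ltn0Sn m.+1); have ey := h_sq (ltn0Sn m).
have xy: h m.+2<=h m.+1.
 by rewrite /h ler_expR !mulNr lerN2 ler_wpM2l// ler_ln ?posrE// ler_nat.
have d: h m.+1^+2-h m.+2^+2 = h m.+1^+2*h m.+2^+2.
 have e2: m.+2%:R = m.+1%:R+1 :> R by rewrite natr1.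
 have n1: m.+1%:R != 0 :> R by [].
 have n2: m.+1%:R+1 != 0 :> R by rewrite natr1.
 by rewrite ex ey e2; move: n1 n2; move: (m.+1%:R) => x n1 n2; field; rewrite ?n1 ?n2.
move: x0 y0 xy d; move: (h m.+2) (h m.+1) => x y; clear.
move=> x0 y0 xy d.
have k1: (y-x)*(y+x) = y^+2*x^+2 by rewrite -d; ring.
have k2: (y-x)*(2*y) >= y^+2*x^+2.
 by rewrite -k1 ler_wpM2l ?subr_ge0//; lra.
have k3: y*(x^+2*x)<=y*(2*(y-x)).
 apply: (@le_trans _ _ (y^+2*x^+2)); last by apply: (le_trans k2); apply: eq_le_; ring.
 have : x^+2*x<=x^+2*y by rewrite ler_wpM2l ?sqr_ge0.
 by move=> k4; have := ler_wpM2l (ltW y0) k4; move=> /le_trans; apply; apply: eq_le_; ring.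
by rewrite ler_pM2l// in k3; rewrite exprSr.
Qed.

(** The coefficient of [p^j] in the weighted sum, using that [Lambda(p^j)/ln(p^j)] is [1/j]; it is
    zero off the primes. *)
Definition cf (j : nat) (V g : R -> R) (l : R) (p : nat) : R :=
 (prime p)%:R*(j%:R^-1*h p^+j*V (j%:R * ln p%:R)*g (j%:R * ln p%:R/l)).

Lemma sum_two (F : nat -> R) A B : (forall p, (A<=p)%N -> F p = 0) -> (forall p, (B<=p)%N -> F p = 0) ->
 \sum_(0<=p<A) F p = \sum_(0<=p<B) F p.
Proof.
move=> hA hB; wlog AB : A B hA hB/(A<=B)%N.
 by move=> H; case: (leqP A B) => [/H->//|/ltnW BA]; rewrite -(H B A).
rewrite [RHS](@big_cat_nat _ _ _ A)//= [X in _+X]big1_seq ?addr0// => p /andP[_].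
by rewrite mem_index_iota => /andP[/hA].
Qed.

(** Powers [p^j] with [j >= 3] are summed trivially: a geometric series in [h p <= 3/4] costs 4, the
    sum of [p^(-3/2)] costs 2, whence 8. Exponents 1 and 2 are kept as trigonometric polynomials of
    length [M0], beyond which [g] vanishes. *)
Lemma DEC (V g : R -> R) (X l V0 Cg D t ph : R) (M0 : nat) : M0 = (Num.truncn (expR (D * l))).+1 -> 2<=X -> 0<l -> 0<D ->
 (forall u, ln X<u -> V u = 0) -> (forall u, `|V u| <= V0) ->
 (forall u, D<=u -> g u = 0) -> (forall u, 0<=u -> `|g u| <= Cg) ->
 `|\sum_(1<=k<(Num.truncn X).+1) vm k*(h k*V (ln k%:R)/ln k%:R*g (ln k%:R/l)*cos (t * ln k%:R+ph))|
 <= `|trig M0 (cf 1 V g l) 1 ph t| + `|trig M0 (cf 2 V g l) 2 ph t| + 8*V0*Cg.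
Proof.
move=> M0E X2 l0 D0 VX Vb gD gb; set M := (Num.truncn X).+1.
have X0: 0<=X by lra.
have /andP[_ XM] := truncn_itv X0; rewrite -/M in XM.
have M3: (2<M)%N by rewrite -(@ltr_nat R) (le_lt_trans X2).
pose F j p : R := (prime p)%:R*(j%:R^-1*h p^+j*V (j%:R * ln p%:R)*g (j%:R * ln p%:R/l)*cos (j%:R * t * ln p%:R+ph)).
have lnpj p j : (0<p)%N -> ln (p ^ j)%:R = j%:R * ln p%:R :> R by move=> p0; rewrite natrX lnXn ?ltr0n// mulr_natl.
have FX j p : (0<j)%N -> (M<=p ^ j)%N -> F j p = 0.
 move=> j0 Mp; rewrite /F; case pp : (prime p); last by rewrite mul0r.
 rewrite -lnpj ?prime_gt0// VX ?mulr0 ?mul0r ?mulr0//.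
 rewrite ltr_ln ?posrE; [|lra|by rewrite ltr0n expn_gt0 prime_gt0].
 by apply: (lt_le_trans XM); rewrite ler_nat.
have FM j p : (0<j)%N -> (M0<=p)%N -> F j p = 0.
 move=> j0 Mp; rewrite /F gD ?mulr0 ?mul0r ?mulr0//.
 have /andP[_ h1] := truncn_itv (expR_ge0 (D * l)); rewrite -M0E in h1.
 have pM: M0%:R<=p%:R :> R by rewrite ler_nat.
 have Dl: D * l<=ln p%:R.
  by rewrite -[leLHS]expRK ler_ln ?posrE ?expR_gt0 ?(lt_le_trans (expR_gt0 (D * l)))// ltW// ?(lt_le_trans h1).
 rewrite ler_pdivlMr//; apply: (le_trans Dl); rewrite ler_peMl ?ler1n//.
 by rewrite (le_trans _ Dl)// mulr_ge0// ltW.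
have FMp j p : (0<j)%N -> (M<=p)%N -> F j p = 0.
 move=> j0 Mp; case pp : (prime p); last by rewrite /F pp mul0r.
 by apply: FX => //; apply: (leq_trans Mp); rewrite -[leqLHS]expn1 leq_pexp2l// prime_gt0.
have -> : \sum_(1<=k<M) vm k*(h k*V (ln k%:R)/ln k%:R*g (ln k%:R/l)*cos (t * ln k%:R+ph)) =
  \sum_(1<=j<M) \sum_(0<=p<M) F j p.
 rewrite sum_vm; apply: eq_big_nat => j /andP[j0 _].
 rewrite [LHS]big_mkcond/=; apply: eq_bigr => p _.
 case pp : (prime p); last by rewrite /F pp mul0r.
 case: ltnP => pM; last by rewrite FX// mul0r.
 have p0 := prime_gt0 pp; have lp : 0<ln p%:R :> R by rewrite ln_gt0// ltr1n prime_gt1.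
 rewrite mul1r /F pp mul1r h_pow// lnpj//.
 have -> : t*(j%:R * ln p%:R) = j%:R * t * ln p%:R by ring.
 have j1: j%:R != 0 :> R by rewrite pnatr_eq0 -lt0n.
 move: (h p^+j) (V _) (g _) (cos _) => a b c d.
 by field; rewrite j1 lt0r_neq0.
have E j : (0<j)%N -> \sum_(0<=p<M) F j p = trig M0 (cf j V g l) j%:R ph t.
 move=> j0; rewrite (sum_two (B := M0)); [|by move=> p; exact: FMp|by move=> p; exact: FM].
 rewrite big_mkord /trig; apply: eq_bigr => p _; rewrite /F /cf.
 by rewrite !mulrA.
rewrite (@big_cat_nat _ _ _ 3)//= 2?big_nat_recr//= big_geq// add0r !E//.
apply: (le_trans (ler_normD _ _)); apply: lerD; first exact: ler_normD.
have V00: 0<=V0 := le_trans (normr_ge0 _) (Vb 0).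
have Cg0: 0<=Cg := le_trans (normr_ge0 _) (gb 0 (lexx 0)).
have tb j p : (3<=j)%N -> `|F j p| <= (prime p)%:R*(V0*Cg*h p^+j).
 move=> j3; rewrite /F normrM (ger0_norm (ler0n R _)); case pp : (prime p); last by rewrite !mul0r.
 rewrite !mul1r !normrM.
 have lp : 0<=ln p%:R :> R by rewrite ln_ge0// ler1n prime_gt0.
 have h1: `|j%:R^-1| <= 1 :> R by rewrite ger0_norm ?invr_ge0// invf_le1 ?ltr0n ?ler1n// (leq_trans _ j3).
 have h2: `|h p^+j| = h p^+j by rewrite ger0_norm// exprn_ge0// ltW// h_gt0.
 have h3: `|g (j%:R * ln p%:R/l)| <= Cg by apply: gb; rewrite divr_ge0 ?(ltW l0)// mulr_ge0.
 rewrite h2.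
 have q0: 0<=h p^+j by rewrite exprn_ge0// ltW// h_gt0.
 have q1: `|j%:R^-1| * h p^+j<=1*h p^+j by rewrite ler_wpM2r.
 have q2 := ler_pM (mulr_ge0 (normr_ge0 _) q0) (normr_ge0 _) q1 (Vb (j%:R * ln p%:R)).
 have q3 := ler_pM (mulr_ge0 (mulr_ge0 (normr_ge0 _) q0) (normr_ge0 _)) (normr_ge0 _) q2 h3.
 have q4 := ler_pM (mulr_ge0 (mulr_ge0 (mulr_ge0 (normr_ge0 _) q0) (normr_ge0 _)) (normr_ge0 _)) (normr_ge0 _) q3 (ncos_le1 (j%:R * t * ln p%:R+ph)).
 by apply: (le_trans q4); apply: eq_le_; ring.
apply: (@le_trans _ _ (\sum_(3<=j<M) \sum_(0<=p<M) (prime p)%:R*(V0*Cg*h p^+j))).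
 apply: (le_trans (ler_norm_sum _ _ _)); apply: ler_sum_nat => j /andP[j3 _].
 by apply: (le_trans (ler_norm_sum _ _ _)); apply: ler_sum => p _; exact: tb.
rewrite exchange_big/=.
have -> : 8*V0*Cg = V0*Cg*(4*2) by ring.
apply: (@le_trans _ _ (V0*Cg*(4 * \sum_(2<=p<M) h p^+3))); last first.
 by rewrite ler_wpM2l ?mulr_ge0// ler_wpM2l// h3_sum.
rewrite (@big_cat_nat _ _ _ 2)//=; last exact: ltnW.
rewrite [X in X + _]big1_seq ?add0r; last first.
 move=> p /andP[_]; rewrite mem_index_iota => /andP[_ p2]; apply: big1 => j _.
 by case: p p2 => [|[|p]]// _; rewrite mul0r.
rewrite !mulr_sumr; apply: ler_sum_nat => p /andP[p2 _].
have hp := ltW (h_gt0 p).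
apply: (@le_trans _ _ (V0*Cg * \sum_(3<=j<M) h p^+j)); last first.
 by rewrite ler_wpM2l ?mulr_ge0// geom3// h_34.
rewrite mulr_sumr; apply: ler_sum => j _; rewrite ler_piMl//; last by case: (prime p).
by rewrite !mulr_ge0// exprn_ge0.
Qed.

End prob.

(** * Measure estimates and choice of parameters *)

Section mp.
Variable R : realType.
Notation mu := (@lebesgue_measure R).
Notation vm := (@von_mangoldt R).

Lemma ev_meas (f : R -> R) (T y : R) : continuous f ->
 measurable ([set t : R | ((T<=t<=2*T) && (y<=f t))%R] : set (measurableTypeR R)).
Proof.
move=> cf; set S := (X in measurable X).
rewrite (_ : S = `[T, 2*T]%classic `&` f @^-1` `[y, +oo[%classic).
 have mf: measurable_fun (setT : set (measurableTypeR R)) f by exact: cont_meas.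
 apply: measurableI => //; rewrite -[X in measurable X]setTI.
 by apply: mf => //; exact: measurable_itv.
apply/seteqP; split => t.
 by move=> /andP[h1 h2]; split; rewrite /= in_itv/= ?h1// h2.
by move=> [h1 h2]; move: h1 h2; rewrite /= !in_itv /= andbT /S /= => -> ->.
Qed.

Lemma ev_meas_abs (f : R -> R) (T y : R) : continuous f -> measurable (ev f T y : set (measurableTypeR R)).
Proof.
move=> cf; apply: (@ev_meas (fun t => `|f t|)) => t.
by apply: (@continuous_comp R R R f (fun x => `|x|)); [exact: cf|exact: norm_continuous].
Qed.

Lemma mu_cover (S A B : set (measurableTypeR R)) (a b : R) : measurable S -> measurable A -> measurable B ->
 S `<=` A `|` B -> (mu A<=a%:E)%E -> (mu B<=b%:E)%E -> (mu S<=(a+b)%:E)%E.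
Proof.
move=> mS mA mB SAB hA hB; rewrite EFinD; apply: (@le_trans _ _ (mu A+mu B)%E); last exact: leeD.
apply: le_trans (measureU2 _ mA mB); apply: le_measure; [exact/mem_set|apply/mem_set; exact: measurableU|exact: SAB].
Qed.

Lemma cf_np j (V g : R -> R) l p : ~~ prime p -> cf j V g l p = 0.
Proof. by rewrite /cf => /negbTE ->; rewrite mul0r. Qed.

Lemma cf_sq j (V g : R -> R) l p V0 Cg : (forall u, `|V u| <= V0) -> `|g (j%:R * ln p%:R/l)| <= Cg -> (0<j)%N ->
 cf j V g l p^+2<=V0^+2*(Cg^+2*((prime p)%:R*(h R p^+2)^+j)).
Proof.
move=> Vb gb j0; rewrite /cf exprMn; case: (prime p); last by rewrite !mul0r !mulr0 expr0n mul0r.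
rewrite expr1n !mul1r (exprMn _ _ (g _)) (exprMn _ _ (V _)) (exprMn _ _ (h R p^+j)).
have h1: (j%:R^-1 : R)^+2<=1.
 have j1: 0<=(j%:R^-1 : R)<=1 by rewrite invr_ge0 ler0n invf_le1 ?ltr0n ?ler1n.
 by case/andP: j1 => a b; rewrite expr_le1.
have h2: V (j%:R * ln p%:R)^+2<=V0^+2 by rewrite -(real_normK (num_real (V _))); apply: powm.
have h3: g (j%:R * ln p%:R/l)^+2<=Cg^+2 by rewrite -(real_normK (num_real (g _))); apply: powm.
have h0: 0<=(h R p^+2)^+j by rewrite exprn_ge0// sqr_ge0.
have e: (h R p^+j)^+2 = (h R p^+2)^+j by rewrite -!exprM mulnC.
rewrite e.
have q1: j%:R^-1^+2*(h R p^+2)^+j<=1*(h R p^+2)^+j by rewrite ler_wpM2r.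
have q2 := ler_pM (mulr_ge0 (sqr_ge0 _) h0) (sqr_ge0 _) q1 h2.
have q3 := ler_pM (mulr_ge0 (mulr_ge0 (sqr_ge0 _) h0) (sqr_ge0 _)) (sqr_ge0 _) q2 h3.
by apply: (le_trans q3); apply: eq_le_; ring.
Qed.

Lemma ip_h p : (prime p)%:R*(h R p^+2) = ip R p.
Proof. by rewrite /ip; case pp : (prime p); rewrite ?mul0r// h_sq// prime_gt0. Qed.

Lemma sum_ord_ip (F : nat -> R) N : (F 0%N = 0) -> \sum_(i<N.+1) F i = \sum_(1<=i<N.+1) F i.
Proof. by move=> F0; rewrite -(big_mkord xpredT F) big_ltn// F0 add0r. Qed.

(** The inverse squares of the primes are majorized by [p^(-3/2)], already summed in [h3_sum]. *)
Lemma sig2 (V g : R -> R) l V0 Cg M : (forall u, `|V u| <= V0) -> (forall u, 0<=u -> `|g u| <= Cg) -> 0<l ->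
 \sum_(i<M) cf 2 V g l i^+2<=V0^+2*(2*Cg^+2).
Proof.
move=> Vb gb l0; apply: (@le_trans _ _ (\sum_(i<M) V0^+2*(Cg^+2*((prime i)%:R*(h R i^+2)^+2)))).
 apply: ler_sum => i _; apply: cf_sq => //; apply: gb.
 rewrite divr_ge0 ?(ltW l0)// mulr_ge0//; case: (i : nat) => [|k]; first by rewrite ln0.
 by rewrite ln_ge0// ler1n.
rewrite -!mulr_sumr ler_wpM2l ?sqr_ge0// mulrC ler_wpM2r ?sqr_ge0//.
apply: le_trans (h3_sum R M); rewrite -(big_mkord xpredT (fun i => (prime i)%:R*(h R i^+2)^+2)).
case: (leqP M 2) => M2.
 rewrite [leRHS]big_geq// big1_seq// => i /andP[_]; rewrite mem_index_iota => /andP[_ iM].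
 by have := leq_trans iM M2; case: i {iM} => [|[|i]]//; rewrite mul0r.
rewrite (@big_cat_nat _ _ _ 2)//=; last exact: ltnW.
rewrite [X in X + _]big1_seq ?add0r; last first.
 by move=> i /andP[_]; rewrite mem_index_iota => /andP[_]; case: i => [|[|i]]//; rewrite mul0r.
apply: ler_sum_nat => i /andP[i2 _].
have h0 := ltW (h_gt0 R i); have h1: h R i<=1 by have := h_34 R i2; lra.
apply: (@le_trans _ _ ((h R i^+2)^+2)); first by rewrite ler_piMl ?exprn_ge0 ?sqr_ge0//; case: (prime i).
by rewrite -exprM ler_wiXn2l.
Qed.

(** The vanishing of [g] at 0 replaces [1/p] by [(ln p)^2/(p l^2)], whose sum up to [exp(D l)] stays
    bounded. 13 = 1 + 12, the 12 coming from [6/l <= 12 D]. *)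
Lemma sigw (V g : R -> R) l V0 Cw D M : (forall u, `|V u| <= V0) -> (forall u, 0<=u -> `|g u| <= Cw*u) -> 0<l ->
 1<=D -> 1/(2*D)<=l -> M = (Num.truncn (expR (D * l))).+1 -> 0<=Cw ->
 \sum_(i<M) cf 1 V g l i^+2<=V0^+2*(13*Cw^+2*D^+2).
Proof.
move=> Vb gb l0 D1 lD -> Cw0; set N := Num.truncn _.
have D0: 0<D := lt_le_trans ltr01 D1.
have Dl0: 0<D * l by rewrite mulr_gt0.
have /andP[N1 N2] := truncn_itv (expR_ge0 (D * l)); rewrite -/N in N1 N2.
have N0: (0<N)%N.
 by rewrite /N truncn_gt0; have := expR_ge1Dx (D * l); lra.
have lN: ln N%:R<=D * l by rewrite -[leRHS]expRK ler_ln ?posrE ?ltr0n ?expR_gt0.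
rewrite (sum_ord_ip (F := fun i => cf 1 V g l i^+2)); last by rewrite cf_np// expr0n.
apply: (@le_trans _ _ (\sum_(1<=i<N.+1) (V0^+2*(Cw^+2/l^+2))*(ip R i * ln i%:R^+2))).
 apply: ler_sum_nat => i /andP[i1 _]; have li: 0<=ln i%:R :> R by rewrite ln_ge0// ler1n.
 apply: (le_trans (cf_sq Vb (gb _ (divr_ge0 (mulr_ge0 (ler0n _ 1) li) (ltW l0))) (ltn0Sn 0))).
 rewrite expr1 ip_h mul1r; apply: eq_le_; field; exact: lt0r_neq0.
rewrite -mulr_sumr -mulrA ler_wpM2l ?sqr_ge0//.
apply: (@le_trans _ _ (Cw^+2/l^+2*(D * l*(D * l+6)))).
 rewrite ler_wpM2l ?divr_ge0 ?sqr_ge0//; apply: (le_trans (ip_sq R N0)).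
 have lN0: 0<=ln N%:R :> R by rewrite ln_ge0// ler1n.
 by apply: ler_pM => //; lra.
have -> : Cw^+2/l^+2*(D * l*(D * l+6)) = Cw^+2*(D*(D+6/l)) by field; exact: lt0r_neq0.
rewrite (_ : 13*Cw^+2*D^+2 = Cw^+2*(D*(13*D))); last by ring.
rewrite ler_wpM2l ?sqr_ge0// ler_wpM2l ?(ltW D0)//.
have : 6/l<=12*D.
 rewrite ler_pdivrMr//; have : 1<=l*(2*D) by rewrite -ler_pdivrMr ?mulr_gt0.
 by lra.
by lra.
Qed.

Lemma sig1 (V g : R -> R) l V0 (P : pred nat) N : (forall u, `|V u| <= V0) -> (forall u, 0<=u -> `|g u| <= 1) -> 0<l ->
 \sum_(i<N.+1) (if P i then cf 1 V g l i else 0)^+2<=V0^+2 * \sum_(1<=i<N.+1) (if P i then ip R i else 0).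
Proof.
move=> Vb gb l0.
rewrite (sum_ord_ip (F := fun i => (if P i then cf 1 V g l i else 0)^+2)); last by case: (P 0%N); rewrite ?cf_np// expr0n.
rewrite mulr_sumr; apply: ler_sum_nat => i /andP[i1 _]; case: (P i); last by rewrite expr0n mulr0.
have li: 0<=ln i%:R :> R by rewrite ln_ge0// ler1n.
apply: (le_trans (cf_sq Vb (gb _ (divr_ge0 (mulr_ge0 (ler0n _ 1) li) (ltW l0))) (ltn0Sn 0))).
by rewrite expr1 ip_h expr1n mul1r.
Qed.

(** Mertens gives the logarithm of a ratio of logarithms. [ip_tail] starts after [N1 - 1], whose
    logarithm is still at least [y/3]; for [N1 <= 2] the tail is everything and [y <= 2], the second
    alternative. *)
Lemma tail_ip N1 N (y DL : R) : 0<y -> expR y<N1.+1%:R -> ln N%:R<=DL -> (0<N)%N ->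
 \sum_(1<=i<N.+1) (if (N1<=i)%N then ip R i else 0)<=27+ln (1+3*(DL/y)) \/
 (y<=2 /\ \sum_(1<=i<N.+1) (if (N1<=i)%N then ip R i else 0)<=27+ln (1+DL)).
Proof.
move=> y0 yN lN N0.
have DL0: 0<=DL by apply: le_trans lN; rewrite ln_ge0// ler1n.
have sb a : 0<=a -> 0<=ln (1+a) :> R by move=> a0; rewrite ln_ge0// lerDl.
case: (leqP N1 2) => N12.
 right; have y2: y<=2.
  have := @expR_ge1Dx R y; have : N1.+1%:R<=3%:R :> R by rewrite ler_nat.
  by lra.
 split=> //; apply: (@le_trans _ _ (\sum_(1<=i<N.+1) ip R i)).
  by apply: ler_sum => i _; case: ifP => // _; exact: ip_ge0.
 case: (leqP N 1) => N1'.
  have -> : N = 1%N by apply/eqP; rewrite eqn_leq N1'.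
  by rewrite big_nat1 /ip /= mul0r addr_ge0// sb.
 apply: (le_trans (ip_all R N1')); rewrite addrC lerD2l.
 have lN1: 0<ln N%:R :> R by have := @ln_ge12 R N N1'; lra.
 by rewrite ler_ln ?posrE//; lra.
left; case: (leqP N1 N) => NN; last first.
 have r0: 0<=27+ln (1+3*(DL/y)).
  by rewrite addr_ge0// sb// mulr_ge0// divr_ge0// ltW.
 rewrite big1_seq// => i /andP[_]; rewrite mem_index_iota => /andP[_ iN].
 by rewrite leqNgt (leq_trans iN NN).
have N1E: N1 = N1.-1.+1 by rewrite prednK// (leq_trans _ N12).
have -> : \sum_(1<=i<N.+1) (if (N1<=i)%N then ip R i else 0) = \sum_(N1<=i<N.+1) ip R i.
 rewrite (@big_cat_nat _ _ _ N1)//=; [|by rewrite (leq_trans _ N12)|exact: leqW].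
 rewrite [X in X + _]big1_seq ?add0r; last first.
  by move=> i /andP[_]; rewrite mem_index_iota => /andP[_ iN]; rewrite leqNgt iN.
 by apply: eq_big_nat => i /andP[-> _].
have M2: (2<=N1.-1)%N by rewrite -ltnS -N1E.
have MN: (N1.-1<=N)%N by apply: leq_trans NN; exact: leq_pred.
rewrite N1E; apply: (le_trans (ip_tail R M2 MN)).
have lM := @ln_ge12 R _ M2; have lN2 := @ln_ge12 R _ (leq_trans M2 MN).
have lMy: y/3<=ln N1.-1%:R.
 case: (leP y (3/2)) => hy; first by lra.
 have l2: ln 2<=1 :> R by have := @le_ln1Dx R 1; have -> : 1+1 = 2 :> R by []; apply; lra.
 have : y<=ln 2+ln N1.-1%:R.
  rewrite -lnM ?posrE// ?ltr0n ?(leq_trans _ M2)// -[leLHS]expRK ler_ln ?posrE ?expR_gt0//; last first.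
   by rewrite mulr_gt0// ltr0n (leq_trans _ M2).
  apply: (le_trans (ltW yN)); rewrite -natrM ler_nat N1E /=.
  by rewrite mul2n -addnn -addn2 leq_add2l.
 by lra.
have y3: 0<y/3 by rewrite divr_gt0.
apply: (@le_trans _ _ (25+ln (1+3*(DL/y)))); last by rewrite lerD2r ler_nat.
rewrite lerD2l ler_ln ?posrE ?divr_gt0//; [|lra|lra|].
 apply: (@le_trans _ _ (DL/(y/3))).
  apply: ler_pM => //; [lra|rewrite invr_ge0; lra|].
  by rewrite lef_pV2 ?posrE//; lra.
 have -> : DL/(y/3) = 3*(DL/y) by field; exact: lt0r_neq0.
 by rewrite lerDr.
by rewrite ltr_pwDl// mulr_ge0// divr_ge0// ltW.
Qed.

Lemma cf_M0 (V g : R -> R) l D p M0 : M0 = (Num.truncn (expR (D * l))).+1 -> 0<l ->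
 (forall u, D<=u -> g u = 0) -> (M0<=p)%N -> cf 1 V g l p = 0.
Proof.
move=> -> l0 gD Mp; rewrite /cf gD ?mulr0// mul1r.
have /andP[_ h1] := truncn_itv (expR_ge0 (D * l)).
have pM := le_trans (ltW h1) (_ : _<=p%:R); rewrite ler_pdivlMr// -[leLHS]expRK.
have p0: 0<p%:R :> R by rewrite ltr0n (leq_trans _ Mp).
by rewrite ler_ln ?posrE ?expR_gt0//; apply: pM; rewrite ler_nat.
Qed.

(** Nothing relates [N1] to [M0]: if [N1] is larger, the coefficients between them vanish. *)
Lemma trig_split (V g : R -> R) l M0 N1 ph t : (forall p, (M0<=p)%N -> cf 1 V g l p = 0) ->
 trig M0 (cf 1 V g l) 1 ph t = trig N1 (fun p => if (p<N1)%N then cf 1 V g l p else 0) 1 ph t +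
  trig M0 (fun p => if (N1<=p)%N then cf 1 V g l p else 0) 1 ph t.
Proof.
move=> hM.
have -> : trig N1 (fun p => if (p<N1)%N then cf 1 V g l p else 0) 1 ph t = trig M0 (fun p => if (p<N1)%N then cf 1 V g l p else 0) 1 ph t.
 pose F p := (if (p<N1)%N then cf 1 V g l p else 0)*cos (1 * t * ln p%:R+ph).
 rewrite /trig -(big_mkord xpredT F) -[RHS](big_mkord xpredT F); apply: sum_two => p hp; rewrite /F.
  by rewrite ltnNge hp mul0r.
 by rewrite hM// if_same mul0r.
rewrite /trig -big_split/=; apply: eq_bigr => i _; rewrite -mulrDl; congr (_*_).
by case: leqP; rewrite ?addr0 ?add0r.
Qed.

Lemma truncn_half (x : R) : 1<=x -> x/2<=(Num.truncn x)%:R.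
Proof.
move=> x1; have /andP[_ h] := truncn_itv (le_trans ler01 x1).
have : 1<=(Num.truncn x)%:R :> R by rewrite ler1n truncn_gt0.
by rewrite -natr1 in h; lra.
Qed.

(** With [q = W^(1/4)] the right side is [eta^2 W q^2]. Both [K + ln W <= (K+4) q] and
    [K + 4 <= c eta^2 q] hold once [W] is large. *)
Lemma quart (k K W eta c : R) : 0<c -> 0<eta -> 1<=W -> 0<=K -> 0<=k -> k<=W/c ->
 4*((K+4)/(c*eta^+2))<=ln W ->
 k*(K+ln W)<=eta^+2*W^+2*expR (- (1/2) * ln W).
Proof.
move=> c0 e0 W1 K0 k0 kW hW; set q := expR (1/4 * ln W).
have W0: 0<W := lt_le_trans ltr01 W1.
have lW: 0<=ln W by rewrite ln_ge0.
have q1: 1+1/4 * ln W<=q := expR_ge1Dx _.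
have qW: q^+4 = W by rewrite /q -expRM_natl (_ : 4*(1/4 * ln W) = ln W) ?lnK ?posrE//; field.
have q0: 0<q := expR_gt0 _.
have rE: expR (- (1/2) * ln W)*q^+2 = 1.
 by rewrite /q -expRM_natl -expRD -[RHS]expR0; congr expR; field.
have -> : eta^+2*W^+2*expR (- (1/2) * ln W) = eta^+2*W*q^+2.
 move: rE; set rr := expR _ => rE.
 have -> : eta^+2*W^+2*rr = eta^+2*W*(W*rr) by ring.
 have -> : W*rr = q^+4*rr by rewrite qW.
 have -> : q^+4*rr = rr*q^+2*q^+2 by ring.
 by rewrite rE mul1r.
have qQ: (K+4)/(c*eta^+2)<=q by lra.
have ce: 0<c*eta^+2 by rewrite mulr_gt0// exprn_gt0.
rewrite ler_pdivrMr// in qQ.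
have s1: K+ln W<=(K+4)*q.
 have : ln W<=4*q by lra.
 have : K*1<=K*q by rewrite ler_wpM2l//; lra.
 by lra.
have s2: K+ln W<=c*eta^+2*q^+2.
 apply: (le_trans s1); have := ler_wpM2r (ltW q0) qQ; move/le_trans; apply; apply: eq_le_; ring.
have s0: 0<=K+ln W by exact: addr_ge0.
apply: (le_trans (ler_pM k0 s0 kW s2)); apply: eq_le_; field; exact: lt0r_neq0.
Qed.

Lemma trexp (x : R) : 0<=x -> (0<Num.truncn (expR x))%N.
Proof. by move=> x0; rewrite truncn_gt0 -[leLHS]expR0 ler_expR. Qed.

Lemma ln_trexp (x : R) : 0<=x -> ln (Num.truncn (expR x))%:R<=x.
Proof.
move=> x0; have /andP[h _] := truncn_itv (expR_ge0 x).
by rewrite -[leRHS]expRK ler_ln ?posrE ?ltr0n ?expR_gt0// trexp.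
Qed.

(** The lower bound is required by [L_main]; the upper one keeps the number [k0] of moments below
    [W^2]. *)
Lemma abnd (eta W L2 : R) : 0<eta<=1/40 -> 2<=L2 -> L2<=W^+2 ->
 1/4<=((1-6*eta)*W)^+2/((1+eta)*L2)<=W^+2/2.
Proof.
move=> /andP[e0 e1] L20 LW; have sg0: 0<(1+eta)*L2 by rewrite mulr_gt0//; lra.
rewrite ler_pdivlMr// ler_pdivrMr// exprMn.
have h1: 1/4*(1+eta)<=(1-6*eta)^+2 by rewrite expr2; move: e0 e1; clear; nra.
have h2: (1-6*eta)^+2<=1 by rewrite expr2; move: e0 e1; clear; nra.
move: h1 h2 (sqr_ge0 (1-6*eta)); move: ((1-6*eta)^+2) => x h1 h2 x0.
have e3: 0<=1/4*(1+eta) by lra.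
have L0: 0<=L2 by lra.
have h3 := ler_pM e3 L0 h1 LW.
have W0 := sqr_ge0 W; have h4 := ler_wpM2r W0 h2.
have h5: W^+2/2*2<=W^+2/2*((1+eta)*L2).
 rewrite ler_wpM2l ?divr_ge0//; have := mulr_ge0 (ltW e0) L0; lra.
by apply/andP; split; lra.
Qed.

(** [exp y] is the longest length whose power [2 k0] stays below [T]; the primes up to it carry the
    variance [ln (ln T) + O(1)]. *)
Lemma PAR1 (T W a : R) k0 y : 0<T -> 2<=ln (ln T) -> 0<ln T -> k0 = (Num.truncn a).+1 -> 0<=a<=W^+2/2 ->
 ln (ln T)<=W^+2 -> y = ln T/(2*k0%:R) ->
 [/\ k0%:R<=W^+2, 0<y, ((Num.truncn (expR y)) ^ (2*k0))%:R<=T &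
  \sum_(1<=i<(Num.truncn (expR y)).-1.+1) ip R i<=ln (ln T)+27].
Proof.
move=> T0 L2 lT0 k0E /andP[a0 aW] LW yE.
have k00: 0<k0%:R :> R by rewrite k0E.
have k01: 1<=k0%:R :> R by rewrite ler1n k0E.
have yp: 0<y by rewrite yE divr_gt0// mulr_gt0.
have ylT: y<=ln T.
 by rewrite yE ler_pdivrMr ?mulr_gt0// ler_peMr ?(ltW lT0)//; lra.
have /andP[N1a _] := truncn_itv (expR_ge0 y).
split=> //.
- have /andP[ka _] := truncn_itv a0.
 have -> : k0%:R = (Num.truncn a)%:R+1 :> R by rewrite k0E natr1.
 have := L2; lra.
- rewrite natrX; apply: (le_trans (powm _ (ler0n _ _) N1a)); rewrite -expRM_natl natrM yE.
 by rewrite mulrC divfK ?lnK ?posrE// lt0r_neq0// mulr_gt0.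
case: (leqP (Num.truncn (expR y)).-1 1) => hN.
 apply: (@le_trans _ _ 0); last by lra.
 rewrite big1_seq// => i /andP[_]; rewrite mem_index_iota ltnS => /andP[i1 iN].
 have -> : i = 1%N by apply/eqP; rewrite eqn_leq i1 (leq_trans iN hN).
 by rewrite /ip /= mul0r.
apply: (le_trans (ip_all R hN)); rewrite lerD2r.
have lN1: 0<ln (Num.truncn (expR y)).-1%:R :> R by have := @ln_ge12 R _ hN; lra.
rewrite ler_ln ?posrE//; apply: le_trans ylT; apply: le_trans (ln_trexp (ltW yp)).
by rewrite ler_ln ?posrE ?ltr0n ?trexp ?(ltW yp) ?(ltn_trans _ hN)// ler_nat leq_pred.
Qed.

(** [M0 <= exp(3 D l)], rounding included, and [6 D l W / c = ln T]: this is the origin of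
    [c = 6 D beta]. *)
Lemma PAR2 (D beta T W l c : R) M0 : 1<=D -> 0<beta -> c = 6*D*beta -> c<=W -> 1<=W -> 0<T -> 0<ln T ->
 l = beta * ln T/W -> 1/(2*D)<=l -> M0 = (Num.truncn (expR (D * l))).+1 ->
 [/\ (M0 ^ (2*Num.truncn (W/c)))%:R<=T, W/c/2<=(Num.truncn (W/c))%:R & (Num.truncn (W/c))%:R<=W/c].
Proof.
move=> D1 b0 cE cW W1 T0 lT0 lE lD M0E; set k1 := Num.truncn (W/c).
have D0: 0<D := lt_le_trans ltr01 D1.
have Wp: 0<W := lt_le_trans ltr01 W1.
have c0: 0<c by rewrite cE !mulr_gt0.
have Wc: 1<=W/c by rewrite ler_pdivlMr// mul1r.
have /andP[k1a _] := truncn_itv (le_trans ler01 Wc).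
split=> //; last exact: truncn_half.
have DlE: D * l*W = D*beta * ln T by rewrite lE; field; exact: lt0r_neq0.
have Dl2: 1/2<=D * l by move: lD; rewrite ler_pdivrMr ?mulr_gt0//; clear; lra.
have h1: M0%:R<=expR (D * l*3) :> R.
 have /andP[Na Nb] := truncn_itv (expR_ge0 (D * l)).
 rewrite M0E -natr1; have h2: expR (D * l)*2<=expR (D * l+1).
  by rewrite expRD ler_wpM2l ?expR_ge0//; have := @expR_ge1Dx R 1; clear; lra.
 have h3 := @expR_ge1Dx R (D * l); apply: (@le_trans _ _ (expR (D * l+1))); first by lra.
 by rewrite ler_expR; lra.
rewrite natrX; apply: (le_trans (powm _ (ler0n _ _) h1)); rewrite -expRM_natl natrM.
rewrite -[leRHS]lnK ?posrE// ler_expR.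
have Dl6: 0<=D * l*6 by lra.
have h4 := ler_wpM2r Dl6 k1a.
have h5: W/c*(D * l*6) = ln T.
 have -> : W/c*(D * l*6) = D * l*W*6/c by ring.
 by rewrite DlE cE; field; rewrite !lt0r_neq0.
by rewrite -h5; apply: le_trans h4; apply: eq_le_; ring.
Qed.

(** [D l / y] is [2 D beta k0 / W], at most [2 D beta W] since [k0 <= W^2]; so the primes between
    the two lengths contribute only [ln W + O(1)] to the variance. *)
Lemma PAR3 (D beta T W l c y : R) k0 : 1<=D -> 0<beta -> c = 6*D*beta -> 1<=W -> 0<ln T ->
 l = beta * ln T/W -> 0<l -> (0<k0)%N -> y = ln T/(2*k0%:R) -> k0%:R<=W^+2 ->
 \sum_(1<=i<(Num.truncn (expR (D * l))).+1) (if (Num.truncn (expR y)<=i)%N then ip R i else 0)<=27+c+ln W.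
Proof.
move=> D1 b0 cE W1 lT0 lE l0 k00 yE k0W.
have D0: 0<D := lt_le_trans ltr01 D1.
have Wp: 0<W := lt_le_trans ltr01 W1.
have kR: 0<k0%:R :> R by rewrite ltr0n.
have c0: 0<c by rewrite cE !mulr_gt0.
have Dl0: 0<D * l by rewrite mulr_gt0.
have yp: 0<y by rewrite yE divr_gt0// mulr_gt0.
have /andP[_ N1b] := truncn_itv (expR_ge0 y).
have hc x : 0<=x -> x<=c*W -> 27+ln (1+x)<=27+c+ln W.
 move=> x0 xc; have h1: ln (1+x)<=ln ((1+c)*W).
  by rewrite ler_ln ?posrE ?mulr_gt0//; move: x0 xc c0 W1; clear; lra.
 have h2: ln (1+c)<=c by apply: le_ln1Dx; move: c0; clear; lra.
 rewrite lnM ?posrE// in h1; last by move: c0; clear; lra.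
 by move: h1 h2; clear; lra.
have kk: k0%:R/W<=W by rewrite ler_pdivrMr// -expr2.
have Dly: D * l/y = 2*D*beta*(k0%:R/W).
 by rewrite yE lE; field; rewrite !lt0r_neq0.
have DB: 0<D*beta by rewrite mulr_gt0.
have kW0: 0<=k0%:R/W by rewrite divr_ge0// ltW.
have hk := ler_wpM2l (ltW DB) kk.
have hk0 := mulr_ge0 (ltW DB) kW0.
case: (tail_ip yp N1b (ln_trexp (ltW Dl0)) (trexp (ltW Dl0))) => [h1|[y2 h1]]; apply: (le_trans h1); apply: hc.
- by rewrite Dly; move: hk0; clear; lra.
- by rewrite Dly cE; move: hk hk0; clear; lra.
- exact: ltW.
have -> : D * l = y*(D * l/y) by field; exact: lt0r_neq0.
rewrite Dly; have := ler_wpM2r hk0 y2; rewrite cE; move: hk hk0; clear; lra.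
Qed.

(** All thresholds on [W] follow from one on [T], because [W] is at least the square root of
    [ln (ln T)]. *)
Lemma THR (Q0 A c eta : R) : 0<=Q0 -> 0<=A -> 0<=c -> 0<eta ->
 exists2 T1 : R, 3<=T1 & forall T W : R, T1<=T -> Num.sqrt (ln (ln T))<=W ->
 [/\ 0<T, 0<ln T, 2<=ln (ln T)<=W^+2, 27<=eta * ln (ln T) & [/\ 2<=W, 4*Q0<=ln W, A<=W & c<=W]].
Proof.
move=> Q00 A0 c0 e0; pose W0 := expR (4*Q0)+A+c+2.
have eQ: 0<expR (4*Q0) := expR_gt0 _.
have W00: 2<=W0 by rewrite /W0; move: A0 c0 eQ; clear; lra.
have e27: 0<=27/eta by rewrite divr_ge0// ltW.
have W02: 0<=W0^+2 := sqr_ge0 _.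
pose L0 := W0^+2+27/eta+2.
have ee0 := expR_gt0 (expR L0).
exists (expR (expR L0)+3) => [|T W hT hW]; first by rewrite lerDr ltW.
have T0: 0<T by apply: lt_le_trans hT; rewrite addr_gt0.
have lT: expR L0<=ln T by rewrite -[leLHS]expRK ler_ln ?posrE//; apply: le_trans hT; rewrite lerDl.
have lT0: 0<ln T := lt_le_trans (expR_gt0 _) lT.
have LL: L0<=ln (ln T) by rewrite -[leLHS]expRK ler_ln ?posrE ?expR_gt0.
have L20: 2<=ln (ln T) by apply: le_trans LL; rewrite /L0 lerDr addr_ge0.
have WW: W0<=W.
 apply: le_trans hW; rewrite -[leLHS]ger0_norm; last by move: W00; clear; lra.
 rewrite -sqrtr_sqr ler_sqrt; first by apply: le_trans LL; rewrite /L0 -addrA lerDl addr_ge0.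
 by move: L20; clear; lra.
have Wp: 0<W by move: W00 WW; clear; lra.
split=> //.
- rewrite L20 /= -[leLHS]sqr_sqrtr; last by move: L20; clear; lra.
 by apply: powm => //; exact: sqrtr_ge0.
- rewrite mulrC -ler_pdivrMr//; apply: le_trans LL; rewrite /L0; move: W02; clear; lra.
split; [exact: le_trans WW| | |].
- by rewrite -[leLHS]expRK ler_ln ?posrE//; apply: le_trans WW; rewrite /W0; move: A0 c0; clear; lra.
- by apply: le_trans WW; rewrite /W0; move: eQ c0; clear; lra.
- by apply: le_trans WW; rewrite /W0; move: eQ A0; clear; lra.
Qed.

(** A point of [S] makes one of five polynomials large: the short prime sum, treated by [L_main], or
    one of four others of variance [O(ln W)], treated by [L_tail], whence 12 = 4 * 3. *)
Lemma MP (D Cw beta eta : R) : 1<=D -> 0<=Cw -> 0<beta -> 0<eta<=1/40 ->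
 exists (Cc T1 : R), [/\ 0<Cc, 3<=T1 & forall (V g1 g2 : R -> R) (T X W V0 l ph1 ph2 : R) (S : set (measurableTypeR R)),
  T1<=T -> 2<=X -> Num.sqrt (ln (ln T))<=W -> l = beta * ln T/W -> 1/(2*D)<=l -> 0<V0 ->
  (forall u, ln X<u -> V u = 0) -> (forall u, `|V u| <= V0) ->
  (forall u, D<=u -> g1 u = 0 /\ g2 u = 0) -> (forall u, 0<=u -> `|g1 u| <= 1) ->
  (forall u, 0<=u -> `|g2 u| <= Cw /\ `|g2 u| <= Cw*u) -> measurable S ->
  (forall t, S t -> (T<=t<=2*T) /\ W*V0 <=
    `|\sum_(1<=k<(Num.truncn X).+1) vm k*(h R k*V (ln k%:R)/ln k%:R*g1 (ln k%:R/l)*cos (t * ln k%:R+ph1))| +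
    `|\sum_(1<=k<(Num.truncn X).+1) vm k*(h R k*V (ln k%:R)/ln k%:R*g2 (ln k%:R/l)*cos (t * ln k%:R+ph2))| + eta*W*V0) ->
  (mu S<=(T*(3*(expR 6/eta)*expR (- (1-eta)*(((1-6*eta)*W)^+2/((1+eta) * ln (ln T)))) +
    12*expR (- (Cc*W * ln W))))%:E)%E].
Proof.
move=> D1 Cw0 b0 /andP[e0 e1].
have D0: 0<D := lt_le_trans ltr01 D1.
pose c := 6*D*beta; have c0: 0<c by rewrite !mulr_gt0.
(* [K1 + ln W] bounds all four small variances, so that one moment order [k1] serves them. *)
pose K1 := 27+c+(2+2*Cw^+2+13*Cw^+2*D^+2).
have Cw2: 0<=2*Cw^+2 by rewrite mulr_ge0 ?sqr_ge0.
have Cw3: 0<=13*Cw^+2*D^+2 by rewrite mulr_ge0 ?sqr_ge0// mulr_ge0 ?sqr_ge0.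
have K10: 0<=K1 by rewrite /K1 !addr_ge0// ltW.
have Q00: 0<=(K1+4)/(c*eta^+2) by apply: divr_ge0; [exact: addr_ge0|apply: mulr_ge0; [exact: ltW|exact: sqr_ge0]].
have cw0: 0<=8*(1+Cw)/eta by rewrite divr_ge0 ?(ltW e0)// mulr_ge0// addr_ge0.
have [T1 T13 hT1] := THR Q00 cw0 (ltW c0) e0.
exists (24*D*beta)^-1, T1; split=> //; first by rewrite invr_gt0 !mulr_gt0.
move=> V g1 g2 T X W V0 l ph1 ph2 S hT X2 hW lE lD V00 VX Vb gD g1b g2b mS hS.
have [T0 lT0 /andP[L20 L2W] L27 [W2 lW cwW cW]] := hT1 T W hT hW.
set L2 := ln (ln T) in hW L20 L2W L27 *.
have W1: 1<=W by apply: le_trans W2; rewrite ler1n.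
have Wp: 0<W := lt_le_trans ltr01 W1.
have lW0: 0<=ln W by rewrite ln_ge0.
have l0: 0<l by apply: lt_le_trans lD; rewrite divr_gt0// mulr_gt0.
have e011: 0<eta<=1/40 by rewrite e0.
have /andP[a4 aW] := abnd e011 L20 L2W.
pose a := ((1-6*eta)*W)^+2/((1+eta)*L2).
pose sg := (1+eta)*L2.
have sg0: 0<sg by rewrite mulr_gt0 ?addr_gt0// (lt_le_trans _ L20).
have y0: 0<(1-6*eta)*W by rewrite mulr_gt0//; move: e1; clear; lra.
have aE: a*sg = ((1-6*eta)*W)^+2 by rewrite /a divfK// lt0r_neq0.
have a0: 0<=a by apply: le_trans a4; rewrite divr_ge0.
pose k0 := (Num.truncn a).+1.
pose y := ln T/(2*k0%:R).
have a0W: 0<=a<=W^+2/2 by rewrite a0.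
have [k0W yp MT1 sm0] := PAR1 T0 L20 lT0 (erefl k0) a0W L2W (erefl y).
pose N1 := Num.truncn (expR y).
have N10: (0<N1)%N := trexp (ltW yp).
pose M0 := (Num.truncn (expR (D * l))).+1.
pose k1 := Num.truncn (W/c).
have [MT2 k1b k1a] := PAR2 D1 b0 (erefl c) cW W1 T0 lT0 lE lD (erefl M0).
rewrite -/k1 in MT2 k1a k1b.
pose st := K1+ln W.
have kst: k1%:R*st<=eta^+2*W^+2*expR (- (1/2) * ln W) by apply: (quart c0).
have gD1 u : D<=u -> g1 u = 0 by move=> /gD [].
have gD2 u : D<=u -> g2 u = 0 by move=> /gD [].
have g2b1 u : 0<=u -> `|g2 u| <= Cw by move=> /g2b [].
have g2b2 u : 0<=u -> `|g2 u| <= Cw*u by move=> /g2b [].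
have V02 := sqr_ge0 V0.
pose cm p := if (p<N1)%N then cf 1 V g1 l p else 0.
pose ct p := if (N1<=p)%N then cf 1 V g1 l p else 0.
have cmp i : ~~ prime i -> cm i = 0 by move=> h1; rewrite /cm cf_np// if_same.
have ctp i : ~~ prime i -> ct i = 0 by move=> h1; rewrite /ct cf_np// if_same.
have sm: \sum_(i<N1) cm i^+2<=V0^+2*sg.
 rewrite -(prednK N10); apply: (le_trans (sig1 (fun p => (p<N1)%N) N1.-1 Vb g1b l0)); rewrite ler_wpM2l//.
 apply: (@le_trans _ _ (\sum_(1<=i<N1.-1.+1) ip R i)).
  by apply: ler_sum => i _; case: ifP => // _; exact: ip_ge0.
 by apply: (le_trans sm0); rewrite /sg mulrDl mul1r lerD.
have st_tail: \sum_(i<M0) ct i^+2<=V0^+2*st.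
 apply: (le_trans (sig1 (fun p => (N1<=p)%N) (Num.truncn (expR (D * l))) Vb g1b l0)); rewrite ler_wpM2l//.
 apply: (le_trans (PAR3 D1 b0 (erefl c) W1 lT0 lE l0 (ltn0Sn _) (erefl y) k0W)).
 by rewrite /st /K1 lerD2r lerDl !addr_ge0.
have le_st x : x<=2+2*Cw^+2+13*Cw^+2*D^+2 -> V0^+2*x<=V0^+2*st.
 move=> hx; rewrite ler_wpM2l// /st /K1.
 have h0: 0<=27+c+ln W by rewrite !addr_ge0// ltW.
 by move: hx h0; clear; lra.
have s3: \sum_(i<M0) cf 2 V g1 l i^+2<=V0^+2*st.
 by apply: (le_trans (sig2 M0 Vb g1b l0)); apply: le_st; rewrite expr1n mulr1 -addrA lerDl addr_ge0.
have s4: \sum_(i<M0) cf 1 V g2 l i^+2<=V0^+2*st.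
 by apply: (le_trans (sigw Vb g2b2 l0 D1 lD (erefl M0) Cw0)); apply: le_st; rewrite lerDr addr_ge0.
have s5: \sum_(i<M0) cf 2 V g2 l i^+2<=V0^+2*st.
 by apply: (le_trans (sig2 M0 Vb g2b1 l0)); apply: le_st; rewrite addrAC lerDr addr_ge0.
have b2: 1<=2 :> R by rewrite ler1n.
have e01: 0<eta<=1 by rewrite e0 (le_trans e1)// ler_pdivrMr// mul1r ler1n.
have E1 := L_main ph1 T0 e01 MT1 cmp V00 y0 sg0 sm a4 aE.
have E2 := L_tail ph1 (lexx 1) T0 MT2 ctp V00 e0 W1 st_tail kst.
have E3 := L_tail ph1 b2 T0 MT2 (@cf_np 2 V g1 l) V00 e0 W1 s3 kst.
have E4 := L_tail ph2 (lexx 1) T0 MT2 (@cf_np 1 V g2 l) V00 e0 W1 s4 kst.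
have E5 := L_tail ph2 b2 T0 MT2 (@cf_np 2 V g2 l) V00 e0 W1 s5 kst.
have mE f z : continuous f -> measurable (ev f T z : set (measurableTypeR R)) by exact: ev_meas_abs.
have m1 := mE _ ((1-6*eta)*W*V0) (@trig_cont R N1 cm 1 ph1).
have m2 := mE _ (eta*W*V0) (@trig_cont R M0 ct 1 ph1).
have m3 := mE _ (eta*W*V0) (@trig_cont R M0 (cf 2 V g1 l) 2 ph1).
have m4 := mE _ (eta*W*V0) (@trig_cont R M0 (cf 1 V g2 l) 1 ph2).
have m5 := mE _ (eta*W*V0) (@trig_cont R M0 (cf 2 V g2 l) 2 ph2).
have id2 (A B : set (measurableTypeR R)) : A `|` B `<=` A `|` B by [].
have U45 := mu_cover (measurableU _ _ m4 m5) m4 m5 (@id2 _ _) E4 E5.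
have U345 := mu_cover (measurableU _ _ m3 (measurableU _ _ m4 m5)) m3 (measurableU _ _ m4 m5) (@id2 _ _) E3 U45.
have U2345 := mu_cover (measurableU _ _ m2 (measurableU _ _ m3 (measurableU _ _ m4 m5))) m2 (measurableU _ _ m3 (measurableU _ _ m4 m5)) (@id2 _ _) E2 U345.
have cov := mu_cover mS m1 (measurableU _ _ m2 (measurableU _ _ m3 (measurableU _ _ m4 m5))) _ E1 U2345.
apply: (le_trans (cov _)).
 move=> t /hS [tT hW2].
 have d1 := DEC t ph1 (erefl M0) X2 l0 D0 VX Vb gD1 g1b.
 have d2 := DEC t ph2 (erefl M0) X2 l0 D0 VX Vb gD2 g2b1.
 have sp := trig_split N1 ph1 t (fun p => cf_M0 V (erefl M0) l0 gD1).
 have n1 := ler_normD (trig N1 cm 1 ph1 t) (trig M0 ct 1 ph1 t); rewrite -sp in n1.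
 have big: 8*V0*1+8*V0*Cw<=eta*W*V0.
  have h1: 8*(1+Cw)<=eta*W.
   by rewrite mulrC [leRHS]mulrC -ler_pdivrMr// (mulrC (1+Cw)).
  by have := ler_wpM2r (ltW V00) h1; clear; lra.
 rewrite /ev /= tT /=.
 (* The six [eta] reserved: four for the small polynomials, one for higher prime powers, one for the
    error already present in the hypothesis on [S]. *)
 case: (leP ((1-6*eta)*W*V0) `|trig N1 cm 1 ph1 t|) => q1; first by left.
 case: (leP (eta*W*V0) `|trig M0 ct 1 ph1 t|) => q2; first by right; left.
 case: (leP (eta*W*V0) `|trig M0 (cf 2 V g1 l) 2 ph1 t|) => q3; first by right; right; left.
 case: (leP (eta*W*V0) `|trig M0 (cf 1 V g2 l) 1 ph2 t|) => q4; first by right; right; right; left.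
 case: (leP (eta*W*V0) `|trig M0 (cf 2 V g2 l) 2 ph2 t|) => q5; first by right; right; right; right.
 exfalso; move: hW2 d1 d2 n1 big q1 q2 q3 q4 q5.
 set A := `|\sum_(1 <= _ < _) _|; set B := `|\sum_(1 <= _ < _) _|.
 have -> : (1-6*eta)*W*V0 = W*V0-6*(eta*W*V0) by ring.
 move: (eta*W*V0) (W*V0) (8*V0*1) (8*V0*Cw) `|trig N1 _ _ _ _| `|trig M0 ct _ _ _| `|trig M0 (cf 2 V g1 l) _ _ _| `|trig M0 (cf 1 V g1 l) _ _ _| `|trig M0 (cf 1 V g2 l) _ _ _| `|trig M0 (cf 2 V g2 l) _ _ _| A B.
 by clear => *; lra.
rewrite lee_fin -/a.
have tl: expR (- (k1%:R/2) * ln W)<=expR (- ((24*D*beta)^-1*W * ln W)).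
 rewrite ler_expR mulNr lerN2 ler_wpM2r//.
 have -> : (24*D*beta)^-1*W = W/c/4 by rewrite /c; field; rewrite !lt0r_neq0.
 by have := k1b; clear; lra.
have := ler_wpM2l (ltW T0) tl.
move: (expR (- (k1%:R/2) * ln W)) (expR (- ((24*D*beta)^-1*W * ln W))) (expR (- (1-eta)*a)) => x z w hx.
have -> : 3*T*(expR 6/eta*w) = T*(3*(expR 6/eta)*w) by ring.
by rewrite mulrDr lerD2l; move: hx; clear; lra.
Qed.

End mp.

(** * Assembly of the two estimates *)

Section final.
Variable R : realType.
Notation mu := (@lebesgue_measure R).
Notation vm := (@von_mangoldt R).

(** The maximum with 2 keeps every frequency positive, as [outRe] and [outIm] require for all
    indices; the sums start at 2, where it is the logarithm. *)
Definition vv (i : nat) : R := ln (maxn 2 i)%:R.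

Lemma vv_ge i : 1/2<=vv i.
Proof. by apply: ln_ge12; rewrite leq_maxl. Qed.

Lemma vv_gt0 i : 0<vv i.
Proof. by apply: lt_le_trans (vv_ge i); rewrite divr_gt0. Qed.

Lemma vm_conv_vv (G : nat -> R -> R) M : (1<M)%N ->
 \sum_(1<=k<M) vm k*G k (ln k%:R) = \sum_(i <- index_iota 2 M) vm i*G i (vv i).
Proof.
move=> M1; rewrite big_ltn// (_ : vm 1 = 0)// mul0r add0r.
apply: eq_big_nat => i /andP[i2 _]; rewrite /vv (maxn_idPr i2)//.
Qed.

Lemma ps_term (x L t : R) :
 complex.Re (x%:C*cexp (- (2^-1 +i* t)*L%:C)) = x*(expR (- (1/2)*L)*cos (t*L)) /\
 complex.Im (x%:C*cexp (- (2^-1 +i* t)*L%:C)) = - (x*(expR (- (1/2)*L)*sin (t*L))).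
Proof.
have -> : - (2^-1 +i* t)*L%:C = (- (1/2)*L) +i* (- (t*L)).
 by apply/eqP; rewrite eq_complex /=; apply/andP; split; apply/eqP; [field|ring].
by rewrite /cexp /= cosN sinN !mul0r subr0 addr0 !mulrN.
Qed.

Definition av (V : R -> R -> R) X (i : nat) : R := vm i*(h R i*V X (vv i)).

Lemma ps_Re (V : R -> R -> R) X t : 2<=X -> complex.Re (prime_sum V X t) =
 \sum_(i <- index_iota 2 (Num.truncn X).+1) av V X i/vv i*cos (t*vv i).
Proof.
move=> X2; have M1: (1<(Num.truncn X).+1)%N by rewrite ltnS truncn_gt0 (le_trans _ X2)// ler1n.
rewrite /prime_sum (big_morph (@complex.Re R) (@ReD R) (erefl : complex.Re (0 : R[i]) = 0)).
transitivity (\sum_(1<=k<(Num.truncn X).+1) vm k*(h R k*V X (ln k%:R)/ln k%:R*cos (t * ln k%:R))).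
 by apply: eq_bigr => k _; have [-> _] := ps_term (vm k*V X (ln k%:R)/ln k%:R) (ln k%:R) t; rewrite /h; ring.
rewrite (vm_conv_vv (fun k x => h R k*V X x/x*cos (t*x)) M1).
by apply: eq_bigr => i _; rewrite /av; ring.
Qed.

Lemma ps_Im (V : R -> R -> R) X t : 2<=X -> complex.Im (prime_sum V X t) =
 - \sum_(i <- index_iota 2 (Num.truncn X).+1) av V X i/vv i*sin (t*vv i).
Proof.
move=> X2; have M1: (1<(Num.truncn X).+1)%N by rewrite ltnS truncn_gt0 (le_trans _ X2)// ler1n.
rewrite /prime_sum (big_morph (@complex.Im R) (@ImD R) (erefl : complex.Im (0 : R[i]) = 0)).
transitivity (- \sum_(1<=k<(Num.truncn X).+1) vm k*(h R k*V X (ln k%:R)/ln k%:R*sin (t * ln k%:R))).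
 rewrite -sumrN; apply: eq_bigr => k _; have [_ ->] := ps_term (vm k*V X (ln k%:R)/ln k%:R) (ln k%:R) t; rewrite /h; ring.
rewrite (vm_conv_vv (fun k x => h R k*V X x/x*sin (t*x)) M1).
by congr (- _); apply: eq_bigr => i _; rewrite /av; ring.
Qed.

Lemma ps_w (V : R -> R -> R) X l t ph (g : R -> R) : 2<=X ->
 \sum_(i <- index_iota 2 (Num.truncn X).+1) av V X i/vv i*g (vv i/l)*cos (t*vv i+ph) =
 \sum_(1<=k<(Num.truncn X).+1) vm k*(h R k*V X (ln k%:R)/ln k%:R*g (ln k%:R/l)*cos (t * ln k%:R+ph)).
Proof.
move=> X2; have M1: (1<(Num.truncn X).+1)%N by rewrite ltnS truncn_gt0 (le_trans _ X2)// ler1n.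
rewrite (vm_conv_vv (fun k x => h R k*V X x/x*g (x/l)*cos (t*x+ph)) M1).
by apply: eq_bigr => i _; rewrite /av; ring.
Qed.

Lemma ps_cont (V : R -> R -> R) X : 2<=X ->
 continuous (fun t => complex.Re (prime_sum V X t)) /\ continuous (fun t => complex.Im (prime_sum V X t)).
Proof.
move=> X2; split.
 have -> : (fun t => complex.Re (prime_sum V X t)) = Tc (index_iota 2 (Num.truncn X).+1) (fun i => av V X i/vv i) vv.
  by apply/funext => t; rewrite ps_Re.
 exact: Tc_cont vv_gt0.
have -> : (fun t => complex.Im (prime_sum V X t)) = fun t => - \sum_(i <- index_iota 2 (Num.truncn X).+1) av V X i/vv i*sin (t*vv i).
 by apply/funext => t; rewrite ps_Im.
set r := index_iota _ _.
apply: (@lip_cont _ _ (\sum_(i <- r) `|av V X i/vv i| * vv i)) => x y.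
set A := \sum_(i <- r) _; set B := \sum_(i <- r) _.
have -> : - A - - B = - (A-B) by rewrite opprD.
rewrite normrN -sumrB mulr_suml.
apply: (le_trans (ler_norm_sum _ _ _)); apply: ler_sum => i _.
rewrite -mulrBr (normrM (av V X i/vv i)) -[leRHS]mulrA ler_wpM2l//; apply: (le_trans (sin_lip _ _)).
by rewrite -mulrBl normrM mulrC (gtr0_norm (vv_gt0 i)).
Qed.

(** All losses of [MP] amount to [(1-eta)(1-6 eta)^2/(1+eta)], which is at least [1 - 20 eta]. *)
Lemma eta_ineq (eps eta W L2 : R) : 0<eta<=1/40 -> 20*eta<=eps -> 0<L2 ->
 (1-eps)*W^+2/L2<=(1-eta)*(((1-6*eta)*W)^+2/((1+eta)*L2)).
Proof.
move=> /andP[e0 e1] ee L0; have e2: 0<1+eta by move: e0; clear; lra.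
have -> : (1-eta)*(((1-6*eta)*W)^+2/((1+eta)*L2)) = ((1-eta)*(1-6*eta)^+2/(1+eta))*W^+2/L2.
 by field; rewrite !lt0r_neq0.
rewrite ler_wpM2r ?invr_ge0 ?(ltW L0)// ler_wpM2r ?sqr_ge0// ler_pdivlMr//.
apply: (@le_trans _ _ ((1-20*eta)*(1+eta))); first by rewrite ler_wpM2r ?(ltW e2)//; move: ee; clear; lra.
have h: 36*eta*eta^+2<=36*1*eta^+2.
 by rewrite ler_wpM2r ?sqr_ge0//; move: e1; clear; lra.
rewrite -subr_ge0.
have -> : (1-eta)*(1-6*eta)^+2-(1-20*eta)*(1+eta) = 6*eta+68*eta^+2-36*eta*eta^+2 by ring.
by have := sqr_ge0 eta; move: e0 h; move: (36*eta*eta^+2) (eta^+2) => x y; lra.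
Qed.

End final.

Theorem theorem3 (R : realType) (RH : riemann_hypothesis R)
    (m : R) (m_ge2 : 2 <= m) (V : R -> R -> R)
    (V_cont : forall X : R, 2 <= X -> continuous (V X))
    (Vi : condition_i V) (Vii : condition_ii m V) (Viii : condition_iii V)
    (Vhat_gt0 : forall X y : R, 2 <= X -> 0 < fourier (V X) y%:C)
    (eps : R) (eps_gt0 : 0 < eps) (v : R) (v_gt0 : 0 < v) :
  exists Ceps Deps K T0 : R, [/\ 0 < Ceps, 0 < Deps &
    forall T X W : R,
      T0 <= T -> 2 <= X -> X <= T `^ (2 * m) -> v <= V X 0 ->
      Num.sqrt (ln (ln T)) <= W ->
      ((T^-1)%:E * lebesgue_measure
          [set t : R | ((T <= t <= 2 * T) &&
             (W * V X 0 <= `|complex.Im (prime_sum V X t)|))%R]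
        <= (K * (expR (- ((1 - eps) * W ^+ 2 / ln (ln T)))
                 + expR (- (Ceps * W * ln W))))%:E)%E /\
      ((T^-1)%:E * lebesgue_measure
          [set t : R | ((T <= t <= 2 * T) &&
             (W * V X 0 <= complex.Re (prime_sum V X t)))%R]
        <= (K * (expR (- ((1 - eps) * W ^+ 2 / ln (ln T)))
                 + expR (- (Deps * W * ln W))))%:E)%E].
Proof.
have [n [C0 [B0 [T0 [C00 B00 T03 [VB KEY]]]]]] := KEY2 RH m_ge2 V_cont Vi Vii Viii Vhat_gt0.
have [Cr [q [Cr0 qb q0 HR]]] := outRe R n.
have [Ci [s [w [Ci0 sb sw0 wb HI]]]] := outIm R n.
(* 20 is the total loss in [eta_ineq]; the cap gives [eta <= 1/40]. *)
pose eta := Num.min eps (1/2)/20.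
have eta0: 0<eta by rewrite divr_gt0// lt_min eps_gt0 divr_gt0.
have eta1: eta<=1/40.
 have : Num.min eps (1/2)<=1/2 by rewrite ge_min lexx orbT.
 by rewrite /eta; clear; lra.
have etaE: 20*eta<=eps.
 have : Num.min eps (1/2)<=eps by rewrite ge_min lexx.
 by rewrite /eta; clear; lra.
(* The larger of the two supports given by [outRe] and [outIm]. *)
pose D : R := n.+3%:R.
have D1: 1<=D by rewrite ler1n.
have D0: 0<D := lt_le_trans ltr01 D1.
(* The shift [z/l] in [KEY] satisfies [1 + |z/l| <= (1 + 2 D)(1 + |z|)] as long as
   [l >= 1/(2 D)]. *)
pose B1 := B0*(1+2*D)^+n.
have DD: 0<=1+2*D by rewrite addr_ge0// mulr_ge0// ltW.
have B10: 0<=B1 by rewrite mulr_ge0// exprn_ge0.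
pose CC := (Cr+Ci+1)*(B1+1).
have CC0: 0<CC by rewrite mulr_gt0// ltr_wpDl// addr_ge0.
have CrC: Cr*B1<=CC by apply: ler_pM => //; [rewrite -addrA lerDl addr_ge0|rewrite lerDl].
have CiC: Ci*B1<=CC by apply: ler_pM => //; [rewrite addrAC lerDr addr_ge0|rewrite lerDl].
have ev0: 0<eta*v by rewrite mulr_gt0.
(* Makes the smoothing cost, at most [CC ln T / l], equal to [eta v W] for [l = beta ln T / W]. *)
pose beta := CC/(eta*v).
have beta0: 0<beta by rewrite divr_gt0.
have eta01: 0<eta<=1/40 by rewrite eta0.
have [Cc [T1 [Cc0 T13 HMP]]] := MP D1 Ci0 beta0 eta01.
have [T2 _ HT2] := THR (lexx 0) (lexx 0) (lexx 0) eta0.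
pose K := 3*(expR 6/eta)+12.
have K3: 0<=3*(expR 6/eta) by rewrite mulr_ge0// divr_ge0 ?expR_ge0// ltW.
have K0: 0<=K by rewrite addr_ge0.
exists Cc, Cc, K, (`|T0| + `|T1| + `|T2|); split=> // T X W hT X2 XT vV hW.
have TT0: T0<=T.
 by apply: le_trans hT; apply: (le_trans (ler_norm T0)); rewrite -addrA lerDl addr_ge0.
have TT1: T1<=T.
 by apply: le_trans hT; apply: (le_trans (ler_norm T1)); rewrite addrAC lerDr addr_ge0.
have TT2: T2<=T.
 by apply: le_trans hT; apply: (le_trans (ler_norm T2)); rewrite lerDr addr_ge0.
have [Tp lT0 /andP[L20 _] _ [W2 _ _ _]] := HT2 T W TT2 hW.
have L2p: 0<ln (ln T) := lt_le_trans (ltr0n R 2) L20.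
have Wp: 0<W := lt_le_trans (ltr0n R 2) W2.
have V00: 0<V X 0 := lt_le_trans v_gt0 vV.
have Vb u : `|V X u| <= V X 0 by have [] := VB X u X2.
have Vs u : ln X<u -> V X u = 0.
 by move=> hu; have [_ _] := Vi X X2; apply; apply: lt_le_trans hu (ler_norm u).
have [cRe cIm] := ps_cont V X2.
set r := index_iota 2 (Num.truncn X).+1.
have TB l t z : 1/(2*D)<=l -> T<=t<=2*T -> Tc r (av V X) (@vv R) (t+z/l)<=B1 * ln T*(1 + `|z|)^+n.
 move=> lD tT; have l0: 0<l by apply: lt_le_trans lD; rewrite divr_gt0// mulr_gt0.
 have M1: (1<(Num.truncn X).+1)%N by rewrite ltnS truncn_gt0 (le_trans _ X2)// ler1n.
 have := KEY T X t (z/l) TT0 X2 XT tT.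
 rewrite (vm_conv_vv (fun k x => expR (- (1/2) * ln k%:R)*V X x*cos ((t+z/l)*x)) M1).
 have -> : \sum_(i <- index_iota 2 (Num.truncn X).+1) von_mangoldt R i*(expR (- (1/2) * ln i%:R)*V X (vv R i)*cos ((t+z/l)*vv R i)) =
   Tc r (av V X) (@vv R) (t+z/l).
  by rewrite /Tc; apply: eq_bigr => i _; rewrite /av /h; ring.
 move/le_trans; apply.
 have -> : B1 * ln T*(1 + `|z|)^+n = B0 * ln T*((1+2*D)*(1 + `|z|))^+n.
  by rewrite exprMn /B1; move: ((1+2*D)^+n) ((1 + `|z|)^+n) => *; ring.
 rewrite ler_wpM2l ?mulr_ge0 ?(ltW lT0)//; apply: powm; first by rewrite addr_ge0.
 have li: l^-1<=2*D.
  by rewrite -[leRHS]invrK lef_pV2 ?posrE ?invr_gt0 ?mulr_gt0//; move: lD; rewrite div1r.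
 rewrite normrM (gtr0_norm (_ : 0<l^-1)) ?invr_gt0//.
 have := ler_wpM2l (normr_ge0 z) li; have := normr_ge0 z; move: D0; move: `|z| (l^-1) => x y; clear; lra.
have BT0: 0<=B1 * ln T by rewrite mulr_ge0// ltW.
have fin (S : set (measurableTypeR R)) : (@lebesgue_measure R S<=(T*(3*(expR 6/eta)*expR (- (1-eta)*(((1-6*eta)*W)^+2/((1+eta) * ln (ln T)))) +
    12*expR (- (Cc*W * ln W))))%:E)%E -> ((T^-1)%:E * @lebesgue_measure R S<=(K*(expR (- ((1-eps)*W^+2/ln (ln T)))+expR (- (Cc*W * ln W))))%:E)%E.
 move=> h; apply: (@le_trans _ _ ((T^-1)%:E*(T*(3*(expR 6/eta)*expR (- (1-eta)*(((1-6*eta)*W)^+2/((1+eta) * ln (ln T)))) +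
    12*expR (- (Cc*W * ln W))))%:E)%E).
  by apply: lee_wpmul2l => //; rewrite lee_fin invr_ge0 ltW.
 rewrite -EFinM lee_fin (mulrA T^-1 T) mulVf ?lt0r_neq0// mul1r.
 have hx: expR (- (1-eta)*(((1-6*eta)*W)^+2/((1+eta) * ln (ln T))))<=expR (- ((1-eps)*W^+2/ln (ln T))).
  by rewrite ler_expR mulNr lerN2; exact: eta_ineq.
 rewrite mulrDr; apply: lerD.
  by apply: ler_pM => //; rewrite lerDl.
 by rewrite ler_wpM2r ?expR_ge0// lerDr.
have vD i : D<=vv R i/(1/(2*D)).
 have -> : vv R i/(1/(2*D)) = 2*vv R i*D by field; rewrite lt0r_neq0.
 by rewrite ler_peMl ?(ltW D0)//; have := vv_ge R i; lra.
have D2: 0<2*D by rewrite mulr_gt0.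
have evW: 0<eta*v*W by rewrite mulr_gt0.
have gen (S : set (measurableTypeR R)) (g1 g2 : R -> R) (ph1 ph2 Cg : R) : 0<=Cg -> Cg*B1<=CC ->
  (forall u, D<=u -> g1 u = 0 /\ g2 u = 0) -> (forall u, 0<=u -> `|g1 u| <= 1) ->
  (forall u, 0<=u -> `|g2 u| <= Ci /\ `|g2 u| <= Ci*u) -> measurable S ->
  (forall t, S t -> T<=t<=2*T) ->
  (forall t l, S t -> 0<l -> 1/(2*D)<=l -> W*V X 0 <=
    `|\sum_(i <- r) av V X i/vv R i*g1 (vv R i/l)*cos (t*vv R i+ph1)| +
    `|\sum_(i <- r) av V X i/vv R i*g2 (vv R i/l)*cos (t*vv R i+ph2)| + Cg*(B1 * ln T)/l) ->
  ((T^-1)%:E * @lebesgue_measure R S<=(K*(expR (- ((1-eps)*W^+2/ln (ln T)))+expR (- (Cc*W * ln W))))%:E)%E.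
 move=> Cg0 CgC gD g1b g2b mS ST hS.
 (* If the intended [l] is below [1/(2 D)], the value [l = 1/(2 D)] is used instead. Since all
    frequencies are at least 1/2, every weight vanishes and only the smoothing cost remains, which
    is below [W V X 0]. *)
 have [hl|hl] := leP (1/(2*D)) (beta * ln T/W).
  apply: fin; apply: (HMP (V X) g1 g2 T X W (V X 0) (beta * ln T/W) ph1 ph2 S) => // t St.
  split; first exact: ST.
  have lp : 0<beta * ln T/W by rewrite divr_gt0// mulr_gt0.
  have := hS t _ St lp hl; rewrite !ps_w// => /le_trans; apply; rewrite lerD2l.
  have -> : Cg*(B1 * ln T)/(beta * ln T/W) = Cg*B1*(eta*v*W/CC).
   by rewrite /beta; field; rewrite !lt0r_neq0.
  apply: (@le_trans _ _ (CC*(eta*v*W/CC))).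
   by rewrite ler_wpM2r//; apply: divr_ge0; exact: ltW.
  rewrite mulrC divfK ?lt0r_neq0// mulrAC; apply: ler_wpM2l => //; exact/ltW/mulr_gt0.
 suff -> : S = set0 by rewrite measure0 mule0 lee_fin mulr_ge0// addr_ge0// expR_ge0.
 apply/seteqP; split=> // t St; exfalso.
 have lp : 0<1/(2*D) by rewrite divr_gt0// mulr_gt0.
 have := hS t _ St lp (lexx _).
 rewrite big1; last by move=> i _; have [-> _] := gD _ (vD i); rewrite mulr0 mul0r.
 rewrite big1; last by move=> i _; have [_ ->] := gD _ (vD i); rewrite mulr0 mul0r.
 rewrite normr0 !add0r; apply/negP; rewrite -ltNge.
 have -> : Cg*(B1 * ln T)/(1/(2*D)) = Cg*B1*(2*D * ln T) by field; rewrite lt0r_neq0.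
 apply: (@le_lt_trans _ _ (CC*(2*D * ln T))).
  by rewrite ler_wpM2r// !mulr_ge0// ltW.
 apply: (@lt_le_trans _ _ (eta*v*W)).
  move: hl; have -> : beta * ln T/W = CC*(2*D * ln T)/(eta*v*W)/(2*D).
   by rewrite /beta; field; rewrite !lt0r_neq0.
  by rewrite ltr_pM2r ?invr_gt0// (ltr_pdivrMr _ _ evW) mul1r.
 rewrite mulrC ler_wpM2l ?(ltW Wp)//; apply: le_trans vV.
 by rewrite ger_pMl//; apply: (le_trans eta1); lra.
split.
 (* The phase [- pi/2] presents the sine sum as a cosine sum; the second sum is the genuine cosine
    correction of [outIm]. *)
 apply: (gen _ s w (- (pi/2)) 0 Ci) => //.
 - by apply: (@ev_meas R (fun t => `|complex.Im (prime_sum V X t)|)) => t;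
   apply: (@continuous_comp R R R _ (fun x => `|x|)); [exact: cIm|exact: norm_continuous].
 - by move=> t /= /andP[].
 move=> t l /= /andP[tT hW'] l0 lD; apply: (le_trans hW').
 rewrite ps_Im// normrN; apply: (le_trans (HI r (av V X) (@vv R) t (B1 * ln T) l (@vv_gt0 R) BT0 l0 _)).
  by move=> z; exact: TB.
 rewrite lerD2r; apply: lerD; rewrite le_eqVlt; apply/orP; left; apply/eqP; congr (`| _ |); apply: eq_bigr => i _.
  by rewrite cosBpihalf.
 by rewrite addr0.
(* For the real part there is no correction term, so the second weight is zero. *)
apply: (gen _ q (fun=> 0) 0 0 Cr) => //.
- by move=> u uD; split=> //; apply: q0; apply: le_trans uD; rewrite ler_nat.
- by move=> u /qb /andP[h1 h2]; rewrite ger0_norm.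
- by move=> u u0; rewrite normr0; split=> //; exact: mulr_ge0.
- exact: ev_meas.
- by move=> t /= /andP[].
move=> t l /= /andP[tT hW'] l0 lD; apply: (le_trans hW').
rewrite ps_Re//; apply: (le_trans (HR r (av V X) (@vv R) t (B1 * ln T) l (@vv_gt0 R) BT0 l0 _)).
 by move=> z; exact: TB.
rewrite lerD2r -[leLHS]addr0; apply: lerD => //.
apply: le_trans (ler_norm _) _; rewrite le_eqVlt; apply/orP; left; apply/eqP; congr (`| _ |); apply: eq_bigr => i _.
by rewrite addr0.
Qed.
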